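(* Let $(X,\rho,\mu)$ be a quasi-metric measure space where $\mu$ is a Borel regular $Q$-doubling measure for some $Q\in(0,\infty)$, and suppose that $\Omega\subset X$ is a $\mu$-measurable locally uniformly perfect set (with at least two points and with $\mu(B_\rho(x,r)\cap\Omega)>0$ for all $x\in\Omega$, $r\in(0,1]$). Then the following statements are equivalent. (a) There exists a constant $C_\mu\in(0,\infty)$ such that $\mu(B_\rho(x,r))\le C_\mu\,\mu(B_\rho(x,r)\cap\Omega)$ for any $x\in\Omega$ and $r\in(0,1]$. (b) $\Omega$ is an $N^s_{p,q}$-extension domain for some $p\in(0,\infty)$, $q\in(0,\infty]$, and $s\in(0,\mathrm{ind}(X,\rho))$, in the sense that there exists a positive constant $C$ such that for any $u\in N^s_{p,q}(\Omega,\rho,\mu)$ there exists a $\widetilde u\in N^s_{p,q}(X,\rho,\mu)$ for which $u=\widetilde u|_\Omega$ and $\|\widetilde u\|_{N^s_{p,q}(X,\rho,\mu)}\le C\|u\|_{N^s_{p,q}(\Omega,\rho,\mu)}$. (c) There exist $s\in(0,\mathrm{ind}(X,\rho))$, $p\in(0,\infty)$, and $q\in(0,\infty]$ with $p,q>Q/(Q+s)$, and a bounded linear operator $\mathscr E:N^s_{p,q}(\Omega,\rho,\mu)\to N^s_{p,q}(X,\rho,\mu)$ with the property that $(\mathscr Eu)|_\Omega=u$ for any $u\in N^s_{p,q}(\Omega,\rho,\mu)$. (d) There exist $\varepsilon,s\in(0,\infty)$, $p\in(0,Q/\varepsilon)$, $q\in(0,\infty]$ with $\varepsilon<s\preceq_q\mathrm{ind}(\Omega,\rho)$,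 and $C_S\in(0,\infty)$ such that, for any ball $B_0:=B_\rho(x_0,R_0)$ with $x_0\in\Omega$ and $R_0\in(0,1]$, one has $$\|u\|_{L^{p^*}(B_0\cap\Omega)}\le\frac{C_S}{[\mu(B_0)]^{\varepsilon/Q}}\left[R_0^s\|u\|_{\dot N^s_{p,q}(\Omega,\rho,\mu)}+\|u\|_{L^p(\Omega)}\right]$$ whenever $u\in\dot N^s_{p,q}(\Omega,\rho,\mu)$, where $p^*:=Qp/(Q-\varepsilon p)$. (e) There exist $\varepsilon,s\in(0,\infty)$, $p\in(0,Q/\varepsilon)$, $q\in(0,\infty]$ with $\varepsilon<s\preceq_q\mathrm{ind}(\Omega,\rho)$, and $C_P\in(0,\infty)$ such that, for any ball $B_0:=B_\rho(x_0,R_0)$ with $x_0\in\Omega$ and $R_0\in(0,1]$, one has $$\inf_{\gamma\in\mathbb R}\|u-\gamma\|_{L^{p^*}(B_0\cap\Omega)}\le\frac{C_PR_0^s}{[\mu(B_0)]^{\varepsilon/Q}}\|u\|_{\dot N^s_{p,q}(\Omega,\rho,\mu)}$$ whenever $u\in\dot N^s_{p,q}(\Omega,\rho,\mu)$, where $p^*:=Qp/(Q-\varepsilon p)$. (f) There exist $c_1,c_2,\omega\in(0,\infty)$, $q\in(0,\infty]$, and $\varepsilon,s\in(0,\infty)$ satisfying $\varepsilon<s\preceq_q\mathrm{ind}(\Omega,\rho)$ such that $$\int_{B_0\cap\Omega}\exp\left[\left(c_1\frac{[\mu(B_0)]^{\varepsilon/Q}|u-u_{B_0\cap\Omega}|}{R_0^s\|u\|_{\dot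 N^s_{Q/\varepsilon,q}(\Omega,\rho,\mu)}}\right)^\omega\right]d\mu\le c_2\,\mu(B_0)$$ whenever $B_0$ is a $\rho$-ball centered in $\Omega$ having radius $R_0\in(0,1]$, and $u\in\dot N^s_{Q/\varepsilon,q}(\Omega,\rho,\mu)$ with $\|u\|_{\dot N^s_{Q/\varepsilon,q}(\Omega,\rho,\mu)}>0$. (g) There exist $\varepsilon,s\in(0,\infty)$, $p\in(Q/\varepsilon,\infty)$, $q\in(0,\infty]$ with $\varepsilon<s\preceq_q\mathrm{ind}(\Omega,\rho)$, and $C_H\in(0,\infty)$ such that, for any ball $B_0:=B_\rho(x_0,R_0)$ with $x_0\in\Omega$ and $R_0\in(0,1]$, every function $u\in\dot N^s_{p,q}(\Omega,\rho,\mu)$ has a Hölder continuous representative of order $s-Q/p$ on $B_0\cap\Omega$, denoted by $u$ again, satisfying $$|u(x)-u(y)|\le C_H[\rho(x,y)]^{s-Q/p}\frac{R_0^{Q/p}}{[\mu(B_0)]^{1/p}}\|u\|_{\dot N^s_{p,q}(\Omega,\rho,\mu)},\quad\forall\,x,y\in B_0\cap\Omega.$$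
   Context: **Quasi-metric measure spaces.** A quasi-metric on a set $X$ (always of cardinality at least $2$) is a function $\rho:X\times X\to[0,\infty)$ for which there are positive constants $C_0,C_1$ such that for all $x,y,z\in X$: $\rho(x,y)=0$ iff $x=y$; $\rho(y,x)\le C_0\rho(x,y)$; $\rho(x,y)\le C_1\max\{\rho(x,z),\rho(z,y)\}$. Balls are $B_\rho(x,r)=\{y\in X:\rho(x,y)<r\}$. The topology $\tau_\rho$ consists of the sets $O$ such that every $x\in O$ admits $r>0$ with $B_\rho(x,r)\subset O$. A quasi-metric measure space $(X,\rho,\mu)$ consists of such $X,\rho$ and a Borel measure $\mu$ such that every $\rho$-ball is $\mu$-measurable with $\mu(B_\rho(x,r))\in(0,\infty)$ for all $x\in X$, $r\in(0,\infty)$. $\mu$ is Borel regular if every $\mu$-measurable set is contained in a Borel set of equal measure. $\mu$ is $Q$-doubling if there is $\kappa>0$ such that $\kappa(r/R)^Q\le\mu(B_\rho(x,r))/\mu(B_\rho(y,R))$ whenever $x,y\in X$ and $0<r\le R<\infty$ satisfy $B_\rho(x,r)\subset B_\rho(y,R)$. **Locally uniformly perfect.** $\Omega$ is locally uniformly perfect if there is $\lambda\in(0,1)$ such that for all $x\in\Omega$ and $r\in(0,1]$: $(B_\rho(x,r)\cap\Omega)\setminus B_\rho(x,\lambda r)\ne\emptyset$ whenever $\Omega\setminus B_\rho(x,r)\ne\emptyset$. **Index.** For a quasi-metric $\varrho$ on $Y$ put $C_\varrho:=\sup\frac{\varrho(x,y)}{\max\{\varrho(x,z),\varrho(z,y)\}}\in[1,\infty)$,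 the supremum being over $x,y,z\in Y$ not all equal. Write $\varrho\approx\rho$ if $c^{-1}\varrho\le\rho\le c\varrho$ on $Y\times Y$ for some $c>0$. Define $\mathrm{ind}(Y,\rho):=\sup_{\varrho\approx\rho}(\log_2 C_\varrho)^{-1}\in(0,\infty]$, the supremum over all quasi-metrics $\varrho$ on $Y$ with $\varrho\approx\rho$ (with $(\log_2 1)^{-1}:=\infty$). $\mathrm{ind}(\Omega,\rho)$ is computed for $\rho$ restricted to $\Omega$. For $s\in(0,\infty)$, $q\in(0,\infty]$, $s\preceq_q\mathrm{ind}(Y,\rho)$ means $s\le\mathrm{ind}(Y,\rho)$, with $s=\mathrm{ind}(Y,\rho)$ permitted only when $q=\infty$ and the supremum defining $\mathrm{ind}(Y,\rho)$ is attained. **Function spaces.** Let $s,p\in(0,\infty)$, $q\in(0,\infty]$. A sequence $\vec g=\{g_k\}_{k\in\mathbb Z}$ of nonnegative $\mu$-measurable functions on $X$ is a fractional $s$-gradient of a $\mu$-measurable $u:X\to\mathbb R$ if there is $E\subset X$ with $\mu(E)=0$ such that $|u(x)-u(y)|\le[\rho(x,y)]^s[g_k(x)+g_k(y)]$ for all $k\in\mathbb Z$ and all $x,y\in X\setminus E$ with $2^{-k-1}\le\rho(x,y)<2^{-k}$. The set of these is $\mathbb D^s_\rho(u)$. Put $\|\vec g\|_{\ell^q(L^p(X))}:=\big\|\{\|g_k\|_{L^p(X,\mu)}\}_{k\in\mathbb Z}\big\|_{\ell^q}$ and $\|u\|_{\dot N^s_{p,q}(X,\rho,\mu)}:=\inf_{\vec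 g\in\mathbb D^s_\rho(u)}\|\vec g\|_{\ell^q(L^p(X))}$ ($\inf\emptyset:=\infty$); $\dot N^s_{p,q}$ is the set of $\mu$-measurable real-valued $u$ for which this is finite. $N^s_{p,q}:=\dot N^s_{p,q}\cap L^p$ with $\|u\|_{N^s_{p,q}}:=\|u\|_{\dot N^s_{p,q}}+\|u\|_{L^p}$. The spaces on $\Omega$ are defined in the same way with $X$ replaced by $\Omega$ and $\rho,\mu$ restricted. $u_E:=\mu(E)^{-1}\int_Eu\,d\mu$; statements involving $u_E$ include that $u$ is integrable on $E$. *)

(* Defs.v *)
From HB Require Import structures.
From mathcomp Require Import all_boot all_order all_algebra.
From mathcomp Require Import all_classical all_reals all_analysis.

Set Implicit Arguments.
Unset Strict Implicit.
Unset Printing Implicit Defensive.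

Import Order.TTheory GRing.Theory Num.Theory.

Local Open Scope classical_set_scope.
Local Open Scope ring_scope.

(* Spaces living on a subset [Y] of [X] are relativized to [Y] rather than
   built on a subtype: only the values of functions at points of [Y] (and of
   quasi-metrics on [Y * Y]) matter. The spaces on [X] are those on [setT]. *)

Definition is_quasi_metric (R : realType) (X : Type) (Y : set X)
    (rho : X -> X -> R) : Prop :=
  (exists x y, [/\ Y x, Y y & x <> y]) /\
  exists C0 C1 : R, [/\ 0 < C0, 0 < C1 &
    forall x y z, Y x -> Y y -> Y z ->
      [/\ 0 <= rho x y,
          rho x y = 0 <-> x = y,
          rho y x <= C0 * rho x y &
          rho x y <= C1 * Num.max (rho x z) (rho z y)]].

Definition qball (R : realType) (X : Type) (rho : X -> X -> R) (x : X) (r : R)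
    : set X := [set y | rho x y < r].

Definition qopen (R : realType) (X : Type) (rho : X -> X -> R) : set (set X) :=
  [set O | forall x, O x -> exists2 r : R, 0 < r & qball rho x r `<=` O].

Definition qborel (R : realType) (X : Type) (rho : X -> X -> R)
    : set (set X) := <<s qopen rho >>.

(* Balls need not belong to [qborel rho], whence the separate assumption. *)
Definition quasi_metric_measure_space (R : realType) (d : measure_display)
    (X : measurableType d) (rho : X -> X -> R) (mu : {measure set X -> \bar R})
    : Prop :=
  [/\ is_quasi_metric [set: X] rho,
      forall B : set X, qborel rho B -> measurable B &
      forall (x : X) (r : R), 0 < r ->
        [/\ measurable (qball rho x r),
            (0 < mu (qball rho x r))%E &
            (mu (qball rho x r) < +oo)%E]].

Definition borel_regular (R : realType) (d : measure_display)
    (X : measurableType d) (rho : X -> X -> R) (mu : {measure set X -> \bar R})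
    : Prop :=
  forall A : set X, measurable A ->
    exists B : set X, [/\ qborel rho B, A `<=` B & mu B = mu A].

Definition doubling (R : realType) (d : measure_display)
    (X : measurableType d) (rho : X -> X -> R) (mu : {measure set X -> \bar R})
    (Q : R) : Prop :=
  exists2 kappa : R, 0 < kappa &
    forall (x y : X) (r r' : R), 0 < r -> r <= r' ->
      qball rho x r `<=` qball rho y r' ->
      kappa * (r / r') `^ Q
        <= fine (mu (qball rho x r)) / fine (mu (qball rho y r')).

Definition locally_uniformly_perfect (R : realType) (X : Type)
    (rho : X -> X -> R) (Omega : set X) : Prop :=
  exists lambda : R, [/\ 0 < lambda, lambda < 1 &
    forall (x : X) (r : R), Omega x -> 0 < r -> r <= 1 ->
      Omega `\` qball rho x r !=set0 ->
      (qball rho x r `&` Omega) `\` qball rho x (lambda * r) !=set0].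

Definition qm_const (R : realType) (X : Type) (Y : set X) (rho : X -> X -> R)
    : R :=
  sup [set t | exists x y z : X, [/\ Y x, Y y, Y z, ~ (x = y /\ y = z) &
                 t = rho x y / Num.max (rho x z) (rho z y)]].

Definition qm_equiv (R : realType) (X : Type) (Y : set X)
    (rho1 rho2 : X -> X -> R) : Prop :=
  exists2 c : R, 0 < c & forall x y : X, Y x -> Y y ->
    c^-1 * rho1 x y <= rho2 x y /\ rho2 x y <= c * rho1 x y.

(* The inverse on [\bar R] satisfies [0^-1 = +oo]. *)
Definition qm_exponent (R : realType) (X : Type) (Y : set X)
    (rho : X -> X -> R) : \bar R :=
  (((ln (qm_const Y rho) / ln 2)%R%:E)^-1)%E.

Definition qm_index_set (R : realType) (X : Type) (Y : set X) (rho : X -> X -> R)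
    : set (\bar R) :=
  [set t | exists rho' : X -> X -> R,
     [/\ is_quasi_metric Y rho', qm_equiv Y rho' rho & t = qm_exponent Y rho']].

Definition qm_index (R : realType) (X : Type) (Y : set X) (rho : X -> X -> R)
    : \bar R := ereal_sup (qm_index_set Y rho).

(* $s \preceq_q \mathrm{ind}(Y, \rho)$ *)
Definition le_qm_index (R : realType) (X : Type) (q : \bar R) (s : R)
    (Y : set X) (rho : X -> X -> R) : Prop :=
  (s%:E <= qm_index Y rho)%E /\
  (s%:E = qm_index Y rho -> q = +oo%E /\ qm_index_set Y rho (qm_index Y rho)).

Definition Lp_norm (R : realType) (d : measure_display) (X : measurableType d)
    (mu : {measure set X -> \bar R}) (Y : set X) (p : R) (u : X -> R) : \bar R :=
  ('N[mu]_(p%:E) [(EFin \o u) \_ Y])%E.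

(* meant for [q] in (0, +oo] and nonnegative [a] *)
Definition lq_norm (R : realType) (q : \bar R) (a : int -> \bar R) : \bar R :=
  match q with
  | r%:E => ((\esum_(k in [set: int]) (a k `^ r)) `^ r^-1)%E
  | _ => ereal_sup (range a)
  end.

Definition fractional_gradient (R : realType) (d : measure_display)
    (X : measurableType d) (rho : X -> X -> R) (mu : {measure set X -> \bar R})
    (Y : set X) (s : R) (u : X -> R) (g : int -> X -> R) : Prop :=
  [/\ forall k, measurable_fun Y (g k),
      forall k x, Y x -> 0 <= g k x &
      exists E : set X, [/\ measurable E, mu E = 0%E &
        forall (k : int) (x y : X), (Y `\` E) x -> (Y `\` E) y ->
          2 ^ (- k - 1) <= rho x y -> rho x y < 2 ^ (- k) ->
          `|u x - u y| <= rho x y `^ s * (g k x + g k y)]].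

(* norm and elements of $\dot N^s_{p,q}(Y, \rho, \mu)$ *)
Definition dotN_norm (R : realType) (d : measure_display)
    (X : measurableType d) (rho : X -> X -> R) (mu : {measure set X -> \bar R})
    (Y : set X) (s p : R) (q : \bar R) (u : X -> R) : \bar R :=
  ereal_inf [set lq_norm q (fun k => Lp_norm mu Y p (g k)) |
              g in [set g | fractional_gradient rho mu Y s u g]].

Definition dotN (R : realType) (d : measure_display)
    (X : measurableType d) (rho : X -> X -> R) (mu : {measure set X -> \bar R})
    (Y : set X) (s p : R) (q : \bar R) : set (X -> R) :=
  [set u | measurable_fun Y u /\ (dotN_norm rho mu Y s p q u < +oo)%E].

(* norm and elements of $N^s_{p,q}(Y, \rho, \mu)$ *)
Definition N_norm (R : realType) (d : measure_display)
    (X : measurableType d) (rho : X -> X -> R) (mu : {measure set X -> \bar R})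
    (Y : set X) (s p : R) (q : \bar R) (u : X -> R) : \bar R :=
  (dotN_norm rho mu Y s p q u + Lp_norm mu Y p u)%E.

Definition N_space (R : realType) (d : measure_display)
    (X : measurableType d) (rho : X -> X -> R) (mu : {measure set X -> \bar R})
    (Y : set X) (s p : R) (q : \bar R) : set (X -> R) :=
  [set u | dotN rho mu Y s p q u /\ (Lp_norm mu Y p u < +oo)%E].

Definition extension_domain (R : realType) (d : measure_display)
    (X : measurableType d) (rho : X -> X -> R) (mu : {measure set X -> \bar R})
    (Omega : set X) (s p : R) (q : \bar R) : Prop :=
  exists2 C : R, 0 < C &
    forall u, N_space rho mu Omega s p q u ->
      exists v, [/\ N_space rho mu setT s p q v,
        forall x, Omega x -> v x = u x &
        (N_norm rho mu setT s p q v <= C%:E * N_norm rho mu Omega s p q u)%E].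

(* The second clause says that [E u] depends only on the restriction of [u] to
   [Omega], i.e. that [E] is an operator on functions defined on [Omega]. *)
Definition bounded_linear_extension (R : realType) (d : measure_display)
    (X : measurableType d) (rho : X -> X -> R) (mu : {measure set X -> \bar R})
    (Omega : set X) (s p : R) (q : \bar R) (E : (X -> R) -> (X -> R)) : Prop :=
  [/\ forall u, N_space rho mu Omega s p q u -> N_space rho mu setT s p q (E u),
      forall u v, N_space rho mu Omega s p q u ->
        (forall x, Omega x -> u x = v x) -> E u = E v,
      forall (a : R) u v, N_space rho mu Omega s p q u ->
        N_space rho mu Omega s p q v ->
        E (fun x => a * u x + v x) = (fun x => a * E u x + E v x),
      exists2 C : R, 0 < C & forall u, N_space rho mu Omega s p q u ->
        (N_norm rho mu setT s p q (E u) <= C%:E * N_norm rho mu Omega s p q u)%E &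
      forall u, N_space rho mu Omega s p q u -> forall x, Omega x -> E u x = u x].

Definition mean (R : realType) (d : measure_display) (X : measurableType d)
    (mu : {measure set X -> \bar R}) (E : set X) (u : X -> R) : R :=
  (fine (mu E))^-1 * \int[mu]_(x in E) u x.

Definition hoelder_on (R : realType) (X : Type) (rho : X -> X -> R)
    (A : set X) (alpha : R) (u : X -> R) : Prop :=
  exists M : R, forall x y, A x -> A y -> `|u x - u y| <= M * rho x y `^ alpha.

(* Main.v *)
Require Import Defs.
From HB Require Import structures.
From mathcomp Require Import all_boot all_order all_algebra.
From mathcomp Require Import all_classical all_reals all_analysis.
From mathcomp Require Import measurable_realfun.
From mathcomp Require Import ring lra zify.

Set Implicit Arguments.
Unset Strict Implicit.
Unset Printing Implicit Defensive.

Import Order.TTheory GRing.Theory Num.Theory.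
Local Open Scope classical_set_scope.
Local Open Scope ring_scope.

(** Each of (b)-(g) is shown to be equivalent to the measure density property (a).

    Metrization.  A quasi-metric with constant [C] in its maximum inequality has
    powers [rho^beta], [C^beta <= 2], that are comparable to a pseudometric [D]
    ([snowflake_of_index], by the sharp form of Frink's lemma).  The index only
    enters through this: a smoothness [s] allowed by the index is at most
    [beta], so that functions Lipschitz for [D] have smoothness [s].  All the
    analysis is done with [D], for which the measure is doubling.

    From (a) to (d)-(g).  A fractional gradient gives, at each scale [2^-n], an
    integrable function [H_n] with [|u x - u y|^p <= H_n x + H_n y] when [x] and
    [y] are closer than that scale ([pgradient_of_dotN]).  Off a set of small
    measure [H_n] is small; under (a) balls are heavier than these bad sets, so
    any two good points are joined by a chain of points that are good at their
    own scales ([good_chain_bound]).  For [s p > Q] this yields Hölder estimates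
    almost everywhere ([hoelder_ae]).  As the parameters in (d)-(g) may be
    chosen, [p = 2 Q / s] and [q] infinite serve for all four statements.

    From (b), (d)-(g) to (a).  Each of them is tested on cut-offs [u] that are 1
    on the [D]-ball of radius [a] around a point of the domain and 0 off the
    ball of radius [b]; their norms are computed in [cutoff_norm].  Every one of
    the five inequalities then bounds the smaller of the masses of the inner
    ball and of the part outside the outer ball by a power, larger than 1, of
    the mass of the outer ball ([separation]).  For (b) the extension of [u]
    lives on the whole space, where chains exist without any assumption on the
    domain ([weak_type_separation]).  Iterating over radii as in De Giorgi's
    argument, a ball lighter than its complement cannot be too light
    ([lighter_ball_density]); uniform perfectness provides two disjoint balls of
    comparable radius, and the lighter of them is heavy enough for both
    ([density_of_separation]).

    From (a) to (c).  The function is averaged over the domain at the scales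
    [2^-m]; off the domain the extension is the telescoping sum of the
    differences of successive averages, each cut off at distance about [2^-m]
    from the domain ([scale_sum]).  These averages are linear in [u] and exist
    near the domain because of (a).  Each difference is bounded by the local
    average of [H_m] to the power [1/p] and is Lipschitz at its scale
    ([scale_term_bound]); local averages are dominated by sums over nets with
    bounded overlap ([average_majorant]), so that the sum over all scales has
    the right norm ([scale_sum_majorant]).  A large [p] makes the sum converge
    at every point, which keeps the operator linear pointwise, and on the domain
    it agrees with [u] almost everywhere ([scale_sum_ae]). *)

(** * Pseudometrics equivalent to powers of a quasi-metric *)

Definition is_pmetric (R : realType) (X : Type) (D : X -> X -> R) : Prop :=
  [/\ forall x, D x x = 0, forall x y, D x y = D y x &
      forall x y z, D x y <= D x z + D z y].

Section Chains.
Context {R : realType} {X : Type} (q : X -> X -> R).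
Hypothesis q_ge0 : forall x y, 0 <= q x y.
Hypothesis q_xx : forall x, q x x = 0.
Hypothesis q_sym : forall x y, q x y = q y x.
Hypothesis q_max : forall x y z, q x y <= 2 * Num.max (q x z) (q z y).

Fixpoint chain_cost (x : X) (s : seq X) (y : X) : R :=
  if s is z :: s' then q x z + chain_cost z s' y else q x y.

Definition chain_dist (x y : X) : R := inf [set chain_cost x s y | s in setT].

Lemma chain_cost_ge0 x s y : 0 <= chain_cost x s y.
Proof. by elim: s x => [|z s IH] x //=; rewrite addr_ge0. Qed.

Lemma chain_cost_cat x s z t y :
  chain_cost x (s ++ z :: t) y = chain_cost x s z + chain_cost z t y.
Proof. by elim: s x => [|w s IH] x //=; rewrite IH addrA. Qed.

Lemma chain_cost_rev x s y : chain_cost x (rev s) y = chain_cost y s x.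
Proof.
elim: s y => [|z s IH] y /=; first by rewrite q_sym.
by rewrite rev_cons -cats1 chain_cost_cat /= IH q_sym addrC.
Qed.

Let costs x y : set R := [set chain_cost x s y | s in setT].

Let has_inf_costs x y : has_inf (costs x y).
Proof.
split; first by exists (q x y); exists [::].
by exists 0 => _ [s _ <-]; exact: chain_cost_ge0.
Qed.

Lemma chain_dist_le x s y : chain_dist x y <= chain_cost x s y.
Proof. by apply: ge_inf; [case: (has_inf_costs x y)|exists s]. Qed.

Lemma chain_dist_le_q x y : chain_dist x y <= q x y.
Proof. exact: (chain_dist_le x [::] y). Qed.

Lemma chain_dist_ge x y m : (forall s, m <= chain_cost x s y) -> m <= chain_dist x y.
Proof.
move=> H; apply: lb_le_inf; first by exists (q x y); exists [::].
by move=> _ [s _ <-].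
Qed.

Lemma chain_dist_pmetric : is_pmetric chain_dist.
Proof.
have sym_le x y : chain_dist x y <= chain_dist y x.
  apply: chain_dist_ge => s.
  by rewrite -chain_cost_rev chain_dist_le.
split=> [x|x y|x y z].
- apply/eqP; rewrite eq_le -{1}(q_xx x) chain_dist_le_q /=.
  by apply: chain_dist_ge => s; exact: chain_cost_ge0.
- by apply/eqP; rewrite eq_le !sym_le.
- rewrite -lerBlDr; apply: chain_dist_ge => s.
  rewrite lerBlDr addrC -lerBlDr; apply: chain_dist_ge => t.
  by rewrite lerBlDr addrC -chain_cost_cat chain_dist_le.
Qed.

(** With these weights (1 for the end links, 2 for the others) a chain that is
    cut at a link, the link being kept in both parts, does not change its cost. *)
Fixpoint weighted_tail (x : X) (s : seq X) (y : X) : R :=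
  if s is z :: s' then 2 * q x z + weighted_tail z s' y else q x y.

Definition weighted_cost (x : X) (s : seq X) (y : X) : R :=
  if s is z :: s' then q x z + weighted_tail z s' y else q x y.

Lemma weighted_tail_le x s y : weighted_tail x s y <= 2 * chain_cost x s y.
Proof.
elim: s x => [|z s IH] x /=; first by have := q_ge0 x y; lra.
by have := IH z; lra.
Qed.

Lemma weighted_cost_le x s y : weighted_cost x s y <= 2 * chain_cost x s y.
Proof.
case: s => [|z s] /=; first by have := q_ge0 x y; lra.
by have := weighted_tail_le z s y; have := q_ge0 x z; lra.
Qed.

Lemma weighted_cost_split x s z' z t y :
  weighted_cost x (s ++ z' :: z :: t) y =
  weighted_cost x (rcons s z') z + weighted_cost z' (z :: t) y.
Proof.
have tail w r : weighted_tail w (r ++ z' :: z :: t) y =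
    weighted_tail w (rcons r z') z + (q z' z + weighted_tail z t y).
  by elim: r w => [|v r IH] w /=; [|rewrite IH]; lra.
by case: s => [|w s] /=; [|rewrite tail]; lra.
Qed.

Lemma switch_point (a : pred X) (x : X) (s : seq X) : ~~ a x -> has a s ->
  (exists z t, s = z :: t /\ a z) \/
  exists r z' z t, [/\ s = r ++ z' :: z :: t, ~~ a z' & a z].
Proof.
elim: s x => [//|w s IH] x nax /=.
case: (boolP (a w)) => [aw _|naw /= has_s]; first by left; exists w, s.
right; case: (IH w naw has_s) => [[z [t [-> az]]]|[r [z' [z [t [-> naz' az]]]]]].
  by exists [::], w, z, t.
by exists (w :: r), z', z, t.
Qed.

(** The sharp form of Frink's lemma (the constant 2 in [q_max] cannot be
    enlarged).  Along the chain the points that are far from [x] come after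
    those that are far from [y], so some link [(z', z)] switches from one kind
    to the other; [q x y] is then at most twice each of [q x z] and [q z' y],
    hence at most their sum, and the link shared by the two shorter chains is
    counted once in each, as its weight 2 in the whole chain allows. *)
Lemma le_weighted_cost x s y : q x y <= 2 * weighted_cost x s y.
Proof.
have [n] := ubnP (size s); elim: n => // n IH in x s y *; move=> sz_s.
have wt_ge0 w r u : 0 <= weighted_tail w r u.
  by elim: r w => [|v r IHr] w //=; have := IHr v; have := q_ge0 w v; lra.
have w_ge0 w r u : 0 <= weighted_cost w r u.
  by case: r => [|v r] //=; have := wt_ge0 v r u; have := q_ge0 w v; lra.
have [|qxy_gt0] := lerP (q x y) 0; first by have := w_ge0 x s y; lra.
pose a z := q x y <= 2 * q x z.
have nax : ~~ a x by rewrite /a q_xx mulr0 -ltNge.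
have nearP z : ~~ a z -> q x y <= 2 * q z y.
  by rewrite /a -ltNge => lt_xz; have := q_max x y z; rewrite maxEle; case: ifP => _; lra.
case: (boolP (has a s)) => [has_s|no_s].
  case: (switch_point nax has_s) => [[z [t [-> az]]]|[r [z' [z [t [def_s naz' az]]]]]].
    by move: az; rewrite /a /=; have := wt_ge0 z t y; lra.
  rewrite def_s weighted_cost_split.
  move: sz_s; rewrite def_s size_cat /= => sz_s.
  have := IH x (rcons r z') z; rewrite size_rcons.
  have := IH z' (z :: t) y; rewrite /=.
  move=> /(_ ltac:(lia)) h1 /(_ ltac:(lia)) h2.
  by move: az (nearP _ naz'); rewrite /a; lra.
case/lastP: s => [|r z] in sz_s no_s *; first by rewrite /=; lra.
have {no_s}/nearP : ~~ a z by move: no_s; rewrite has_rcons negb_or => /andP[].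
have le_last w v : q z y <= weighted_tail w (rcons v z) y.
  elim: v w => [|u v IHv] w /=; first by have := q_ge0 w z; lra.
  by have := IHv u; have := q_ge0 w u; lra.
case: r sz_s => [|w r] _ /=; first by have := q_ge0 x z; lra.
by have := le_last w r; have := q_ge0 x w; lra.
Qed.

Lemma q_le_chain_dist x y : q x y <= 4 * chain_dist x y.
Proof.
rewrite -ler_pdivrMl //; apply: chain_dist_ge => s.
by have := le_weighted_cost x s y; have := weighted_cost_le x s y; lra.
Qed.
End Chains.

(** * The index and pseudometrics *)
Lemma powR_le (R : realType) (a b r : R) : 0 <= r -> 0 <= a -> a <= b ->
  a `^ r <= b `^ r.
Proof. by move=> r0 a0 ab; apply: ge0_ler_powR; rewrite // nnegrE ?(le_trans a0). Qed.

Lemma powR_lt (R : realType) (a b r : R) : 0 < r -> 0 <= a -> a < b ->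
  a `^ r < b `^ r.
Proof. by move=> r0 a0 ab; apply: gt0_ltr_powR; rewrite // nnegrE ?(le_trans a0) // ltW. Qed.

Definition snowflake (R : realType) (X : Type) (Y : set X) (rho D : X -> X -> R)
    (beta c : R) : Prop :=
  forall x y, Y x -> Y y ->
    D x y <= c * rho x y `^ beta /\ rho x y `^ beta <= c * D x y.

Section Index.
Context {R : realType} {X : Type}.
Implicit Types (Y : set X) (rho D : X -> X -> R).

Lemma qm_const_bound Y rho : is_quasi_metric Y rho ->
  1 <= qm_const Y rho /\ forall x y z, Y x -> Y y -> Y z ->
    rho x y <= qm_const Y rho * Num.max (rho x z) (rho z y).
Proof.
move=> [[a [b [Ya Yb ab]]] [C0 [C1 [C0_gt0 C1_gt0 H]]]].
set S := [set t | exists x y z : X, [/\ Y x, Y y, Y z, ~ (x = y /\ y = z) &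
                 t = rho x y / Num.max (rho x z) (rho z y)]].
have max_gt0 x y z : Y x -> Y y -> Y z -> ~ (x = y /\ y = z) ->
    0 < Num.max (rho x z) (rho z y).
  move=> Yx Yy Yz nxyz; have [xz0 /(iffLR) xzE _ _] := H x z z Yx Yz Yz.
  have [zy0 /(iffLR) zyE _ _] := H z y y Yz Yy Yy.
  rewrite lt_max !lt0r xz0 zy0 !andbT -negb_and; apply/negP => /andP[/eqP xz /eqP zy].
  by apply: nxyz; split; [rewrite (xzE xz) (zyE zy)|rewrite (zyE zy)].
have ubS : has_ubound S.
  exists C1 => _ [x [y [z [Yx Yy Yz nxyz ->]]]].
  by rewrite ler_pdivrMr ?max_gt0 //; case: (H x y z Yx Yy Yz).
have S1 : S 1.
  exists a, b, b; split=> //; first by case.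
  have := max_gt0 a b b Ya Yb Yb (fun h => ab h.1).
  have [_ /(iffRL) bb0 _ _] := H b b b Yb Yb Yb; rewrite (bb0 erefl).
  have [ab0 _ _ _] := H a b b Ya Yb Yb.
  by move=> gt0; move: (gt0); rewrite max_l // => gt0'; rewrite divff // gt_eqF.
split; first exact: ub_le_sup.
move=> x y z Yx Yy Yz; have [[xy yz]|nxyz] := pselect (x = y /\ y = z).
  subst y z; have [_ /(iffRL) xx0 _ _] := H x x x Yx Yx Yx.
  by rewrite (xx0 erefl) maxxx mulr0.
rewrite -ler_pdivrMr ?max_gt0 //; apply: ub_le_sup => //.
by exists x, y, z.
Qed.

(** The exponent of [rho] is the largest power that brings its constant down to
    2, the value up to which chains of small total cost cannot exist. *)
Lemma qm_const_powR_le2 Y rho beta : is_quasi_metric Y rho -> 0 < beta ->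
  (beta%:E <= qm_exponent Y rho)%E -> qm_const Y rho `^ beta <= 2.
Proof.
move=> /qm_const_bound[C_ge1 _] beta_gt0; rewrite /qm_exponent inver.
set C := qm_const Y rho in C_ge1 *.
have lnC : 0 <= ln C by rewrite ln_ge0.
have ln2 : 0 < ln 2 :> R by rewrite ln_gt0 // ltr1n.
have C_gt0 : 0 < C by apply: lt_le_trans C_ge1.
case: ifPn => [|nz].
  rewrite mulf_eq0 invr_eq0 (gt_eqF ln2) orbF => /eqP lnC0 _.
  by rewrite /powR gt_eqF // lnC0 mulr0 expR0 ler1n.
have lnC_gt0 : 0 < ln C.
  by rewrite lt0r lnC andbT; apply: contraNneq nz => ->; rewrite mul0r.
rewrite lee_fin invf_div ler_pdivlMr // => le_ln.
rewrite /powR gt_eqF // -[leRHS](@lnK _ 2) ?ler_expR // posrE.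
exact: ltr0n.
Qed.

(** Off [Y] the quasi-metric carries no information, so it is transported to
    the whole of [X] along a retraction of [X] onto [Y]. *)
Lemma snowflake_of_exponent Y rho beta : is_quasi_metric Y rho -> 0 < beta ->
  (beta%:E <= qm_exponent Y rho)%E ->
  exists D c, [/\ is_pmetric D, 0 < c & snowflake Y rho D beta c].
Proof.
move=> qmY beta_gt0 le_beta.
have Cb := qm_const_powR_le2 qmY beta_gt0 le_beta.
have [C_ge1 Cmax] := qm_const_bound qmY.
case: qmY => [[a [_ [Ya _ _]]] [C0 [C1 [C0_gt0 C1_gt0 H]]]].
pose pi x := if pselect (Y x) then x else a.
have Ypi x : Y (pi x) by rewrite /pi; case: pselect.
have piE x : Y x -> pi x = x by rewrite /pi; case: pselect.
pose m x y := Num.max (rho (pi x) (pi y)) (rho (pi y) (pi x)).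
have rho_ge0 x y : 0 <= rho (pi x) (pi y) by case: (H _ _ _ (Ypi x) (Ypi y) (Ypi y)).
have m_ge0 x y : 0 <= m x y by rewrite le_max rho_ge0.
have m_xx x : m x x = 0.
  by rewrite /m maxxx; case: (H _ _ _ (Ypi x) (Ypi x) (Ypi x)) => _ /(iffRL)/(_ erefl).
have m_sym x y : m x y = m y x by rewrite /m maxC.
have C_ge0 : 0 <= qm_const Y rho by apply: le_trans C_ge1.
have m_max x y z : m x y <= qm_const Y rho * Num.max (m x z) (m z y).
  have le1 : Num.max (rho (pi x) (pi z)) (rho (pi z) (pi y)) <= Num.max (m x z) (m z y).
    by rewrite ge_max !le_max !lexx ?orbT.
  have le2 : Num.max (rho (pi y) (pi z)) (rho (pi z) (pi x)) <= Num.max (m x z) (m z y).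
    by rewrite ge_max !le_max !lexx ?orbT.
  rewrite ge_max; apply/andP; split.
    by apply: (le_trans (Cmax _ _ _ (Ypi x) (Ypi y) (Ypi z))); rewrite ler_wpM2l.
  by apply: (le_trans (Cmax _ _ _ (Ypi y) (Ypi x) (Ypi z))); rewrite ler_wpM2l.
pose q x y := m x y `^ beta.
have q_ge0 x y : 0 <= q x y by exact: powR_ge0.
have q_xx x : q x x = 0 by rewrite /q m_xx powR0 // gt_eqF.
have q_sym x y : q x y = q y x by rewrite /q m_sym.
have q_max x y z : q x y <= 2 * Num.max (q x z) (q z y).
  have mM : Num.max (m x z) (m z y) `^ beta <= Num.max (q x z) (q z y).
    by rewrite /q [in leLHS]maxEle; case: ifP => _; rewrite le_max lexx ?orbT.
  apply: (@le_trans _ _ ((qm_const Y rho * Num.max (m x z) (m z y)) `^ beta)).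
    by apply: powR_le => //; exact: ltW.
  have max_ge0 : 0 <= Num.max (m x z) (m z y) by rewrite le_max m_ge0.
  by rewrite powRM //; apply: ler_pM => //; exact: powR_ge0.
exists (chain_dist q), (Num.max 4 (Num.max 1 C0 `^ beta)); split.
- exact: chain_dist_pmetric.
- by rewrite lt_max ltr0n.
move=> x y Yx Yy; have mE : rho x y <= m x y <= Num.max 1 C0 * rho x y.
  have [h0 _ h1 _] := H x y y Yx Yy Yy.
  rewrite /m !piE // le_max lexx ge_max /=.
  rewrite ler_peMl ?le_max ?lexx //= (le_trans h1) // ler_wpM2r // le_max lexx orbT //.
have rho0 : 0 <= rho x y by move: (rho_ge0 x y); rewrite !piE.
case/andP: mE => le1 le2; split.
  apply: (le_trans (chain_dist_le_q q_ge0 x y)).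
  apply: (@le_trans _ _ ((Num.max 1 C0 * rho x y) `^ beta)).
    by apply: powR_le => //; exact: ltW.
  by rewrite powRM // ?le_max ?ler01 // ler_wpM2r ?powR_ge0 // le_max lexx orbT.
apply: (@le_trans _ _ (q x y)); first by apply: powR_le => //; exact: ltW.
apply: (le_trans (q_le_chain_dist q_ge0 q_xx q_max x y)).
rewrite ler_wpM2r ?le_max ?lexx //.
by apply: chain_dist_ge => s; exact: chain_cost_ge0.
Qed.

(** The index is a supremum over the quasi-metrics equivalent to [rho], so an
    estimate for one of these has to be carried over to [rho]. *)
Lemma snowflake_equiv Y rho' rho D beta c : 0 <= beta -> 0 < c -> is_pmetric D ->
  (forall x y, Y x -> Y y -> 0 <= rho' x y) ->
  qm_equiv Y rho' rho -> snowflake Y rho' D beta c ->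
  exists2 c', 0 < c' & snowflake Y rho D beta c'.
Proof.
move=> b0 c0 [Dxx Dsym Dtri] rho'0 [k k0 H] snow.
have D0 x y : 0 <= D x y by have := Dtri x x y; rewrite Dxx (Dsym y x); lra.
have kb : 0 < k `^ beta by apply: powR_gt0.
exists (c * k `^ beta); first by rewrite mulr_gt0.
move=> x y Yx Yy; have [s1 s2] := snow x y Yx Yy; have [h1 h2] := H x y Yx Yy.
have r0 : 0 <= rho x y.
  by apply: le_trans h1; rewrite mulr_ge0 // ?rho'0 // invr_ge0 ltW.
split.
  apply: (le_trans s1); rewrite -mulrA ler_pM2l // -powRM //; last exact: ltW.
  by apply: powR_le => //; [exact: rho'0|rewrite -ler_pdivrMl].
apply: (@le_trans _ _ ((k * rho' x y) `^ beta)); first exact: powR_le.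
rewrite powRM ?(ltW k0) ?rho'0 // [c * _]mulrC -mulrA ler_pM2l //.
Qed.

(** The restriction on the attainment of the index is exactly what leaves room
    for an exponent [beta > s] unless [q] is infinite. *)
Lemma snowflake_of_index Y rho (q : \bar R) s : 0 < s -> le_qm_index q s Y rho ->
  exists beta D c, [/\ s <= beta, q <> +oo%E -> s < beta, is_pmetric D, 0 < c &
    snowflake Y rho D beta c].
Proof.
move=> s_gt0 [le_s eq_s].
have main rho' beta : is_quasi_metric Y rho' -> qm_equiv Y rho' rho ->
    (beta%:E <= qm_exponent Y rho')%E -> s <= beta -> (q <> +oo%E -> s < beta) ->
  exists beta D c, [/\ s <= beta, q <> +oo%E -> s < beta, is_pmetric D, 0 < c &
    snowflake Y rho D beta c].
  move=> qm' eqv le_b sb sb'.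
  have b0 : 0 < beta by exact: lt_le_trans sb.
  have [D [c [Dm c0 snow]]] := snowflake_of_exponent qm' b0 le_b.
  have rho'0 x y : Y x -> Y y -> 0 <= rho' x y.
    by case: qm' => _ [C0 [C1 [_ _ H]]] Yx Yy; case: (H x y y Yx Yy Yy).
  have [c' c'0 snow'] := snowflake_equiv (ltW b0) c0 Dm rho'0 eqv snow.
  by exists beta, D, c'.
move: le_s; rewrite le_eqVlt => /predU1P[/[dup] sE /eq_s[qE [rho' [qm' eqv tE]]]|].
  by apply: (main rho' s) => //; rewrite -tE -sE.
move=> /ereal_sup_gt[t [rho' [qm' eqv tE]]] lt_s.
have [b [sb bt]] : exists b : R, s < b /\ (b%:E <= t)%E.
  case: t lt_s {tE} => [r| |//] lt_s; first by exists r; rewrite lte_fin in lt_s.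
  by exists (s + 1); rewrite leey; split=> //; lra.
apply: (main rho' b) => //; [by rewrite -tE|exact: ltW].
Qed.

Lemma qm_exponent_gt0 Y rho : is_quasi_metric Y rho ->
  exists2 beta : R, 0 < beta & (beta%:E <= qm_exponent Y rho)%E.
Proof.
move=> /qm_const_bound[C_ge1 _]; rewrite /qm_exponent inver.
case: ifPn => [_|nz]; first by exists 1; rewrite ?leey.
exists ((ln (qm_const Y rho) / ln 2)^-1) => //.
by rewrite invr_gt0 lt0r nz divr_ge0 // ln_ge0 // ler1n.
Qed.

Lemma qm_exponent_le_index Y rho : is_quasi_metric Y rho ->
  (qm_exponent Y rho <= qm_index Y rho)%E.
Proof.
move=> qmY; apply: ereal_sup_ubound; exists rho; split=> //.
by exists 1 => // x y _ _; rewrite invr1 mul1r.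
Qed.

Lemma snowflake_sub Y Y' rho D beta c : Y' `<=` Y ->
  snowflake Y rho D beta c -> snowflake Y' rho D beta c.
Proof. by move=> YY snow x y /YY Yx /YY Yy; exact: snow. Qed.

Lemma is_quasi_metric_sub Y rho : is_quasi_metric setT rho ->
  (exists x y, [/\ Y x, Y y & x <> y]) -> is_quasi_metric Y rho.
Proof.
move=> [_ [C0 [C1 [h0 h1 H]]]] Y2; split=> //.
by exists C0, C1; split=> // x y z _ _ _; exact: H.
Qed.
End Index.

(** * Doubling metrics *)

(** The second clause replaces a topology: on measurable sets, functions that
    are continuous for [D] are measurable. *)
Definition doubling_metric (R : realType) (d : measure_display)
    (X : measurableType d) (D : X -> X -> R) (mu : {measure set X -> \bar R})
    (Cd Qd : R) : Prop :=
  [/\ is_pmetric D,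
      forall (Y : set X) (f : X -> R), measurable Y ->
        (forall x, Y x -> forall e, 0 < e -> exists2 r, 0 < r &
           forall y, Y y -> D x y < r -> `|f x - f y| < e) ->
        measurable_fun Y f,
      forall x r, 0 < r ->
        (0 < mu (qball D x r))%E /\ (mu (qball D x r) < +oo)%E &
      forall x r r', 0 < r -> r <= r' ->
        fine (mu (qball D x r')) <=
          Cd * (r' / r) `^ Qd * fine (mu (qball D x r))].

Section PMetric.
Context {R : realType} {X : Type} {D : X -> X -> R}.
Hypothesis Dm : is_pmetric D.

Lemma pm_xx x : D x x = 0. Proof. by case: Dm. Qed.
Lemma pm_sym x y : D x y = D y x. Proof. by case: Dm. Qed.
Lemma pm_tri z x y : D x y <= D x z + D z y. Proof. by case: Dm. Qed.
Lemma pm_ge0 x y : 0 <= D x y.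
Proof. by have := pm_tri y x x; rewrite pm_xx (pm_sym y x); lra. Qed.
Lemma pm_lip x y z : `|D x y - D x z| <= D y z.
Proof.
have := pm_tri y x z; have := pm_tri z x y; rewrite (pm_sym z y) => h1 h2.
by rewrite ler_norml; lra.
Qed.

Lemma snowflake_le Y rho beta c c' : c <= c' ->
  snowflake Y rho D beta c -> snowflake Y rho D beta c'.
Proof.
move=> cc snow x y Yx Yy; have [h1 h2] := snow x y Yx Yy; split.
  by apply: (le_trans h1); rewrite ler_wpM2r ?powR_ge0.
by apply: (le_trans h2); rewrite ler_wpM2r ?pm_ge0.
Qed.
End PMetric.

Lemma powRVK (R : realType) (x b : R) : 0 <= x -> b != 0 -> (x `^ b^-1) `^ b = x.
Proof. by move=> x0 b0; rewrite -powRrM mulVf // powRr1. Qed.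

Lemma powRKV (R : realType) (x b : R) : 0 <= x -> b != 0 -> (x `^ b) `^ b^-1 = x.
Proof. by move=> x0 b0; rewrite -powRrM mulfV // powRr1. Qed.

Lemma powR_invl (R : realType) (x r : R) : 0 <= x -> (x^-1) `^ r = (x `^ r)^-1.
Proof. by move=> x0; rewrite -(powRN x r) -mulN1r powRrM powR_inv1. Qed.

Lemma powR_divl (R : realType) (x y r : R) : 0 <= x -> 0 <= y ->
  (x / y) `^ r = x `^ r / y `^ r.
Proof. by move=> x0 y0; rewrite powRM ?invr_ge0 // powR_invl. Qed.

Lemma powR_lt_inv (R : realType) (x y b : R) : 0 < b -> 0 <= x -> 0 <= y ->
  x `^ b < y -> x < y `^ b^-1.
Proof.
move=> b0 x0 y0 h; rewrite -(powRKV x0 (lt0r_neq0 b0)).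
by apply: powR_lt; rewrite ?invr_gt0 ?powR_ge0.
Qed.

Lemma lt_powR_inv (R : realType) (x y b : R) : 0 < b -> 0 <= x -> 0 <= y ->
  x < y `^ b^-1 -> x `^ b < y.
Proof.
by move=> b0 x0 y0 h; rewrite -[ltRHS](powRVK y0 (lt0r_neq0 b0)); apply: powR_lt.
Qed.

Section DoublingMetric.
Context {R : realType} {d : measure_display} {X : measurableType d}.
Context (rho : X -> X -> R) (mu : {measure set X -> \bar R}) (Q : R).
Hypothesis hX : quasi_metric_measure_space rho mu.
Hypothesis hQ : 0 < Q.
Hypothesis hdoubling : doubling rho mu Q.

Lemma qm_ge0 x y : 0 <= rho x y.
Proof. by case: hX => [[_ [C0 [C1 [_ _ H]]]] _ _]; case: (H x y y I I I). Qed.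

(** Functions continuous for [D] are measurable because preimages of open sets
    are open for [rho], hence Borel, up to intersection with the domain; masses
    of [D]-balls are compared through the [rho]-balls nested between them. *)
Lemma snowflake_doubling_metric D beta c : 0 < beta -> 1 <= c -> is_pmetric D ->
  snowflake setT rho D beta c ->
  exists2 Cd, 0 < Cd & doubling_metric D mu Cd (Q / beta).
Proof.
move=> b0 c1 Dm snow; have c0 : 0 < c by exact: lt_le_trans c1.
case: hX => qmX borelX ballX.
have Dle x y r : 0 < r -> rho x y < (r / c) `^ beta^-1 -> D x y < r.
  move=> r0 h; apply: (le_lt_trans (proj1 (snow x y I I))).
  rewrite mulrC -ltr_pdivlMr //; apply: lt_powR_inv => //; first exact: qm_ge0.
  by rewrite divr_ge0 // ltW.
have leD x y r : 0 < r -> D x y < r -> rho x y < (c * r) `^ beta^-1.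
  move=> r0 h; apply: powR_lt_inv => //; [exact: qm_ge0|by rewrite mulr_ge0 // ltW|].
  by apply: (le_lt_trans (proj2 (snow x y I I))); rewrite ltr_pM2l.
have cont Y (f : X -> R) : measurable Y ->
    (forall x, Y x -> forall e, 0 < e -> exists2 r, 0 < r &
      forall y, Y y -> D x y < r -> `|f x - f y| < e) -> measurable_fun Y f.
  move=> mY cf; move=> _; apply: (measurability _ (RGenOInfty.measurableE R)) => //.
  move=> /= _ [_ [a ->]] <-.
  pose U := [set z | exists x r, [/\ Y x, D x z < r &
    forall w, Y w -> D x w < r -> a < f w]].
  have -> : Y `&` f @^-1` `]a, +oo[ = Y `&` U.
    apply/seteqP; split=> [z [Yz]|z [Yz [x [r [Yx xz H]]]]].
      rewrite /= in_itv /= andbT => az; split=> //.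
      have [r r0 H] := cf z Yz (f z - a) ltac:(by rewrite subr_gt0).
      exists z, r; split=> //; first by rewrite pm_xx.
      by move=> w Yw /(H w Yw); rewrite ltr_norml; lra.
    by split=> //=; rewrite in_itv /= andbT; apply: H.
  apply: measurableI => //; apply: borelX; apply: sub_gen_smallest.
  move=> z [x [r [Yx xz H]]].
  have r0 : 0 < r - D x z by rewrite subr_gt0.
  exists (((r - D x z) / c) `^ beta^-1); first by rewrite powR_gt0 // divr_gt0.
  move=> w /(Dle z w _ r0) zw; exists x, r; split=> //.
  by apply: (le_lt_trans (pm_tri Dm z x w)); lra.
have mball x r : measurable (qball D x r).
  have -> : qball D x r = setT `&` D x @^-1` `]-oo, r[%classic.
    by apply/seteqP; split=> z; rewrite /= in_itv //= => -[].
  apply: cont => // y _ e e0; exists e => // z _ yz.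
  exact: (le_lt_trans (pm_lip Dm x y z)).
have inner x r : 0 < r -> qball rho x ((r / c) `^ beta^-1) `<=` qball D x r.
  by move=> r0 y; exact: Dle.
have outer x r : 0 < r -> qball D x r `<=` qball rho x ((c * r) `^ beta^-1).
  by move=> r0 y; exact: leD.
have pos x r : 0 < r -> (0 < mu (qball D x r))%E /\ (mu (qball D x r) < +oo)%E.
  move=> r0; split.
    have h : 0 < (r / c) `^ beta^-1 by rewrite powR_gt0 // divr_gt0.
    have [mb b_gt0 _] := ballX x _ h; apply: (lt_le_trans b_gt0).
    by apply: le_measure; rewrite ?inE //; exact: inner.
  have h : 0 < (c * r) `^ beta^-1 by rewrite powR_gt0 // mulr_gt0.
  have [mb _ b_lty] := ballX x _ h; apply: le_lt_trans b_lty.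
  by apply: le_measure; rewrite ?inE //; exact: outer.
have [k k0 Hk] := hdoubling.
exists (k^-1 * (c ^+ 2) `^ (Q / beta)).
  by rewrite mulr_gt0 ?invr_gt0 // powR_gt0 // exprn_gt0.
split=> // x r r' r0 rr'.
have r'0 : 0 < r' by exact: lt_le_trans rr'.
set a := (r / c) `^ beta^-1; set b := (c * r') `^ beta^-1.
have a0 : 0 < a by rewrite powR_gt0 // divr_gt0.
have bb0 : 0 < b by rewrite powR_gt0 // mulr_gt0.
have [ma va vaoo] := ballX x a a0; have [mb vb vboo] := ballX x b bb0.
have [vr vroo] := pos x r r0; have [vr' vr'oo] := pos x r' r'0.
have le_ba : fine (mu (qball D x r')) <= fine (mu (qball rho x b)).
  by rewrite fine_le ?ge0_fin_numE //; apply: le_measure; rewrite ?inE //; exact: outer.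
have le_ar : fine (mu (qball rho x a)) <= fine (mu (qball D x r)).
  by rewrite fine_le ?ge0_fin_numE //; apply: le_measure; rewrite ?inE //; exact: inner.
have fa : 0 < fine (mu (qball rho x a)) by rewrite fine_gt0 // va.
have fb : 0 < fine (mu (qball rho x b)) by rewrite fine_gt0 // vb.
have sub_ab : qball rho x a `<=` qball rho x b.
  by apply: (subset_trans (inner x r r0)) => y xy; apply: outer => //; exact: lt_le_trans rr'.
have ab : a <= b.
  apply: powR_le; rewrite ?invr_ge0 ?divr_ge0 ?(ltW b0) ?(ltW c0) ?(ltW r0) //.
  apply: (@le_trans _ _ r); first by rewrite ler_pdivrMr // ler_peMr // ltW.
  by apply: (le_trans rr'); rewrite ler_peMl // ltW.
have := Hk x x a b a0 ab sub_ab.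
have -> : (a / b) `^ Q = (r / r') `^ (Q / beta) / (c ^+ 2) `^ (Q / beta).
  have -> : a / b = ((r / r') / c ^+ 2) `^ beta^-1.
    rewrite /a /b -powR_divl ?divr_ge0 ?mulr_ge0 ?ltW //; congr (_ `^ _).
    by field; rewrite !gt_eqF.
  by rewrite -powRrM [_ * Q]mulrC powR_divl // ?divr_ge0 ?exprn_ge0 // ltW.
rewrite ler_pdivlMr // => h.
have -> : (r' / r) `^ (Q / beta) = ((r / r') `^ (Q / beta))^-1.
  by rewrite -powR_invl ?invf_div // divr_ge0 // ltW.
set t := (r / r') `^ (Q / beta) in h *; set u := (c ^+ 2) `^ (Q / beta) in h *.
have t0 : 0 < t by rewrite powR_gt0 // divr_gt0.
have u0 : 0 < u by rewrite powR_gt0 // exprn_gt0.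
apply: (le_trans le_ba).
have -> : k^-1 * u * t^-1 * fine (mu (qball D x r)) =
  (k * (t / u))^-1 * fine (mu (qball D x r)) by field; rewrite !gt_eqF.
rewrite ler_pdivlMl ?mulr_gt0 ?invr_gt0 //.
exact: (le_trans h).
Qed.
End DoublingMetric.

(** * Gradients in integrated form *)

Lemma powR_addr_le (R : realType) (a b p : R) : 0 <= a -> 0 <= b -> 0 < p ->
  (a + b) `^ p <= 2 `^ p * (a `^ p + b `^ p).
Proof.
move=> a0 b0 p0; have pge0 := ltW p0.
have [ab|ba] := lerP a b.
  apply: (@le_trans _ _ ((2 * b) `^ p)).
    by apply: powR_le => //; [rewrite addr_ge0|lra].
  by rewrite powRM // ler_wpM2l ?powR_ge0 // lerDr powR_ge0.
apply: (@le_trans _ _ ((2 * a) `^ p)).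
  by apply: powR_le => //; [rewrite addr_ge0|lra].
by rewrite powRM // ler_wpM2l ?powR_ge0 // lerDl powR_ge0.
Qed.

Lemma powR_root_le (R : realType) (a A B p : R) : 0 <= a -> 0 <= A -> 0 <= B ->
  0 < p -> a `^ p <= A + B -> a <= 2 `^ p^-1 * (A `^ p^-1 + B `^ p^-1).
Proof.
move=> a0 A0 B0 p0 h; have p1 : 0 < p^-1 by rewrite invr_gt0.
rewrite -[a](powRKV a0 (lt0r_neq0 p0)).
apply: (le_trans (powR_le (ltW p1) (powR_ge0 _ _) h)).
exact: powR_addr_le.
Qed.

Lemma dyadic_shell (R : realType) (r : R) : 0 < r ->
  exists k : int, 2 ^ (- k - 1) <= r /\ r < 2 ^ (- k).
Proof.
move=> r0; have ln2 : 0 < ln 2 :> R by rewrite ln_gt0 // ltr1n.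
pose t := ln r / ln 2; exists (- (Num.floor t + 1)).
have rE : r = 2 `^ t by rewrite /powR pnatr_eq0 /t divfK ?gt_eqF // lnK.
have /andP[h1 h2] := floor_itv t.
rewrite opprK addrK -!powR_intmul // rE; split; first by rewrite ler_powR // ler1n.
rewrite /powR pnatr_eq0 ltr_expR ltr_pM2r //.
Qed.

Lemma nneseries_geometric_le (R : realType) (f : (\bar R)^nat) (a z : R) :
  0 <= a -> 0 <= z -> z < 1 -> (forall n, 0 <= f n)%E ->
  (forall n, f n <= (a * z ^+ n)%:E)%E ->
  (\sum_(0 <= n <oo) f n <= (a / (1 - z))%:E)%E.
Proof.
move=> a0 z0 z1 f0 fle; have dz : 0 < 1 - z by rewrite subr_gt0.
apply: lime_le; first by apply: is_cvg_nneseries => n _ _; exact: f0.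
near=> N; apply: (@le_trans _ _ (\sum_(0 <= n < N) (a * z ^+ n)%:E)%E).
  by apply: lee_sum => n _; exact: fle.
rewrite sumEFin lee_fin -mulr_sumr ler_wpM2l //.
have : (\sum_(0 <= i < N) z ^+ i) * (1 - z) = 1 - z ^+ N.
  rewrite big_mkord; have h := subrX1 z N.
  have -> : 1 - z ^+ N = - (z ^+ N - 1) by ring.
  by rewrite h; ring.
move=> h; rewrite -[leRHS]mul1r ler_pdivlMr // h.
by rewrite gerBl exprn_ge0.
Unshelve. all: by end_near. Qed.

Lemma poweR_le (R : realType) (x y : \bar R) (r : R) : 0 <= r ->
  (0 <= x)%E -> (x <= y)%E -> (x `^ r <= y `^ r)%E.
Proof.
move=> r0 x0 xy; by apply: gt0_ler_poweR; rewrite // in_itv /= leey andbT // (le_trans x0).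
Qed.

Section LpNorm.
Context {R : realType} {d : measure_display} {X : measurableType d}.
Context (mu : {measure set X -> \bar R}).
Implicit Types (Y : set X) (u : X -> R) (p : R).

Lemma Lp_norm_powR Y u p : 0 < p ->
  (Lp_norm mu Y p u `^ p = \int[mu]_(x in Y) (`|u x| `^ p)%:E)%E.
Proof.
move=> p0; rewrite /Lp_norm powR_Lnorm ?gt_eqF // [RHS]integral_mkcond.
apply: eq_integral => x _; rewrite /patch; case: ifP => _ //=.
by rewrite normr0 powR0 // gt_eqF.
Qed.

Lemma Lp_norm_ge0 Y p u : (0 <= Lp_norm mu Y p u)%E.
Proof. exact: Lnorm_ge0. Qed.

Lemma Lp_norm_le Y u p M : 0 < p -> 0 <= M ->
  (Lp_norm mu Y p u <= M%:E)%E =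
  (\int[mu]_(x in Y) (`|u x| `^ p)%:E <= (M `^ p)%:E)%E.
Proof.
move=> p0 M0; rewrite -Lp_norm_powR // -poweR_EFin.
apply/idP/idP => [h|h]; first by apply: poweR_le => //; [exact: ltW|exact: Lp_norm_ge0].
have := @poweR_le _ _ _ p^-1 ltac:(by rewrite invr_ge0 ltW) (poweR_ge0 _ _) h.
by rewrite -!poweRrM mulfV ?gt_eqF // !poweRe1 ?Lp_norm_ge0 ?lee_fin.
Qed.
End LpNorm.

(** The seminorms for all [q] dominate the one for infinite [q], the only one
    that estimates from above have to deal with. *)
Lemma le_lq_norm (R : realType) (q : \bar R) (a : int -> \bar R) k :
  (0 < q)%E -> (forall k, 0 <= a k)%E -> (a k <= lq_norm q a)%E.
Proof.
move=> q0 a0; have sup_le : (a k <= ereal_sup (range a))%E.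
  by apply: ereal_sup_ubound; exists k.
case: q q0 => [r|_|//] //; rewrite lte_fin /lq_norm => r0.
have h : (a k `^ r <= \esum_(k in [set: int]) (a k `^ r))%E.
  apply: esum_ge; exists [set k]; first by split=> //; exact: finite_set1.
  by rewrite fsbig_set1.
have := @poweR_le _ _ _ r^-1 ltac:(by rewrite invr_ge0 ltW) (poweR_ge0 _ _) h.
by rewrite -poweRrM mulfV ?gt_eqF // poweRe1.
Qed.

(** Raised to the power [p], fractional gradients become integrable functions;
    the value [+oo] makes exceptional null sets unnecessary. *)
Definition pgradient (R : realType) (d : measure_display) (X : measurableType d)
    (Y : set X) (dist : X -> X -> R) (p : R) (u : X -> R) (r : R)
    (H : X -> \bar R) : Prop :=
  [/\ measurable_fun Y H, forall x, (0 <= H x)%E &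
      forall x y, Y x -> Y y -> dist x y < r ->
        ((`|u x - u y| `^ p)%:E <= H x + H y)%E].

Section Gradient.
Context {R : realType} {d : measure_display} {X : measurableType d}.
Context (rho : X -> X -> R) (mu : {measure set X -> \bar R}).
Hypothesis rho_ge0 : forall x y, 0 <= rho x y.
Hypothesis rho_eq0 : forall x y, rho x y = 0 -> x = y.
Context (Y : set X) (s p : R).
Hypothesis mY : measurable Y.
Hypotheses (s0 : 0 < s) (p0 : 0 < p).

Lemma measurable_normr_powR (g : X -> R) (r : R) : measurable_fun Y g ->
  measurable_fun Y (fun x => (`|g x| `^ r)%:E).
Proof.
move=> mg; apply/measurable_EFinP.
apply: (measurableT_comp (measurable_powR r)).
exact: measurableT_comp.
Qed.

(** The shells of radius less than [r] are summed up in [l^p]; the gain [rho^s]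
    makes the sum geometric, so that a uniform bound on the norms of the
    [g_k] is enough. *)
Lemma pgradient_of_dotN (q : \bar R) (u : X -> R) (M : R) : (0 < q)%E ->
  (dotN_norm rho mu Y s p q u < M%:E)%E -> forall r, 0 < r ->
  exists2 H, pgradient Y rho p u r H &
    (\int[mu]_(x in Y) H x <=
     (2 `^ p * 2 `^ (s * p) / (1 - 2 `^ (- (s * p))) * (M * r `^ s) `^ p)%:E)%E.
Proof.
move=> q0 /ereal_inf_lt[_ [g [mg g0 [E [mE muE gE]]] <-]] ltM r r0.
have M0 : 0 < M.
  rewrite -lte_fin; apply: le_lt_trans ltM; apply: le_trans (le_lq_norm 0 q0 _) => //.
    exact: Lp_norm_ge0.
  by move=> k; exact: Lp_norm_ge0.
have gM k : (\int[mu]_(x in Y) (`|g k x| `^ p)%:E <= (M `^ p)%:E)%E.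
  rewrite -Lp_norm_le ?(ltW M0) //; apply: le_trans (ltW ltM).
  by apply: (@le_lq_norm _ q (fun k => Lp_norm mu Y p (g k))) => // k'; exact: Lp_norm_ge0.
have [k0 [k0r rk0]] := dyadic_shell r0.
pose w n : R := 2 `^ p * (2 ^ (- (k0 + n%:Z))) `^ (s * p).
have w0 n : 0 <= w n by rewrite mulr_ge0 ?powR_ge0.
pose G n x := ((w n)%:E * (`|g (k0 + n%:Z) x| `^ p)%:E)%E.
have G0 n x : (0 <= G n x)%E by rewrite mule_ge0 // lee_fin // powR_ge0.
have mG n : measurable_fun Y (G n).
  by apply: measurable_funeM; exact: measurable_normr_powR.
pose T x := (\sum_(0 <= n <oo) G n x)%E.
have T0 x : (0 <= T x)%E by apply: nneseries_ge0 => n _ _; exact: G0.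
have mT : measurable_fun Y T by
    by apply: (ge0_emeasurable_sum (P := xpredT)) => [n z _ _|n _].
pose P := (fun _ : X => +oo%E : \bar R) \_ E.
have P0 x : (0 <= P x)%E by rewrite /P /patch; case: ifP.
have mP : measurable_fun Y P.
  by apply/measurable_restrict => //; exact: measurable_cst.
exists (fun x => T x + P x)%E; first split=> [||x y Yx Yy xyr].
- exact: emeasurable_funD.
- by move=> x; rewrite adde_ge0.
- have [xE|nxE] := pselect (E x).
    rewrite {1}/P /patch mem_set // addey ?addye ?leey // -ltNye.
      by apply: lt_le_trans (adde_ge0 (T0 y) (P0 y)); rewrite ltNy0.
    by apply: lt_le_trans (T0 x); rewrite ltNy0.
  have [yE|nyE] := pselect (E y).
    rewrite {2}/P /patch (mem_set yE) [(T y + _)%E]addey ?addey ?leey // -ltNye.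
      by apply: lt_le_trans (adde_ge0 (T0 x) (P0 x)); rewrite ltNy0.
    by apply: lt_le_trans (T0 y); rewrite ltNy0.
  rewrite /P /patch !memNset // !adde0.
  have := rho_ge0 x y; rewrite le_eqVlt => /predU1P[/esym/rho_eq0 ->|xy0].
    by rewrite subrr normr0 powR0 ?gt_eqF // adde_ge0.
  have [k [k1 k2]] := dyadic_shell xy0.
  have le_k : (k0 <= k)%R.
    rewrite -ltzD1 -ltrN2 opprD.
    have : 2 ^ (- k - 1) < 2 ^ (- k0) :> R.
      by apply: (le_lt_trans k1); exact: lt_trans rk0.
    by rewrite ltr_eXz2l // ltr1n.
  have [n kE] : exists n : nat, k = k0 + n%:Z.
    exists `|k - k0|%N.
    by rewrite gez0_abs ?subr_ge0 // addrCA subrr addr0.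
  have TG z : (G n z <= T z)%E.
    rewrite /T (nneseriesD1 (n := n)) //; apply: leeDl.
    by apply: nneseries_ge0 => m _ _; exact: G0.
  apply: le_trans (leeD (TG x) (TG y)); rewrite /G -!EFinM -EFinD lee_fin /w -kE.
  have := gE k x y (conj Yx nxE) (conj Yy nyE) k1 k2 => h.
  set t : R := 2 ^ (- k) in k2 *; have t0 : 0 < t by exact: exprz_gt0.
  apply: (@le_trans _ _ ((t `^ s * (`|g k x| + `|g k y|)) `^ p)).
    apply: powR_le => //; first exact: ltW.
    apply: (le_trans h); apply: ler_pM; rewrite ?powR_ge0 ?addr_ge0 ?g0 //.
      by apply: powR_le => //; [exact: ltW|exact: ltW].
    by rewrite !ger0_norm ?g0.
  rewrite powRM ?powR_ge0 ?addr_ge0 // -powRrM.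
  rewrite -mulrDr [2 `^ p * _]mulrC -mulrA ler_wpM2l ?powR_ge0 //.
  exact: powR_addr_le.
have -> : (\int[mu]_(x in Y) (T x + P x) = \int[mu]_(x in Y) T x)%E.
  apply: ge0_ae_eq_integral => //; first exact: emeasurable_funD.
    by move=> x _; rewrite adde_ge0.
  exists E; split=> // x /= h; apply: contrapT => nE; apply: h => Yx.
  by rewrite /P /patch memNset // adde0.
rewrite /T integral_nneseries //.
set z : R := 2 `^ (- (s * p)); have z1 : z < 1.
  by rewrite /z powRN invf_lt1 ?powR_gt0 // -[ltLHS](powRr0 2) /powR pnatr_eq0 /= ltr_expR
     mul0r mulr_gt0 ?mulr_gt0 // ln_gt0 // ltr1n.
have z0 : 0 <= z by exact: powR_ge0.
have -> : 2 `^ p * 2 `^ (s * p) / (1 - z) * (M * r `^ s) `^ p =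
    (2 `^ p * (2 * r) `^ (s * p) * M `^ p) / (1 - z).
  rewrite powRM ?powR_ge0 ?(ltW M0) // -powRrM [(2 * r) `^ _]powRM ?(ltW r0) //; ring.
apply: nneseries_geometric_le => //.
- by rewrite !mulr_ge0 ?powR_ge0.
- by move=> n; apply: integral_ge0 => x _; exact: G0.
move=> n; rewrite /G ge0_integralZl_EFin //; last exact: measurable_normr_powR.
have wle : w n <= 2 `^ p * (2 * r) `^ (s * p) * z ^+ n.
  rewrite /w -mulrA; apply: ler_wpM2l; first exact: powR_ge0.
  rewrite opprD expfzDr // powRM ?exprz_ge0 // /z.
  have -> : (2 ^ (- n%:Z)) `^ (s * p) = (2 `^ (- (s * p))) ^+ n :> R.
    rewrite -powR_mulrn ?powR_ge0 // -powRrM -powR_intmul // -powRrM.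
    by congr (_ `^ _); rewrite rmorphN /= -pmulrn; ring.
  apply: ler_wpM2r; first by rewrite exprn_ge0.
  apply: powR_le; [by rewrite mulr_ge0 // ltW|by rewrite exprz_ge0|].
  by move: k0r; rewrite expfzDr // exprN1; lra.
apply: (@le_trans _ _ ((w n)%:E * (M `^ p)%:E)%E); first by rewrite lee_wpmul2l ?lee_fin.
rewrite -EFinM lee_fin; apply: (le_trans (ler_wpM2r (powR_ge0 M p) wle)).
by rewrite mulrAC.
Qed.
End Gradient.

Section DotN.
Context {R : realType} {d : measure_display} {X : measurableType d}.
Context (rho : X -> X -> R) (mu : {measure set X -> \bar R}).
Context (Y : set X) (s p : R).
Hypothesis mY : measurable Y.
Hypotheses (s0 : 0 < s) (p0 : 0 < p).

Lemma dotN_norm_ge0 (q : \bar R) (u : X -> R) : (0 < q)%E ->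
  (0 <= dotN_norm rho mu Y s p q u)%E.
Proof.
move=> q0; apply: le_ereal_inf_tmp => _ [g _ <-].
apply: (@le_trans _ _ (Lp_norm mu Y p (g 0))); first exact: Lp_norm_ge0.
apply: (@le_lq_norm _ q (fun k => Lp_norm mu Y p (g k))) => // k.
exact: Lp_norm_ge0.
Qed.

Lemma finite_integral_infty_null (H : X -> \bar R) : measurable_fun Y H ->
  (forall x, 0 <= H x)%E -> (\int[mu]_(x in Y) H x < +oo)%E ->
  measurable (Y `&` H @^-1` [set +oo%E]) /\ mu (Y `&` H @^-1` [set +oo%E]) = 0%E.
Proof.
move=> mH H0 intH; have mA : measurable (Y `&` H @^-1` [set +oo%E]).
  by apply: mH => //; exact: emeasurable_set1.
split=> //; have : mu.-integrable Y H.
  apply/integrableP; split=> //.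
  by under eq_integral do rewrite gee0_abs //.
move=> /(integrable_ae mY)[N [mN N0 sN]].
apply/eqP; rewrite eq_le measure_ge0 andbT -N0; apply: le_measure; rewrite ?inE //.
by move=> x [Yx /= Hx]; apply: sN => /= /(_ Yx); rewrite Hx.
Qed.

(** Conversely, functions [H_k] at all dyadic scales yield the fractional
    gradient [2^((k+1)s) H_k^(1/p)]; the null sets where some [H_k] is infinite
    make up its exceptional set. *)
Lemma dotN_of_pgradient (u : X -> R) (M : R) : 0 <= M ->
  (forall k : int, exists2 H, pgradient Y rho p u (2 ^ (- k)) H &
     (\int[mu]_(x in Y) H x <= ((M * (2 ^ (- k)) `^ s) `^ p)%:E)%E) ->
  (dotN_norm rho mu Y s p +oo u <= (2 `^ s * 2 `^ p^-1 * M)%:E)%E.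
Proof.
move=> M0 grads.
have /choice[H HH] : forall k : int, exists H, pgradient Y rho p u (2 ^ (- k)) H /\
    (\int[mu]_(x in Y) H x <= ((M * (2 ^ (- k)) `^ s) `^ p)%:E)%E.
  by move=> k; have [H h1 h2] := grads k; exists H.
have gH k := (HH k).1; have intH k := (HH k).2.
have mH k : measurable_fun Y (H k) by case: (gH k).
have H0 k x : (0 <= H k x)%E by case: (gH k).
have p1 : 0 < p^-1 by rewrite invr_gt0.
have intHoo k : (\int[mu]_(x in Y) H k x < +oo)%E.
  by apply: le_lt_trans (intH k) _; rewrite ltry.
pose c (k : int) : R := (2 ^ (k + 1)) `^ s * 2 `^ p^-1.
have c0 k : 0 <= c k by rewrite mulr_ge0 ?powR_ge0.
pose g (k : int) x := c k * fine (H k x) `^ p^-1.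
have g0 k x : 0 <= g k x by rewrite mulr_ge0 ?powR_ge0.
have mfine k : measurable_fun Y (fun x => fine (H k x)).
  exact: measurableT_comp.
have mg k : measurable_fun Y (g k).
  apply: measurable_funM => //.
  exact: (measurableT_comp (measurable_powR p^-1)).
pose A (k : int) := Y `&` H k @^-1` [set +oo%E].
pose B n := if @unpickle int n is Some k then A k else set0.
have mB n : measurable (B n).
  by rewrite /B; case: unpickle => // k; case: (finite_integral_infty_null (mH k) (H0 k) (intHoo k)).
have muB n : mu (B n) = 0%E.
  by rewrite /B; case: unpickle => [k|]; [case: (finite_integral_infty_null (mH k) (H0 k) (intHoo k))|rewrite measure0].
have gfrac : fractional_gradient rho mu Y s u g.
  split; [exact: mg|by move=> k x _; exact: g0|].
  exists (\bigcup_n B n); split; first exact: bigcup_measurable.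
    apply: measure_negligible; first exact: bigcup_measurable.
    by apply: negligible_bigcup => n; exists (B n); split.
  move=> k x y [Yx nEx] [Yy nEy] kx xk.
  have fin z : Y z -> ~ (\bigcup_n B n) z -> H k z \is a fin_num.
    move=> Yz nEz; rewrite ge0_fin_numE // ltey; apply/eqP => Hz.
    apply: nEz; exists (pickle k); first by [].
    by rewrite /B pickleK; split.
  have [_ _ /(_ x y Yx Yy xk)] := gH k.
  rewrite -(fineK (fin x Yx nEx)) -(fineK (fin y Yy nEy)) -EFinD lee_fin => h.
  have := powR_root_le (normr_ge0 _) (fine_ge0 (H0 k x)) (fine_ge0 (H0 k y)) p0 h.
  move=> {}h; apply: (le_trans h); rewrite /g -mulrDr mulrA; apply: ler_wpM2r.
    by rewrite addr_ge0 ?powR_ge0.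
  rewrite /c mulrA ler_peMl ?powR_ge0 // -powRM ?exprz_ge0 //; last first.
    by apply: le_trans kx; rewrite exprz_ge0.
  apply: (@le_trans _ _ ((2 ^ (- k - 1) * 2 ^ (k + 1)) `^ s)).
    by rewrite -expfzDr // -opprD addNr expr0z powR1.
  apply: powR_le; rewrite ?(ltW s0) ?mulr_ge0 ?exprz_ge0 //.
  by rewrite ler_wpM2r // exprz_ge0.
apply: (@le_trans _ _ (lq_norm +oo (fun k => Lp_norm mu Y p (g k)))).
  by apply: ereal_inf_lbound; exists g.
rewrite /lq_norm; apply: ge_ereal_sup => _ [k _ <-].
rewrite Lp_norm_le // ?mulr_ge0 ?powR_ge0 //.
have -> : (\int[mu]_(x in Y) (`|g k x| `^ p)%:E =
    (c k `^ p)%:E * \int[mu]_(x in Y) (fine (H k x))%:E)%E.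
  rewrite -ge0_integralZl_EFin ?powR_ge0 //; last 2 first.
  - by move=> x _; rewrite lee_fin fine_ge0.
  - exact/measurable_EFinP.
  apply: eq_integral => x _; rewrite ger0_norm ?g0 // /g powRM ?powR_ge0 //.
  by rewrite powRVK // ?fine_ge0 // gt_eqF.
have lefine : (\int[mu]_(x in Y) (fine (H k x))%:E <= \int[mu]_(x in Y) H k x)%E.
  apply: ge0_le_integral => //.
  - by move=> x _; rewrite lee_fin fine_ge0.
  - exact/measurable_EFinP.
  by move=> x _; have := H0 k x; case: (H k x) => [r| |] //= _; rewrite leey.
apply: (@le_trans _ _ ((c k `^ p)%:E * ((M * (2 ^ (- k)) `^ s) `^ p)%:E)%E).
  by rewrite lee_wpmul2l ?lee_fin ?powR_ge0 // (le_trans lefine).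
rewrite -EFinM lee_fin -powRM // ?mulr_ge0 ?powR_ge0 //.
rewrite le_eqVlt; apply/orP; left; apply/eqP; congr (_ `^ _); rewrite /c.
have -> : (2 ^ (k + 1)) `^ s = 2 `^ s * (2 ^ k) `^ s :> R.
  by rewrite -powRM ?exprz_ge0 // expfzDr // expr1z mulrC.
have e1 : (2 ^ k) `^ s * (2 ^ (- k)) `^ s = 1 :> R.
  by rewrite -powRM ?exprz_ge0 // -expfzDr // subrr expr0z powR1.
rewrite -[RHS]mulr1 -[X in _ = _ * X]e1.
set a := (2 ^ k) `^ s; set b := (2 ^ (- k)) `^ s; set e := 2 `^ s; set f := 2 `^ p^-1.
ring.
Qed.
End DotN.

(** * Chaining through good points *)

Section Chaining.
Context {R : realType} {X : Type} {D : X -> X -> R}.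
Hypothesis Dm : is_pmetric D.
Context (Y B : set X) (u : X -> R) (T : R) (F : nat -> set X) (a : nat -> R).
Hypothesis BY : B `<=` Y.
Hypothesis T0 : 0 < T.
Hypothesis jump : forall n x y, Y x -> Y y -> ~ F n x -> ~ F n y ->
  D x y < 4 * T * 2^-1 ^+ n -> `|u x - u y| <= a n.

Let good n x z := [/\ Y z, D x z < T * 2^-1 ^+ n, ~ F n z & ~ F n.+1 z].

(** A point outside the bad set [F N] is linked to the scale [n] by a chain of
    points, one at each scale in between, avoiding the bad sets of their own
    and of the next scale. *)
Lemma chain_to_scale (N : nat) :
  (forall x n, B x -> (n <= N)%N -> exists z, good n x z) ->
  forall k n x z, (n + k)%N = N -> B x -> ~ F N x -> good n x z ->
  `|u x - u z| <= a N + \sum_(n.+1 <= i < N.+1) a i.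
Proof.
move=> ex_good; elim=> [|k IH] n x z nkN Bx nFx [Yz xz nFz nFz1].
  rewrite addn0 in nkN; subst n; rewrite big_geq // addr0.
  apply: jump => //; first exact: BY.
  have e0 : 0 < T * 2^-1 ^+ N by rewrite mulr_gt0 ?exprn_gt0 ?invr_gt0.
  by move: xz e0; set e := _ ^+ N; lra.
have ltnN : (n < N)%N by rewrite -nkN addnS ltnS leq_addr.
have [z' [Yz' xz' nFz' nFz1']] := ex_good x n.+1 Bx ltnN.
have := IH n.+1 x z' _ Bx nFx (And4 Yz' xz' nFz' nFz1').
rewrite addSnnS => /(_ nkN) h.
have h' : `|u z' - u z| <= a n.+1.
  apply: jump => //; apply: (le_lt_trans (pm_tri Dm x z' z)); rewrite (pm_sym Dm z').
  have e0 : 0 < T * 2^-1 ^+ n by rewrite mulr_gt0 ?exprn_gt0 ?invr_gt0.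
  by move: xz xz' e0; rewrite exprS; set e := _ ^+ n; lra.
have -> : u x - u z = (u x - u z') + (u z' - u z) by ring.
apply: (le_trans (ler_normD _ _)).
rewrite big_ltn //.
move: (\sum_(_ <= i < _) _) h h' => S; lra.
Qed.

(** Two chains are joined at the scale at which both of their points are close. *)
Lemma chain_bound (N n : nat) (x y : X) :
  (forall x n, B x -> (n <= N)%N -> exists z, good n x z) ->
  (n <= N)%N -> B x -> B y -> ~ F N x -> ~ F N y ->
  D x y < 2 * T * 2^-1 ^+ n ->
  `|u x - u y| <= 2 * a N + 2 * \sum_(n <= i < N.+1) a i.
Proof.
move=> ex_good nN Bx By nFx nFy xy.
have [k nkN] : exists k, (n + k)%N = N by exists (N - n)%N; rewrite subnKC.
have [z gz] := ex_good x n Bx nN; have [w gw] := ex_good y n By nN.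
have h1 := chain_to_scale ex_good nkN Bx nFx gz.
have h2 := chain_to_scale ex_good nkN By nFy gw.
case: gz gw => [Yz xz nFz _] [Yw yw nFw _].
have h3 : `|u z - u w| <= a n.
  apply: jump => //; have := pm_tri Dm x z w; have := pm_tri Dm y x w.
  rewrite (pm_sym Dm z x).
  by move: xz yw xy; set e := _ ^+ n; lra.
have a0 : 0 <= a n by apply: le_trans h3.
have -> : u x - u y = (u x - u z) + (u z - u w) + (u w - u y) by ring.
apply: (le_trans (ler_normD _ _)); rewrite (distrC (u w)).
apply: (le_trans (lerD (ler_normD _ _) (lexx _))).
by rewrite big_ltn //; lra.
Qed.
End Chaining.

Section GoodPoints.
Context {R : realType} {d : measure_display} {X : measurableType d}.
Context (mu : {measure set X -> \bar R}) {D : X -> X -> R}.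
Hypothesis Dm : is_pmetric D.
Hypothesis mball : forall x r, measurable (qball D x r).
Context (Y B : set X) (u : X -> R) (p T J m t theta gamma eta : R).
Context (H : nat -> X -> \bar R).
Hypotheses (mY : measurable Y) (BY : B `<=` Y).
Hypotheses (p0 : 0 < p) (T0 : 0 < T) (J0 : 0 <= J) (t0 : 0 < t).
Hypotheses (theta0 : 0 < theta) (theta1 : theta < 1).
Hypothesis gH : forall n, pgradient Y D p u (4 * T * 2^-1 ^+ n) (H n).
Hypothesis intH : forall n,
  (\int[mu]_(x in Y) H n x <= (J * gamma ^+ n)%:E)%E.
Hypothesis mass : forall x n, B x ->
  ((m * eta ^+ n)%:E <= mu (qball D x (T * 2^-1 ^+ n) `&` Y))%E.

(** The points where the increments at scale [n] may exceed [t theta^n]. *)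
Definition bad_set n := Y `&` [set x | (((t * theta ^+ n) `^ p)%:E <= H n x)%E].
Let delta := gamma / theta `^ p.

Lemma measurable_bad_set n : measurable (bad_set n).
Proof. by apply: emeasurable_fun_c_infty => //; case: (gH n). Qed.

Let thetap n : (t * theta ^+ n) `^ p = t `^ p * (theta `^ p) ^+ n.
Proof.
rewrite powRM ?(ltW t0) ?exprn_ge0 ?(ltW theta0) //; congr (_ * _).
rewrite -powR_mulrn ?(ltW theta0) // -powRrM mulrC powRrM powR_mulrn //.
exact: powR_ge0.
Qed.

Lemma mu_bad_set n : (mu (bad_set n) <= (J / t `^ p * delta ^+ n)%:E)%E.
Proof.
have [mH H0 _] := gH n; set a := (t * theta ^+ n) `^ p.
have a0 : 0 < a by rewrite powR_gt0 // mulr_gt0 // exprn_gt0.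
have := le_integral_abse mu mY mH a0.
under [X in (_ <= X)%E]eq_integral do rewrite gee0_abs //.
have -> : Y `&` [set x | (a%:E <= `|H n x|)%E] = bad_set n.
  by apply/seteqP; split=> x [Yx] /=; rewrite gee0_abs.
move=> h; have {h}h := le_trans h (intH n).
have -> : J / t `^ p * delta ^+ n = a^-1 * (J * gamma ^+ n).
  rewrite /a thetap /delta expr_div_n; field.
  by rewrite !gt_eqF ?exprn_gt0 ?powR_gt0.
by rewrite EFinM lee_pdivlMl.
Qed.

(** Bad sets lighter than a ball cannot cover it. *)
Lemma good_points n x : B x ->
  J / t `^ p * (delta ^+ n + delta ^+ n.+1) < m * eta ^+ n ->
  exists z, [/\ Y z, D x z < T * 2^-1 ^+ n, ~ bad_set n z & ~ bad_set n.+1 z].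
Proof.
move=> Bx lt_m; apply: contrapT => no_z.
have sub : qball D x (T * 2^-1 ^+ n) `&` Y `<=` bad_set n `|` bad_set n.+1.
  move=> z [xz Yz]; apply: contrapT => /not_orP[h1 h2]; apply: no_z; by exists z.
have mU : measurable (bad_set n `|` bad_set n.+1).
  by apply: measurableU; exact: measurable_bad_set.
have : (mu (qball D x (T * 2^-1 ^+ n) `&` Y) <= mu (bad_set n `|` bad_set n.+1))%E.
  by apply: le_measure; rewrite ?inE //; exact: measurableI.
apply/negP; rewrite -ltNge; apply: lt_le_trans (mass n Bx).
apply: (@le_lt_trans _ _ (mu (bad_set n) + mu (bad_set n.+1))%E).
  by apply: measureU2; exact: measurable_bad_set.
apply: (le_lt_trans (leeD (mu_bad_set n) (mu_bad_set n.+1))).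
by rewrite -EFinD lte_fin -mulrDr.
Qed.

Lemma jump_bound n x y : Y x -> Y y -> ~ bad_set n x -> ~ bad_set n y ->
  D x y < 4 * T * 2^-1 ^+ n -> `|u x - u y| <= 2 `^ p^-1 * 2 * (t * theta ^+ n).
Proof.
move=> Yx Yy nx ny xy; have [_ H0 /(_ x y Yx Yy xy) h] := gH n.
set a := t * theta ^+ n; have a0 : 0 <= a by rewrite mulr_ge0 ?exprn_ge0 // ltW.
have lt_a z : Y z -> ~ bad_set n z -> (H n z <= (a `^ p)%:E)%E.
  move=> Yz nz; rewrite leNgt; apply/negP => h'; apply: nz; split=> //.
  exact: ltW.
have {}h := le_trans h (leeD (lt_a x Yx nx) (lt_a y Yy ny)).
rewrite -EFinD lee_fin in h.
have := powR_root_le (normr_ge0 _) (powR_ge0 _ _) (powR_ge0 _ _) p0 h.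
by rewrite powRKV // ?gt_eqF // => {}h; apply: (le_trans h); rewrite -mulrA ler_wpM2l ?powR_ge0 //; lra.
Qed.

Lemma good_chain_bound (N n : nat) (x y : X) :
  (forall i, (i <= N)%N ->
     J / t `^ p * (delta ^+ i + delta ^+ i.+1) < m * eta ^+ i) ->
  (n <= N)%N -> B x -> B y -> ~ bad_set N x -> ~ bad_set N y ->
  D x y < 2 * T * 2^-1 ^+ n ->
  `|u x - u y| <= 8 * 2 `^ p^-1 / (1 - theta) * t * theta ^+ n.
Proof.
move=> small nN Bx By nx ny xy.
have d0 : 0 < 1 - theta by rewrite subr_gt0.
set c := 2 `^ p^-1 * 2; have c0 : 0 <= c by rewrite mulr_ge0 ?powR_ge0.
pose a i := c * (t * theta ^+ i).
have a0 i : 0 <= a i by rewrite !mulr_ge0 ?exprn_ge0 ?(ltW t0) ?(ltW theta0).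
have good i z (Bz : B z) (iN : (i <= N)%N) := good_points Bz (small i iN).
have := chain_bound Dm BY T0 jump_bound (N := N) (n := n) (x := x) (y := y).
move=> /(_ (fun z i Bz iN => good i z Bz iN) nN Bx By nx ny xy).
rewrite -/c => h; apply: (le_trans h).
have sumE : \sum_(n <= i < N.+1) c * (t * theta ^+ i) <= c * t * theta ^+ n / (1 - theta).
  rewrite -mulr_sumr -mulr_sumr -!mulrA !ler_wpM2l ?(ltW t0) //.
  rewrite ler_pdivlMr //.
  have -> : (\sum_(n <= i < N.+1) theta ^+ i) * (1 - theta) = theta ^+ n - theta ^+ N.+1.
    rewrite mulrC mulrBl mul1r mulr_sumr -sumrB.
    rewrite (eq_bigr (fun i => - theta ^+ i.+1 - - theta ^+ i)); last first.
      by move=> i _; rewrite exprS opprK addrC.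
    by rewrite (telescope_sumr (fun i => - theta ^+ i)) ?leqW // opprK addrC.
  by rewrite gerBl exprn_ge0 // ltW.
have aN : c * (t * theta ^+ N) <= \sum_(n <= i < N.+1) c * (t * theta ^+ i).
  rewrite big_nat_recr //= lerDr; apply: sumr_ge0 => i _; exact: a0.
have -> : 8 * 2 `^ p^-1 / (1 - theta) * t * theta ^+ n = 4 * (c * t * theta ^+ n / (1 - theta)).
  by rewrite /c; field; rewrite gt_eqF.
by move: (\sum_(n <= i < N.+1) _) sumE aN => S; lra.
Qed.
End GoodPoints.

Lemma geometric_bracket (R : realType) (a z : R) : 1 < a -> 1 < z ->
  exists N, a ^+ N < z /\ z <= a ^+ N.+1.
Proof.
move=> a1 z1; have a0 : 0 < a by exact: lt_trans a1.
have lna : 0 < ln a by rewrite ln_gt0.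
have ex : exists n, z <= a ^+ n.
  exists (Num.bound (ln z / ln a)); rewrite -powR_mulrn ?(ltW a0) //.
  have z0 : 0 < z by exact: lt_trans z1.
  have zE : z = a `^ (ln z / ln a) by rewrite /powR gt_eqF // divfK ?gt_eqF // lnK.
  rewrite {1}zE; apply: ler_powR; first exact: ltW.
  apply: ltW; apply: archi_boundP.
  by rewrite divr_ge0 // ltW // ln_gt0.
case: (ex_minnP ex) => [[|N] le_z minN]; first by move: le_z; rewrite expr0 leNgt z1.
exists N; split=> //; rewrite ltNge; apply/negP => /minN.
by rewrite ltnn.
Qed.

Section Embeddings.
Context {R : realType} {d : measure_display} {X : measurableType d}.
Context (mu : {measure set X -> \bar R}) {D : X -> X -> R}.
Hypothesis Dm : is_pmetric D.
Hypothesis mball : forall x r, measurable (qball D x r).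

(** Hypotheses shared by the two embeddings: gradients at the scales
    [4 T 2^-n] and lower mass bounds at the scales [T 2^-n]. *)
Definition scale_data (p gamma eta : R) (Y B : set X) (u : X -> R) (T J m : R)
    (H : nat -> X -> \bar R) : Prop :=
  [/\ [/\ measurable Y, B `<=` Y, 0 < T, 0 < J & 0 < m],
      forall n, pgradient Y D p u (4 * T * 2^-1 ^+ n) (H n),
      forall n, (\int[mu]_(x in Y) H n x <= (J * gamma ^+ n)%:E)%E &
      forall x n, B x ->
        ((m * eta ^+ n)%:E <= mu (qball D x (T * 2^-1 ^+ n) `&` Y))%E].

(** With thresholds proportional to [theta^n] for a small constant, a chain
    between [S1] and [S0] would be too short to climb from 0 to 1.  The chain
    exists as long as the bad sets are smaller than balls, so [S1] or [S0] lies
    in the bad set of the first scale at which this fails. *)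
Lemma weak_type_separation (p theta gamma eta c1 : R) :
  0 < p -> 0 < theta -> theta < 1 -> 0 < gamma -> 0 < eta -> 0 <= c1 ->
  eta < gamma / theta `^ p -> gamma / theta `^ p < 1 ->
  exists C kappa, [/\ 0 < C, 0 < kappa & forall Y B u T J m H S1 S0,
    scale_data p gamma eta Y B u T J m H ->
    (forall x y, B x -> B y -> D x y < 2 * T) ->
    (mu B <= (c1 * m)%:E)%E ->
    measurable B -> measurable S1 -> measurable S0 -> S1 `<=` B -> S0 `<=` B ->
    (forall x y, S1 x -> S0 y -> 1 <= `|u x - u y|) ->
    (Order.min (mu S1) (mu S0) <= (C * m * (J / m) `^ (1 + kappa))%:E)%E].
Proof.
move=> p0 th0 th1 g0 eta0 c10; set delta := gamma / _ => eta_delta delta1.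
have delta0 : 0 < delta by exact: lt_trans eta_delta.
set a := delta / eta; have a1 : 1 < a by rewrite ltr_pdivlMr // mul1r.
have a0 : 0 < a by exact: lt_trans a1.
have lna : 0 < ln a by rewrite ln_gt0.
have lnd : ln delta < 0 by rewrite ln_lt0 // delta0.
set kappa := - ln delta / ln a.
have kappa0 : 0 < kappa by rewrite divr_gt0 // oppr_gt0.
have dth : 0 < 1 - theta by rewrite subr_gt0.
have two0 : 0 < 2 `^ p^-1 :> R by rewrite powR_gt0.
set t := (1 - theta) / (16 * 2 `^ p^-1).
have t0 : 0 < t by rewrite divr_gt0 // mulr_gt0.
have tp0 : 0 < t `^ p by rewrite powR_gt0.
set c2 := t `^ p / (1 + delta).
have c20 : 0 < c2 by rewrite divr_gt0 // addr_gt0.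
set K1 := (c1 + 1) / c2 `^ (1 + kappa).
have K10 : 0 < K1 by rewrite divr_gt0 ?powR_gt0 // ltr_wpDl.
set K2 := (t `^ p)^-1 * delta^-1 * (c2^-1) `^ kappa.
have K20 : 0 < K2 by rewrite !mulr_gt0 ?invr_gt0 ?powR_gt0 // invr_gt0.
exists (K1 + K2), kappa; split=> //; first by rewrite addr_gt0.
move=> Y B u T J m H S1 S0 [[mY BY T0 J0 m0] gH intH mass] diamB muB mB mS1 mS0 SB1 SB0 sep.
have Jm0 : 0 < J / m by rewrite divr_gt0.
pose z := c2 / (J / m).
have [z1|z1] := lerP z 1.
  apply: (@le_trans _ _ (mu B)).
    by rewrite ge_min; apply/orP; left; apply: le_measure; rewrite ?inE.
  apply: (le_trans muB); rewrite lee_fin.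
  have c2le : c2 <= J / m by move: z1; rewrite /z ler_pdivrMr // mul1r.
  apply: (@le_trans _ _ (K1 * m * (J / m) `^ (1 + kappa))); last first.
    rewrite -2!mulrA; apply: ler_wpM2r; last by rewrite lerDl ltW.
    by rewrite mulr_ge0 ?powR_ge0 // ltW.
  rewrite mulrAC ler_pM2r // /K1 mulrAC ler_pdivlMr ?powR_gt0 //.
  apply: ler_pM; rewrite ?powR_ge0 //; first by rewrite lerDl.
  by apply: powR_le; rewrite ?(ltW c20) // addr_ge0 // ltW.
have [N [aNz zaN]] := geometric_bracket a1 z1.
have small i : (i <= N)%N -> J / t `^ p * (delta ^+ i + delta ^+ i.+1) < m * eta ^+ i.
  move=> iN; have : a ^+ i < z by apply: le_lt_trans aNz; rewrite ler_weXn2l // ltW.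
  rewrite /a expr_div_n ltr_pdivrMr ?exprn_gt0 // /z /c2 => h.
  have -> : J / t `^ p * (delta ^+ i + delta ^+ i.+1) = delta ^+ i * (J / t `^ p * (1 + delta)).
    by rewrite exprS; ring.
  have W0 : 0 < J / t `^ p * (1 + delta) by rewrite mulr_gt0 ?divr_gt0 ?addr_gt0.
  rewrite -ltr_pdivlMr //; apply: (lt_le_trans h).
  rewrite le_eqVlt; apply/orP; left; apply/eqP; field.
  by rewrite !gt_eqF // addr_gt0.
have bad S : S `<=` B -> measurable S -> S `<=` bad_set Y p t theta H N ->
    (mu S <= ((K1 + K2) * m * (J / m) `^ (1 + kappa))%:E)%E.
  move=> SB mS Sbad; apply: (@le_trans _ _ (mu (bad_set Y p t theta H N))).
    apply: le_measure; rewrite ?inE //.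
    by apply: (measurable_bad_set (D := D) (u := u) (T := T)) => //.
  have := mu_bad_set (D := D) (u := u) (T := T) mY t0 th0 gH intH N.
  move=> h; apply: (le_trans h); rewrite lee_fin -/delta.
  apply: (@le_trans _ _ (K2 * m * (J / m) `^ (1 + kappa))); last first.
    rewrite -2!mulrA; apply: ler_wpM2r; last by rewrite lerDr ltW.
    by rewrite mulr_ge0 ?powR_ge0 // ltW.
  have dN : delta ^+ N.+1 <= z^-1 `^ kappa.
    have -> : delta ^+ N.+1 = (a ^+ N.+1)^-1 `^ kappa.
      have aK : a `^ kappa = delta^-1.
        by rewrite /powR gt_eqF // /kappa divfK ?gt_eqF // expRN lnK.
      rewrite powR_invl ?exprn_ge0 ?(ltW a0) // -[a ^+ _]powR_mulrn ?(ltW a0) //.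
      by rewrite powRAC powR_mulrn ?powR_ge0 // aK exprVn invrK.
    apply: powR_le; rewrite ?(ltW kappa0) ?invr_ge0 ?exprn_ge0 ?(ltW a0) //.
    by rewrite lef_pV2 // posrE ?exprn_gt0 // (lt_trans _ z1).
  have -> : K2 * m * (J / m) `^ (1 + kappa) = J / t `^ p * (delta^-1 * z^-1 `^ kappa).
    have -> : z^-1 = c2^-1 * (J / m) by rewrite /z invf_div mulrC.
    rewrite [(c2^-1 * _) `^ _]powRM ?invr_ge0 ?(ltW c20) ?(ltW Jm0) // powRD; last first.
      by apply/implyP => _; rewrite gt_eqF.
    rewrite powRr1 ?(ltW Jm0) // /K2.
    set A := c2^-1 `^ kappa; set E := (J / m) `^ kappa; field.
    by rewrite !gt_eqF.
  rewrite ler_wpM2l ?divr_ge0 ?(ltW J0) ?(ltW tp0) // ler_pdivlMl // -exprS.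
  exact: dN.
rewrite ge_min; apply/orP.
have [S1bad|/nonsubset[x [S1x nx]]] := pselect (S1 `<=` bad_set Y p t theta H N).
  by left; exact: bad.
right; apply: bad => // y S0y; apply: contrapT => ny.
have := good_chain_bound Dm mball mY BY p0 T0 t0 th0 th1 gH intH mass small (leq0n N)
  (SB1 x S1x) (SB0 y S0y) nx ny.
rewrite !expr0 !mulr1 => /(_ (diamB x y (SB1 x S1x) (SB0 y S0y))).
have := sep x y S1x S0y.
have -> : 8 * 2 `^ p^-1 / (1 - theta) * t = 2^-1 by rewrite /t; field; rewrite !gt_eqF.
lra.
Qed.

(** When the bad sets shrink as fast as the balls, chains of every length exist
    and almost every point lies in finitely many bad sets only. *)
Lemma hoelder_ae (p gamma eta : R) :
  0 < p -> 0 < gamma -> gamma < eta -> eta < 1 ->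
  exists2 C, 0 < C & forall Y B u T J m H,
    scale_data p gamma eta Y B u T J m H ->
    exists E, [/\ measurable E, mu E = 0%E & forall x y n,
      (B `\` E) x -> (B `\` E) y -> D x y < 2 * T * 2^-1 ^+ n ->
      `|u x - u y| <= C * (J / m) `^ p^-1 * ((gamma / eta) `^ p^-1) ^+ n].
Proof.
move=> p0 g0 ge eta1; have eta0 : 0 < eta by exact: lt_trans ge.
set theta := (gamma / eta) `^ p^-1.
have ge0 : 0 < gamma / eta by rewrite divr_gt0.
have th0 : 0 < theta by rewrite powR_gt0.
have thp : theta `^ p = gamma / eta by rewrite powRVK ?(ltW ge0) // gt_eqF.
have th1 : theta < 1.
  apply: (@lt_le_trans _ _ (1 `^ p^-1)); last by rewrite powR1.
  apply: powR_lt; rewrite ?invr_gt0 ?(ltW ge0) //.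
  by rewrite ltr_pdivrMr // mul1r.
have dth : 0 < 1 - theta by rewrite subr_gt0.
have two0 : 0 < 2 `^ p^-1 :> R by rewrite powR_gt0.
exists (8 * 2 `^ p^-1 / (1 - theta) * 2 `^ p^-1).
  by rewrite !mulr_gt0 // invr_gt0.
move=> Y B u T J m H [[mY BY T0 J0 m0] gH intH mass].
have Jm0 : 0 < J / m by rewrite divr_gt0.
set t := (2 * (J / m)) `^ p^-1.
have t0 : 0 < t by rewrite powR_gt0 // mulr_gt0.
have tp : t `^ p = 2 * (J / m) by apply: powRVK; [rewrite mulr_ge0 // ltW|rewrite gt_eqF].
have deltaE : gamma / theta `^ p = eta by rewrite thp; field; rewrite !gt_eqF.
set F := bad_set Y p t theta H.
have mF n : measurable (F n).
  by apply: (measurable_bad_set (D := D) (u := u) (T := T)).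
exists (lim_sup_set F); split.
- by apply: bigcap_measurable => // n _; exact: bigcup_measurable.
- apply: lim_sup_set_cvg0 => //.
  apply: (@le_lt_trans _ _ (J / t `^ p / (1 - eta))%:E); last exact: ltry.
  apply: nneseries_geometric_le => //; rewrite ?(ltW eta0) ?divr_ge0 ?powR_ge0 ?(ltW J0) //.
  move=> n; have := mu_bad_set (D := D) (u := u) (T := T) mY t0 th0 gH intH n.
  by rewrite deltaE.
move=> x y n [Bx nEx] [By nEy] xy.
have ev z : ~ lim_sup_set F z -> exists M, forall N, (M <= N)%N -> ~ F N z.
  move=> nz; apply: contrapT => h; apply: nz => M _.
  apply: contrapT => h'; apply: h; exists M => N MN FN.
  by apply: h'; exists N.
have [M1 h1] := ev x nEx; have [M2 h2] := ev y nEy.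
pose N := maxn n (maxn M1 M2).
have := good_chain_bound Dm mball mY BY p0 T0 t0 th0 th1 gH intH mass (N := N) (n := n)
  (x := x) (y := y).
have -> : 8 * 2 `^ p^-1 / (1 - theta) * 2 `^ p^-1 * (J / m) `^ p^-1 = 8 * 2 `^ p^-1 / (1 - theta) * t.
  by rewrite /t [(2 * _) `^ _]powRM ?(ltW Jm0) // mulrA.
apply=> //; rewrite ?leq_maxl //; last 2 first.
- by apply: h1; rewrite /N !leq_max leqnn orbT.
- by apply: h2; rewrite /N !leq_max leqnn !orbT.
move=> i _; rewrite deltaE tp exprS.
have -> : J / (2 * (J / m)) = m / 2 by field; rewrite !gt_eqF.
have : 0 < m * eta ^+ i by rewrite mulr_gt0 ?exprn_gt0.
set e := eta ^+ i => me0.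
have -> : m / 2 * (e + eta * e) = (m * e) * ((1 + eta) / 2) by field.
by rewrite gtr_pMr // ltr_pdivrMr // mul1r -[ltRHS]/(1 + 1) ltrD2l.
Qed.
End Embeddings.

(** * Oscillation estimates on sets with the measure density property *)

Definition measure_density (R : realType) (d : measure_display)
    (X : measurableType d) (rho : X -> X -> R) (mu : {measure set X -> \bar R})
    (Omega : set X) : Prop :=
  exists2 Cmu : R, 0 < Cmu &
    forall (x : X) (r : R), Omega x -> 0 < r -> r <= 1 ->
      (mu (qball rho x r) <= Cmu%:E * mu (qball rho x r `&` Omega))%E.

Section DoublingMetricFacts.
Context {R : realType} {d : measure_display} {X : measurableType d}.
Context {mu : {measure set X -> \bar R}} {D : X -> X -> R} {Cd Qd : R}.
Hypothesis dmD : doubling_metric D mu Cd Qd.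

Lemma dm_pmetric : is_pmetric D. Proof. by case: dmD. Qed.

Lemma dm_measurable_dist x : measurable_fun setT (D x).
Proof.
case: dmD => Dm cont _ _; apply: cont => // y _ e e0; exists e => // z _ yz.
exact: (le_lt_trans (pm_lip Dm x y z)).
Qed.

Lemma dm_measurable_ball x r : measurable (qball D x r).
Proof.
have -> : qball D x r = setT `&` D x @^-1` `]-oo, r[%classic.
  by apply/seteqP; split=> z; rewrite /= in_itv //= => -[].
exact: dm_measurable_dist.
Qed.

Lemma dm_fin x r : mu (qball D x r) \is a fin_num.
Proof.
case: dmD => Dm _ pos _; have [r0|r0] := lerP r 0.
  have -> : qball D x r = set0.
    apply/seteqP; split=> // y; rewrite /qball /= => /lt_le_trans/(_ r0).
    by rewrite ltNge (pm_ge0 Dm).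
  by rewrite measure0.
by rewrite ge0_fin_numE //; case: (pos x r r0).
Qed.

Lemma dm_gt0 x r : 0 < r -> 0 < fine (mu (qball D x r)).
Proof. by move=> r0; case: dmD => _ _ /(_ x r r0)[h1 h2] _; rewrite fine_gt0 // h1. Qed.

Lemma dm_doubling x r r' : 0 < r -> r <= r' ->
  fine (mu (qball D x r')) <= Cd * (r' / r) `^ Qd * fine (mu (qball D x r)).
Proof. by case: dmD => _ _ _; apply. Qed.
End DoublingMetricFacts.

Section Density.
Context {R : realType} {d : measure_display} {X : measurableType d}.
Context (rho : X -> X -> R) (mu : {measure set X -> \bar R}) (Omega : set X).
Context (D : X -> X -> R) (beta c Cd Qd : R).
Hypothesis rho_ge0 : forall x y, 0 <= rho x y.
Hypothesis mrho : forall x r, measurable (qball rho x r).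
Hypotheses (beta0 : 0 < beta) (c1 : 1 <= c) (Cd0 : 0 < Cd) (Qd0 : 0 < Qd).
Hypothesis snow : snowflake setT rho D beta c.
Hypothesis dmD : doubling_metric D mu Cd Qd.
Hypothesis mO : measurable Omega.

Let c0 : 0 < c. Proof. exact: lt_le_trans c1. Qed.

Lemma dist_lt_of_rho x y r : 0 <= r -> rho x y < r -> D x y < c * r `^ beta.
Proof.
move=> r0 h; apply: (le_lt_trans (proj1 (snow I I))).
by rewrite ltr_pM2l //; apply: powR_lt.
Qed.

Lemma rho_lt_of_dist x y r : 0 <= r -> D x y < r -> rho x y < (c * r) `^ beta^-1.
Proof.
move=> r0 h; apply: powR_lt_inv => //; first by rewrite mulr_ge0 // ltW.
by apply: (le_lt_trans (proj2 (snow I I))); rewrite ltr_pM2l.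
Qed.

(** Small [D]-balls contain [rho]-balls of comparable mass. *)
Lemma density_dist : measure_density rho mu Omega -> exists c2 r1, [/\ 0 < c2, 0 < r1 &
  forall x r, Omega x -> 0 < r -> r <= r1 ->
    c2 * fine (mu (qball D x r)) <= fine (mu (qball D x r `&` Omega))].
Proof.
move=> [Cmu Cmu0 dens]; have mD x r := dm_measurable_ball dmD x r.
exists (Cmu^-1 * Cd^-1 * (c ^+ 2) `^ (- Qd)), c; split=> //.
  by rewrite !mulr_gt0 ?invr_gt0 ?powR_gt0 // exprn_gt0.
move=> x r Ox r0 rc.
set a := (r / c) `^ beta^-1; have a0 : 0 < a by rewrite powR_gt0 // divr_gt0.
have a1 : a <= 1.
  apply: (@le_trans _ _ (1 `^ beta^-1)); last by rewrite powR1.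
  apply: powR_le; rewrite ?invr_ge0 ?divr_ge0 ?(ltW beta0) ?(ltW r0) ?(ltW c0) //.
  by rewrite ler_pdivrMr // mul1r.
have sub1 : qball rho x a `&` Omega `<=` qball D x r `&` Omega.
  move=> y [xy Oy]; split=> //; have := dist_lt_of_rho (ltW a0) xy.
  by rewrite powRVK ?divr_ge0 ?(ltW r0) ?(ltW c0) ?gt_eqF // mulrC divfK ?gt_eqF.
have sub2 : qball D x (r / c ^+ 2) `<=` qball rho x a.
  move=> y; have rc0 : 0 <= r / c ^+ 2 by rewrite divr_ge0 ?exprn_ge0 ?(ltW r0) ?(ltW c0).
  move=> /(rho_lt_of_dist rc0); rewrite /qball /= /a.
  by have -> : c * (r / c ^+ 2) = r / c by field; rewrite gt_eqF.
have finO : mu (qball D x r `&` Omega) \is a fin_num.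
  rewrite ge0_fin_numE //; apply: (@le_lt_trans _ _ (mu (qball D x r))).
    by apply: le_measure; rewrite ?inE //; exact: measurableI.
  by have := dm_fin dmD x r; rewrite ge0_fin_numE.
have h1 : (mu (qball D x (r / c ^+ 2)) <= Cmu%:E * mu (qball D x r `&` Omega))%E.
  apply: (@le_trans _ _ (mu (qball rho x a))); first by apply: le_measure; rewrite ?inE.
  apply: (le_trans (dens x a Ox a0 a1)); rewrite lee_wpmul2l ?lee_fin ?(ltW Cmu0) //.
  by apply: le_measure; rewrite ?inE //; exact: measurableI.
have rc2 : r / c ^+ 2 <= r.
  by rewrite ler_pdivrMr ?exprn_gt0 // ler_peMr ?(ltW r0) // exprn_ege1.
have rc20 : 0 < r / c ^+ 2 by rewrite divr_gt0 // exprn_gt0.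
have h2 := dm_doubling dmD x rc20 rc2.
have h3 : fine (mu (qball D x (r / c ^+ 2))) <= Cmu * fine (mu (qball D x r `&` Omega)).
  by rewrite -lee_fin EFinM !fineK // (dm_fin dmD).
move: h2; have -> : r / (r / c ^+ 2) = c ^+ 2.
  by field; rewrite ?gt_eqF ?exprn_gt0.
rewrite powRN; set P := (c ^+ 2) `^ Qd; have P0 : 0 < P by rewrite powR_gt0 // exprn_gt0.
set V := fine (mu (qball D x r)).
have -> : Cmu^-1 * Cd^-1 * P^-1 * V = Cmu^-1 * (Cd^-1 * (P^-1 * V)) by ring.
move=> h2; rewrite ler_pdivrMl //; apply: le_trans h3.
by rewrite !ler_pdivrMl // mulrA [P * _]mulrC.
Qed.

Lemma pgradient_dist (q : \bar R) (s p : R) (u : X -> R) (M : R) : (forall x y, rho x y = 0 -> x = y) ->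
  0 < s -> 0 < p -> (0 < q)%E -> (dotN_norm rho mu Omega s p q u < M%:E)%E ->
  forall r, 0 < r -> exists2 H, pgradient Omega D p u r H &
    (\int[mu]_(x in Omega) H x <=
     (2 `^ p * 2 `^ (s * p) / (1 - 2 `^ (- (s * p))) *
       (M `^ p * (c * r) `^ (s * p / beta)))%:E)%E.
Proof.
move=> rho_eq0 s0 p0 q0 ltM r r0.
have M0 : 0 <= M.
  by rewrite -lee_fin; apply: ltW; apply: le_lt_trans ltM; exact: dotN_norm_ge0.
have cr0 : 0 < (c * r) `^ beta^-1 by rewrite powR_gt0 // mulr_gt0.
have [H [mH H0 gH] intH] := pgradient_of_dotN rho_ge0 rho_eq0 mO s0 p0 q0 ltM cr0.
exists H; first split=> // x y Ox Oy xy.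
  by apply: gH => //; apply: rho_lt_of_dist => //; exact: ltW.
apply: (le_trans intH); rewrite lee_fin le_eqVlt; apply/orP; left; apply/eqP.
congr (_ * _); rewrite powRM ?powR_ge0 // -!powRrM; congr (_ * _ `^ _).
by ring.
Qed.
End Density.

Lemma half_powR (R : realType) (a : R) (n : nat) : (2^-1 ^+ n) `^ a = (2^-1 `^ a) ^+ n.
Proof.
by rewrite -powR_mulrn ?invr_ge0 // powRAC powR_mulrn ?powR_ge0.
Qed.

Section HoelderEstimate.
Context {R : realType} {d : measure_display} {X : measurableType d}.
Context (rho : X -> X -> R) (mu : {measure set X -> \bar R}) (Omega : set X).
Context (D : X -> X -> R) (beta c Cd Q : R).
Hypothesis hX : quasi_metric_measure_space rho mu.
Hypotheses (beta0 : 0 < beta) (c1 : 1 <= c) (Cd0 : 0 < Cd) (Q0 : 0 < Q).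
Hypothesis snow : snowflake setT rho D beta c.
Hypothesis dmD : doubling_metric D mu Cd (Q / beta).
Hypothesis mO : measurable Omega.
Hypothesis dens : measure_density rho mu Omega.

Let c0 : 0 < c. Proof. exact: lt_le_trans c1. Qed.
Let rho_ge0 x y : 0 <= rho x y. Proof. exact: (qm_ge0 hX). Qed.
Let rho_eq0 x y : rho x y = 0 -> x = y.
Proof. by case: hX => [[_ [C0 [C1 [_ _ H]]]] _ _]; case: (H x y y I I I) => _ /(iffLR). Qed.
Let mrho x r : measurable (qball rho x r).
Proof.
have [r0|r0] := lerP r 0; last by case: hX => _ _ /(_ x r r0)[].
have -> : qball rho x r = set0; last exact: measurable0.
apply/seteqP; split=> // y; rewrite /qball /= => /lt_le_trans/(_ r0).
by rewrite ltNge rho_ge0.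
Qed.

(** Below the scale [R0] the balls centred in [Omega] carry a fixed fraction of
    the mass that doubling predicts from [B0]. *)
Lemma mass_in_ball : exists2 c3, 0 < c3 & forall x0 R0 x n,
  0 < R0 -> R0 <= 1 -> (qball rho x0 R0 `&` Omega) x ->
  ((c3 * fine (mu (qball rho x0 R0)) * (2^-1 `^ (Q / beta)) ^+ n)%:E <=
   mu (qball D x (c * R0 `^ beta * 2^-1 ^+ n) `&` Omega))%E.
Proof.
have Qd0 : 0 < Q / beta by rewrite divr_gt0.
have [c2 [r1 [c20 r10 H]]] := density_dist rho_ge0 mrho beta0 c1 Cd0 snow dmD mO dens.
pose k := Num.min 1 (r1 / c).
have k0 : 0 < k by rewrite lt_min ltr01 divr_gt0.
have k1 : k <= 1 by rewrite ge_min lexx.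
exists (c2 / (Cd * (2 / k) `^ (Q / beta))).
  by rewrite !divr_gt0 // mulr_gt0 // powR_gt0 // divr_gt0.
move=> x0 R0 x n R00 R01 [xB Ox].
set T := c * R0 `^ beta; set h := 2^-1 ^+ n.
have h0 : 0 < h by rewrite exprn_gt0 // invr_gt0.
have h1 : h <= 1 by rewrite exprn_ile1 // ?invr_ge0 // invf_le1 // ler1n.
have T0 : 0 < T by rewrite mulr_gt0 // powR_gt0.
have Tc : T <= c.
  rewrite ler_piMr ?(ltW c0) //; apply: (@le_trans _ _ (1 `^ beta)); last by rewrite powR1.
  by apply: powR_le; rewrite ?(ltW beta0) ?(ltW R00).
have Th0 : 0 < T * h by rewrite mulr_gt0.
have kTh0 : 0 < k * (T * h) by rewrite mulr_gt0.
have kTh1 : k * (T * h) <= r1.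
  apply: (@le_trans _ _ (r1 / c * c)); last by rewrite divfK // gt_eqF.
  apply: ler_pM; rewrite ?(ltW k0) ?(ltW Th0) //; first by rewrite ge_min lexx orbT.
  by apply: (le_trans _ Tc); rewrite ler_piMr // ltW.
have mD := dm_measurable_ball dmD.
have sub : qball D x (k * (T * h)) `&` Omega `<=` qball D x (T * h) `&` Omega.
  by move=> y [xy Oy]; split=> //; apply: (lt_le_trans xy); rewrite ler_piMl // ltW.
have finO r : mu (qball D x r `&` Omega) \is a fin_num.
  rewrite ge0_fin_numE //; apply: (@le_lt_trans _ _ (mu (qball D x r))).
    by apply: le_measure; rewrite ?inE //; exact: measurableI.
  by have := dm_fin dmD x r; rewrite ge0_fin_numE.
apply: (@le_trans _ _ (mu (qball D x (k * (T * h)) `&` Omega))); last first.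
  by apply: le_measure; rewrite ?inE //; exact: measurableI.
rewrite -(fineK (finO _)) lee_fin; apply: le_trans (H x _ Ox kTh0 kTh1).
have Dm := dm_pmetric dmD.
have sub2 : qball rho x0 R0 `<=` qball D x (2 * T).
  move=> y yB; apply: (le_lt_trans (pm_tri Dm x0 x y)).
  have := dist_lt_of_rho rho_ge0 beta0 c1 snow (ltW R00) yB.
  have := dist_lt_of_rho rho_ge0 beta0 c1 snow (ltW R00) xB.
  rewrite (pm_sym Dm x) -/T => e1 e2; apply: (lt_le_trans (ltrD e1 e2)).
  by rewrite mulrDl mul1r.
have le2T : k * (T * h) <= 2 * T.
  apply: (@le_trans _ _ T); last by rewrite ler_peMl ?(ltW T0) // ler1n.
  apply: (@le_trans _ _ (T * h)); first by rewrite ler_piMl // ltW.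
  by rewrite ler_piMr // ltW.
have h2 := dm_doubling dmD x kTh0 le2T.
have h3 : fine (mu (qball rho x0 R0)) <= fine (mu (qball D x (2 * T))).
  apply: fine_le; rewrite ?(dm_fin dmD) //; last by apply: le_measure; rewrite ?inE.
  by case: hX => _ _ /(_ x0 R0 R00)[_ _ ?]; rewrite ge0_fin_numE.
move: h2; have -> : 2 * T / (k * (T * h)) = 2 / k * h^-1 by field; rewrite !gt_eqF.
rewrite powRM ?divr_ge0 ?invr_ge0 ?(ltW k0) ?(ltW h0) // powR_invl ?(ltW h0) //.
rewrite /h half_powR; set e := _ ^+ n; set K := (2 / k) `^ _.
have e0 : 0 < e by rewrite exprn_gt0 // powR_gt0 // invr_gt0.
have K0 : 0 < K by rewrite powR_gt0 // divr_gt0.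
set V := fine (mu (qball rho x0 R0)) in h3 *; set W := fine _ => h2.
have h4 := le_trans h3 h2.
have -> : c2 / (Cd * K) * V * e = c2 * (V * e / (Cd * K)) by field; rewrite !gt_eqF.
rewrite ler_pM2l // ler_pdivrMr ?mulr_gt0 // -ler_pdivlMr //; apply: (le_trans h4).
by rewrite le_eqVlt; apply/orP; left; apply/eqP; field; rewrite gt_eqF.
Qed.

Let half0 : 0 < 2^-1 :> R. Proof. by rewrite invr_gt0. Qed.

Lemma half_powR_lt (a b : R) : a < b -> (2^-1 : R) `^ b < 2^-1 `^ a.
Proof.
move=> ab; rewrite /powR gt_eqF // ltr_expR ltr_nM2r //.
by apply: ln_lt0; rewrite half0 invf_lt1 // ltr1n.
Qed.

(** In a ball of radius [R0] the scales [T 2^-n] start at [T = c R0^beta]; the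
    decay of the gradients is [2^(-s p / beta)] per scale, that of masses
    [2^(-Q / beta)]. *)
Lemma scale_data_in_ball (s p : R) : 0 < s -> 0 < p ->
  exists c3 K, [/\ 0 < c3, 0 < K & forall (q : \bar R) x0 R0 u M, (0 < q)%E -> 0 < R0 ->
    R0 <= 1 -> 0 < M -> (dotN_norm rho mu Omega s p q u < M%:E)%E ->
    exists H, scale_data mu (D := D) p (2^-1 `^ (s * p / beta)) (2^-1 `^ (Q / beta))
      Omega (qball rho x0 R0 `&` Omega) u (c * R0 `^ beta) (K * (R0 `^ s * M) `^ p)
      (c3 * fine (mu (qball rho x0 R0))) H].
Proof.
move=> s0 p0; have [c3 c30 mass] := mass_in_ball.
set K := 2 `^ p * 2 `^ (s * p) / (1 - 2 `^ (- (s * p))).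
have K0 : 0 < K.
  rewrite divr_gt0 ?mulr_gt0 ?powR_gt0 // subr_gt0 powRN -powR_invl // -[ltRHS](powRr0 2^-1).
  by apply: half_powR_lt; rewrite mulr_gt0.
exists c3, (K * (4 * c ^+ 2) `^ (s * p / beta)); split=> //.
  by rewrite mulr_gt0 // powR_gt0 // mulr_gt0 // exprn_gt0.
move=> q x0 R0 u M q0 R00 R01 M0 ltM.
set B := qball rho x0 R0 `&` Omega; set V := fine (mu (qball rho x0 R0)).
have V0 : 0 < V by case: hX => _ _ /(_ x0 R0 R00)[_ h1 h2]; rewrite fine_gt0 // h1.
set T := c * R0 `^ beta; have T0 : 0 < T by rewrite mulr_gt0 // powR_gt0.
have cT n : 0 < 4 * T * 2^-1 ^+ n by rewrite mulr_gt0 ?exprn_gt0 // mulr_gt0.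
have grad := pgradient_dist rho_ge0 beta0 c1 snow mO rho_eq0 s0 p0 q0 ltM.
have /choice[H HH] n : exists H,
    pgradient Omega D p u (4 * T * 2^-1 ^+ n) H /\
    (\int[mu]_(x in Omega) H x <= (K * (M `^ p * (c * (4 * T * 2^-1 ^+ n)) `^ (s * p / beta)))%:E)%E.
  by have [H h1 h2] := grad _ (cT n); exists H.
exists H; split; [split=> //| | |].
- by move=> x [].
- apply: mulr_gt0; last by rewrite powR_gt0 // mulr_gt0 // powR_gt0.
  by rewrite mulr_gt0 // powR_gt0 // mulr_gt0 // exprn_gt0.
- exact: mulr_gt0.
- by move=> n; case: (HH n).
- move=> n; case: (HH n) => _ h; apply: (le_trans h); rewrite lee_fin -half_powR.
  have -> : c * (4 * T * 2^-1 ^+ n) = (4 * c ^+ 2) * R0 `^ beta * 2^-1 ^+ n by rewrite /T; ring.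
  have e0 : 0 <= 4 * c ^+ 2 by rewrite mulr_ge0 // exprn_ge0 // ltW.
  have e1 : 0 <= 4 * c ^+ 2 * R0 `^ beta by rewrite mulr_ge0 // powR_ge0.
  rewrite (powRM _ e1) ?exprn_ge0 ?(ltW half0) // (powRM _ e0) ?powR_ge0 // -powRrM.
  have -> : beta * (s * p / beta) = s * p by field; rewrite gt_eqF.
  rewrite [(R0 `^ s * M) `^ p]powRM ?powR_ge0 ?(ltW M0) // -powRrM.
  by rewrite le_eqVlt; apply/orP; left; apply/eqP; ring.
- by move=> x n Bx; apply: mass.
Qed.

(** The distance of two points determines the scale at which their chains meet;
    since [s p > Q] the gradients decay faster than the masses. *)
Lemma hoelder_estimate (s p : R) : 0 < s -> 0 < p -> Q < s * p ->
  exists2 C, 0 < C & forall (q : \bar R) x0 R0 u M, (0 < q)%E -> 0 < R0 -> R0 <= 1 ->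
    0 < M -> (dotN_norm rho mu Omega s p q u < M%:E)%E ->
    exists E, [/\ measurable E, mu E = 0%E & forall x y,
      ((qball rho x0 R0 `&` Omega) `\` E) x -> ((qball rho x0 R0 `&` Omega) `\` E) y ->
      `|u x - u y| <= C * M * rho x y `^ (s - Q / p) *
        (R0 `^ (Q / p) / fine (mu (qball rho x0 R0)) `^ p^-1)].
Proof.
move=> s0 p0 Qsp; have [c3 [K [c30 K0 data]]] := scale_data_in_ball s0 p0.
set gamma := (2^-1 : R) `^ (s * p / beta) in data; set eta := (2^-1 : R) `^ (Q / beta) in data.
have g0 : 0 < gamma by exact: powR_gt0.
have eta0 : 0 < eta by exact: powR_gt0.
have ge : gamma < eta by apply: half_powR_lt; rewrite ltr_pM2r // invr_gt0.
have eta1 : eta < 1 by rewrite -[ltRHS](powRr0 2^-1); apply: half_powR_lt; rewrite divr_gt0.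
have mD := dm_measurable_ball dmD.
have [Ch Ch0 hoelder] := hoelder_ae mu (dm_pmetric dmD) mD p0 g0 ge eta1.
set alpha := s - Q / p.
have alpha0 : 0 < alpha by rewrite subr_gt0 ltr_pdivrMr.
have thetaE : (gamma / eta) `^ p^-1 = 2^-1 `^ (alpha / beta).
  rewrite /gamma /eta -powRB; last by apply/implyP => _; rewrite gt_eqF.
  by rewrite -powRrM; congr (_ `^ _); rewrite /alpha; field; rewrite !gt_eqF.
set A := (K / c3) `^ p^-1.
have A0 : 0 < A by rewrite powR_gt0 // divr_gt0.
exists (Ch * A); first by rewrite mulr_gt0.
move=> q x0 R0 u M q0 R00 R01 M0 ltM; have [H HH] := data q x0 R0 u M q0 R00 R01 M0 ltM.
have [E [mE muE hE]] := hoelder _ _ _ _ _ _ _ HH.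
set B := qball rho x0 R0 `&` Omega in hE *; set V := fine (mu (qball rho x0 R0)) in hE *.
have V0 : 0 < V by case: hX => _ _ /(_ x0 R0 R00)[_ h1 h2]; rewrite fine_gt0 // h1.
set T := c * R0 `^ beta in hE; have T0 : 0 < T by rewrite mulr_gt0 // powR_gt0.
exists E; split=> // x y Ex Ey.
have Dm := dm_pmetric dmD.
have DT z : B z -> D x0 z < T.
  by move=> [zB _]; exact: (dist_lt_of_rho rho_ge0 beta0 c1 snow (ltW R00) zB).
have := pm_ge0 Dm x y; rewrite le_eqVlt => /predU1P[Dxy0|Dxy].
  have : x = y.
    apply: rho_eq0; have := proj2 (@snow x y I I); rewrite -Dxy0 mulr0 => h.
    have : rho x y `^ beta = 0 by apply/eqP; rewrite eq_le h powR_ge0.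
    exact: powR_eq0_eq0.
  by move=> ->; rewrite subrr normr0 !mulr_ge0 ?powR_ge0 ?invr_ge0 ?powR_ge0 ?ltW.
have Dxy2T : D x y < 2 * T.
  apply: (le_lt_trans (pm_tri Dm x0 x y)); rewrite (pm_sym Dm x x0).
  apply: (lt_le_trans (ltrD (DT x (proj1 Ex)) (DT y (proj1 Ey)))).
  by rewrite mulrDl mul1r.
have [n [n1 n2]] : exists n, D x y < 2 * T * 2^-1 ^+ n /\ T * 2^-1 ^+ n <= D x y.
  have : 1 < 2 * T / D x y by rewrite ltr_pdivlMr // mul1r.
  move=> /(geometric_bracket (ltr1n R 2))[n [h1 h2]]; exists n; rewrite exprVn; split.
    by rewrite ltr_pdivlMr ?exprn_gt0 // mulrC -ltr_pdivlMr.
  move: h2; rewrite ler_pdivrMr // exprS -mulrA ler_pM2l // => h2.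
  by rewrite ler_pdivrMr ?exprn_gt0 // mulrC.
have := hE x y n Ex Ey n1; rewrite thetaE -half_powR => h; apply: (le_trans h).
have rD : (2^-1 ^+ n) `^ (alpha / beta) <= (rho x y / R0) `^ alpha.
  have -> : alpha / beta = beta^-1 * alpha by rewrite mulrC.
  rewrite powRrM; apply: powR_le; rewrite ?(ltW alpha0) ?powR_ge0 //.
  rewrite -[leRHS](@powRKV _ _ beta) ?divr_ge0 ?(ltW R00) ?gt_eqF //.
  apply: powR_le; rewrite ?invr_ge0 ?(ltW beta0) ?exprn_ge0 ?invr_ge0 //.
  rewrite powR_divl ?(ltW R00) // ler_pdivlMr ?powR_gt0 // -(ler_pM2l c0).
  have -> : c * (2^-1 ^+ n * R0 `^ beta) = T * 2^-1 ^+ n by rewrite /T; ring.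
  exact: (le_trans n2 (proj1 (@snow x y I I))).
apply: (le_trans (ler_wpM2l _ rD)); first by rewrite mulr_ge0 ?powR_ge0 // ltW.
have JmE : (K * (R0 `^ s * M) `^ p / (c3 * V)) `^ p^-1 = A * M * R0 `^ s / V `^ p^-1.
  have -> : K * (R0 `^ s * M) `^ p / (c3 * V) = K / c3 * (R0 `^ s * M) `^ p / V.
    by field; rewrite !gt_eqF.
  have P0 : 0 <= K / c3 by rewrite divr_ge0 // ltW.
  have P1 : 0 <= R0 `^ s * M by rewrite mulr_ge0 ?powR_ge0 // ltW.
  have P2 : 0 <= K / c3 * (R0 `^ s * M) `^ p by rewrite mulr_ge0 ?powR_ge0.
  rewrite (powR_divl _ P2 (ltW V0)).
  by rewrite (powRM _ P0 (powR_ge0 _ _)) -/A (powRKV P1 (lt0r_neq0 p0)); ring.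
rewrite JmE powR_divl ?(ltW R00) //.
have -> : R0 `^ s = R0 `^ (Q / p) * R0 `^ alpha.
  rewrite -powRD; first by congr (_ `^ _); rewrite /alpha; ring.
  by apply/implyP => _; rewrite gt_eqF.
rewrite le_eqVlt; apply/orP; left; apply/eqP; field.
by rewrite !gt_eqF ?powR_gt0.
Qed.
End HoelderEstimate.

Lemma le_mul_addV (R : realType) (a b k : R) : 0 <= k ->
  (forall n : nat, a <= k * (b + n.+1%:R^-1)) -> a <= k * b.
Proof.
rewrite le_eqVlt => /predU1P[<- /(_ 0)|k0 H]; first by rewrite !mul0r.
rewrite leNgt; apply/negP; rewrite -ltr_pdivlMl // => /ltr_add_invr[n].
by rewrite ltr_pdivlMl // ltNge H.
Qed.

(** An estimate known off a null set is extended across that set, by the infimum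
    of the cones [u z + M D x z]. *)
Lemma mcshane (R : realType) (X : Type) (D : X -> X -> R) (A : set X) (u : X -> R) (M : R) :
  is_pmetric D -> 0 <= M -> (forall x y, A x -> A y -> `|u x - u y| <= M * D x y) ->
  exists v, (forall x, A x -> v x = u x) /\ forall x y, `|v x - v y| <= M * D x y.
Proof.
move=> Dm M0 lipu; have [[z0 Az0]|A0] := pselect (A !=set0); last first.
  exists (fun _ => 0); split=> [x Ax|x y]; first by exfalso; apply: A0; exists x.
  by rewrite subrr normr0 mulr_ge0 // (pm_ge0 Dm).
pose S x := [set u z + M * D x z | z in A].
have infS x : has_inf (S x).
  split; first by exists (u z0 + M * D x z0); exists z0.
  exists (u z0 - M * D x z0) => _ [z Az <-].
  have := lipu z0 z Az0 Az; rewrite ler_norml => /andP[_ h].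
  have := ler_wpM2l M0 (pm_tri Dm x z0 z); rewrite mulrDr (pm_sym Dm z0 x).
  lra.
have le1 x y : inf (S x) - M * D x y <= inf (S y).
  apply: lb_le_inf; first by case: (infS y).
  move=> _ [z Az <-]; rewrite lerBlDr.
  apply: (@le_trans _ _ (u z + M * D x z)); first by apply: ge_inf; [case: (infS x)|exists z].
  have := ler_wpM2l M0 (pm_tri Dm y x z); rewrite mulrDr.
  lra.
exists (fun x => inf (S x)); split=> [x Ax|x y].
  apply/eqP; rewrite eq_le; apply/andP; split.
    by apply: ge_inf; [case: (infS x)|exists x; rewrite // (pm_xx Dm) mulr0 addr0].
  apply: lb_le_inf; first by case: (infS x).
  move=> _ [z Az <-]; have := lipu x z Ax Az; rewrite ler_norml => /andP[_ h].
  lra.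
have := le1 x y; have := le1 y x; rewrite (pm_sym Dm y x) ler_norml; lra.
Qed.

Section Oscillation.
Context {R : realType} {d : measure_display} {X : measurableType d}.
Context (rho : X -> X -> R) (mu : {measure set X -> \bar R}) (Q : R) (Omega : set X).
Hypothesis hX : quasi_metric_measure_space rho mu.
Hypothesis hQ : 0 < Q.
Hypothesis hdoubling : doubling rho mu Q.
Hypothesis hOmega : measurable Omega.
Hypothesis hOmega_two : exists x y : X, [/\ Omega x, Omega y & x <> y].
Hypothesis hOmega_pos : forall (x : X) (r : R), Omega x -> 0 < r -> r <= 1 ->
       (0 < mu (qball rho x r `&` Omega))%E.

Lemma qm_measurable_ball x r : measurable (qball rho x r).
Proof.
have [r0|r0] := lerP r 0; last by case: hX => _ _ /(_ x r r0)[].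
have -> : qball rho x r = set0; last exact: measurable0.
apply/seteqP; split=> // y; rewrite /qball /= => /lt_le_trans/(_ r0).
by rewrite ltNge (qm_ge0 hX).
Qed.

Lemma qm_ball_gt0 x r : 0 < r -> 0 < fine (mu (qball rho x r)).
Proof. by move=> r0; case: hX => _ _ /(_ x r r0)[_ h1 h2]; rewrite fine_gt0 // h1. Qed.

Lemma qm_ball_fin x r : 0 < r -> mu (qball rho x r) \is a fin_num.
Proof. by move=> r0; case: hX => _ _ /(_ x r r0)[_ h1 h2]; rewrite ge0_fin_numE. Qed.

Lemma snowflake_X : exists beta D c Cd, [/\ 0 < beta, 1 <= c, 0 < Cd,
  snowflake setT rho D beta c & doubling_metric D mu Cd (Q / beta)].
Proof.
have qmX : is_quasi_metric setT rho by case: hX.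
have [beta b0 ble] := qm_exponent_gt0 qmX.
have [D [c [Dm c0 snow]]] := snowflake_of_exponent qmX b0 ble.
have c1 : 1 <= Num.max c 1 by rewrite le_max lexx orbT.
have snow1 : snowflake setT rho D beta (Num.max c 1).
  by apply: (snowflake_le Dm _ snow); rewrite le_max lexx.
have [Cd Cd0 dm] := snowflake_doubling_metric hX hdoubling b0 c1 Dm snow1.
by exists beta, D, (Num.max c 1), Cd.
Qed.

Lemma qm_diameter : exists2 k, 0 < k & forall x0 r x y, 0 < r ->
  qball rho x0 r x -> qball rho x0 r y -> rho x y <= k * r.
Proof.
case: hX => [[_ [C0 [C1 [C00 C10 H]]]] _ _].
exists (C1 * Num.max C0 1); first by rewrite mulr_gt0 // lt_max ltr01 orbT.
move=> x0 r x y r0; rewrite /qball /= => xr yr.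
have [_ _ _ h] := H x y x0 I I I; apply: (le_trans h).
rewrite -mulrA ler_pM2l // ge_max; apply/andP; split.
  have [_ _ h1 _] := H x0 x x0 I I I; apply: (le_trans h1).
  apply: ler_pM; [exact: ltW|exact: (qm_ge0 hX)|by rewrite le_max lexx|exact: ltW].
apply: (le_trans (ltW yr)); rewrite ler_peMl ?(ltW r0) //.
by rewrite le_max lexx orbT.
Qed.

(** The Hölder estimate in the form from which all four embeddings follow. *)
Definition osc_bound (s p C : R) : Prop := forall x0 R0 u,
  Omega x0 -> 0 < R0 -> R0 <= 1 -> dotN rho mu Omega s p +oo u ->
  exists E, [/\ measurable E, mu E = 0%E & forall x y,
    ((qball rho x0 R0 `&` Omega) `\` E) x -> ((qball rho x0 R0 `&` Omega) `\` E) y ->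
    `|u x - u y| <= C * fine (dotN_norm rho mu Omega s p +oo u) *
      rho x y `^ (s - Q / p) * (R0 `^ (Q / p) / fine (mu (qball rho x0 R0)) `^ p^-1)].

(** For [p = 2 Q / s] the Hölder exponent [s - Q / p] is [s / 2]; the smoothness
    [s] is small enough for [rho^(s/2)] to be comparable to a pseudometric, which
    makes the Hölder estimate a Lipschitz estimate. *)
Lemma density_hoelder : measure_density rho mu Omega ->
  exists s C D c, [/\ 0 < s, 0 < C, le_qm_index +oo s Omega rho,
    (is_pmetric D /\ 0 < c) /\ snowflake Omega rho D (s / 2) c &
    osc_bound s (2 * Q / s) C].
Proof.
move=> dens; have [beta [D [c [Cd [b0 c1 Cd0 snow dm]]]]] := snowflake_X.
have qmX : is_quasi_metric setT rho by case: hX.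
have qmO : is_quasi_metric Omega rho by exact: is_quasi_metric_sub.
have [b1 b10 b1le] := qm_exponent_gt0 qmO.
pose s := b1 / 2; have s0 : 0 < s by rewrite divr_gt0.
have sb1 : s < b1 by rewrite ltr_pdivrMr // ltr_pMr // ltr1n.
have s_ind : (s%:E < qm_index Omega rho)%E.
  apply: (@lt_le_trans _ _ b1%:E); first by rewrite lte_fin.
  exact: le_trans b1le (qm_exponent_le_index qmO).
have s20 : 0 < s / 2 by rewrite divr_gt0.
have s2le : ((s / 2)%:E <= qm_exponent Omega rho)%E.
  apply: le_trans b1le; rewrite lee_fin; apply: le_trans (ltW sb1).
  by rewrite ler_pdivrMr // ler_peMr ?(ltW s0) // ler1n.
have [D' [c' [Dm' c'0 snow']]] := snowflake_of_exponent qmO s20 s2le.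
have p0 : 0 < 2 * Q / s by rewrite divr_gt0 // mulr_gt0.
have Qsp : Q < s * (2 * Q / s).
  have -> : s * (2 * Q / s) = Q + Q by field; rewrite gt_eqF.
  by rewrite ltrDl.
have [C C0 H] := hoelder_estimate hX b0 c1 Cd0 hQ snow dm hOmega dens s0 p0 Qsp.
exists s, C, D', c'; split=> //.
  by split; [exact: ltW|move=> h; move: s_ind; rewrite h ltxx].
move=> x0 R0 u Ox0 R00 R01 [_ norm_fin].
set p := 2 * Q / s in p0 Qsp H norm_fin *.
have norm0 : (0 <= dotN_norm rho mu Omega s p +oo u)%E by exact: dotN_norm_ge0.
set N := fine (dotN_norm rho mu Omega s p +oo u).
have NE : dotN_norm rho mu Omega s p +oo u = N%:E by rewrite fineK // ge0_fin_numE.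
have N0 : 0 <= N by rewrite fine_ge0.
have /choice[E HE] n : exists E, [/\ measurable E, mu E = 0%E & forall x y,
      ((qball rho x0 R0 `&` Omega) `\` E) x -> ((qball rho x0 R0 `&` Omega) `\` E) y ->
      `|u x - u y| <= C * (N + n.+1%:R^-1) * rho x y `^ (s - Q / p) *
        (R0 `^ (Q / p) / fine (mu (qball rho x0 R0)) `^ p^-1)].
  apply: (H +oo%E) => //; first by rewrite ltr_wpDl.
  by rewrite NE lte_fin ltrDl.
have mE : measurable (\bigcup_n E n) by apply: bigcup_measurable => n _; case: (HE n).
exists (\bigcup_n E n); split=> //.
  apply: measure_negligible => //; apply: negligible_bigcup => n.
  by exists (E n); split=> //; case: (HE n).
move=> x y [xB nEx] [yB nEy].
set Z := rho x y `^ _; set W := _ / _; have Z0 : 0 <= Z by exact: powR_ge0.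
have W0 : 0 <= W by rewrite divr_ge0 ?powR_ge0.
have -> : C * N * Z * W = C * Z * W * N by ring.
apply: le_mul_addV.
  by apply: mulr_ge0 => //; apply: mulr_ge0 => //; exact: ltW.
move=> n; case: (HE n) => _ _ /(_ x y).
have -> : C * Z * W * (N + n.+1%:R^-1) = C * (N + n.+1%:R^-1) * Z * W by ring.
move=> h; apply: h; split=> // h; [apply: nEx; exists n|apply: nEy; exists n]; by [].
Qed.
End Oscillation.

(** * From the measure density property to the embeddings *)

Section Embeddings.
Context {R : realType} {d : measure_display} {X : measurableType d}.
Context (rho : X -> X -> R) (mu : {measure set X -> \bar R}) (Q : R) (Omega : set X).
Hypothesis hX : quasi_metric_measure_space rho mu.
Hypothesis hQ : 0 < Q.
Hypothesis hOmega : measurable Omega.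
Hypothesis hOmega_pos : forall (x : X) (r : R), Omega x -> 0 < r -> r <= 1 ->
       (0 < mu (qball rho x r `&` Omega))%E.

Lemma Lp_norm_le_ae (B E : set X) (f : X -> R) (r K V : R) : 0 < r -> 0 <= K -> 0 <= V ->
  measurable B -> measurable E -> mu E = 0%E -> measurable_fun B f ->
  (mu B <= V%:E)%E -> (forall x, (B `\` E) x -> `|f x| <= K) ->
  (Lp_norm mu B r f <= (K * V `^ r^-1)%:E)%E.
Proof.
move=> r0 K0 V0 mB mE E0 mf muB le_K.
rewrite Lp_norm_le ?mulr_ge0 ?powR_ge0 //.
have mfr : measurable_fun B (fun x => (`|f x| `^ r)%:E) by exact: measurable_normr_powR.
rewrite (ge0_negligible_integral mE) //.
have mBE : measurable (B `\` E) by exact: measurableD.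
apply: (@le_trans _ _ (\int[mu]_(x in B `\` E) (K `^ r)%:E)%E).
  apply: ge0_le_integral => //.
  - by apply: measurable_funS mfr => //; exact: subDsetl.
  - by move=> x BEx; rewrite lee_fin; apply: powR_le; rewrite ?(ltW r0) ?le_K.
rewrite integral_cst // powRM ?powR_ge0 // powRVK ?gt_eqF // EFinM.
rewrite lee_wpmul2l ?lee_fin ?powR_ge0 //; apply: le_trans muB.
by apply: le_measure; rewrite ?inE //; exact: subDsetl.
Qed.

Lemma measureD_null (B E : set X) : measurable B -> measurable E -> mu E = 0%E ->
  (mu B < +oo)%E -> mu (B `\` E) = mu B.
Proof.
move=> mB mE E0 finB; rewrite measureD //.
rewrite [X in (_ - X)%E](_ : _ = 0%E) ?sube0 //.
apply/eqP; rewrite eq_le measure_ge0 andbT -E0.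
by apply: le_measure; rewrite ?inE //; exact: measurableI.
Qed.

Let mball x r : measurable (qball rho x r). Proof. exact: (qm_measurable_ball hX). Qed.

Let mB x r : measurable (qball rho x r `&` Omega).
Proof. exact: measurableI. Qed.

Let muB_le x r : 0 < r ->
  (mu (qball rho x r `&` Omega) <= (fine (mu (qball rho x r)))%:E)%E.
Proof.
by move=> r0; rewrite fineK ?(qm_ball_fin hX) //; apply: le_measure; rewrite ?inE.
Qed.

Lemma outside_null x0 R0 E : Omega x0 -> 0 < R0 -> R0 <= 1 -> measurable E ->
  mu E = 0%E -> ((qball rho x0 R0 `&` Omega) `\` E) !=set0.
Proof.
move=> Ox R00 R01 mE muE; apply: nonsubset => sub.
have := hOmega_pos Ox R00 R01; apply/negP; rewrite -leNgt -muE.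
by apply: le_measure; rewrite ?inE.
Qed.

Section Consequences.
Context (s C : R).
Let p := 2 * Q / s.
Hypotheses (s0 : 0 < s) (C0 : 0 < C).
Hypothesis le_s : le_qm_index +oo s Omega rho.
Hypothesis oscH : osc_bound rho mu Q Omega s p C.

Let p0 : 0 < p. Proof. by rewrite divr_gt0 // mulr_gt0. Qed.
Let alphaE : s - Q / p = s / 2.
Proof. by rewrite /p; field; rewrite !gt_eqF. Qed.
Let norm u := dotN_norm rho mu Omega s p +oo u.
Let N u := fine (norm u).
Let V x r := fine (mu (qball rho x r)).
Let norm_ge0 u : (0 <= norm u)%E. Proof. exact: dotN_norm_ge0. Qed.
Let N_ge0 u : 0 <= N u. Proof. by rewrite fine_ge0. Qed.
Let normE u : dotN rho mu Omega s p +oo u -> norm u = (N u)%:E.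
Proof. by move=> [_ h]; rewrite fineK // ge0_fin_numE. Qed.
Let V_gt0 x r : 0 < r -> 0 < V x r. Proof. exact: (qm_ball_gt0 hX). Qed.

Lemma osc_ball : exists2 C1, 0 < C1 & forall x0 R0 u,
  Omega x0 -> 0 < R0 -> R0 <= 1 -> dotN rho mu Omega s p +oo u ->
  exists E, [/\ measurable E, mu E = 0%E & forall x y,
    ((qball rho x0 R0 `&` Omega) `\` E) x -> ((qball rho x0 R0 `&` Omega) `\` E) y ->
    `|u x - u y| <= C1 * N u * (R0 `^ s / V x0 R0 `^ p^-1)].
Proof.
have [k k0 diam] := qm_diameter hX.
exists (C * k `^ (s / 2)); first by rewrite mulr_gt0 ?powR_gt0.
move=> x0 R0 u Ox R00 R01 Nu; have [E [mE muE H]] := oscH Ox R00 R01 Nu.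
exists E; split=> // x y xE yE; apply: (le_trans (H x y xE yE)); rewrite alphaE.
have le_rho : rho x y `^ (s / 2) <= k `^ (s / 2) * R0 `^ (s / 2).
  rewrite -powRM ?(ltW k0) ?(ltW R00) //; apply: powR_le.
  - by rewrite divr_ge0 // ltW.
  - exact: (qm_ge0 hX).
  - by apply: (diam x0) => //; [exact: xE.1.1|exact: yE.1.1].
have -> : R0 `^ s = R0 `^ (s / 2) * R0 `^ (Q / p).
  rewrite -powRD; last by apply/implyP => _; rewrite gt_eqF.
  by congr (_ `^ _); rewrite -alphaE; ring.
rewrite -/(N u) -/(V x0 R0); set W := V x0 R0 `^ p^-1.
have -> : C * k `^ (s / 2) * N u * (R0 `^ (s / 2) * R0 `^ (Q / p) / W) =
  C * N u * (k `^ (s / 2) * R0 `^ (s / 2)) * (R0 `^ (Q / p) / W) by ring.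
apply: ler_wpM2r; first by rewrite divr_ge0 ?powR_ge0.
by apply: ler_wpM2l => //; rewrite mulr_ge0 // ltW.
Qed.

Lemma embedding_hoelder (D : X -> X -> R) (c : R) : is_pmetric D -> 0 < c ->
  snowflake Omega rho D (s / 2) c ->
  exists (eps s p : R) (q : \bar R) (CH : R),
     [/\ [/\ 0 < eps, 0 < s, Q / eps < p & (0 < q)%E],
         eps < s, le_qm_index q s Omega rho, 0 < CH &
         forall (x0 : X) (R0 : R), Omega x0 -> 0 < R0 -> R0 <= 1 ->
         forall u : X -> R, dotN rho mu Omega s p q u ->
           let B0 := qball rho x0 R0 in
           exists v : X -> R,
             [/\ {ae mu, forall x, (B0 `&` Omega) x -> v x = u x},
                 hoelder_on rho (B0 `&` Omega) (s - Q / p) v &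
                 forall x y : X, (B0 `&` Omega) x -> (B0 `&` Omega) y ->
                   (`|v x - v y|%:E
                    <= (CH * rho x y `^ (s - Q / p)
                        * (R0 `^ (Q / p) / fine (mu B0) `^ p^-1))%:E
                       * dotN_norm rho mu Omega s p q u)%E]].
Proof.
move=> Dm c0 snow; exists (3 / 4 * s), s, p, +oo%E, (C * c ^+ 2); split=> //.
- split=> //; first by rewrite mulr_gt0.
  have -> : Q / (3 / 4 * s) = 2 / 3 * p by rewrite /p; field; rewrite gt_eqF.
  by rewrite gtr_pMl // ltr_pdivrMr // mul1r ltr_nat.
- by rewrite gtr_pMl // ltr_pdivrMr // mul1r ltr_nat.
- by rewrite mulr_gt0 // exprn_gt0.
move=> x0 R0 Ox R00 R01 u Nu B0; have [E [mE muE H]] := oscH Ox R00 R01 Nu.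
set W := R0 `^ (Q / p) / _ in H *; have W0 : 0 <= W by rewrite divr_ge0 ?powR_ge0.
rewrite -/(N u) alphaE in H *.
have CNW0 : 0 <= C * N u * W.
  by apply: mulr_ge0 => //; apply: mulr_ge0 => //; exact: ltW.
have lip x y : ((B0 `&` Omega) `\` E) x -> ((B0 `&` Omega) `\` E) y ->
    `|u x - u y| <= C * N u * c * W * D x y.
  move=> xE yE; apply: (le_trans (H x y xE yE)).
  have [_ h] := snow x y xE.1.2 yE.1.2.
  have -> : C * N u * rho x y `^ (s / 2) * W = C * N u * W * rho x y `^ (s / 2) by ring.
  have -> : C * N u * c * W * D x y = C * N u * W * (c * D x y) by ring.
  exact: ler_wpM2l.
have M0 : 0 <= C * N u * c * W.
  have -> : C * N u * c * W = C * N u * W * c by ring.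
  by rewrite mulr_ge0 // ltW.
have [v [vE vlip]] := mcshane Dm M0 lip.
have vest x y : (B0 `&` Omega) x -> (B0 `&` Omega) y ->
    `|v x - v y| <= C * c ^+ 2 * N u * W * rho x y `^ (s / 2).
  move=> [_ Ox1] [_ Oy1]; apply: (le_trans (vlip x y)).
  have [h _] := snow x y Ox1 Oy1.
  have -> : C * c ^+ 2 * N u * W * rho x y `^ (s / 2) =
     C * N u * c * W * (c * rho x y `^ (s / 2)) by ring.
  exact: ler_wpM2l.
exists v; split.
- exists E; split=> // x /= nvx; apply: contrapT => nEx; apply: nvx => Bx.
  by apply: vE.
- by exists (C * c ^+ 2 * N u * W) => x y Bx By; exact: vest.
move=> x y Bx By; rewrite -/(norm u) (normE Nu) -EFinM lee_fin.
apply: (le_trans (vest x y Bx By)); rewrite le_eqVlt; apply/orP; left; apply/eqP.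
by ring.
Qed.

Let pstarE : Q * p / (Q - s / 4 * p) = 2 * p.
Proof. by rewrite /p; field; rewrite ?gt_eqF // /p; have := hQ; have := s0; lra. Qed.

(** In the ball [u] stays within its oscillation of the value at a good point. *)
Lemma embedding_poincare : exists (eps s p : R) (q : \bar R) (CP : R),
     [/\ [/\ 0 < eps, 0 < s, 0 < p, p < Q / eps & (0 < q)%E],
         eps < s, le_qm_index q s Omega rho, 0 < CP &
         forall (x0 : X) (R0 : R), Omega x0 -> 0 < R0 -> R0 <= 1 ->
         forall u : X -> R, dotN rho mu Omega s p q u ->
           let B0 := qball rho x0 R0 in
           (ereal_inf (range (fun gamma : R =>
              Lp_norm mu (B0 `&` Omega) (Q * p / (Q - eps * p))
                (fun x => (u x - gamma)%R)))
            <= (CP * R0 `^ s / fine (mu B0) `^ (eps / Q))%:E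
               * dotN_norm rho mu Omega s p q u)%E].
Proof.
have [C1 C10 H] := osc_ball.
exists (s / 4), s, p, +oo%E, C1; split=> //.
- split=> //; first by rewrite divr_gt0.
  have -> : Q / (s / 4) = 2 * p by rewrite /p; field; rewrite gt_eqF.
  by rewrite ltr_pMl // ltr1n.
- by rewrite ltr_pdivrMr // ltr_pMr // ltr1n.
move=> x0 R0 Ox R00 R01 u Nu /=; set B0 := qball rho x0 R0.
have [E [mE muE {}H]] := H x0 R0 u Ox R00 R01 Nu.
have [x1 x1E] := outside_null Ox R00 R01 mE muE.
rewrite pstarE -/(norm u) (normE Nu) -EFinM -/(V x0 R0).
have V0 := V_gt0 x0 R00; set v := V x0 R0 in H V0 *.
apply: (@le_trans _ _ (Lp_norm mu (B0 `&` Omega) (2 * p) (fun x => (u x - u x1)%R))).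
  by apply: ereal_inf_lbound; exists (u x1).
apply: (@le_trans _ _ (C1 * N u * (R0 `^ s / v `^ p^-1) * v `^ (2 * p)^-1)%:E).
  apply: (@Lp_norm_le_ae _ E) => //.
  - by rewrite mulr_gt0.
  - by apply: mulr_ge0; [apply: mulr_ge0 => //; exact: ltW|rewrite divr_ge0 ?powR_ge0].
  - exact: ltW.
  - exact: mB.
  - apply: (@measurable_funB _ _ _ _ u (cst (u x1))) => //; case: Nu => mu_ _.
    exact: (measurable_funS hOmega (@subIsetr _ _ _) mu_).
  - exact: muB_le.
  - by move=> x xE; exact: H.
rewrite lee_fin le_eqVlt; apply/orP; left; apply/eqP.
have -> : s / 4 / Q = (2 * p)^-1 by rewrite /p; field; rewrite !gt_eqF.
have -> : v `^ p^-1 = v `^ (2 * p)^-1 * v `^ (2 * p)^-1.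
  rewrite -powRD; last by apply/implyP => _; rewrite gt_eqF.
  by congr (_ `^ _); field; rewrite gt_eqF.
by field; rewrite gt_eqF // powR_gt0.
Qed.

(** A function small in mean is small at some point of every large set. *)
Lemma small_value (x0 : X) (R0 : R) (u : X -> R) (L : R) (E : set X) :
  Omega x0 -> 0 < R0 -> R0 <= 1 -> measurable_fun Omega u -> measurable E ->
  mu E = 0%E -> 0 <= L -> (Lp_norm mu Omega p u < L%:E)%E ->
  exists2 x1, ((qball rho x0 R0 `&` Omega) `\` E) x1 &
    `|u x1| <= L / fine (mu (qball rho x0 R0 `&` Omega)) `^ p^-1.
Proof.
move=> Ox R00 R01 mu_ mE muE L0 ltL; set B := qball rho x0 R0 `&` Omega.
have B0 : 0 < fine (mu B).
  rewrite fine_gt0 // hOmega_pos //=; apply: le_lt_trans (muB_le x0 R00) _.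
  exact: ltry.
have finB : mu B \is a fin_num.
  by rewrite ge0_fin_numE //; apply: le_lt_trans (muB_le x0 R00) _; exact: ltry.
apply: contrapT => no_x.
have big x : (B `\` E) x -> (L / fine (mu B) `^ p^-1) `^ p <= `|u x| `^ p.
  move=> xBE; apply: powR_le; rewrite ?(ltW p0) ?divr_ge0 ?powR_ge0 //.
  by rewrite leNgt; apply/negP => lt; apply: no_x; exists x => //; exact: ltW.
rewrite powR_divl ?powR_ge0 // powRVK ?gt_eqF ?(ltW B0) // in big.
have mB' : measurable B by exact: mB.
have mBE : measurable (B `\` E) by apply: measurableD.
have mup : measurable_fun Omega (fun x => (`|u x| `^ p)%:E) by exact: measurable_normr_powR.
have muBE : mu (B `\` E) = mu B by apply: measureD_null => //; exact: le_lt_trans (muB_le x0 R00) (ltry _).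
have : ((L `^ p)%:E <= \int[mu]_(x in Omega) (`|u x| `^ p)%:E)%E.
  apply: (@le_trans _ _ (\int[mu]_(x in B `\` E) (`|u x| `^ p)%:E)%E); last first.
    by apply: ge0_subset_integral => //; move=> x [[]].
  apply: (@le_trans _ _ (\int[mu]_(x in B `\` E) (L `^ p / fine (mu B))%:E)%E).
    rewrite integral_cst // muBE -(fineK finB) -EFinM fineK // divfK ?gt_eqF //.
  apply: ge0_le_integral => //.
  - by move=> x _; rewrite lee_fin divr_ge0 ?powR_ge0 // ltW.
  - by apply: (measurable_funS hOmega _ mup) => x [[]].
rewrite -Lp_norm_powR // -poweR_EFin => h.
have := @poweR_le _ _ _ p^-1 ltac:(by rewrite invr_ge0 ltW) (poweR_ge0 _ _) h.
rewrite -!poweRrM mulfV ?gt_eqF // !poweRe1 ?Lp_norm_ge0 ?lee_fin //.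
by rewrite leNgt ltL.
Qed.

(** The oscillation is added to the value at a point where [u] is small; (a)
    turns the mass of the ball in the domain into the mass of the ball. *)
Lemma embedding_sobolev : measure_density rho mu Omega ->
  exists (eps s p : R) (q : \bar R) (CS : R),
     [/\ [/\ 0 < eps, 0 < s, 0 < p, p < Q / eps & (0 < q)%E],
         eps < s, le_qm_index q s Omega rho, 0 < CS &
         forall (x0 : X) (R0 : R), Omega x0 -> 0 < R0 -> R0 <= 1 ->
         forall u : X -> R, dotN rho mu Omega s p q u ->
           let B0 := qball rho x0 R0 in
           (Lp_norm mu (B0 `&` Omega) (Q * p / (Q - eps * p)) u
            <= (CS / fine (mu B0) `^ (eps / Q))%:E
               * ((R0 `^ s)%:E * dotN_norm rho mu Omega s p q u
                  + Lp_norm mu Omega p u))%E].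
Proof.
move=> [Cmu Cmu0 dens]; have [C1 C10 H] := osc_ball.
have K0 : 0 < Cmu `^ p^-1 by exact: powR_gt0.
exists (s / 4), s, p, +oo%E, (C1 + Cmu `^ p^-1); split=> //.
- split=> //; first by rewrite divr_gt0.
  have -> : Q / (s / 4) = 2 * p by rewrite /p; field; rewrite gt_eqF.
  by rewrite ltr_pMl // ltr1n.
- by rewrite ltr_pdivrMr // ltr_pMr // ltr1n.
- exact: addr_gt0.
move=> x0 R0 Ox R00 R01 u Nu /=; set B0 := qball rho x0 R0.
rewrite pstarE -/(norm u) (normE Nu) -EFinM -/(V x0 R0).
have V0 := V_gt0 x0 R00; set v := V x0 R0 in V0 *.
have -> : s / 4 / Q = (2 * p)^-1 by rewrite /p; field; rewrite !gt_eqF.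
set w := v `^ (2 * p)^-1; have w0 : 0 < w by exact: powR_gt0.
have vE : v `^ p^-1 = w * w.
  rewrite -powRD; last by apply/implyP => _; rewrite gt_eqF.
  by congr (_ `^ _); field; rewrite gt_eqF.
have A0 : 0 < C1 + Cmu `^ p^-1 by exact: addr_gt0.
have RN0 : 0 <= R0 `^ s * N u by rewrite mulr_ge0 // powR_ge0.
have mu_ : measurable_fun Omega u by case: Nu.
have main L : 0 <= L -> (Lp_norm mu Omega p u < L%:E)%E ->
    (Lp_norm mu (B0 `&` Omega) (2 * p) u <=
      ((C1 + Cmu `^ p^-1) / w * (R0 `^ s * N u + L))%:E)%E.
  move=> L0 ltL; have [E [mE muE HE]] := H x0 R0 u Ox R00 R01 Nu.
  have [x1 x1E ux1] := small_value Ox R00 R01 mu_ mE muE L0 ltL.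
  have b0 : 0 < fine (mu (B0 `&` Omega)).
    rewrite fine_gt0 // hOmega_pos //=; apply: le_lt_trans (muB_le x0 R00) _.
    exact: ltry.
  have le_b : v <= Cmu * fine (mu (B0 `&` Omega)).
    have := dens x0 R0 Ox R00 R01; rewrite -/B0 -(fineK (qm_ball_fin hX x0 R00)) -/(V x0 R0).
    rewrite -(@fineK _ (mu (B0 `&` Omega))) -?EFinM ?lee_fin //.
    by rewrite ge0_fin_numE //; apply: le_lt_trans (muB_le x0 R00) _; exact: ltry.
  have ux1' : `|u x1| <= L * Cmu `^ p^-1 / v `^ p^-1.
    apply: (le_trans ux1); rewrite -mulrA; apply: ler_wpM2l => //.
    rewrite ler_pdivlMr ?powR_gt0 // ler_pdivrMl ?powR_gt0 // -powRM ?(ltW b0) ?(ltW Cmu0) //.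
    apply: powR_le; [by rewrite invr_ge0 ltW|exact: ltW|by rewrite mulrC].
  apply: (@le_trans _ _ ((C1 * N u * (R0 `^ s / v `^ p^-1) + L * Cmu `^ p^-1 / v `^ p^-1) * v `^ (2 * p)^-1)%:E).
    apply: (@Lp_norm_le_ae _ E) => //.
    - by rewrite mulr_gt0.
    - apply: addr_ge0; last by rewrite divr_ge0 ?mulr_ge0 ?powR_ge0.
      by apply: mulr_ge0; [apply: mulr_ge0 => //; exact: ltW|rewrite divr_ge0 ?powR_ge0].
    - exact: ltW.
    - exact: mB.
    - exact: (measurable_funS hOmega (@subIsetr _ _ _) mu_).
    - exact: muB_le.
    - move=> x xE; have -> : u x = (u x - u x1) + u x1 by ring.
      by apply: (le_trans (ler_normD _ _)); apply: lerD => //; exact: HE.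
  rewrite lee_fin vE -/w; set k := Cmu `^ p^-1 in K0 *.
  set a := R0 `^ s; set n := N u.
  have -> : (C1 * n * (a / (w * w)) + L * k / (w * w)) * w = (C1 * (a * n) + k * L) / w.
    by field; rewrite gt_eqF.
  rewrite mulrAC ler_pM2r ?invr_gt0 // mulrDl mulrDr.
  have e1 : 0 <= C1 * L by rewrite mulr_ge0 // ltW.
  have e2 : 0 <= k * (a * n) by rewrite mulr_ge0 // ltW.
  rewrite mulrDr; move: e1 e2.
  move: (C1 * (a * n)) (k * L) (C1 * L) (k * (a * n)) => t1 t2 t3 t4 e1 e2.
  have -> : t1 + t3 + (t4 + t2) = (t1 + t2) + (t3 + t4) by ring.
  by rewrite lerDl addr_ge0.
have Lp0 := Lp_norm_ge0 mu Omega p u.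
case: (Lp_norm mu Omega p u) Lp0 main => [l| |//] l0 main; last first.
  by rewrite addey // gt0_muley ?leey // lte_fin divr_gt0.
rewrite -EFinD -EFinM; rewrite lee_fin in l0.
have fin : Lp_norm mu (B0 `&` Omega) (2 * p) u \is a fin_num.
  rewrite ge0_fin_numE ?Lp_norm_ge0 //.
  apply: (@le_lt_trans _ _ ((C1 + Cmu `^ p^-1) / w * (R0 `^ s * N u + (l + 1)))%:E).
    by apply: main; [rewrite addr_ge0|rewrite lte_fin ltrDl].
  exact: ltry.
rewrite -(fineK fin) lee_fin; apply: le_mul_addV; first by rewrite divr_ge0 // ltW.
move=> n; rewrite -lee_fin fineK // -addrA; apply: main; first by rewrite addr_ge0 // invr_ge0.
by rewrite lte_fin ltrDl.
Qed.

(** Dividing by the oscillation makes the integrand bounded. *)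
Lemma embedding_exponential : exists (c1 c2 omega : R) (q : \bar R) (eps s : R),
     [/\ [/\ 0 < c1, 0 < c2, 0 < omega & (0 < q)%E],
         [/\ 0 < eps, 0 < s & eps < s], le_qm_index q s Omega rho &
         forall (x0 : X) (R0 : R), Omega x0 -> 0 < R0 -> R0 <= 1 ->
         forall u : X -> R, dotN rho mu Omega s (Q / eps) q u ->
           (0 < dotN_norm rho mu Omega s (Q / eps) q u)%E ->
           let B0 := qball rho x0 R0 in
           mu.-integrable (B0 `&` Omega) (EFin \o u) /\
           (\int[mu]_(x in B0 `&` Omega)
              (expR ((c1 * (fine (mu B0) `^ (eps / Q)
                            * `|u x - mean mu (B0 `&` Omega) u|
                            / (R0 `^ s
                               * fine (dotN_norm rho mu Omega s (Q / eps) q u))))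
                     `^ omega))%:E
            <= c2%:E * mu B0)%E].
Proof.
have [C1 C10 H] := osc_ball.
exists C1^-1, (expR 1), 1, +oo%E, (s / 2), s; split=> //.
- by split=> //; rewrite ?invr_gt0 // expR_gt0.
- by split=> //; [rewrite divr_gt0|rewrite ltr_pdivrMr // ltr_pMr // ltr1n].
move=> x0 R0 Ox R00 R01 u.
have -> : Q / (s / 2) = p by rewrite /p; field; rewrite gt_eqF.
have -> : s / 2 / Q = p^-1 by rewrite /p; field; rewrite !gt_eqF.
move=> Nu; rewrite -/(norm u) (normE Nu) lte_fin => Nu0 /=.
set B0 := qball rho x0 R0; have mu_ : measurable_fun Omega u by case: Nu.
have mB0 : measurable (B0 `&` Omega) by exact: mB.
have muB : measurable_fun (B0 `&` Omega) u.
  exact: (measurable_funS hOmega (@subIsetr _ _ _) mu_).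
have [E [mE muE HE]] := H x0 R0 u Ox R00 R01 Nu.
have [x1 x1E] := outside_null Ox R00 R01 mE muE.
rewrite -/(V x0 R0); set v := V x0 R0 in HE *; have V0 : 0 < v by exact: V_gt0.
set O := C1 * N u * (R0 `^ s / v `^ p^-1) in HE.
have O0 : 0 <= O.
  by apply: mulr_ge0; [apply: mulr_ge0 => //; exact: ltW|rewrite divr_ge0 ?powR_ge0].
have finB : (mu (B0 `&` Omega) < +oo)%E by apply: le_lt_trans (muB_le x0 R00) _; exact: ltry.
set A := (B0 `&` Omega) `\` E in HE x1E.
have mA : measurable A by exact: measurableD.
have AB : A `<=` B0 `&` Omega by exact: subDsetl.
have muA : measurable_fun A u by exact: (measurable_funS mB0 AB muB).
have muAE : mu A = mu (B0 `&` Omega) by exact: measureD_null.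
have b0 : 0 < fine (mu (B0 `&` Omega)) by rewrite fine_gt0 // hOmega_pos.
have intA : mu.-integrable A (EFin \o u).
  apply: (measurable_bounded_integrable mA); rewrite ?muAE //.
  exists (O + `|u x1|); split; first exact: num_real.
  move=> t tO y Ay; apply: ltW; apply: le_lt_trans tO.
  have -> : u y = (u y - u x1) + u x1 by ring.
  by apply: (le_trans (ler_normD _ _)); rewrite lerD2r; exact: HE.
have intB : mu.-integrable (B0 `&` Omega) (EFin \o u).
  by apply/(negligible_integrable mE mB0 _ muE) => //; apply/measurable_EFinP.
split=> //.
have meanE : mean mu (B0 `&` Omega) u = (fine (mu A))^-1 * \int[mu]_(x in A) u x.
  rewrite /mean muAE; congr (_ * _); rewrite /Rintegral; congr fine.
  by apply: negligible_integral.
have mean_osc x : A x -> `|u x - mean mu (B0 `&` Omega) u| <= O.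
  move=> Ax; rewrite meanE muAE.
  have a0 : 0 < fine (mu A) by rewrite muAE.
  have const k : \int[mu]_(y in A) k = k * fine (mu A) by rewrite Rintegral_cst.
  have intk (k : R) : mu.-integrable A (EFin \o cst k).
    apply: (measurable_bounded_integrable mA); rewrite ?muAE //.
    by exists `|k|; split; [exact: num_real|move=> t kt y _; exact: ltW].
  have h1 : \int[mu]_(y in A) u y <= \int[mu]_(y in A) cst (u x + O) y.
    apply: le_Rintegral => // y Ay; have := HE x y Ax Ay.
    by rewrite ler_norml /cst => /andP[h _]; lra.
  have h2 : \int[mu]_(y in A) cst (u x - O) y <= \int[mu]_(y in A) u y.
    apply: le_Rintegral => // y Ay; have := HE x y Ax Ay.
    by rewrite ler_norml /cst => /andP[_ h]; lra.
  rewrite Rintegral_cst // in h1; rewrite Rintegral_cst // in h2.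
  rewrite ler_distlC; rewrite -muAE; apply/andP; split.
    by rewrite ler_pdivlMl // mulrC.
  by rewrite ler_pdivrMl // mulrC.
have mint : measurable_fun (B0 `&` Omega) (fun x => (expR ((C1^-1 *
    (v `^ p^-1 * `|u x - mean mu (B0 `&` Omega) u| / (R0 `^ s * N u))) `^ 1))%:E).
  apply/measurable_EFinP; apply: measurableT_comp => //.
  apply: (measurableT_comp (measurable_powR 1)).
  apply: measurable_funM => //; apply: measurable_funM => //.
  apply: measurable_funM => //; apply: measurableT_comp => //.
  exact: (@measurable_funB _ _ _ _ u (cst _)).
rewrite (ge0_negligible_integral mE) //.
apply: (@le_trans _ _ (\int[mu]_(x in A) (cst (expR 1)%:E) x)%E).
  apply: ge0_le_integral => //.
  - exact: (measurable_funS mB0 AB mint).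
  - move=> x Ax; rewrite lee_fin ler_expR powRr1; last first.
      by rewrite mulr_ge0 ?divr_ge0 ?mulr_ge0 ?powR_ge0 ?invr_ge0 ?normr_ge0 // ltW.
    rewrite ler_pdivrMl // mulr1 ler_pdivrMr ?mulr_gt0 ?powR_gt0 //.
    have vp0 : 0 < v `^ p^-1 by exact: powR_gt0.
    rewrite mulrC -ler_pdivlMr //; apply: (le_trans (mean_osc x Ax)).
    by rewrite /O le_eqVlt; apply/orP; left; apply/eqP; ring.
rewrite integral_cst // muAE lee_wpmul2l ?lee_fin ?expR_ge0 //.
by apply: le_measure; rewrite ?inE //; exact: mball.
Qed.
End Consequences.
End Embeddings.

(** * Cut-off functions *)

Section GeometricLq.
Context {R : realType}.

Lemma esum_int_geometric (w A : R) (k1 : int) (f : int -> \bar R) :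
  0 <= w -> w < 1 -> 0 <= A -> (forall k, 0 <= f k)%E ->
  (forall k, f k <= (A * w ^+ `|k - k1|%N)%:E)%E ->
  (\esum_(k in [set: int]) f k <= (A / (1 - w) + A / (1 - w))%:E)%E.
Proof.
move=> w0 w1 A0 f0 fle.
pose up (n : nat) : int := k1 + n%:Z; pose down (n : nat) : int := k1 - n.+1%:Z.
have seriesle (e : nat -> int) : injective e -> (forall n, (n <= `|e n - k1|)%N) ->
    (\esum_(k in [set e n | n in setT]) f k <= (A / (1 - w))%:E)%E.
  move=> inj absE.
  have -> : [set e n | n in setT] = [set e x | x in (fun x : nat => xpredT x)].
    by apply/seteqP; split=> _ [n _ <-]; exists n.
  rewrite (esum_pred_image f e xpredT) => [|n _|x y _ _]; [|exact: f0|exact: inj].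
  apply: nneseries_geometric_le => //.
  move=> n; apply: (le_trans (fle (e n))); rewrite lee_fin ler_wpM2l //.
  by apply: ler_wiXn2l => //; exact: ltW.
apply: (@le_trans _ _ (\esum_(k in [set up n | n in setT]) f k +
                       \esum_(k in [set down n | n in setT]) f k)%E).
  rewrite (esumID [set up n | n in setT]) // setTI; apply: leeD2l.
  rewrite (_ : [set: int] `&` _ = [set down n | n in setT]) // setTI.
  apply/seteqP; split=> [k nup|_ [n _ <-] [m _]]; last first.
    by rewrite /up /down => /addrI; rewrite -NegzE.
  have lt : k < k1.
    rewrite ltNge; apply/negP => le; apply: nup; exists `|k - k1|%N => //.
    by rewrite /up gez0_abs ?subr_ge0 // addrCA subrr addr0.
  exists `|k - k1|.-1%N => //; rewrite /down prednK; last by rewrite absz_gt0 subr_eq0 lt_eqF.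
  by rewrite ltz0_abs ?subr_lt0 // opprK addrCA subrr addr0.
rewrite EFinD; apply: leeD; apply: seriesle => n.
- by move=> m /addrI /eqP; rewrite eqz_nat => /eqP.
- by rewrite /up [k1 + _]addrC addrK.
- by move=> m /addrI /oppr_inj /eqP; rewrite eqz_nat eqSS => /eqP.
- by rewrite /down [k1 - _]addrC addrK abszN.
Qed.

(** For finite [q] the decay must be strict, which is where [s < beta] enters. *)
Lemma lq_norm_geometric (q : \bar R) (z : R) : (0 < q)%E -> 0 < z -> z <= 1 ->
  (q <> +oo%E -> z < 1) ->
  exists2 C, 0 < C & forall (a : int -> \bar R) A k1, 0 <= A ->
    (forall k, 0 <= a k)%E -> (forall k, a k <= (A * z ^+ `|k - k1|%N)%:E)%E ->
    (lq_norm q a <= (A * C)%:E)%E.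
Proof.
case: q => [r| |//] q0 z0 z1 zq; last first.
  exists 1 => // a A k1 A0 a0 aA; rewrite mulr1; apply: ge_ereal_sup => _ [k _ <-].
  by apply: (le_trans (aA k)); rewrite lee_fin ler_piMr // exprn_ile1 // ltW.
have {}zq : z < 1 by apply: zq.
rewrite lte_fin in q0.
have w1 : z `^ r < 1.
  apply: (@lt_le_trans _ _ (1 `^ r)); last by rewrite powR1.
  by apply: powR_lt => //; exact: ltW.
set K := (1 - z `^ r)^-1 + (1 - z `^ r)^-1.
have K0 : 0 < K by rewrite addr_gt0 // invr_gt0 subr_gt0.
exists (K `^ r^-1); first exact: powR_gt0.
move=> a A k1 A0 a0 aA; rewrite /lq_norm.
have le1 k : (a k `^ r <= (A `^ r * (z `^ r) ^+ `|k - k1|%N)%:E)%E.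
  apply: (le_trans (poweR_le (ltW q0) (a0 k) (aA k))).
  rewrite poweR_EFin powRM ?exprn_ge0 ?(ltW z0) // lee_fin.
  by rewrite -[z ^+ _]powR_mulrn ?(ltW z0) // powRAC powR_mulrn ?powR_ge0.
have := esum_int_geometric (powR_ge0 z r) w1 (powR_ge0 A r) (fun k => poweR_ge0 (a k) r) le1.
move=> h; have := @poweR_le _ _ _ r^-1 ltac:(by rewrite invr_ge0 ltW) _ h.
move=> /(_ (esum_ge0 (fun k _ => poweR_ge0 (a k) r))) {}h; apply: (le_trans h).
have -> : A `^ r / (1 - z `^ r) + A `^ r / (1 - z `^ r) = A `^ r * K by rewrite mulrDr.
rewrite poweR_EFin powRM ?powR_ge0 ?(ltW K0) // powRKV // gt_eqF //.
Qed.
End GeometricLq.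

Definition cutoff (R : realType) (X : Type) (D : X -> X -> R) (x : X) (a b : R) (y : X) : R :=
  Num.max 0 (Num.min 1 ((b - D x y) / (b - a))).

Section Cutoff.
Context {R : realType} {X : Type} {D : X -> X -> R}.
Hypothesis Dm : is_pmetric D.
Context (x : X) (a b : R).
Hypothesis ab : a < b.
Let u := cutoff D x a b.
Let L0 : 0 < b - a. Proof. by rewrite subr_gt0. Qed.

Lemma cutoff_ge0 y : 0 <= u y. Proof. by rewrite le_max lexx. Qed.

Lemma cutoff_le1 y : u y <= 1. Proof. by rewrite ge_max ler01 ge_min lexx. Qed.

Lemma cutoff_eq1 y : D x y <= a -> u y = 1.
Proof.
move=> h; have h1 : 1 <= (b - D x y) / (b - a) by rewrite ler_pdivlMr // mul1r lerD2l lerN2.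
by rewrite /u /cutoff (min_idPl h1) (max_idPr ler01).
Qed.

Lemma cutoff_eq0 y : b <= D x y -> u y = 0.
Proof.
move=> h; have h1 : (b - D x y) / (b - a) <= 0.
  by rewrite pmulr_lle0 ?invr_gt0 // subr_le0.
apply/eqP; rewrite eq_le cutoff_ge0 andbT ge_max lexx /= ge_min.
by rewrite h1 orbT.
Qed.

Lemma cutoff_lip y z : `|u y - u z| <= Num.min 1 (D y z / (b - a)).
Proof.
have le v w : u v - u w <= D v w / (b - a).
  rewrite lerBlDr /u /cutoff; set t := (b - D x w) / _; set r := D v w / _.
  have r0 : 0 <= r by rewrite divr_ge0 ?(pm_ge0 Dm) // ltW.
  have tr : (b - D x v) / (b - a) <= r + t.
    rewrite /r /t -mulrDl ler_pM2r ?invr_gt0 //.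
    by have := pm_tri Dm v x w; lra.
  rewrite ge_max addr_ge0 ?le_max ?lexx //=.
  have [t1|t1] := lerP t 1; last by rewrite (max_idPr ler01) ge_min lerDr r0.
  rewrite ge_min; apply/orP; right; apply: (le_trans tr).
  by rewrite lerD2l le_max lexx orbT.
have := le y z; have := le z y; rewrite (pm_sym Dm z y) => h1 h2.
rewrite le_min; apply/andP; split; rewrite ler_norml; last by lra.
have := cutoff_ge0 y; have := cutoff_ge0 z; have := cutoff_le1 y; have := cutoff_le1 z.
by rewrite -/u; lra.
Qed.
End Cutoff.

Section CutoffNorm.
Context {R : realType} {d : measure_display} {X : measurableType d}.
Context (rho : X -> X -> R) (mu : {measure set X -> \bar R}) (Y : set X).
Context (D : X -> X -> R) (beta c s p : R) (q : \bar R).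
Hypothesis rho_ge0 : forall x y, 0 <= rho x y.
Hypothesis mY : measurable Y.
Hypotheses (s0 : 0 < s) (p0 : 0 < p) (q0 : (0 < q)%E) (c0 : 0 < c).
Hypotheses (sb : s <= beta) (sbq : q <> +oo%E -> s < beta).
Hypothesis Dm : is_pmetric D.
Hypothesis snow : snowflake Y rho D beta c.
Hypothesis mD : forall x, Y x -> measurable_fun Y (D x).

Let beta0 : 0 < beta. Proof. exact: lt_le_trans sb. Qed.

Lemma measurable_set_dist x b : Y x -> measurable (Y `&` qball D x b).
Proof.
move=> Yx; have -> : Y `&` qball D x b = Y `&` D x @^-1` `]-oo, b[%classic.
  by apply/seteqP; split=> z [Yz]; rewrite /qball /= in_itv.
exact: mD.
Qed.

Lemma measurable_cutoff x a b : Y x -> measurable_fun Y (cutoff D x a b).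
Proof.
move=> Yx; apply: measurable_maxr => //; apply: measurable_minr => //.
apply: measurable_funM => //.
by apply: (@measurable_funB _ _ _ _ (cst b) (D x)) => //; exact: mD.
Qed.

Let coef (L : R) (k : int) : R := (2 ^ (k + 1)) `^ s * Num.min 1 (c * (2 ^ (- k)) `^ beta / L).

Let coef_ge0 L k : 0 < L -> 0 <= coef L k.
Proof.
move=> L0; rewrite mulr_ge0 ?powR_ge0 // le_min ler01 divr_ge0 ?mulr_ge0 ?powR_ge0 //.
  exact: ltW.
exact: ltW.
Qed.

Let min_exp := Num.min s (beta - s).
Let z : R := 2 `^ (- min_exp).

(* The coefficients peak at the scale of the transition layer of the cut-off. *)
Lemma coef_decay L : 0 < L -> exists k1 : int, forall k,
  coef L k <= 2 `^ (s + beta) * (c / L) `^ (s / beta) * z ^+ `|k - k1|%N.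
Proof.
move=> L0; have r0 : 0 < (L / c) `^ beta^-1 by rewrite powR_gt0 // divr_gt0.
have [k1 [h1 h2]] := dyadic_shell r0; exists k1 => k.
have e20 k' : 0 < 2 ^ k' :> R by exact: exprz_gt0.
have k1s : (2 ^ k1) `^ s <= (c / L) `^ (s / beta).
  have -> : s / beta = beta^-1 * s by rewrite mulrC.
  rewrite powRrM; apply: powR_le; rewrite ?(ltW s0) ?(ltW (e20 _)) //.
  have -> : c / L = (L / c)^-1 by rewrite invf_div.
  rewrite powR_invl ?divr_ge0 ?(ltW L0) ?(ltW c0) // -[leLHS]invrK lef_pV2 ?posrE ?invr_gt0 //.
  by rewrite invr_expz; exact: ltW.
have cL : c / L <= (2 ^ (k1 + 1)) `^ beta.
  have -> : c / L = (L / c)^-1 by rewrite invf_div.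
  rewrite -[leRHS]invrK lef_pV2 ?posrE ?divr_gt0 ?invr_gt0 ?powR_gt0 //.
  rewrite -powR_invl ?(ltW (e20 _)) // invr_expz opprD.
  rewrite -[leRHS](@powRVK _ _ beta) ?divr_ge0 ?(ltW L0) ?(ltW c0) ?gt_eqF //.
  by apply: powR_le; rewrite ?(ltW beta0) ?(ltW (e20 _)).
have zn n : z ^+ n = 2 `^ (- (min_exp * n%:R)).
  by rewrite /z -powR_mulrn ?powR_ge0 // -powRrM mulNr.
have nat_pow (n : nat) t : (2 ^ n%:Z) `^ t = 2 `^ (t * n%:R) :> R.
  by rewrite -powR_intmul // -powRrM mulrC.
have two_le (t t' : R) : t <= t' -> 2 `^ t <= 2 `^ t' by move=> h; apply: ler_powR => //; rewrite ler1n.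
rewrite /coef zn; set B := (c / L) `^ (s / beta) in k1s *.
have [kk1|k1k] := lerP k k1.
  set n := `|k - k1|%N; have kE : k = k1 - n%:Z.
    by rewrite /n lez0_abs ?subr_le0 // opprK addrCA subrr addr0.
  apply: (@le_trans _ _ ((2 ^ (k + 1)) `^ s)).
    by rewrite ler_piMr ?powR_ge0 // ge_min lexx.
  rewrite kE -addrA [- _ + 1]addrC addrA !expfzDr // expr1z.
  rewrite !powRM ?mulr_ge0 ?(ltW (e20 _)) // -invr_expz powR_invl ?(ltW (e20 _)) // nat_pow -powRN.
  rewrite powRD; last by rewrite pnatr_eq0 implybT.
  set A := (2 ^ k1) `^ s in k1s *.
  have -> : A * 2 `^ s * 2 `^ (- (s * n%:R)) = 2 `^ s * A * 2 `^ (- (s * n%:R)) by ring.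
  have one_le : 1 <= 2 `^ beta :> R by apply: (@le_trans _ _ (2 `^ 0)); [rewrite powRr0|apply: two_le; exact: ltW].
  apply: ler_pM; rewrite ?mulr_ge0 ?powR_ge0 //.
    apply: ler_pM; rewrite ?powR_ge0 //; first by rewrite ler_peMr ?powR_ge0.
  by apply: two_le; rewrite lerN2 ler_wpM2r // ge_min lexx.
set n := `|k - k1|%N; have kE : k = k1 + n%:Z.
  by rewrite /n gez0_abs ?subr_ge0 ?(ltW k1k) // addrCA subrr addr0.
apply: (@le_trans _ _ ((2 ^ (k + 1)) `^ s * (c * (2 ^ (- k)) `^ beta / L))).
  by rewrite ler_wpM2l ?powR_ge0 // ge_min lexx orbT.
have -> : c * (2 ^ (- k)) `^ beta / L = c / L * (2 ^ (- k)) `^ beta by ring.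
apply: (@le_trans _ _ ((2 ^ (k + 1)) `^ s * ((2 ^ (k1 + 1)) `^ beta * (2 ^ (- k)) `^ beta))).
  by rewrite ler_wpM2l ?powR_ge0 // ler_wpM2r ?powR_ge0.
rewrite -(@powRM _ (2 ^ (k1 + 1))) ?(ltW (e20 _)) // -expfzDr //.
have -> : k1 + 1 + - k = 1 - n%:Z by rewrite kE; ring.
rewrite kE -addrA [n%:Z + 1]addrC addrA !expfzDr // expr1z.
rewrite !powRM ?mulr_ge0 ?(ltW (e20 _)) // -invr_expz powR_invl ?(ltW (e20 _)) // !nat_pow -powRN.
rewrite powRD; last by rewrite pnatr_eq0 implybT.
set A := (2 ^ k1) `^ s in k1s *.
have -> : A * 2 `^ s * 2 `^ (s * n%:R) * (2 `^ beta * 2 `^ (- (beta * n%:R))) =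
   2 `^ s * 2 `^ beta * A * (2 `^ (s * n%:R) * 2 `^ (- (beta * n%:R))) by ring.
rewrite -(powRD (x := 2) (r := s * n%:R)); last by rewrite pnatr_eq0 implybT.
apply: ler_pM; rewrite ?mulr_ge0 ?powR_ge0 //.
  by rewrite ler_wpM2l ?mulr_ge0 ?powR_ge0.
apply: two_le; rewrite -mulrBl -mulNr ler_wpM2r //.
by rewrite lerNr opprB ge_min lexx orbT.
Qed.

(** The gradient at scale [2^-k] is supported in the outer ball and its size is
    the oscillation of the cut-off at that scale. *)
Lemma cutoff_norm : exists2 C, 0 < C & forall x a b m, Y x -> a < b -> 0 <= m ->
  (mu (Y `&` qball D x b) <= m%:E)%E ->
  (dotN_norm rho mu Y s p q (cutoff D x a b) <=
    (C * (b - a) `^ (- (s / beta)) * m `^ p^-1)%:E)%E.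
Proof.
have me0 : 0 <= min_exp by rewrite le_min (ltW s0) subr_ge0.
have z0 : 0 < z by rewrite powR_gt0.
have z1 : z <= 1.
  by rewrite /z powRN invf_le1 ?powR_gt0 // -[leLHS](powRr0 2) ler_powR // ler1n.
have z1q : q <> +oo%E -> z < 1.
  move=> /sbq lt_sb; have me : 0 < min_exp by rewrite lt_min s0 subr_gt0.
  rewrite /z powRN invf_lt1 ?powR_gt0 // -[ltLHS](powRr0 2) /powR pnatr_eq0 ltr_expR mul0r.
  by rewrite mulr_gt0 // ln_gt0 // ltr1n.
have [Cq Cq0 Hq] := lq_norm_geometric q0 z0 z1 z1q.
exists (2 `^ (s + beta) * c `^ (s / beta) * Cq); first by rewrite !mulr_gt0 ?powR_gt0.
move=> x a b m Yx ab m0 mum; set L := b - a; have L0 : 0 < L by rewrite subr_gt0.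
set u := cutoff D x a b; set A := Y `&` qball D x b.
have mA : measurable A by exact: measurable_set_dist.
pose g (k : int) y := coef L k * \1_A y.
have g0 k y : 0 <= g k y by rewrite mulr_ge0 ?coef_ge0.
have gfrac : fractional_gradient rho mu Y s u g.
  split; [move=> k|by move=> k y _; exact: g0|].
    by apply: measurable_funM => //; exact: measurable_indic.
  exists set0; split=> // k y w [Yy _] [Yw _] k1 k2.
  have e20 k' : 0 < 2 ^ k' :> R by exact: exprz_gt0.
  have minle : `|u y - u w| <= Num.min 1 (c * (2 ^ (- k)) `^ beta / L).
    apply: (le_trans (cutoff_lip Dm x ab y w)); rewrite le_min ge_min lexx /=.
    rewrite ge_min; apply/orP; right; rewrite ler_pM2r ?invr_gt0 //.
    apply: (le_trans (proj1 (snow Yy Yw))); rewrite ler_pM2l //.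
    by apply: powR_le; rewrite ?(ltW beta0) // ltW.
  have main : `|u y - u w| <= rho y w `^ s * coef L k.
    apply: (le_trans minle); rewrite mulrA ler_peMl //.
      by rewrite le_min ler01 divr_ge0 ?mulr_ge0 ?powR_ge0 // ltW.
    rewrite -powRM // ?(ltW (e20 _)) //; apply: (@le_trans _ _ (1 `^ s)); first by rewrite powR1.
    apply: powR_le; rewrite ?(ltW s0) //.
    apply: (@le_trans _ _ (2 ^ (- k - 1) * 2 ^ (k + 1))).
      by rewrite -expfzDr // -opprD addNr expr0z.
    by rewrite ler_wpM2r // ltW.
  have ind1 v : A v -> \1_A v = 1 :> R by move=> Av; rewrite indicE mem_set.
  have out v : Y v -> ~ A v -> u v = 0.
    move=> Yv nAv; apply: cutoff_eq0 => //; rewrite leNgt; apply/negP => lt.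
    by apply: nAv.
  have cL0 : 0 <= coef L k by exact: coef_ge0.
  have [Ay|nAy] := pselect (A y).
    apply: (le_trans main); rewrite ler_wpM2l ?powR_ge0 // /g ind1 // mulr1.
    by rewrite lerDl; exact: g0.
  have [Aw|nAw] := pselect (A w).
    apply: (le_trans main); rewrite ler_wpM2l ?powR_ge0 // /g (ind1 w) // mulr1.
    by rewrite lerDr; exact: g0.
  rewrite !out // subrr normr0 mulr_ge0 ?powR_ge0 //.
  by rewrite addr_ge0 //; exact: g0.
apply: (@le_trans _ _ (lq_norm q (fun k => Lp_norm mu Y p (g k)))).
  by apply: ereal_inf_lbound; exists g.
have [k1 decay] := coef_decay L0.
have -> : 2 `^ (s + beta) * c `^ (s / beta) * Cq * L `^ (- (s / beta)) * m `^ p^-1 =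
   (2 `^ (s + beta) * (c / L) `^ (s / beta) * m `^ p^-1) * Cq.
  by rewrite powR_divl ?(ltW c0) ?(ltW L0) // powRN; ring.
apply: (Hq _ _ k1).
- by rewrite !mulr_ge0 ?powR_ge0.
- by move=> k; exact: Lp_norm_ge0.
move=> k; apply: (@le_trans _ _ (coef L k * m `^ p^-1)%:E); last first.
  rewrite lee_fin [leRHS]mulrAC; apply: ler_wpM2r; [exact: powR_ge0|exact: decay].
have cm0 : 0 <= coef L k * m `^ p^-1 by apply: mulr_ge0; [exact: coef_ge0|exact: powR_ge0].
rewrite (Lp_norm_le _ _ _ p0 cm0).
have -> : (\int[mu]_(y in Y) (`|g k y| `^ p)%:E =
   (coef L k `^ p)%:E * \int[mu]_(y in Y) (\1_A y)%:E)%E.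
  rewrite -ge0_integralZl_EFin ?powR_ge0 //; last first.
    by apply/measurable_EFinP; exact: measurable_indic.
  apply: eq_integral => y _; rewrite ger0_norm ?g0 // /g powRM ?coef_ge0 // EFinM.
  congr (_ * _)%E; rewrite indicE; case: (_ \in _); first by rewrite powR1.
  by rewrite powR0 // gt_eqF.
rewrite integral_indic // setIC -/A (_ : Y `&` A = A); last by rewrite /A setIA setIid.
rewrite powRM ?coef_ge0 ?powR_ge0 // powRVK ?gt_eqF // EFinM.
by rewrite lee_wpmul2l ?lee_fin ?powR_ge0.
Qed.
End CutoffNorm.

(** * From separation of concentric sets to the measure density property *)

(** Superlinear recursive bounds force decay from small initial values. *)
Lemma de_giorgi (R : realType) (K B sigma : R) : 0 < K -> 1 < B -> 0 < sigma ->
  exists2 delta, 0 < delta & forall (a : nat -> R) (m : R), 0 < m ->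
    (forall j, m <= a j) -> (forall j, a j.+1 <= K * B ^+ j * a j `^ (1 + sigma)) ->
    delta <= a 0%N.
Proof.
move=> K0 B1 s0; have B0 : 0 < B by exact: lt_trans B1.
set gamma := B `^ (- sigma^-1); have g0 : 0 < gamma by exact: powR_gt0.
have gs : gamma `^ sigma = B^-1.
  by rewrite /gamma -powRrM mulNr mulVf ?gt_eqF // powR_inv1 // ltW.
have g1 : gamma < 1.
  rewrite /gamma powRN invf_lt1 ?powR_gt0 //.
  apply: (@le_lt_trans _ _ (1 `^ sigma^-1)); first by rewrite powR1.
  by apply: powR_lt; rewrite ?invr_gt0.
set delta := (gamma / K) `^ sigma^-1.
have d0 : 0 < delta by rewrite powR_gt0 // divr_gt0.
have ds : delta `^ sigma = gamma / K.
  by apply: powRVK; [rewrite divr_ge0 // ltW|rewrite gt_eqF].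
exists delta => // a m m0 ma rec; rewrite leNgt; apply/negP => lt_a0.
have decay j : a j <= delta * gamma ^+ j.
  elim: j => [|j IH]; first by rewrite mulr1 ltW.
  have aj0 : 0 <= a j by apply: le_trans (ma j); exact: ltW.
  apply: (le_trans (rec j)).
  apply: (@le_trans _ _ (K * B ^+ j * (delta * gamma ^+ j) `^ (1 + sigma))).
    rewrite ler_wpM2l ?mulr_ge0 ?exprn_ge0 ?(ltW B0) ?(ltW K0) //.
    by apply: powR_le; rewrite ?addr_ge0 // ltW.
  have dg0 : 0 <= delta * gamma ^+ j by rewrite mulr_ge0 ?exprn_ge0 // ltW.
  rewrite powRD; last by apply/implyP => _; rewrite gt_eqF // mulr_gt0 // exprn_gt0.
  rewrite (powRr1 dg0) [(delta * _) `^ sigma]powRM ?exprn_ge0 ?(ltW d0) ?(ltW g0) // ds.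
  have gj : (gamma ^+ j) `^ sigma = B^-1 ^+ j.
    by rewrite -powR_mulrn ?(ltW g0) // powRAC gs powR_mulrn // invr_ge0 ltW.
  rewrite gj exprVn exprS le_eqVlt; apply/orP; left; apply/eqP; field.
  by rewrite !gt_eqF // exprn_gt0.
have [N _ gN] : exists2 N : nat, True & delta * gamma ^+ N < m.
  have V1 : 1 < gamma^-1 by rewrite invf_gt1.
  have z1 : 1 < 1 + delta / m by rewrite ltrDl divr_gt0.
  have [N [_ h]] := geometric_bracket V1 z1; exists N.+1 => //.
  have : delta / m < gamma^-1 ^+ N.+1 by apply: lt_le_trans h; rewrite ltrDr.
  by rewrite exprVn ltr_pdivrMr // ltr_pdivlMl ?exprn_gt0 // mulrC.
by have := le_lt_trans (le_trans (ma N) (decay N)) gN; rewrite ltxx.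
Qed.

(** What all embeddings have in common when applied to cut-offs.  The exponent
    [1 + sigma], larger than 1, is their gain of integrability. *)
Definition separation (R : realType) (d : measure_display) (X : measurableType d)
    (rho : X -> X -> R) (mu : {measure set X -> \bar R}) (Omega : set X)
    (D : X -> X -> R) (beta : R) : Prop :=
  exists K A sigma, [/\ 0 < K, 0 < A, 0 < sigma & forall x R0 a b,
    Omega x -> 0 < R0 -> R0 <= 1 -> 0 < a -> a < b -> b <= R0 `^ beta ->
    let B0 := qball rho x R0 in let V := fine (mu B0) in
    (Order.min (mu ((B0 `&` Omega) `&` [set y | (D x y <= a)%R]))
               (mu ((B0 `&` Omega) `&` [set y | (b <= D x y)%R])) <=
     (K * V * (R0 `^ beta / (b - a)) `^ A *
       (fine (mu (Omega `&` qball D x b)) / V) `^ (1 + sigma))%:E)%E].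

Section Density.
Context {R : realType} {d : measure_display} {X : measurableType d}.
Context (rho : X -> X -> R) (mu : {measure set X -> \bar R}) (Q : R) (Omega : set X).
Hypothesis hX : quasi_metric_measure_space rho mu.
Hypothesis hQ : 0 < Q.
Hypothesis hdoubling : doubling rho mu Q.
Hypothesis hOmega : measurable Omega.
Hypothesis hOmega_perfect : locally_uniformly_perfect rho Omega.
Hypothesis hOmega_two : exists x y : X, [/\ Omega x, Omega y & x <> y].
Hypothesis hOmega_pos : forall (x : X) (r : R), Omega x -> 0 < r -> r <= 1 ->
       (0 < mu (qball rho x r `&` Omega))%E.
Context (D : X -> X -> R) (beta c : R).
Hypotheses (beta0 : 0 < beta) (c1 : 1 <= c) (Dm : is_pmetric D).
Hypothesis snow : snowflake Omega rho D beta c.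
Hypothesis mD : forall x, Omega x -> measurable_fun Omega (D x).

Let c0 : 0 < c. Proof. exact: lt_le_trans c1. Qed.
Let rho_ge0 := qm_ge0 hX.
Let mball x r : measurable (qball rho x r). Proof. exact: (qm_measurable_ball hX). Qed.
Let mOD x b : Omega x -> measurable (Omega `&` qball D x b).
Proof. exact: measurable_set_dist. Qed.

Lemma dist_ball_sub x r t : Omega x -> 0 < t -> c * r <= t `^ beta ->
  Omega `&` qball D x r `<=` qball rho x t `&` Omega.
Proof.
move=> Ox t0 le_t y [Oy xy]; split=> //; rewrite /qball /=.
rewrite -[t](powRKV (ltW t0) (lt0r_neq0 beta0)); apply: powR_lt_inv => //.
  exact: powR_ge0.
by apply: (le_lt_trans (proj2 (snow Ox Oy))); apply: lt_le_trans le_t; rewrite ltr_pM2l.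
Qed.

(** Applied to the radii [eta R0^beta (1/2 + 2^-(j+1))], the separation bounds the
    mass of each ball superlinearly by that of the previous one, as long as the
    complement is heavier.  A ball too light would force the masses to tend to 0,
    although the ball of half the radius has positive mass. *)
Lemma lighter_ball_density eta : separation rho mu Omega D beta -> 0 < eta -> eta <= 1 ->
  c * eta <= 1 ->
  exists2 delta, 0 < delta & forall x R0, Omega x -> 0 < R0 -> R0 <= 1 ->
    (mu (Omega `&` qball D x (eta * R0 `^ beta)) <=
     mu ((qball rho x R0 `&` Omega) `\` qball D x (eta * R0 `^ beta)))%E ->
    delta * fine (mu (qball rho x R0)) <=
      fine (mu (Omega `&` qball D x (eta * R0 `^ beta))).
Proof.
move=> [K [A [sigma [K0 A0 sg0 H]]]] eta0 eta1 ceta.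
have K'0 : 0 < K * (4 / eta) `^ A by rewrite mulr_gt0 // powR_gt0 // divr_gt0.
have B1 : 1 < 2 `^ A :> R.
  apply: (@le_lt_trans _ _ (1 `^ A)); first by rewrite powR1.
  by apply: powR_lt => //; rewrite ltr1n.
have [delta d0 dg] := de_giorgi K'0 B1 sg0.
exists delta => // x R0 Ox R00 R01 lighter.
set T := R0 `^ beta; have T0 : 0 < T by exact: powR_gt0.
set V := fine (mu (qball rho x R0)).
have V0 : 0 < V by exact: (qm_ball_gt0 hX).
pose rad (j : nat) : R := eta * T * (2^-1 + 2^-1 ^+ j.+1).
have h0 j : 0 < 2^-1 ^+ j :> R by rewrite exprn_gt0 // invr_gt0.
have h1 j : 2^-1 ^+ j <= 1 :> R by rewrite exprn_ile1 // ?invr_ge0 // invf_le1 // ler1n.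
have eT0 : 0 < eta * T by rewrite mulr_gt0.
have rad0 j : 0 < rad j by rewrite mulr_gt0 // addr_gt0 ?invr_gt0.
have rad_le j : rad j <= eta * T.
  rewrite /rad ler_piMr ?(ltW eT0) // exprS.
  apply: (@le_trans _ _ (2^-1 + 2^-1 * 1)); first by rewrite lerD2l ler_pM2l ?invr_gt0.
  by rewrite le_eqVlt; apply/orP; left; apply/eqP; field.
have rad_diff j : rad j - rad j.+1 = eta * T * 2^-1 ^+ j.+2.
  by rewrite /rad [2^-1 ^+ j.+2]exprS; field.
have rad_lt j : rad j.+1 < rad j by rewrite -subr_gt0 rad_diff mulr_gt0.
have radS j : rad j <= T.
  by apply: (le_trans (rad_le j)); rewrite ler_piMl // ltW.
pose M j := Omega `&` qball D x (rad j).
have MB j : M j `<=` qball rho x R0 `&` Omega.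
  move=> y [Oy xy]; apply: (dist_ball_sub (r := eta * T)) => //.
    by rewrite -/T mulrA ler_piMl // ltW.
  by split=> //; apply: lt_le_trans (rad_le j).
have mM j : measurable (M j) by exact: mOD.
have Mfin j : mu (M j) \is a fin_num.
  rewrite ge0_fin_numE //; apply: (@le_lt_trans _ _ (mu (qball rho x R0))).
    by apply: le_measure; rewrite ?inE // => y /MB[].
  by have := qm_ball_fin hX x R00; rewrite ge0_fin_numE.
have rad0E : rad 0%N = eta * T by rewrite /rad expr1; field.
have finH : mu (Omega `&` qball D x (eta * T * 2^-1)) \is a fin_num.
  rewrite ge0_fin_numE //; apply: (@le_lt_trans _ _ (mu (M 0%N))).
    apply: le_measure; rewrite ?inE //; first exact: mOD.
    move=> y [Oy xy]; split=> //; rewrite rad0E; apply: (lt_le_trans xy).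
    by rewrite ler_piMr ?(ltW eT0) // invf_le1 // ler1n.
  by have := Mfin 0%N; rewrite ge0_fin_numE.
have := dg (fun j => fine (mu (M j)) / V)
  (fine (mu (Omega `&` qball D x (eta * T * 2^-1))) / V).
rewrite ler_pdivlMr // /M rad0E; apply.
- apply: divr_gt0 => //; rewrite fine_gt0 //; apply/andP; split.
    pose t := Num.min 1 ((eta * T * 2^-1 / c) `^ beta^-1).
    have t0 : 0 < t by rewrite lt_min ltr01 powR_gt0 // divr_gt0 // mulr_gt0 // invr_gt0.
    apply: (lt_le_trans (hOmega_pos Ox t0 _)); first by rewrite ge_min lexx.
    apply: le_measure; rewrite ?inE //; [exact: measurableI|exact: mOD|].
    move=> y [xy Oy]; split=> //; apply: (le_lt_trans (proj1 (snow Ox Oy))).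
    rewrite mulrC -ltr_pdivlMr //; apply: lt_powR_inv => //.
      by rewrite divr_ge0 ?mulr_ge0 ?invr_ge0 // ltW.
    by apply: (lt_le_trans xy); rewrite ge_min lexx orbT.
  by have := finH; rewrite ge0_fin_numE.
- move=> j; rewrite ler_pM2r ?invr_gt0 //; apply: fine_le; [exact: finH|exact: Mfin|].
  apply: le_measure; rewrite ?inE //; [exact: mOD|exact: mOD|].
  move=> y [Oy xy]; split=> //; apply: (lt_le_trans xy).
  by rewrite /rad ler_pM2l // lerDl ltW.
move=> j; have := H x R0 (rad j.+1) (rad j) Ox R00 R01 (rad0 _) (rad_lt j) (radS j).
rewrite /= -/V -/T -/(M j) => h.
have sub1 : M j.+1 `<=` (qball rho x R0 `&` Omega) `&` [set y | (D x y <= rad j.+1)%R].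
  by move=> y My; split; [exact: MB My|case: My => _ /ltW].
have mle : measurable ((qball rho x R0 `&` Omega) `&` [set y | (D x y <= rad j.+1)%R]).
  have -> : (qball rho x R0 `&` Omega) `&` [set y | (D x y <= rad j.+1)%R] =
     qball rho x R0 `&` (Omega `&` D x @^-1` `]-oo, (rad j.+1)]%classic).
    by rewrite -setIA; congr (_ `&` _); apply/seteqP; split=> z [Oz]; rewrite /= in_itv.
  by apply: measurableI => //; exact: mD.
have mge : measurable ((qball rho x R0 `&` Omega) `&` [set y | (rad j <= D x y)%R]).
  have -> : (qball rho x R0 `&` Omega) `&` [set y | (rad j <= D x y)%R] =
     qball rho x R0 `&` (Omega `&` D x @^-1` `[(rad j), +oo[%classic).
    by rewrite -setIA; congr (_ `&` _); apply/seteqP; split=> z [Oz]; rewrite /= in_itv /= andbT.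
  by apply: measurableI => //; exact: mD.
have sub0 : (qball rho x R0 `&` Omega) `\` qball D x (eta * T) `<=`
    (qball rho x R0 `&` Omega) `&` [set y | (rad j <= D x y)%R].
  move=> y [By nxy]; split=> //=; apply: (le_trans (rad_le j)).
  by rewrite leNgt; apply/negP.
have mdiff : measurable ((qball rho x R0 `&` Omega) `\` qball D x (eta * T)).
  have -> : (qball rho x R0 `&` Omega) `\` qball D x (eta * T) =
     (qball rho x R0 `&` Omega) `\` (Omega `&` qball D x (eta * T)).
    apply/seteqP; split=> z [[Bz Oz] h']; split=> // h2; apply: h' => //.
    by case: h2.
  by apply: measurableD; [exact: measurableI|exact: mOD].
have le_min : (mu (M j.+1) <= (K * V * (T / (rad j - rad j.+1)) `^ A *
       (fine (mu (M j)) / V) `^ (1 + sigma))%:E)%E.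
  apply: le_trans h; rewrite le_min; apply/andP; split.
    by apply: le_measure; rewrite ?inE.
  apply: (@le_trans _ _ (mu (Omega `&` qball D x (eta * T)))).
    apply: le_measure; rewrite ?inE //; first exact: mOD.
    by move=> y [Oy xy]; split=> //; apply: lt_le_trans (rad_le j.+1).
  apply: (le_trans lighter); apply: le_measure; rewrite ?inE //.
rewrite -(fineK (Mfin j.+1)) lee_fin in le_min.
rewrite ler_pdivrMr // -/(M j.+1) -/(M j); apply: (le_trans le_min).
rewrite rad_diff; have -> : T / (eta * T * 2^-1 ^+ j.+2) = 4 / eta * 2 ^+ j.
  by rewrite !exprS exprVn; field; rewrite !gt_eqF // exprn_gt0.
rewrite powRM ?divr_ge0 ?exprn_ge0 ?(ltW eta0) //.
have -> : (2 ^+ j) `^ A = (2 `^ A) ^+ j by rewrite -powR_mulrn // powRAC powR_mulrn ?powR_ge0.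
by rewrite le_eqVlt; apply/orP; left; apply/eqP; ring.
Qed.
End Density.

Section DensityOfSeparation.
Context {R : realType} {d : measure_display} {X : measurableType d}.
Context (rho : X -> X -> R) (mu : {measure set X -> \bar R}) (Q : R) (Omega : set X).
Hypothesis hX : quasi_metric_measure_space rho mu.
Hypothesis hQ : 0 < Q.
Hypothesis hdoubling : doubling rho mu Q.
Hypothesis hOmega : measurable Omega.
Hypothesis hOmega_perfect : locally_uniformly_perfect rho Omega.
Hypothesis hOmega_two : exists x y : X, [/\ Omega x, Omega y & x <> y].
Hypothesis hOmega_pos : forall (x : X) (r : R), Omega x -> 0 < r -> r <= 1 ->
       (0 < mu (qball rho x r `&` Omega))%E.
Context (D : X -> X -> R) (beta c : R).
Hypotheses (beta0 : 0 < beta) (c1 : 1 <= c) (Dm : is_pmetric D).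
Hypothesis snow : snowflake Omega rho D beta c.
Hypothesis mD : forall x, Omega x -> measurable_fun Omega (D x).

Let c0 : 0 < c. Proof. exact: lt_le_trans c1. Qed.
Let rho_ge0 := qm_ge0 hX.
Let mball x r : measurable (qball rho x r). Proof. exact: (qm_measurable_ball hX). Qed.
Let mOD x b : Omega x -> measurable (Omega `&` qball D x b).
Proof. exact: measurable_set_dist. Qed.

(** Radii between [r0] and 1 are reduced to [r0] by doubling. *)
Lemma density_small_radii (r0 : R) : 0 < r0 -> r0 <= 1 ->
  (exists2 C, 0 < C & forall x r, Omega x -> 0 < r -> r <= r0 ->
     (mu (qball rho x r) <= C%:E * mu (qball rho x r `&` Omega))%E) ->
  measure_density rho mu Omega.
Proof.
move=> r00 r01 [C C0 H]; have [k k0 Hk] := hdoubling.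
set K := (k * (r0 / 1) `^ Q)^-1.
have kr0 : 0 < k * (r0 / 1) `^ Q by rewrite mulr_gt0 // powR_gt0 // divr_gt0.
have K0 : 0 < K by rewrite invr_gt0.
exists (C + K * C); first by rewrite addr_gt0 // mulr_gt0.
move=> x r Ox r_gt0 r1; have [le_r|lt_r] := lerP r r0.
  apply: (le_trans (H x r Ox r_gt0 le_r)); apply: lee_wpmul2r => //.
  by rewrite lee_fin lerDl mulr_ge0 // ltW.
have sub : qball rho x r0 `<=` qball rho x 1 by move=> y /lt_le_trans; apply.
have := Hk x x r0 1 r00 r01 sub; rewrite ler_pdivlMr ?(qm_ball_gt0 hX) // => h.
have h1 : (mu (qball rho x r) <= K%:E * mu (qball rho x r0))%E.
  apply: (@le_trans _ _ (mu (qball rho x 1))).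
    by apply: le_measure; rewrite ?inE // => y /lt_le_trans; apply.
  rewrite -(fineK (qm_ball_fin hX x r00)) -(fineK (qm_ball_fin hX x (@ltr01 R))).
  by rewrite -EFinM lee_fin /K ler_pdivlMl.
apply: (le_trans h1); apply: (@le_trans _ _ (K%:E * (C%:E * mu (qball rho x r0 `&` Omega)))%E).
  by rewrite lee_wpmul2l ?lee_fin ?(ltW K0) // H.
rewrite muleA -EFinM; apply: (@le_trans _ _ ((K * C)%:E * mu (qball rho x r `&` Omega))%E).
  rewrite lee_wpmul2l ?lee_fin ?mulr_ge0 ?(ltW K0) ?(ltW C0) //.
  apply: le_measure; rewrite ?inE //; [exact: measurableI|exact: measurableI|].
  by move=> y [xy Oy]; split=> //; exact: lt_trans lt_r.
by apply: lee_wpmul2r => //; rewrite lee_fin lerDr ltW.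
Qed.

(** A point of [Omega] in an annulus around [x] yields two disjoint balls of
    comparable radius; the lighter one, around [x] or around that point, leaves
    most of [Omega] outside. *)
Lemma density_of_separation : separation rho mu Omega D beta ->
  measure_density rho mu Omega.
Proof.
move=> sep; case: (hX) => [[_ [C0 [C1 [C00 C10 Hq]]]] _ _].
have sym x y : rho y x <= C0 * rho x y by case: (Hq x y y I I I).
have tri x y z : rho x y <= C1 * Num.max (rho x z) (rho z y) by case: (Hq x y z I I I).
case: hOmega_two => p1 [p2 [Op1 Op2 p12]].
have [lam [lam0 lam1 perfect]] := hOmega_perfect.
set m0 := Num.max C0 1; have m01 : 1 <= m0 by rewrite le_max lexx orbT.
have m0C : C0 <= m0 by rewrite le_max lexx.
have m00 : 0 < m0 by exact: lt_le_trans m01.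
set C1' := Num.max C1 1; have C11 : 1 <= C1' by rewrite le_max lexx orbT.
have C1le : C1 <= C1' by rewrite le_max lexx.
have C1'0 : 0 < C1' by exact: lt_le_trans C11.
set k := C1' * m0 + 1; have k1 : 1 <= k by rewrite lerDr mulr_ge0 // ltW.
have k0 : 0 < k by exact: lt_le_trans k1.
set t0 := rho p1 p2 / (C1' * m0).
have rp0 : 0 < rho p1 p2.
  rewrite lt0r rho_ge0 andbT; apply/eqP => h; apply: p12.
  by case: (Hq p1 p2 p2 I I I) => _ /(iffLR) ->.
have t00 : 0 < t0 by rewrite divr_gt0 // mulr_gt0.
have outside x t : t <= t0 -> Omega `\` qball rho x t !=set0.
  move=> tt0; apply: nonsubset => sub.
  have h1 := sub p1 Op1; have h2 := sub p2 Op2; rewrite /qball /= in h1 h2.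
  have : rho p1 p2 < C1' * m0 * t.
    apply: (le_lt_trans (tri p1 p2 x)); apply: (@le_lt_trans _ _ (C1' * Num.max (rho p1 x) (rho x p2))).
      by rewrite ler_wpM2r // le_max rho_ge0.
    rewrite -mulrA ltr_pM2l // gt_max; apply/andP; split.
      apply: (le_lt_trans (sym x p1)); apply: (@le_lt_trans _ _ (m0 * rho x p1)).
        by rewrite ler_wpM2r.
      by rewrite ltr_pM2l.
    by apply: (lt_le_trans h2); rewrite ler_peMl // (le_trans (rho_ge0 x p1)) // ltW.
  rewrite mulrC -ltr_pdivrMr ?mulr_gt0 // -/t0 => h.
  by have := lt_le_trans h tt0; rewrite ltxx.
set w := (2 * C1' * k)^-1; have w0 : 0 < w by rewrite invr_gt0 !mulr_gt0.
have w1 : w <= 1 by rewrite invf_le1 ?mulr_gt0 // mulr_ege1 // mulr_ege1 // ler1n.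
set eta := (lam * w) `^ beta / (2 * c).
have lw0 : 0 < lam * w by rewrite mulr_gt0.
have lw1 : lam * w <= 1 by rewrite mulr_ile1 // ltW.
have eta0 : 0 < eta by rewrite divr_gt0 ?powR_gt0 // mulr_gt0.
have ceta : c * eta = (lam * w) `^ beta / 2 by rewrite /eta; field; rewrite gt_eqF.
have ceta1 : c * eta <= 1.
  rewrite ceta ler_pdivrMr // mul1r; apply: (@le_trans _ _ (1 `^ beta)).
    by apply: powR_le; rewrite ?(ltW beta0) ?(ltW lw0).
  by rewrite powR1 ler1n.
have eta1 : eta <= 1 by apply: le_trans ceta1; rewrite ler_peMl // ltW.
have [delta d0 light] := lighter_ball_density hX hOmega hOmega_pos beta0 c1 snow mD
  sep eta0 eta1 ceta1.
apply: (@density_small_radii (Num.min (k^-1) (Num.min 1 t0))).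
- by rewrite !lt_min ltr01 t00 invr_gt0 k0.
- by rewrite !ge_min lexx orbT.
exists (delta^-1); first by rewrite invr_gt0.
move=> x r Ox r0; rewrite !le_min => /and3P[rk r1 rt0].
set R0 := k * r; have R00 : 0 < R0 by rewrite mulr_gt0.
have R01 : R0 <= 1 by rewrite /R0 mulrC -ler_pdivlMr // mul1r.
set t := w * R0; have t_gt0 : 0 < t by rewrite mulr_gt0.
have tE : t = r / (2 * C1') by rewrite /t /R0 /w; field; rewrite !gt_eqF.
have C1t : C1' * t < r.
  have -> : C1' * t = r / 2 by rewrite tE; field; rewrite gt_eqF.
  by rewrite ltr_pdivrMr // ltr_pMr // ltr1n.
have tr : t <= r by apply: le_trans (ltW C1t); rewrite ler_peMl // ltW.
have [y [[xy Oy] nxy]] := perfect x t Ox t_gt0 (le_trans tr r1) (outside x t (le_trans tr rt0)).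
have lxy : lam * t <= rho x y by rewrite leNgt; apply/negP.
set U := fun z => Omega `&` qball D z (eta * R0 `^ beta).
have etaR : c * (eta * R0 `^ beta) = (lam * t) `^ beta / 2.
  by rewrite mulrA ceta /t [lam * (w * R0)]mulrA (powRM _ (ltW lw0) (ltW R00)); ring.
have lt0 : 0 < lam * t by rewrite mulr_gt0.
have Usub z : Omega z -> U z `<=` qball rho z t `&` Omega.
  move=> Oz; apply: (dist_ball_sub hX beta0 c1 snow Oz t_gt0); rewrite etaR.
  rewrite ler_pdivrMr //; apply: (@le_trans _ _ (t `^ beta)).
    by apply: powR_le; rewrite ?(ltW beta0) ?(ltW lt0) // ler_piMl // ltW.
  by rewrite ler_peMr ?powR_ge0 // ler1n.
have Uxr : U x `<=` qball rho x r `&` Omega.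
  by move=> z /(Usub x Ox)[xz Oz]; split=> //; exact: lt_le_trans tr.
have Uyr : U y `<=` qball rho x r `&` Omega.
  move=> z /(Usub y Oy)[yz Oz]; split=> //; apply: (le_lt_trans (tri x z y)).
  apply: le_lt_trans C1t; apply: (@le_trans _ _ (C1' * Num.max (rho x y) (rho y z))).
    by rewrite ler_wpM2r // le_max rho_ge0.
  by rewrite ler_pM2l // ge_max (ltW xy) ltW.
have subx : qball rho x r `<=` qball rho x R0.
  by move=> z xz; apply: (lt_le_trans xz); rewrite ler_peMl // ltW.
have suby : qball rho x r `<=` qball rho y R0.
  move=> z xz; apply: (le_lt_trans (tri y z x)).
  apply: (@le_lt_trans _ _ (C1' * Num.max (rho y x) (rho x z))).
    by rewrite ler_wpM2r // le_max rho_ge0.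
  apply: (@le_lt_trans _ _ (C1' * (m0 * r))); last first.
    by rewrite mulrA /R0 /k mulrDl mul1r ltrDl.
  rewrite ler_pM2l // ge_max; apply/andP; split.
    apply: (le_trans (sym x y)); apply: ler_pM; rewrite ?(ltW C00) //.
    by apply: (le_trans (ltW xy)).
  by apply: (le_trans (ltW xz)); rewrite ler_peMl // ltW.
have disj z : U x z -> ~ U y z.
  move=> [Oz xz] [_ yz]; rewrite /qball /= in xz yz.
  have h1 : D x y < 2 * (eta * R0 `^ beta).
    apply: (le_lt_trans (pm_tri Dm z x y)); rewrite (pm_sym Dm z y) mulrDl mul1r.
    exact: ltrD.
  have h2 : rho x y `^ beta < (lam * t) `^ beta.
    apply: (le_lt_trans (proj2 (snow Ox Oy))).
    have -> : (lam * t) `^ beta = c * (2 * (eta * R0 `^ beta)).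
      have -> : c * (2 * (eta * R0 `^ beta)) = 2 * (c * (eta * R0 `^ beta)) by ring.
      by rewrite etaR; field.
    by rewrite ltr_pM2l.
  have := powR_le (ltW beta0) (ltW lt0) lxy; rewrite leNgt h2 //.
have mU z : Omega z -> measurable (U z) by move=> Oz; exact: mOD.
have mBO z s : measurable (qball rho z s `&` Omega) by exact: measurableI.
have mUD z w' : Omega w' -> measurable ((qball rho z R0 `&` Omega) `\` qball D w' (eta * R0 `^ beta)).
  move=> Ow; have -> : (qball rho z R0 `&` Omega) `\` qball D w' (eta * R0 `^ beta) =
     (qball rho z R0 `&` Omega) `\` U w'.
    apply/seteqP; split=> v [[Bv Ov] h']; split=> // h2; apply: h' => //.
    by case: h2.
  by apply: measurableD => //; exact: mU.
have finU z : Omega z -> U z `<=` qball rho x r `&` Omega -> mu (U z) \is a fin_num.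
  move=> Oz sub; rewrite ge0_fin_numE //; apply: (@le_lt_trans _ _ (mu (qball rho x r))).
    by apply: le_measure; rewrite ?inE //; [exact: mU|move=> v /sub[]].
  by have := qm_ball_fin hX x r0; rewrite ge0_fin_numE.
have conclude z : Omega z -> qball rho x r `<=` qball rho z R0 ->
    U z `<=` qball rho x r `&` Omega ->
    delta * fine (mu (qball rho z R0)) <= fine (mu (U z)) ->
    (mu (qball rho x r) <= (delta^-1)%:E * mu (qball rho x r `&` Omega))%E.
  move=> Oz sub Uz h; apply: (@le_trans _ _ ((delta^-1)%:E * mu (U z))%E).
    rewrite -(fineK (finU z Oz Uz)) -EFinM.
    apply: (@le_trans _ _ (mu (qball rho z R0))); first by apply: le_measure; rewrite ?inE.
    by rewrite -(fineK (qm_ball_fin hX z R00)) lee_fin ler_pdivlMl.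
  rewrite lee_wpmul2l ?lee_fin ?invr_ge0 ?(ltW d0) //.
  by apply: le_measure; rewrite ?inE //; exact: mU.
have [le_xy|lt_yx] := leP (mu (U x)) (mu (U y)).
  apply: (conclude x) => //; apply: light => //; apply: (le_trans le_xy).
  apply: le_measure; rewrite ?inE //; [exact: mU|exact: mUD|].
  move=> z Uyz; have [xz Oz] := Uyr z Uyz; split; first by split=> //; exact: subx.
  by move=> h; apply: (disj z) => //; split.
apply: (conclude y) => //; apply: light => //; apply: (le_trans (ltW lt_yx)).
apply: le_measure; rewrite ?inE //; [exact: mU|exact: mUD|].
move=> z Uxz; have [xz Oz] := Uxr z Uxz; split; first by split=> //; exact: suby.
by move=> h; apply: (disj z) => //; split.
Qed.
End DensityOfSeparation.

(** * From the embeddings back to separation *)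

Section Converse.
Context {R : realType} {d : measure_display} {X : measurableType d}.
Context (rho : X -> X -> R) (mu : {measure set X -> \bar R}) (Q : R) (Omega : set X).
Hypothesis hX : quasi_metric_measure_space rho mu.
Hypothesis hQ : 0 < Q.
Hypothesis hdoubling : doubling rho mu Q.
Hypothesis hOmega : measurable Omega.
Hypothesis hOmega_perfect : locally_uniformly_perfect rho Omega.
Hypothesis hOmega_two : exists x y : X, [/\ Omega x, Omega y & x <> y].
Hypothesis hOmega_pos : forall (x : X) (r : R), Omega x -> 0 < r -> r <= 1 ->
       (0 < mu (qball rho x r `&` Omega))%E.

Let rho_ge0 := qm_ge0 hX.
Let mball x r : measurable (qball rho x r). Proof. exact: (qm_measurable_ball hX). Qed.
Let V x r := fine (mu (qball rho x r)).
Let V_gt0 x r : 0 < r -> 0 < V x r. Proof. exact: (qm_ball_gt0 hX). Qed.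

Lemma measurable_dist_Omega D beta c : 0 < beta -> 0 < c -> is_pmetric D ->
  snowflake Omega rho D beta c -> forall x, Omega x -> measurable_fun Omega (D x).
Proof.
move=> b0 c0 Dm snow x Ox.
have [bX [DX [cX [Cd [bX0 cX1 Cd0 snowX [DmX cont _ _]]]]]] := snowflake_X hX hdoubling.
have cX0 : 0 < cX by exact: lt_le_trans cX1.
apply: cont => // y Oy e e0.
have r0 : 0 < (e / c) `^ beta^-1 by rewrite powR_gt0 // divr_gt0.
exists (((e / c) `^ beta^-1) `^ bX / cX); first by rewrite divr_gt0 // powR_gt0.
move=> z Oz yz; apply: (le_lt_trans (pm_lip Dm x y z)).
apply: (le_lt_trans (proj1 (snow y z Oy Oz))); rewrite mulrC -ltr_pdivlMr //.
apply: lt_powR_inv => //; first by rewrite divr_ge0 // ltW.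
rewrite -[ltLHS](powRKV (rho_ge0 y z) (lt0r_neq0 bX0)).
rewrite -[ltRHS](powRKV (ltW r0) (lt0r_neq0 bX0)).
apply: powR_lt; rewrite ?invr_gt0 ?powR_ge0 //.
apply: (le_lt_trans (proj2 (snowX y z I I))).
by rewrite mulrC -ltr_pdivlMr.
Qed.

(** A pseudometric for which cut-offs have smoothness [s] and summability [q];
    the case [s = beta] is only possible for infinite [q]. *)
Lemma test_metric (q : \bar R) s (Y : set X) : 0 < s -> le_qm_index q s Y rho -> Omega `<=` Y ->
  exists beta D c, [/\ s <= beta, q <> +oo%E -> s < beta, is_pmetric D, 1 <= c &
    snowflake Y rho D beta c /\ forall x, Omega x -> measurable_fun Omega (D x)].
Proof.
move=> s0 le_s OY; have [beta [D [c [sb sbq Dm c0 snow]]]] := snowflake_of_index s0 le_s.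
exists beta, D, (Num.max c 1).
have snow1 : snowflake Y rho D beta (Num.max c 1).
  by apply: (snowflake_le Dm _ snow); rewrite le_max lexx.
split=> //; first by rewrite le_max lexx orbT.
split=> // x Ox; apply: (measurable_dist_Omega _ c0 Dm (snowflake_sub OY snow)) => //.
exact: lt_le_trans sb.
Qed.

Section Fixed.
Context (D : X -> X -> R) (beta c : R).
Hypotheses (beta0 : 0 < beta) (c1 : 1 <= c) (Dm : is_pmetric D).
Hypothesis snow : snowflake Omega rho D beta c.
Hypothesis mD : forall x, Omega x -> measurable_fun Omega (D x).
Context (x : X) (R0 a b : R).
Hypotheses (Ox : Omega x) (R00 : 0 < R0) (R01 : R0 <= 1).
Hypotheses (a0 : 0 < a) (ab : a < b) (bR : b <= R0 `^ beta).

Let c0 : 0 < c. Proof. exact: lt_le_trans c1. Qed.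
Let B := qball rho x R0 `&` Omega.
Let S1 := B `&` [set y | (D x y <= a)%R].
Let S0 := B `&` [set y | (b <= D x y)%R].
Let m := fine (mu (Omega `&` qball D x b)).
Let u := cutoff D x a b.

Lemma measurable_inner_set : measurable S1.
Proof.
have -> : S1 = qball rho x R0 `&` (Omega `&` D x @^-1` `]-oo, a]%classic).
  by rewrite /S1 /B -setIA; congr (_ `&` _); apply/seteqP; split=> z [Oz]; rewrite /= in_itv.
by apply: measurableI => //; exact: mD.
Qed.

Lemma measurable_outer_set : measurable S0.
Proof.
have -> : S0 = qball rho x R0 `&` (Omega `&` D x @^-1` `[b, +oo[%classic).
  by rewrite /S0 /B -setIA; congr (_ `&` _); apply/seteqP; split=> z [Oz]; rewrite /= in_itv /= andbT.
by apply: measurableI => //; exact: mD.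
Qed.

Lemma measurable_dist_ball : measurable (Omega `&` qball D x b).
Proof. exact: measurable_set_dist. Qed.

Lemma dist_ball_fin : mu (Omega `&` qball D x b) \is a fin_num.
Proof.
have b0 : 0 < b by exact: lt_trans ab.
have t0 : 0 < (c * b) `^ beta^-1 by rewrite powR_gt0 // mulr_gt0.
rewrite ge0_fin_numE //; apply: (@le_lt_trans _ _ (mu (qball rho x ((c * b) `^ beta^-1)))).
  apply: le_measure; rewrite ?inE //; first exact: measurable_dist_ball.
  apply: (@subset_trans _ (qball rho x ((c * b) `^ beta^-1) `&` Omega)); last exact: subIsetl.
  apply: (dist_ball_sub hX beta0 c1 snow Ox t0).
  by rewrite powRVK ?mulr_ge0 ?gt_eqF ?(ltW c0) ?(ltW b0).
by have := qm_ball_fin hX x t0; rewrite ge0_fin_numE.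
Qed.

Lemma inner_set_le : (mu S1 <= m%:E)%E.
Proof.
rewrite /m fineK ?dist_ball_fin //; apply: le_measure; rewrite ?inE //.
- exact: measurable_inner_set.
- exact: measurable_dist_ball.
by move=> y [[_ Oy] /= xy]; split=> //; exact: le_lt_trans ab.
Qed.

Lemma cutoff_inner y : S1 y -> u y = 1.
Proof. by move=> [_ xy]; exact: cutoff_eq1. Qed.

Lemma cutoff_outer y : S0 y -> u y = 0.
Proof. by move=> [_ xy]; exact: cutoff_eq0. Qed.

Lemma m_ge0 : 0 <= m. Proof. exact: fine_ge0. Qed.

Lemma m_eq0 : m = 0 -> Order.min (mu S1) (mu S0) = 0%E.
Proof.
move=> m0; apply/eqP; rewrite eq_le le_min !measure_ge0 !andbT ge_min.
by have := inner_set_le; rewrite m0 => ->.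
Qed.

(** A function that is 1 on [S1] and 0 on [S0] stays at distance 1/2 of any
    constant on one of the two sets. *)
Lemma min_le_Lp_norm (gamma r Z : R) : 0 < r -> 0 <= Z -> measurable_fun Omega u ->
  (Lp_norm mu B r (fun y => (u y - gamma)%R) <= Z%:E)%E ->
  (Order.min (mu S1) (mu S0) <= ((2 * Z) `^ r)%:E)%E.
Proof.
move=> r0 Z0 mu_; rewrite Lp_norm_le // => le_Z.
have mB : measurable B by exact: measurableI.
have mf : measurable_fun B (fun y => (`|u y - gamma| `^ r)%:E).
  apply: (@measurable_normr_powR _ _ _ B (fun y => u y - gamma)).
  apply: (@measurable_funB _ _ _ _ u (cst gamma)) => //.
  exact: (measurable_funS hOmega (@subIsetr _ _ _) mu_).
have half S : measurable S -> S `<=` B -> (forall y, S y -> 2^-1 <= `|u y - gamma|) ->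
    (mu S <= ((2 * Z) `^ r)%:E)%E.
  move=> mS SB big; have h : ((2^-1 `^ r)%:E * mu S <= (Z `^ r)%:E)%E.
    apply: le_trans le_Z; apply: (@le_trans _ _ (\int[mu]_(y in S) (`|u y - gamma| `^ r)%:E)%E).
      rewrite -integral_cst; last exact: mS.
      apply: ge0_le_integral => //.
      - by move=> y _; rewrite lee_fin powR_ge0.
      - by apply: (measurable_funS mB SB mf).
      - move=> y Sy; rewrite lee_fin; apply: powR_le; rewrite ?(ltW r0) ?invr_ge0 //.
        exact: big.
    by apply: ge0_subset_integral.
  have h2 : 0 < 2^-1 `^ r :> R by rewrite powR_gt0 // invr_gt0.
  rewrite -lee_pdivlMl // in h; apply: (le_trans h).
  rewrite -EFinM lee_fin powRM // powR_invl // invrK.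
  by [].
rewrite ge_min; apply/orP; have [g|g] := lerP gamma 2^-1.
  left; apply: half => [||y Sy]; [exact: measurable_inner_set|by move=> y []|].
  rewrite cutoff_inner //; apply: le_trans (ler_norm _).
  by rewrite lerBrDr -[leRHS](@divff _ 2) // -[X in _ <= X / _]/(1 + 1) mulrDl mul1r lerD2l.
right; apply: half => [||y Sy]; [exact: measurable_outer_set|by move=> y []|].
rewrite cutoff_outer // sub0r normrN; apply: le_trans (ler_norm _).
exact: ltW.
Qed.

Lemma cutoff_Lp_norm p : 0 < p -> measurable_fun Omega u ->
  (Lp_norm mu Omega p u <= (m `^ p^-1)%:E)%E.
Proof.
move=> p0 mu_; rewrite Lp_norm_le ?powR_ge0 // powRVK ?m_ge0 ?gt_eqF //.
rewrite /m fineK ?dist_ball_fin //.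
apply: (@le_trans _ _ (\int[mu]_(y in Omega) (\1_(Omega `&` qball D x b) y)%:E)%E); last first.
  rewrite integral_indic //; last exact: measurable_dist_ball.
  by rewrite setIC setIA setIid.
apply: ge0_le_integral => //.
- exact: (measurable_normr_powR).
- by apply/measurable_EFinP; apply: measurable_indic; exact: measurable_dist_ball.
move=> y Oy; rewrite lee_fin indicE; have [xy|xy] := ltrP (D x y) b.
  rewrite mem_set //= ger0_norm ?cutoff_ge0 //.
  apply: (@le_trans _ _ (1 `^ p)); last by rewrite powR1.
  by apply: powR_le; rewrite ?(ltW p0) ?cutoff_ge0 ?cutoff_le1.
by rewrite /u cutoff_eq0 // normr0 powR0 ?gt_eqF.
Qed.

Let ratio := R0 `^ beta / (b - a).

Lemma ratio_ge1 : 1 <= ratio.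
Proof.
rewrite ler_pdivlMr ?subr_gt0 // mul1r; apply: le_trans bR.
by rewrite lerBlDr lerDl ltW.
Qed.

(** Homogeneity: the constants depend on the radii through this ratio only. *)
Lemma scale_ratio s : R0 `^ s * (b - a) `^ (- (s / beta)) = ratio `^ (s / beta).
Proof.
have L0 : 0 < b - a by rewrite subr_gt0.
rewrite powR_divl ?powR_ge0 ?(ltW L0) // powRN -powRrM; congr (_ `^ _ * _).
by field; rewrite gt_eqF.
Qed.
End Fixed.
End Converse.

(** The Sobolev exponent is where the bound becomes the mass times a power
    [1 + sigma] of the relative mass, with [sigma = eps r / Q]. *)
Lemma sobolev_power (R : realType) (Q K t m V p eps : R) :
  0 < Q -> 0 <= K -> 0 <= t -> 0 <= m -> 0 < V -> 0 < p -> 0 < eps -> p < Q / eps ->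
  let r := Q * p / (Q - eps * p) in 0 < r /\
  (K * t * m `^ p^-1 / V `^ (eps / Q)) `^ r =
    K `^ r * V * t `^ r * (m / V) `^ (1 + eps * r / Q).
Proof.
move=> Q0 K0 t0 m0 V0 p0 e0; rewrite ltr_pdivlMr // mulrC => lt.
have d0 : 0 < Q - eps * p by rewrite subr_gt0.
move=> r; have r0 : 0 < r by rewrite divr_gt0 // mulr_gt0.
have rp : p^-1 * r = 1 + eps * r / Q by rewrite /r; field; rewrite !gt_eqF.
split=> //; rewrite powR_divl ?mulr_ge0 ?powR_ge0 // !powRM ?mulr_ge0 ?powR_ge0 //; last first.
  by rewrite invr_ge0 ltW.
rewrite powR_invl ?(ltW V0) // -!powRrM rp.
have -> : eps / Q * r = eps * r / Q by ring.
have -> : V `^ (1 + eps * r / Q) = V * V `^ (eps * r / Q).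
  by rewrite powRD ?(gt_eqF V0) ?implybT // powRr1 // ltW.
by field; rewrite !gt_eqF // powR_gt0.
Qed.

Section Converse.
Context {R : realType} {d : measure_display} {X : measurableType d}.
Context (rho : X -> X -> R) (mu : {measure set X -> \bar R}) (Q : R) (Omega : set X).
Hypothesis hX : quasi_metric_measure_space rho mu.
Hypothesis hQ : 0 < Q.
Hypothesis hdoubling : doubling rho mu Q.
Hypothesis hOmega : measurable Omega.
Hypothesis hOmega_perfect : locally_uniformly_perfect rho Omega.
Hypothesis hOmega_two : exists x y : X, [/\ Omega x, Omega y & x <> y].
Hypothesis hOmega_pos : forall (x : X) (r : R), Omega x -> 0 < r -> r <= 1 ->
       (0 < mu (qball rho x r `&` Omega))%E.

Let rho_ge0 := qm_ge0 hX.
Let V x r := fine (mu (qball rho x r)).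
Let V_gt0 x r : 0 < r -> 0 < V x r. Proof. exact: (qm_ball_gt0 hX). Qed.

Lemma density_of_poincare (eps s p : R) (q : \bar R) (CP : R) :
  [/\ 0 < eps, 0 < s, 0 < p, p < Q / eps & (0 < q)%E] ->
  le_qm_index q s Omega rho -> 0 < CP ->
  (forall (x0 : X) (R0 : R), Omega x0 -> 0 < R0 -> R0 <= 1 ->
    forall u : X -> R, dotN rho mu Omega s p q u ->
    let B0 := qball rho x0 R0 in
    (ereal_inf (range (fun gamma : R =>
       Lp_norm mu (B0 `&` Omega) (Q * p / (Q - eps * p)) (fun x => (u x - gamma)%R)))
     <= (CP * R0 `^ s / fine (mu B0) `^ (eps / Q))%:E *
        dotN_norm rho mu Omega s p q u)%E) ->
  measure_density rho mu Omega.
Proof.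
move=> [e0 s0 p0 pQ q0] le_s CP0 H.
have [beta [D [c [sb sbq Dm c1 [snow mD]]]]] :=
  test_metric hX hdoubling hOmega s0 le_s (@subset_refl _ Omega).
have b0 : 0 < beta by exact: lt_le_trans sb.
have c0 : 0 < c by exact: lt_le_trans c1.
apply: (density_of_separation hX hdoubling hOmega hOmega_perfect hOmega_two hOmega_pos
  b0 c1 Dm snow mD).
have [C C0 cut] := cutoff_norm mu rho_ge0 hOmega s0 p0 q0 c0 sb sbq Dm snow mD.
have [r0 _] := sobolev_power hQ (ltW hQ) (ltW hQ) (ltW hQ) hQ p0 e0 pQ.
set r := Q * p / (Q - eps * p) in r0.
have K0 : 0 < 4 * CP * C by rewrite mulr_gt0 // mulr_gt0.
exists ((4 * CP * C) `^ r), (s / beta * r), (eps * r / Q); split.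
- exact: powR_gt0.
- by rewrite mulr_gt0 // divr_gt0.
- by rewrite divr_gt0 // mulr_gt0.
move=> x R0 a b Ox R00 R01 a0 ab bR /=; rewrite -/(V x R0).
set m := fine (mu (Omega `&` qball D x b)); set u := cutoff D x a b.
have m0 : 0 <= m by exact: fine_ge0.
have [mE|m_neq0] := eqVneq m 0.
  rewrite (m_eq0 hX hOmega b0 c1 snow mD R0 Ox a0 ab mE) lee_fin.
  by rewrite !mulr_ge0 ?powR_ge0 // ltW // V_gt0.
have m_gt0 : 0 < m by rewrite lt0r m_neq0.
have mu_ : measurable_fun Omega u by exact: measurable_cutoff.
have le_m : (mu (Omega `&` qball D x b) <= m%:E)%E.
  by rewrite /m fineK // (dist_ball_fin hX hOmega b0 c1 snow mD Ox a0 ab).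
have le_N := cut x a b m Ox ab m0 le_m.
have Nu : dotN rho mu Omega s p q u by split=> //; exact: le_lt_trans le_N (ltry _).
have := H x R0 Ox R00 R01 u Nu; rewrite /= -/(V x R0).
set Vx := V x R0; have Vx0 : 0 < Vx by exact: V_gt0.
set t := (R0 `^ beta / (b - a)) `^ (s / beta).
have t0 : 0 < t by rewrite powR_gt0 // divr_gt0 ?powR_gt0 // subr_gt0.
set Z := CP * C * t * m `^ p^-1 / Vx `^ (eps / Q).
have Z0 : 0 < Z by rewrite /Z divr_gt0 ?powR_gt0 // mulr_gt0 ?powR_gt0 // mulr_gt0 // mulr_gt0.
move=> h; have : (ereal_inf (range (fun gamma : R =>
       Lp_norm mu (qball rho x R0 `&` Omega) r (fun x => (u x - gamma)%R))) < (2 * Z)%:E)%E.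
  apply: (@le_lt_trans _ _ Z%:E); last by rewrite lte_fin ltr_pMl // ltr1n.
  apply: (le_trans h); apply: (@le_trans _ _ ((CP * R0 `^ s / Vx `^ (eps / Q))%:E *
    (C * (b - a) `^ (- (s / beta)) * m `^ p^-1)%:E)%E).
    rewrite lee_wpmul2l // lee_fin divr_ge0 ?powR_ge0 // mulr_ge0 ?powR_ge0 //.
    exact: ltW.
  rewrite -EFinM lee_fin /Z /t -(scale_ratio b0 R0 ab s) le_eqVlt; apply/orP; left; apply/eqP.
  by ring.
move=> /ereal_inf_lt[_ [gamma _ <-]] /ltW le_g.
have := min_le_Lp_norm hX hOmega mD Ox ab r0 _ mu_ le_g.
move=> /(_ ltac:(by rewrite mulr_ge0 // ltW)) h2; apply: (le_trans h2).
have -> : 2 * (2 * Z) = 4 * CP * C * t * m `^ p^-1 / Vx `^ (eps / Q) by rewrite /Z; ring.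
have [_ ->] := sobolev_power hQ (ltW K0) (ltW t0) m0 Vx0 p0 e0 pQ.
by rewrite -/r /t -powRrM.
Qed.

Lemma density_of_sobolev (eps s p : R) (q : \bar R) (CS : R) :
  [/\ 0 < eps, 0 < s, 0 < p, p < Q / eps & (0 < q)%E] ->
  le_qm_index q s Omega rho -> 0 < CS ->
  (forall (x0 : X) (R0 : R), Omega x0 -> 0 < R0 -> R0 <= 1 ->
    forall u : X -> R, dotN rho mu Omega s p q u ->
    let B0 := qball rho x0 R0 in
    (Lp_norm mu (B0 `&` Omega) (Q * p / (Q - eps * p)) u
     <= (CS / fine (mu B0) `^ (eps / Q))%:E *
        ((R0 `^ s)%:E * dotN_norm rho mu Omega s p q u + Lp_norm mu Omega p u))%E) ->
  measure_density rho mu Omega.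
Proof.
move=> [e0 s0 p0 pQ q0] le_s CS0 H.
have [beta [D [c [sb sbq Dm c1 [snow mD]]]]] :=
  test_metric hX hdoubling hOmega s0 le_s (@subset_refl _ Omega).
have b0 : 0 < beta by exact: lt_le_trans sb.
have c0 : 0 < c by exact: lt_le_trans c1.
apply: (density_of_separation hX hdoubling hOmega hOmega_perfect hOmega_two hOmega_pos
  b0 c1 Dm snow mD).
have [C C0 cut] := cutoff_norm mu rho_ge0 hOmega s0 p0 q0 c0 sb sbq Dm snow mD.
have [r0 _] := sobolev_power hQ (ltW hQ) (ltW hQ) (ltW hQ) hQ p0 e0 pQ.
set r := Q * p / (Q - eps * p) in r0.
have K0 : 0 < 2 * CS * (C + 1) by rewrite mulr_gt0 ?mulr_gt0 // addr_gt0.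
exists ((2 * CS * (C + 1)) `^ r), (s / beta * r), (eps * r / Q); split.
- exact: powR_gt0.
- by rewrite mulr_gt0 // divr_gt0.
- by rewrite divr_gt0 // mulr_gt0.
move=> x R0 a b Ox R00 R01 a0 ab bR /=; rewrite -/(V x R0).
set m := fine (mu (Omega `&` qball D x b)); set u := cutoff D x a b.
have m0 : 0 <= m by exact: fine_ge0.
have mu_ : measurable_fun Omega u by exact: measurable_cutoff.
have le_m : (mu (Omega `&` qball D x b) <= m%:E)%E.
  by rewrite /m fineK // (dist_ball_fin hX hOmega b0 c1 snow mD Ox a0 ab).
have le_N := cut x a b m Ox ab m0 le_m.
have Nu : dotN rho mu Omega s p q u by split=> //; exact: le_lt_trans le_N (ltry _).
have := H x R0 Ox R00 R01 u Nu; rewrite /= -/(V x R0).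
set Vx := V x R0; have Vx0 : 0 < Vx by exact: V_gt0.
set t := (R0 `^ beta / (b - a)) `^ (s / beta).
have t0 : 0 < t by rewrite powR_gt0 // divr_gt0 ?powR_gt0 // subr_gt0.
have t1 : 1 <= t.
  apply: (@le_trans _ _ (1 `^ (s / beta))); first by rewrite powR1.
  by apply: powR_le; rewrite ?divr_ge0 ?(ltW s0) ?(ltW b0) // (ratio_ge1 a0 ab bR).
set Z := CS * (C + 1) * t * m `^ p^-1 / Vx `^ (eps / Q).
have Z0 : 0 <= Z.
  rewrite /Z divr_ge0 ?powR_ge0 // mulr_ge0 ?powR_ge0 // mulr_ge0 ?(ltW t0) //.
  by rewrite mulr_ge0 ?(ltW CS0) // addr_ge0 // ltW.
move=> h; have le_Z : (Lp_norm mu (qball rho x R0 `&` Omega) r (fun y => (u y - 0)%R) <= Z%:E)%E.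
  rewrite (_ : (fun y => u y - 0) = u); last by apply/funext => y; rewrite subr0.
  apply: (le_trans h).
  have W0 : 0 <= CS / Vx `^ (eps / Q) by rewrite divr_ge0 ?powR_ge0 // ltW.
  apply: (@le_trans _ _ ((CS / Vx `^ (eps / Q))%:E *
    ((R0 `^ s)%:E * (C * (b - a) `^ (- (s / beta)) * m `^ p^-1)%:E + (m `^ p^-1)%:E))%E).
    rewrite lee_wpmul2l ?lee_fin //; apply: leeD.
      by rewrite lee_wpmul2l ?lee_fin ?powR_ge0.
    exact: (cutoff_Lp_norm hX hOmega b0 c1 snow mD Ox a0 ab p0 mu_).
  rewrite lee_fin.
  have -> : R0 `^ s * (C * (b - a) `^ (- (s / beta)) * m `^ p^-1) = C * t * m `^ p^-1.
    by rewrite /t -(scale_ratio b0 R0 ab s); ring.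
  have -> : Z = CS / Vx `^ (eps / Q) * (C * t * m `^ p^-1 + t * m `^ p^-1) by rewrite /Z; ring.
  by rewrite ler_wpM2l // lerD2l ler_peMl ?powR_ge0.
have h2 := min_le_Lp_norm hX hOmega mD Ox ab r0 Z0 mu_ le_Z.
apply: (le_trans h2).
have -> : 2 * Z = 2 * CS * (C + 1) * t * m `^ p^-1 / Vx `^ (eps / Q) by rewrite /Z; ring.
have [_ ->] := sobolev_power hQ (ltW K0) (ltW t0) m0 Vx0 p0 e0 pQ.
by rewrite -/r /t -powRrM.
Qed.

(** A cut-off oscillates by 1, so its norm cannot be small unless the inner or the
    outer set is null; otherwise the mass of the inner set, at most [m], may be
    multiplied by a factor bounded below by 1 that contains [m / V]. *)
Lemma density_of_hoelder (eps s p : R) (q : \bar R) (CH : R) :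
  [/\ 0 < eps, 0 < s, Q / eps < p & (0 < q)%E] -> eps < s ->
  le_qm_index q s Omega rho -> 0 < CH ->
  (forall (x0 : X) (R0 : R), Omega x0 -> 0 < R0 -> R0 <= 1 ->
   forall u : X -> R, dotN rho mu Omega s p q u ->
   let B0 := qball rho x0 R0 in
   exists v : X -> R,
     [/\ {ae mu, forall x, (B0 `&` Omega) x -> v x = u x},
         hoelder_on rho (B0 `&` Omega) (s - Q / p) v &
         forall x y : X, (B0 `&` Omega) x -> (B0 `&` Omega) y ->
           (`|v x - v y|%:E
            <= (CH * rho x y `^ (s - Q / p)
                * (R0 `^ (Q / p) / fine (mu B0) `^ p^-1))%:E
               * dotN_norm rho mu Omega s p q u)%E]) ->
  measure_density rho mu Omega.
Proof.
move=> [e0 s0 pQ q0] es le_s CH0 H.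
have p0 : 0 < p by apply: lt_trans pQ; rewrite divr_gt0.
have [beta [D [c [sb sbq Dm c1 [snow mD]]]]] :=
  test_metric hX hdoubling hOmega s0 le_s (@subset_refl _ Omega).
have b0 : 0 < beta by exact: lt_le_trans sb.
have c0 : 0 < c by exact: lt_le_trans c1.
apply: (density_of_separation hX hdoubling hOmega hOmega_perfect hOmega_two hOmega_pos
  b0 c1 Dm snow mD).
have [C C0 cut] := cutoff_norm mu rho_ge0 hOmega s0 p0 q0 c0 sb sbq Dm snow mD.
have [k k0 diam] := qm_diameter hX.
set alpha := s - Q / p.
have alpha0 : 0 < alpha.
  rewrite subr_gt0; apply: lt_trans es; rewrite ltr_pdivrMr // mulrC.
  by rewrite -ltr_pdivrMr.
set K := CH * k `^ alpha * C.
have K0 : 0 < K by rewrite mulr_gt0 // mulr_gt0 // powR_gt0.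
exists (K `^ p), (s / beta * p), 1; split=> //.
- exact: powR_gt0.
- by rewrite mulr_gt0 // divr_gt0.
move=> x R0 a b Ox R00 R01 a0 ab bR /=; rewrite -/(V x R0).
set m := fine (mu (Omega `&` qball D x b)); set u := cutoff D x a b.
have m0 : 0 <= m by exact: fine_ge0.
have mu_ : measurable_fun Omega u by exact: measurable_cutoff.
have le_m : (mu (Omega `&` qball D x b) <= m%:E)%E.
  by rewrite /m fineK // (dist_ball_fin hX hOmega b0 c1 snow mD Ox a0 ab).
have le_N := cut x a b m Ox ab m0 le_m.
have Nu : dotN rho mu Omega s p q u by split=> //; exact: le_lt_trans le_N (ltry _).
set Vx := V x R0; have Vx0 : 0 < Vx by exact: V_gt0.
set t := (R0 `^ beta / (b - a)) `^ (s / beta).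
have t0 : 0 < t by rewrite powR_gt0 // divr_gt0 ?powR_gt0 // subr_gt0.
have [v [[E [mE muE subE]] _ hv]] := H x R0 Ox R00 R01 u Nu.
set S1 := _ `&` [set y | (D x y <= a)%R]; set S0 := _ `&` [set y | (b <= D x y)%R].
have mS1 : measurable S1 := measurable_inner_set hX hOmega mD R0 a Ox.
have mS0 : measurable S0 := measurable_outer_set hX hOmega mD R0 b Ox.
have bound_ge0 : 0 <= K `^ p * Vx * (R0 `^ beta / (b - a)) `^ (s / beta * p) * (m / Vx) `^ (1 + 1).
  by rewrite !mulr_ge0 ?powR_ge0 // ltW.
have [[y [S1y nEy]]|no1] := pselect (S1 `\` E !=set0); last first.
  rewrite ge_min; apply/orP; left; apply: (@le_trans _ _ (mu E)); last by rewrite muE lee_fin.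
  by apply: le_measure; rewrite ?inE // => y S1y; apply: contrapT => nE; apply: no1; exists y.
have [[z [S0z nEz]]|no0] := pselect (S0 `\` E !=set0); last first.
  rewrite ge_min; apply/orP; right; apply: (@le_trans _ _ (mu E)); last by rewrite muE lee_fin.
  by apply: le_measure; rewrite ?inE // => w S0w; apply: contrapT => nE; apply: no0; exists w.
have vE w : (qball rho x R0 `&` Omega) w -> ~ E w -> v w = u w.
  by move=> Bw nE; apply: contrapT => h; apply: nE; apply: subE => /= h'; apply: h; exact: h'.
have := hv y z S1y.1 S0z.1; rewrite (vE y S1y.1 nEy) (vE z S0z.1 nEz).
rewrite [u y](cutoff_inner ab S1y) [u z](cutoff_outer ab S0z) subr0 normr1 -/(V x R0) -/Vx => h1.
have h2 : 1 <= K * t * (m `^ p^-1 / Vx `^ p^-1).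
  rewrite -lee_fin; apply: (le_trans h1).
  apply: (@le_trans _ _ ((CH * rho y z `^ alpha * (R0 `^ (Q / p) / Vx `^ p^-1))%:E *
     (C * (b - a) `^ (- (s / beta)) * m `^ p^-1)%:E)%E).
    by rewrite lee_wpmul2l // lee_fin !mulr_ge0 ?powR_ge0 ?invr_ge0 ?powR_ge0 // ltW.
  rewrite -EFinM lee_fin.
  apply: (@le_trans _ _ (CH * (k `^ alpha * R0 `^ alpha) * (R0 `^ (Q / p) / Vx `^ p^-1) *
     (C * (b - a) `^ (- (s / beta)) * m `^ p^-1))).
    apply: ler_wpM2r; first by rewrite !mulr_ge0 ?powR_ge0 // ltW.
    apply: ler_wpM2r; first by rewrite divr_ge0 ?powR_ge0.
    apply: ler_wpM2l; first exact: ltW.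
    rewrite -powRM ?(ltW k0) ?(ltW R00) //; apply: powR_le; rewrite ?(ltW alpha0) ?rho_ge0 //.
    by apply: (diam x) => //; [exact: S1y.1.1|exact: S0z.1.1].
  have Rs : R0 `^ s = R0 `^ alpha * R0 `^ (Q / p).
    rewrite -powRD; last by apply/implyP => _; rewrite gt_eqF.
    by congr (_ `^ _); rewrite /alpha; ring.
  by rewrite /t -(scale_ratio b0 R0 ab s) Rs /K le_eqVlt; apply/orP; left; apply/eqP; ring.
have h3 : 1 <= K `^ p * (R0 `^ beta / (b - a)) `^ (s / beta * p) * (m / Vx).
  apply: (@le_trans _ _ (1 `^ p)); first by rewrite powR1.
  have e1 : 0 <= m `^ p^-1 / Vx `^ p^-1 by rewrite divr_ge0 ?powR_ge0.
  have e2 : 0 <= K * t by rewrite mulr_ge0 // ltW.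
  apply: (le_trans (powR_le (ltW p0) ler01 h2)).
  rewrite (powRM _ e2 e1) (powRM _ (ltW K0) (ltW t0)) powR_divl ?powR_ge0 //.
  by rewrite (powRVK m0 (lt0r_neq0 p0)) (powRVK (ltW Vx0) (lt0r_neq0 p0)) /t -powRrM.
rewrite ge_min; apply/orP; left.
apply: (le_trans (inner_set_le hX hOmega b0 c1 snow mD R0 Ox a0 ab)); rewrite lee_fin -/m.
have mV0 : 0 <= m / Vx by rewrite divr_ge0 // ltW.
have -> : (m / Vx) `^ (1 + 1) = m / Vx * (m / Vx).
  by rewrite -[1 + 1]/(2%:R) powR_mulrn // expr2.
have -> : K `^ p * Vx * (R0 `^ beta / (b - a)) `^ (s / beta * p) * (m / Vx * (m / Vx)) =
   m * (K `^ p * (R0 `^ beta / (b - a)) `^ (s / beta * p) * (m / Vx)).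
  by field; rewrite !gt_eqF // subr_gt0.
by rewrite ler_peMr.
Qed.

Lemma measure_le_integral (Y S : set X) (f : X -> \bar R) (a J : R) :
  measurable Y -> measurable S -> S `<=` Y -> measurable_fun Y f -> (forall x, 0 <= f x)%E ->
  0 < a -> (forall x, S x -> (a%:E <= f x)%E) -> (\int[mu]_(x in Y) f x <= J%:E)%E ->
  (mu S <= (a^-1 * J)%:E)%E.
Proof.
move=> mY mS SY mf f0 a0 le_f intJ; rewrite EFinM lee_pdivlMl //.
apply: le_trans intJ; apply: (@le_trans _ _ (\int[mu]_(x in S) f x)%E).
  rewrite -integral_cst //; apply: ge0_le_integral => //.
  - by move=> x _; rewrite lee_fin ltW.
  - exact: (measurable_funS mY SY mf).
exact: ge0_subset_integral.
Qed.

(** The extension has smoothness [s] on the whole space, where balls satisfy mass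
    bounds at all scales.  With thresholds [theta^n], [theta = 2^(-(s-e)/beta)] and
    [e p < Q], the bad sets decay, but more slowly than the masses of balls: this
    is the regime of [weak_type_separation]. *)
Lemma density_of_extension (s p : R) (q : \bar R) :
  0 < s -> (s%:E < qm_index setT rho)%E -> 0 < p -> (0 < q)%E ->
  extension_domain rho mu Omega s p q -> measure_density rho mu Omega.
Proof.
move=> s0 s_lt p0 q0 [CE CE0 ext].
have le_s : le_qm_index q s setT rho.
  by split; [exact: ltW|move=> sE; move: s_lt; rewrite sE ltxx].
have [beta [D [c [sb sbq Dm c1 [snowT mD]]]]] :=
  test_metric hX hdoubling hOmega s0 le_s (@subsetT _ Omega).
have b0 : 0 < beta by exact: lt_le_trans sb.
have c0 : 0 < c by exact: lt_le_trans c1.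
have snow := snowflake_sub (@subsetT _ Omega) snowT.
apply: (density_of_separation hX hdoubling hOmega hOmega_perfect hOmega_two hOmega_pos
  b0 c1 Dm snow mD).
have [C C0 cut] := cutoff_norm mu rho_ge0 hOmega s0 p0 q0 c0 sb sbq Dm snow mD.
have [Cd Cd0 dmD] := snowflake_doubling_metric hX hdoubling b0 c1 Dm snowT.
have densT : measure_density rho mu setT.
  by exists 1 => // x r _ _ _; rewrite setIT mul1e.
have [c3 [K [c30 K0 data]]] :=
  scale_data_in_ball hX b0 c1 Cd0 hQ snowT dmD measurableT densT s0 p0.
set gamma := (2^-1 : R) `^ (s * p / beta) in data.
set eta := (2^-1 : R) `^ (Q / beta) in data.
pose e := Num.min (s / 2) (Q / (2 * p)).
have e0 : 0 < e by rewrite lt_min !divr_gt0 // mulr_gt0.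
have es : e < s.
  by rewrite gt_min ltr_pdivrMr // ltr_pMr // ltr1n.
have ep : e * p < Q.
  rewrite -ltr_pdivlMr // gt_min; apply/orP; right.
  by rewrite ltr_pM2l // ltf_pV2 ?posrE ?mulr_gt0 // ltr_pMl // ltr1n.
pose theta := (2^-1 : R) `^ ((s - e) / beta).
have th0 : 0 < theta by rewrite powR_gt0 // invr_gt0.
have th1 : theta < 1.
  by rewrite -[ltRHS](powRr0 2^-1); apply: half_powR_lt; rewrite divr_gt0 // subr_gt0.
have gth : gamma / theta `^ p = 2^-1 `^ (e * p / beta).
  rewrite /gamma /theta -powRrM -powRB; last by apply/implyP => _; rewrite gt_eqF // invr_gt0.
  by congr (_ `^ _); field; rewrite gt_eqF.
have eta_d : eta < gamma / theta `^ p.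
  by rewrite gth; apply: half_powR_lt; rewrite ltr_pM2r // invr_gt0.
have d1 : gamma / theta `^ p < 1.
  by rewrite gth -[ltRHS](powRr0 2^-1); apply: half_powR_lt; rewrite divr_gt0 // mulr_gt0.
have g0 : 0 < gamma by rewrite powR_gt0 // invr_gt0.
have eta0 : 0 < eta by rewrite powR_gt0 // invr_gt0.
have c3i : 0 <= c3^-1 by rewrite invr_ge0 ltW.
have [C1 [kappa [C10 kappa0 sep]]] :=
  weak_type_separation mu Dm (dm_measurable_ball dmD) p0 th0 th1 g0 eta0 c3i eta_d d1.
set L := K * (2 * (CE * (C + 1))) `^ p / c3.
have CC : 0 < CE * (C + 1) by rewrite mulr_gt0 // addr_gt0.
have L0 : 0 < L by rewrite divr_gt0 // mulr_gt0 // powR_gt0 // mulr_gt0.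
have k1 : 0 < 1 + kappa by rewrite addr_gt0.
exists (C1 * c3 * L `^ (1 + kappa)), (s / beta * p * (1 + kappa)), kappa; split=> //.
- by rewrite mulr_gt0 ?powR_gt0 // mulr_gt0.
- by rewrite mulr_gt0 // mulr_gt0 // divr_gt0.
move=> x R0 a b Ox R00 R01 a0 ab bR /=; rewrite -/(V x R0).
set m := fine (mu (Omega `&` qball D x b)); set u := cutoff D x a b.
set Vx := V x R0; have Vx0 : 0 < Vx by exact: V_gt0.
have m0 : 0 <= m by exact: fine_ge0.
have [mE|m_neq0] := eqVneq m 0.
  rewrite (m_eq0 hX hOmega b0 c1 snow mD R0 Ox a0 ab mE) lee_fin.
  by apply: mulr_ge0; rewrite ?powR_ge0 //; apply: mulr_ge0; rewrite ?powR_ge0 //;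
     apply: mulr_ge0; rewrite ?(ltW Vx0) // mulr_ge0 ?powR_ge0 // mulr_ge0 // ltW.
have m_gt0 : 0 < m by rewrite lt0r m_neq0.
have mu_ : measurable_fun Omega u by exact: measurable_cutoff.
have le_m : (mu (Omega `&` qball D x b) <= m%:E)%E.
  by rewrite /m fineK // (dist_ball_fin hX hOmega b0 c1 snow mD Ox a0 ab).
have le_N := cut x a b m Ox ab m0 le_m.
have Nu : dotN rho mu Omega s p q u by split=> //; exact: le_lt_trans le_N (ltry _).
have le_L := cutoff_Lp_norm hX hOmega b0 c1 snow mD Ox a0 ab p0 mu_.
have Nsu : N_space rho mu Omega s p q u by split=> //; exact: le_lt_trans le_L (ltry _).
have [v [_ vu le_v]] := ext u Nsu.
set w := (b - a) `^ (- (s / beta)).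
have w1 : 1 <= w.
  have ba1 : b - a <= 1.
    apply: (@le_trans _ _ b); first by rewrite lerBlDr lerDl ltW.
    apply: (le_trans bR); apply: (@le_trans _ _ (1 `^ beta)); last by rewrite powR1.
    by apply: powR_le; rewrite // ltW.
  rewrite /w powRN -powR_invl ?subr_ge0 ?(ltW ab) //.
  apply: (@le_trans _ _ (1 `^ (s / beta))); first by rewrite powR1.
  apply: powR_le => //; first by rewrite divr_ge0 // ltW.
  by rewrite invf_ge1 // subr_gt0.
have w0 : 0 < w by exact: lt_le_trans w1.
set M0 := CE * (C + 1) * w * m `^ p^-1.
have M00 : 0 < M0 by apply: mulr_gt0; rewrite ?powR_gt0 // mulr_gt0.
have ltM : (dotN_norm rho mu setT s p q v < (2 * M0)%:E)%E.
  apply: (@le_lt_trans _ _ M0%:E); last by rewrite lte_fin ltr_pMl // ltr1n.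
  apply: (@le_trans _ _ (N_norm rho mu setT s p q v)).
    by rewrite /N_norm leeDl // Lp_norm_ge0.
  apply: (le_trans le_v).
  apply: (@le_trans _ _ (CE%:E * (C * w * m `^ p^-1 + m `^ p^-1)%:E)%E).
    by apply: lee_wpmul2l; rewrite ?lee_fin ?(ltW CE0) // EFinD; apply: leeD.
  rewrite -EFinM lee_fin /M0 -!mulrA; apply: ler_wpM2l; first exact: ltW.
  by rewrite mulrDl mul1r lerD2l ler_peMl // powR_ge0.
have M20 : 0 < 2 * M0 by rewrite mulr_gt0.
have [H HH] := data q x R0 v (2 * M0) q0 R00 R01 M20 ltM.
rewrite setIT -/(V x R0) -/Vx in HH.
set S1 := _ `&` [set y | (D x y <= a)%R]; set S0 := _ `&` [set y | (b <= D x y)%R].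
have mS1 : measurable S1 := measurable_inner_set hX hOmega mD R0 a Ox.
have mS0 : measurable S0 := measurable_outer_set hX hOmega mD R0 b Ox.
have h1 : forall y z, qball rho x R0 y -> qball rho x R0 z -> D y z < 2 * (c * R0 `^ beta).
  move=> y z By Bz; apply: (le_lt_trans (pm_tri Dm x y z)).
  rewrite mulrDl mul1r; apply: ltrD.
    by rewrite (pm_sym Dm); apply: (dist_lt_of_rho rho_ge0 b0 c1 snowT (ltW R00)).
  exact: (dist_lt_of_rho rho_ge0 b0 c1 snowT (ltW R00)).
have h2 : (mu (qball rho x R0) <= (c3^-1 * (c3 * Vx))%:E)%E.
  by rewrite mulKf ?gt_eqF // /Vx /V fineK // (qm_ball_fin hX).
have mB : measurable (qball rho x R0) by exact: (qm_measurable_ball hX).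
have S1B : S1 `<=` qball rho x R0 by move=> y [[]].
have S0B : S0 `<=` qball rho x R0 by move=> y [[]].
have h3 y z : S1 y -> S0 z -> 1 <= `|v y - v z|.
  move=> S1y S0z; rewrite (vu y S1y.1.2) (vu z S0z.1.2).
  rewrite [u y](cutoff_inner ab S1y) [u z](cutoff_outer ab S0z).
  by rewrite subr0 normr1.
apply: (le_trans (sep _ _ _ _ _ _ _ _ _ HH h1 h2 mB mS1 mS0 S1B S0B h3)).
rewrite lee_fin le_eqVlt; apply/orP; left; apply/eqP.
set t := (R0 `^ beta / (b - a)) `^ (s / beta).
have t0 : 0 < t by rewrite powR_gt0 // divr_gt0 ?powR_gt0 // subr_gt0.
have -> : K * (R0 `^ s * (2 * M0)) `^ p / (c3 * Vx) = L * (t `^ p * (m / Vx)).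
  have -> : R0 `^ s * (2 * M0) = 2 * (CE * (C + 1)) * (t * m `^ p^-1).
    by rewrite /t -(scale_ratio b0 R0 ab s) /M0 /w; ring.
  have g1 : 0 <= 2 * (CE * (C + 1)) by rewrite mulr_ge0 // ltW.
  have g2 : 0 <= t * m `^ p^-1 by rewrite mulr_ge0 ?powR_ge0 // ltW.
  rewrite (powRM _ g1 g2) (powRM _ (ltW t0) (powR_ge0 _ _)) (powRVK m0 (lt0r_neq0 p0)) /L.
  by field; rewrite !gt_eqF.
have mV : 0 <= m / Vx by rewrite divr_ge0 // ltW.
rewrite (powRM _ (ltW L0)); last by rewrite mulr_ge0 ?powR_ge0.
rewrite (powRM _ (powR_ge0 _ _) mV).
have -> : (R0 `^ beta / (b - a)) `^ (s / beta * p * (1 + kappa)) = (t `^ p) `^ (1 + kappa).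
  by rewrite /t -!powRrM mulrA.
by ring.
Qed.

Lemma powR_le_expR (z tau : R) : 0 <= z -> 0 < tau -> (z / tau) `^ tau <= expR z.
Proof.
move=> z0 t0; have -> : expR z = expR (z / tau) `^ tau.
  by rewrite -expRM divfK // gt_eqF.
apply: powR_le; rewrite ?(ltW t0) ?divr_ge0 ?(ltW t0) //.
by apply: le_trans (expR_ge1Dx _); rewrite lerDr.
Qed.

(** The exponential dominates the power [2 p], [p = Q / eps], of the quotient; one
    factor of the relative mass comes from each of the two [p]-th powers. *)
Lemma density_of_exponential (eps s c1' c2' omega : R) (q : \bar R) :
  [/\ 0 < c1', 0 < c2', 0 < omega & (0 < q)%E] -> [/\ 0 < eps, 0 < s & eps < s] ->
  le_qm_index q s Omega rho ->
  (forall (x0 : X) (R0 : R), Omega x0 -> 0 < R0 -> R0 <= 1 ->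
    forall u : X -> R, dotN rho mu Omega s (Q / eps) q u ->
    (0 < dotN_norm rho mu Omega s (Q / eps) q u)%E ->
    let B0 := qball rho x0 R0 in
    mu.-integrable (B0 `&` Omega) (EFin \o u) /\
    (\int[mu]_(x in B0 `&` Omega)
       (expR ((c1' * (fine (mu B0) `^ (eps / Q)
                     * `|u x - mean mu (B0 `&` Omega) u|
                     / (R0 `^ s
                        * fine (dotN_norm rho mu Omega s (Q / eps) q u))))
              `^ omega))%:E
     <= c2'%:E * mu B0)%E) ->
  measure_density rho mu Omega.
Proof.
move=> [c1'0 c2'0 w0 q0] [e0 s0 es] le_s H.
have [beta [D [c [sb sbq Dm c1 [snow mD]]]]] :=
  test_metric hX hdoubling hOmega s0 le_s (@subset_refl _ Omega).
have b0 : 0 < beta by exact: lt_le_trans sb.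
have c0 : 0 < c by exact: lt_le_trans c1.
apply: (density_of_separation hX hdoubling hOmega hOmega_perfect hOmega_two hOmega_pos
  b0 c1 Dm snow mD).
have rho_eq0 x y : rho x y = 0 -> x = y.
  by case: hX => -[_ [? [? [_ _ h]]]] _ _ xy; have [_ [/(_ xy)] ] := h x y y I I I.
set p := Q / eps in H; have p0 : 0 < p by rewrite divr_gt0.
have pE : eps / Q = p^-1 by rewrite invf_div.
have [C C0 cut] := cutoff_norm mu rho_ge0 hOmega s0 p0 q0 c0 sb sbq Dm snow mD.
have [k k0 diam] := qm_diameter hX.
set tau := 2 * p / omega; have tau0 : 0 < tau by rewrite divr_gt0 // mulr_gt0.
set L := 2 * C / c1'; have L0 : 0 < L by rewrite divr_gt0 // mulr_gt0.
exists (tau `^ tau * c2' * L `^ (2 * p)), (s / beta * (2 * p)), 1; split=> //.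
- by rewrite mulr_gt0 ?powR_gt0 // mulr_gt0 // powR_gt0.
- by rewrite mulr_gt0 // ?divr_gt0 // mulr_gt0.
move=> x R0 a b Ox R00 R01 a0 ab bR /=; rewrite -/(V x R0).
set m := fine (mu (Omega `&` qball D x b)); set u := cutoff D x a b.
set Vx := V x R0; have Vx0 : 0 < Vx by exact: V_gt0.
have m0 : 0 <= m by exact: fine_ge0.
set bound := (X in (_ <= X%:E)%E).
have [mE|m_neq0] := eqVneq m 0.
  rewrite (m_eq0 hX hOmega b0 c1 snow mD R0 Ox a0 ab mE) lee_fin /bound.
  by apply: mulr_ge0; rewrite ?powR_ge0 //; apply: mulr_ge0; rewrite ?powR_ge0 //;
     apply: mulr_ge0; rewrite ?(ltW Vx0) // mulr_ge0 ?powR_ge0 // mulr_ge0 ?powR_ge0 // ltW.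
have m_gt0 : 0 < m by rewrite lt0r m_neq0.
have bound0 : 0 < bound.
  rewrite /bound; apply: mulr_gt0; last by rewrite powR_gt0 // divr_gt0.
  apply: mulr_gt0; last by rewrite powR_gt0 // divr_gt0 ?powR_gt0 // subr_gt0.
  by apply: mulr_gt0 => //; rewrite mulr_gt0 ?powR_gt0 // mulr_gt0 // powR_gt0.
have mu_ : measurable_fun Omega u by exact: measurable_cutoff.
have le_m : (mu (Omega `&` qball D x b) <= m%:E)%E.
  by rewrite /m fineK // (dist_ball_fin hX hOmega b0 c1 snow mD Ox a0 ab).
have le_N := cut x a b m Ox ab m0 le_m.
have Nu : dotN rho mu Omega s p q u by split=> //; exact: le_lt_trans le_N (ltry _).
set S1 := _ `&` [set y | (D x y <= a)%R]; set S0 := _ `&` [set y | (b <= D x y)%R].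
have mS1 : measurable S1 := measurable_inner_set hX hOmega mD R0 a Ox.
have mS0 : measurable S0 := measurable_outer_set hX hOmega mD R0 b Ox.
have S1O : S1 `<=` Omega by move=> y [[]].
have S0O : S0 `<=` Omega by move=> y [[]].
have u1 y : S1 y -> u y = 1 by move=> S1y; rewrite [u y](cutoff_inner ab S1y).
have u0 y : S0 y -> u y = 0 by move=> S0y; rewrite [u y](cutoff_outer ab S0y).
have : (0 <= dotN_norm rho mu Omega s p q u)%E by exact: dotN_norm_ge0.
rewrite le_eqVlt => /predU1P[N0|N0].
  (* Gradients with arbitrarily small integral force one of the sets to be null. *)
  set K1 := 2 `^ p * 2 `^ (s * p) / (1 - 2 `^ (- (s * p))).
  have K10 : 0 < K1.
    rewrite divr_gt0 ?mulr_gt0 ?powR_gt0 // subr_gt0 powRN -powR_invl // -[ltRHS](powRr0 2^-1).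
    by apply: half_powR_lt; rewrite mulr_gt0.
  have r0 : 0 < 2 * (k * R0) by rewrite mulr_gt0 // mulr_gt0.
  set M := (bound / (2 * K1)) `^ p^-1 / (2 * (k * R0)) `^ s.
  have M0 : 0 < M by rewrite divr_gt0 ?powR_gt0 // divr_gt0 // mulr_gt0.
  have ltM : (dotN_norm rho mu Omega s p q u < M%:E)%E by rewrite -N0 lte_fin.
  have [G [mG G0 gG]] := pgradient_of_dotN rho_ge0 rho_eq0 hOmega s0 p0 q0 ltM r0.
  have -> : M * (2 * (k * R0)) `^ s = (bound / (2 * K1)) `^ p^-1.
    by rewrite /M divfK // gt_eqF // powR_gt0.
  have q1 : 0 <= bound / (2 * K1).
    by apply: divr_ge0; [exact: ltW|apply: mulr_ge0 => //; exact: ltW].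
  rewrite (powRVK q1 (lt0r_neq0 p0)) -/K1 => intG.
  have Gsum y z : S1 y -> S0 z -> (1 <= G y + G z)%E.
    move=> S1y S0z; have := gG y z (S1O _ S1y) (S0O _ S0z).
    rewrite u1 // u0 // subr0 normr1 powR1; apply.
    apply: (@le_lt_trans _ _ (k * R0)); last by rewrite ltr_pMl ?ltr1n // mulr_gt0.
    by apply: (diam x) => //; [exact: S1y.1.1|exact: S0z.1.1].
  have half0 : 0 < 2^-1 :> R by rewrite invr_gt0.
  have final S : measurable S -> S `<=` Omega -> (forall y, S y -> ((2^-1)%:E <= G y)%E) ->
      (mu S <= bound%:E)%E.
    move=> mS SO le_G; apply: (le_trans (measure_le_integral hOmega mS SO mG G0 half0 le_G intG)).
    by rewrite invrK lee_fin le_eqVlt; apply/orP; left; apply/eqP; field; rewrite gt_eqF.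
  rewrite ge_min; apply/orP.
  have [big1|] := pselect (forall y, S1 y -> ((2^-1)%:E <= G y)%E); first by left; exact: final.
  move=> /existsNP[y /not_implyP[S1y /negP]]; rewrite -ltNge => small; right.
  apply: final => // z S0z; rewrite leNgt; apply/negP => small2.
  have := Gsum y z S1y S0z; rewrite leNgt => /negP; apply.
  have -> : 1%E = ((2^-1)%:E + (2^-1)%:E)%E :> \bar R.
    by rewrite -EFinD -[X in X + _]mul1r -[X in _ + X]mul1r -mulrDl divff.
  exact: lteD.
have [int_u le_exp] := H x R0 Ox R00 R01 u Nu N0.
move: le_exp; rewrite pE -/(V x R0) -/Vx => le_exp.
set N := dotN_norm rho mu Omega s p q u in le_N N0 le_exp.
have Nfin : N \is a fin_num.
  by rewrite ge0_fin_numE ?(ltW N0) //; exact: le_lt_trans le_N (ltry _).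
set n := fine N in le_exp; have NE : N = n%:E by rewrite fineK.
have n0 : 0 < n by rewrite -lte_fin -NE.
set av := mean mu _ u in le_exp.
set B := qball rho x R0 `&` Omega in le_exp *.
have mB : measurable B by apply: measurableI => //; exact: (qm_measurable_ball hX).
set f := (F in (\int[mu]_(x in _) F x)%E) in le_exp.
have muB : mu (qball rho x R0) = Vx%:E by rewrite /Vx /V fineK // (qm_ball_fin hX).
rewrite muB -EFinM in le_exp.
set t := (R0 `^ beta / (b - a)) `^ (s / beta).
have t0 : 0 < t by rewrite powR_gt0 // divr_gt0 ?powR_gt0 // subr_gt0.
have Rs0 : 0 < R0 `^ s by rewrite powR_gt0.
have Vp0 : 0 < Vx `^ p^-1 by rewrite powR_gt0.
set Z := c1' * (Vx `^ p^-1 * 2^-1 / (R0 `^ s * n)).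
have Z0 : 0 < Z by rewrite mulr_gt0 // divr_gt0 ?mulr_gt0 // invr_gt0.
have zt : ((Z `^ omega) / tau) `^ tau = Z `^ (2 * p) / tau `^ tau.
  rewrite powR_divl ?powR_ge0 ?(ltW tau0) // -powRrM.
  by congr (_ `^ _ / _); rewrite /tau mulrC divfK // gt_eqF.
have LZ : Z^-1 <= L * t * (m `^ p^-1 / Vx `^ p^-1).
  have -> : Z^-1 = 2 / c1' * (R0 `^ s * n) / Vx `^ p^-1.
    by rewrite /Z; field; rewrite !gt_eqF // ?powR_gt0.
  have -> : L * t * (m `^ p^-1 / Vx `^ p^-1) =
      2 / c1' * (R0 `^ s * (C * (b - a) `^ (- (s / beta)) * m `^ p^-1)) / Vx `^ p^-1.
    by rewrite /L /t -(scale_ratio b0 R0 ab s); ring.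
  apply: ler_wpM2r; first by rewrite invr_ge0 ltW.
  apply: ler_wpM2l; first by rewrite divr_ge0 // ltW.
  by apply: ler_wpM2l; rewrite ?(ltW Rs0) // -lee_fin -NE.
have e1 : 0 <= m `^ p^-1 / Vx `^ p^-1 by rewrite divr_ge0 ?powR_ge0.
have e2 : 0 <= m / Vx by rewrite divr_ge0 // ltW.
have e3 : 0 <= L * t by rewrite mulr_ge0 // ltW.
have e4 : 0 <= 2 * p by rewrite mulr_ge0 // ltW.
have mf : measurable_fun B f.
  apply/measurable_EFinP; apply: measurableT_comp; first exact: measurable_expR.
  apply: (@measurableT_comp _ _ _ _ _ _ (fun z => z `^ omega)); first exact: measurable_powR.
  apply: (@measurable_funM _ _ _ _ (cst c1')) => //.
  apply: (@measurable_funM _ _ _ _ _ (cst (R0 `^ s * n)^-1)) => //.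
  apply: (@measurable_funM _ _ _ _ (cst (Vx `^ p^-1))) => //.
  apply: (@measurableT_comp _ _ _ _ _ _ (fun z : R => `|z|)) => //.
  apply: (@measurable_funB _ _ _ _ u (cst av)) => //.
  exact: (measurable_funS hOmega (@subIsetr _ _ _) mu_).
have final S : measurable S -> S `<=` B -> (forall y, S y -> 2^-1 <= `|u y - av|) ->
    (mu S <= bound%:E)%E.
  move=> mS SB big.
  have zt0 : 0 < Z `^ (2 * p) / tau `^ tau by rewrite divr_gt0 ?powR_gt0.
  have le_f y : S y -> ((Z `^ (2 * p) / tau `^ tau)%:E <= f y)%E.
    move=> Sy; rewrite lee_fin -zt; apply: (le_trans (powR_le_expR (powR_ge0 _ _) tau0)).
    rewrite ler_expR; apply: powR_le; rewrite ?(ltW w0) ?(ltW Z0) //.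
    apply: ler_wpM2l; first exact: ltW.
    apply: ler_wpM2r; first by rewrite invr_ge0 mulr_ge0 // ltW.
    by apply: ler_wpM2l; [exact: ltW|exact: big].
  have f0 y : (0 <= f y)%E by rewrite lee_fin expR_ge0.
  apply: (le_trans (measure_le_integral mB mS SB mf f0 zt0 le_f le_exp)).
  rewrite lee_fin invf_div /bound.
  have -> : (R0 `^ beta / (b - a)) `^ (s / beta * (2 * p)) = t `^ (2 * p) by rewrite powRrM.
  have -> : (m / Vx) `^ (1 + 1) = (m `^ p^-1 / Vx `^ p^-1) `^ (2 * p).
    rewrite -powR_divl ?(ltW Vx0) // -powRrM; congr (_ `^ _).
    by rewrite mulrCA mulVf ?gt_eqF // mulr1.
  have -> : tau `^ tau * c2' * L `^ (2 * p) * Vx * t `^ (2 * p) *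
      (m `^ p^-1 / Vx `^ p^-1) `^ (2 * p) =
      tau `^ tau * (L * t * (m `^ p^-1 / Vx `^ p^-1)) `^ (2 * p) * (c2' * Vx).
    rewrite (powRM _ e3 e1) (powRM _ (ltW L0) (ltW t0)).
    by ring.
  apply: ler_wpM2r; first by rewrite mulr_ge0 // ltW.
  apply: ler_wpM2l; first exact: powR_ge0.
  have -> : (Z `^ (2 * p))^-1 = Z^-1 `^ (2 * p) by rewrite powR_invl // ltW.
  apply: powR_le => //.
  by rewrite invr_ge0 ltW.
rewrite ge_min; apply/orP; have [g|g] := lerP av 2^-1.
  left; apply: final => // [y []//|y Sy].
  rewrite u1 //; apply: le_trans (ler_norm _).
  by rewrite lerBrDr -[leRHS](@divff _ 2) // -[X in _ <= X / _]/(1 + 1) mulrDl mul1r lerD2l.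
right; apply: final => // [y []//|y Sy].
by rewrite u0 // sub0r normrN; apply: le_trans (ler_norm _); exact: ltW.
Qed.
End Converse.

(** * Nets and local averages *)

Section Nets.
Context {R : realType} {d : measure_display} {X : measurableType d}.
Context {mu : {measure set X -> \bar R}} {D : X -> X -> R} {Cd Qd : R}.
Hypothesis dmD : doubling_metric D mu Cd Qd.

Let Dm : is_pmetric D := dm_pmetric dmD.
Let mD := dm_measurable_ball dmD.
Let V x r := fine (mu (qball D x r)).
Let muE x r : mu (qball D x r) = (V x r)%:E. Proof. by rewrite fineK // (dm_fin dmD). Qed.
Let V0 x r : 0 < r -> 0 < V x r. Proof. exact: (dm_gt0 dmD). Qed.

Lemma dm_mass_le x y r r' : 0 < r -> 0 <= r' -> r <= r' + D x y ->
  V x r' <= Cd * ((r' + D x y) / r) `^ Qd * V y r.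
Proof.
move=> r0 r'0 rr; apply: (@le_trans _ _ (V y (r' + D x y))); last exact: (dm_doubling dmD).
rewrite -lee_fin -!muE; apply: le_measure; rewrite ?inE //.
move=> z xz; apply: (le_lt_trans (pm_tri Dm x y z)).
by rewrite (pm_sym Dm y x) addrC ltrD2r.
Qed.

(** The disjoint balls of radius [h / 2] fit in a ball around [y], and each of them
    carries a fixed part of the mass of that ball. *)
Lemma packing (K h : R) (y : X) (z : nat -> X) (J : set nat) : 0 < h -> 0 <= K ->
  trivIset J (fun i => qball D (z i) (h / 2)) ->
  (forall i, J i -> D y (z i) < K * h) ->
  forall n, \sum_(i < n) (\1_J (i : nat) : R) <= Cd * (4 * K + 2) `^ Qd.
Proof.
move=> h0 K0 triv near n; set N := Cd * _.
have h20 : 0 < h / 2 by rewrite divr_gt0.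
have hh : h / 2 <= h by rewrite ler_pdivrMr // ler_pMr // ler1n.
set W := V y ((K + 1) * h).
have K1h : 0 < (K + 1) * h by rewrite mulr_gt0 // ltr_wpDl.
have W0 : 0 < W by exact: V0.
pose F i := if pselect (J i) then qball D (z i) (h / 2) else set0.
have mF i : measurable (F i) by rewrite /F; case: (pselect (J i)) => Ji /=; [exact: mD|exact: measurable0].
have tF : trivIset setT F.
  move=> i j _ _; rewrite /F; case: (pselect (J i)) => Ji /=; case: (pselect (J j)) => Jj /=.
  - by move=> ne; apply: triv.
  - by rewrite setI0 => -[].
  - by rewrite set0I => -[].
  - by rewrite setI0 => -[].
have sub : \big[setU/set0]_(i < n) F i `<=` qball D y ((K + 1) * h).
  rewrite -bigcup_mkord => x [i _]; rewrite /F; case: pselect => //= Ji zx.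
  apply: (le_lt_trans (pm_tri Dm (z i) y x)); rewrite mulrDl mul1r.
  by apply: ltrD; [exact: near|exact: lt_le_trans hh].
have NW i : J i -> W <= N * V (z i) (h / 2).
  move=> Ji; have le_r : h / 2 <= (K + 1) * h + K * h.
    apply: (le_trans hh); rewrite -mulrDl ler_peMl ?(ltW h0) // -addrA [1 + _]addrC addrA.
    by rewrite lerDr addr_ge0.
  rewrite /N; have -> : 4 * K + 2 = ((K + 1) * h + K * h) / (h / 2) by field; rewrite gt_eqF.
  apply: (@le_trans _ _ (V (z i) ((K + 1) * h + K * h))); last exact: (dm_doubling dmD).
  rewrite -lee_fin -!muE; apply: le_measure; rewrite ?inE //.
  move=> x yx; apply: (le_lt_trans (pm_tri Dm y (z i) x)); rewrite addrC.
  by apply: ltrD => //; rewrite (pm_sym Dm); exact: near.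
have N0 : 0 <= N.
  have [y1] : exists y1 : X, y1 = y by exists y.
  have := dm_doubling dmD y h0 (lexx h); rewrite divff ?gt_eqF // powR1 mulr1 => hCd.
  have Cd0 : 0 <= Cd.
    by rewrite -(pmulr_lge0 _ (V0 y h0)); apply: le_trans hCd; exact: ltW (V0 y h0).
  by rewrite mulr_ge0 ?powR_ge0.
have key : \sum_(i < n) \1_J (i : nat) * W <= N * W.
  apply: (@le_trans _ _ (\sum_(i < n) N * fine (mu (F i)))).
    apply: ler_sum => i _; rewrite indicE /F; case: (pselect (J i)) => Ji /=.
      by rewrite mem_set //= mul1r; exact: NW.
    by rewrite memNset //= mul0r measure0 /= mulr0.
  rewrite -mulr_sumr; apply: ler_wpM2l => //.
  have mFfin i : mu (F i) \is a fin_num.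
    by rewrite /F; case: (pselect (J i)) => Ji /=; [exact: (dm_fin dmD)|rewrite measure0].
  rewrite -lee_fin -sumEFin -muE.
  rewrite (eq_bigr (fun i : 'I_n => mu (F i))); last by move=> i _; rewrite fineK.
  rewrite -measure_bigsetU //; apply: le_measure; rewrite ?inE //.
  by apply: bigsetU_measurable.
by move: key; rewrite -mulr_suml ler_pM2r.
Qed.

(** The centres of a maximal disjoint family of balls of radius [h / 2]. Packing
    makes the family countable, which the measurability of sums over it needs. *)
Lemma net_exists (h : R) : 0 < h -> exists (z : nat -> X) (I : set nat),
  trivIset I (fun i => qball D (z i) (h / 2)) /\
  forall x, exists2 i, I i & D (z i) x < h.
Proof.
move=> h0; have h20 : 0 < h / 2 by rewrite divr_gt0.
pose B x := qball D x (h / 2).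
have Bx x : B x x by rewrite /B /qball /= (pm_xx Dm).
have [E [_ trivE maxE]] := ex_maximal_disjoint_subcollection B setT.
have covE x : exists2 z, E z & D z x < h.
  apply: contrapT => no; have nEx : ~ E x.
    by move=> Ex; apply: no; exists x; rewrite ?(pm_xx Dm).
  apply: (maxE (E `|` [set x])) => //.
    by split=> [|/(_ x) sub]; [exact: subsetUl|apply: nEx; apply: sub; right].
  have far z : E z -> B x `&` B z !=set0 -> False.
    move=> Ez [w [xw zw]]; apply: no; exists z => //.
    apply: (le_lt_trans (pm_tri Dm w z x)).
    have -> : h = h / 2 + h / 2 by rewrite -mulrDl -mulr2n -(mulr_natr h 2) mulfK.
    by apply: ltrD; [exact: zw|rewrite (pm_sym Dm); exact: xw].
  move=> i j [Ei|/= ->] [Ej|/= ->] // ne; first exact: trivE.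
    by exfalso; apply: (far _ Ei); rewrite setIC.
  by exfalso; apply: (far _ Ej).
have countE : countable E.
  pose x0 : X := point.
  have -> : E = \bigcup_(n in [set: nat]) (E `&` qball D x0 (n%:R * h)).
    apply/seteqP; split=> [x Ex|x [n _ []] //].
    exists (Num.bound (D x0 x / h)) => //; split=> //.
    by rewrite /qball /= -ltr_pdivrMr // archi_boundP // divr_ge0 ?(pm_ge0 Dm) // ltW.
  apply: bigcup_countable => // n _; apply: finite_set_countable; apply: contrapT.
  move=> /infiniteP/pcard_leP[f].
  have fE i : (E `&` qball D x0 (n%:R * h)) (f i) by exact: funS.
  have trivf : trivIset setT (fun i => B (f i)).
    move=> i j _ _ ne; have fij : f i = f j := trivE _ _ (fE i).1 (fE j).1 ne.
    by apply: (@inj _ _ _ f) => //; rewrite inE.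
  have nR0 : 0 <= n%:R :> R by exact: ler0n.
  have nearf i : [set: nat] i -> D x0 (f i) < n%:R * h by move=> _; exact: (fE i).2.
  have pack := packing h0 nR0 trivf nearf.
  set N := Cd * _ in pack.
  have N0 : 0 <= N by have := pack 0%N; rewrite big_ord0.
  have := pack (Num.bound N).
  rewrite (eq_bigr (fun=> 1)); last by move=> i _; rewrite indicE mem_set.
  rewrite sumr_const card_ord -[1 *+ _]/(_%:R) leNgt => /negP; apply.
  exact: archi_boundP.
move: countE => /countable_injP[g injg].
pose I := g @` E.
have /choice[z zP] : forall i, exists z, I i -> E z /\ g z = i.
  move=> i; have [[z Ez gz]|nI] := pselect (I i); first by exists z.
  by exists point.
exists z, I; split=> [i j Ii Ij ne|x].
  have [Ei gi] := zP i Ii; have [Ej gj] := zP j Ij.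
  by rewrite -gi -gj; congr g; exact: (trivE _ _ Ei Ej ne).
have [w Ew wx] := covE x; exists (g w); first by exists w.
have [Ez gz] := zP (g w) ltac:(by exists w).
by rewrite (injg _ _ _ _ gz) // inE.
Qed.

Lemma dm_const_gt0 : 0 < Cd.
Proof.
have V1 : 0 < V point 1 by exact: V0.
have := dm_doubling dmD point ltr01 (lexx 1); rewrite divff // powR1 mulr1 => le_V.
by rewrite -(pmulr_lgt0 _ V1); exact: lt_le_trans le_V.
Qed.

(** The averages of [H] over balls need not be measurable in the centre; a sum
    over a net dominates them, and its integral is under control because the
    balls of a net have bounded overlap. *)
Lemma average_majorant (L : R) : 0 <= L -> exists2 C, 0 < C &
  forall (Y : set X) (h : R) (H : X -> \bar R), measurable Y -> 0 < h ->
    measurable_fun Y H -> (forall x, 0 <= H x)%E ->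
    exists G : X -> \bar R, [/\ measurable_fun setT G, forall x, (0 <= G x)%E,
      forall x, (((V x h)^-1)%:E * \int[mu]_(y in qball D x (L * h) `&` Y) H y <= G x)%E &
      (\int[mu]_x G x <= C%:E * \int[mu]_(x in Y) H x)%E].
Proof.
move=> L0; have Cd0 := dm_const_gt0.
set kappa := Cd * 2 `^ Qd; have kappa0 : 0 < kappa by rewrite mulr_gt0 // powR_gt0.
have L1 : 0 <= L + 1 by rewrite addr_ge0.
set N := Cd * (4 * (L + 1) + 2) `^ Qd.
have N0 : 0 < N by rewrite mulr_gt0 // powR_gt0 // ltr_wpDl // mulr_ge0.
exists (kappa * N); first by rewrite mulr_gt0.
move=> Y h H mY h0 mH H0; have [z [I [triv cov]]] := net_exists h0.
pose S i := [set x | I i /\ D (z i) x < h].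
pose T i := [set y | I i /\ D (z i) y < (L + 1) * h].
have mIset i (r : R) : measurable [set x | I i /\ D (z i) x < r].
  have [Ii|nI] := pselect (I i).
    by rewrite (_ : mkset _ = qball D (z i) r) //; apply/seteqP; split=> x //= -[].
  by rewrite (_ : mkset _ = set0) //; apply/seteqP; split=> x //= -[].
have mS i : measurable (S i) by exact: mIset.
have mT i : measurable (T i) by exact: mIset.
pose J i := (\int[mu]_(y in Y) (H y * (\1_(T i) y)%:E))%E.
have J0 i : (0 <= J i)%E.
  by apply: integral_ge0 => y _; rewrite mule_ge0 // lee_fin.
pose k i := ((kappa / V (z i) h)%:E * J i)%E.
have k0 i : (0 <= k i)%E.
  by rewrite mule_ge0 // lee_fin divr_ge0 ?(ltW kappa0) // ltW // V0.
pose g i x := (k i * (\1_(S i) x)%:E)%E.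
have g0 i x : (0 <= g i x)%E by rewrite mule_ge0 // lee_fin.
have mind i : measurable_fun setT (fun x => (\1_(S i) x)%:E : \bar R).
  by apply/measurable_EFinP; exact: measurable_indic.
have mg i : measurable_fun setT (g i) by exact: measurable_funeM.
exists (fun x => \sum_(i <oo) g i x)%E; split.
- exact: ge0_emeasurable_sum.
- by move=> x; apply: nneseries_ge0.
- move=> x; have [i Ii ix] := cov x.
  have le_V : V (z i) h <= kappa * V x h.
    have hh : h <= 2 * h by rewrite ler_peMl ?ler1n // ltW.
    have -> : kappa = Cd * (2 * h / h) `^ Qd by rewrite mulfK // gt_eqF.
    apply: le_trans (dm_doubling dmD x h0 hh).
    rewrite -lee_fin -!muE; apply: le_measure; rewrite ?inE // => w iw.
    apply: (le_lt_trans (pm_tri Dm (z i) x w)); rewrite mulrDl mul1r.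
    by apply: ltrD => //; rewrite (pm_sym Dm).
  apply: (@le_trans _ _ (g i x)); last first.
    have h1 := @nneseries_lim_ge _ (fun j => g j x) xpredT 0 i.+1 (fun j _ _ => g0 j x).
    by apply: le_trans h1; rewrite big_nat_recr //= leeDr // sume_ge0.
  have -> : g i x = k i by rewrite /g indicE mem_set ?mule1.
  apply: lee_pmul.
  - by rewrite lee_fin invr_ge0 ltW // V0.
  - by apply: integral_ge0.
  - rewrite lee_fin ler_pdivlMr ?V0 // mulrC ler_pdivrMr ?V0 //.
  have -> : J i = (\int[mu]_(y in Y `&` T i) H y)%E by rewrite integral_mkcondr epatch_indic.
  apply: ge0_subset_integral.
  - exact: measurableI.
  - exact: measurableI.
  - exact: (measurable_funS mY (@subIsetl _ _ _) mH).
  - by [].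
  move=> y [xy Yy]; split=> //; split=> //; rewrite mulrDl mul1r addrC.
  by apply: (le_lt_trans (pm_tri Dm x (z i) y)); apply: ltrD.
rewrite integral_nneseries //.
have le_term i : (\int[mu]_x g i x <= kappa%:E * J i)%E.
  have -> : (\int[mu]_x g i x = k i * \int[mu]_x (\1_(S i) x)%:E)%E.
    by apply: ge0_integralZl => // x _; rewrite lee_fin.
  rewrite integral_indic // setIT.
  have [Ii|nI] := pselect (I i); last first.
    have -> : S i = set0 by apply/seteqP; split=> x //= -[].
    by rewrite measure0 mule0 mule_ge0 // lee_fin ltW.
  have -> : S i = qball D (z i) h by apply/seteqP; split=> x //= -[].
  rewrite muE /k muleAC -EFinM divfK ?gt_eqF ?V0 //.
apply: (@le_trans _ _ (\sum_(i <oo) kappa%:E * J i)%E).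
  by apply: lee_nneseries => i *; [exact: integral_ge0|exact: le_term].
rewrite nneseriesZl //.
rewrite [(kappa * N)%:E]EFinM -[leRHS]muleA; apply: lee_wpmul2l; first by rewrite lee_fin ltW.
rewrite /J -integral_nneseries //; last first.
- by move=> i y _; rewrite mule_ge0 // lee_fin.
- by move=> i; apply: emeasurable_funM => //; apply: measurable_funTS; apply/measurable_EFinP; exact: measurable_indic.
have N0' : (0 <= N%:E)%E by rewrite lee_fin ltW.
rewrite -ge0_integralZl //; apply: ge0_le_integral => //.
- by move=> y _; apply: nneseries_ge0 => i _ _; rewrite mule_ge0 // lee_fin.
- apply: ge0_emeasurable_sum => [i y _ _|i _]; first by rewrite mule_ge0 // lee_fin.
  by apply: emeasurable_funM => //; apply: measurable_funTS; apply/measurable_EFinP; exact: measurable_indic.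
- exact: measurable_funeM.
move=> y Yy; apply: lime_le.
  by apply: is_cvg_nneseries => i _ _; rewrite mule_ge0 // lee_fin.
apply: nearW => n; rewrite -ge0_sume_distrr; last by move=> i _; rewrite lee_fin.
rewrite muleC; apply: lee_wpmul2r => //; rewrite sumEFin lee_fin big_mkord.
pose Jy := [set i | T i y].
rewrite (eq_bigr (fun i : 'I_n => \1_Jy (i : nat))); last first.
  by move=> i _; rewrite !indicE; congr (_%:R); congr (nat_of_bool _); apply/asboolP/asboolP.
apply: (packing (h := h) (y := y) (z := z)) => //.
  by apply: sub_trivIset triv => i [].
by move=> i [_ iy]; rewrite (pm_sym Dm).
Qed.
End Nets.

(** * Smoothing by averages over the domain *)

Section RealEstimates.
Context {R : realType}.

Lemma quotient_lip (N N' A A' alpha b E t : R) :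
  0 < alpha -> alpha <= A -> alpha <= A' -> 0 <= t -> 0 <= E -> 0 <= b ->
  `|N - N'| <= t * E -> `|N'| <= E -> `|A - A'| <= t * b ->
  `|N / A - N' / A'| <= t * (E / alpha) * (1 + b / alpha).
Proof.
move=> al0 alA alA' t0 E0 b0 NN N'E AA.
have A0 : 0 < A by exact: lt_le_trans alA.
have A'0 : 0 < A' by exact: lt_le_trans alA'.
have -> : N / A - N' / A' = (N - N') / A + (N' / A') * ((A' - A) / A).
  by field; rewrite !gt_eqF.
have iA : A^-1 <= alpha^-1 by rewrite lef_pV2.
have iA' : A'^-1 <= alpha^-1 by rewrite lef_pV2.
apply: (le_trans (ler_normD _ _)).
have -> : t * (E / alpha) * (1 + b / alpha) = t * E / alpha + (E / alpha) * (t * b / alpha).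
  by ring.
rewrite !normrM !normfV !(gtr0_norm A0) !(gtr0_norm A'0) [`|A' - A|]distrC.
have iA0 : 0 <= A^-1 by rewrite invr_ge0 ltW.
have iA'0 : 0 <= A'^-1 by rewrite invr_ge0 ltW.
apply: lerD; first by apply: ler_pM.
by apply: ler_pM; [exact: mulr_ge0|exact: mulr_ge0|exact: ler_pM|exact: ler_pM].
Qed.

(** The elementary inequality that replaces Jensen's: both cases [t <= lam] and
    [t >= lam] are clear. *)
Lemma le_add_power (p lam t : R) : 1 <= p -> 0 < lam -> 0 <= t ->
  t <= lam + lam `^ (1 - p) * t `^ p.
Proof.
move=> p1 l0 t0; have [tl|lt] := lerP t lam.
  by rewrite ler_wpDr // mulr_ge0 ?powR_ge0.
have tp : 0 < t by exact: lt_trans lt.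
apply: (@le_trans _ _ (lam `^ (1 - p) * t `^ p)); last by rewrite lerDr ltW.
have -> : 1 - p = - (p - 1) by ring.
rewrite powRN mulrC ler_pdivlMr ?powR_gt0 //.
have -> : t `^ p = t * t `^ (p - 1).
  rewrite -[X in X * _](powRr1 t0) -powRD ?(gt_eqF tp) ?implybT //.
  by congr (_ `^ _); ring.
by apply: ler_wpM2l => //; apply: powR_le; rewrite ?subr_ge0 ?(ltW l0) ?(ltW lt).
Qed.
End RealEstimates.

Section Averages.
Context {R : realType} {d : measure_display} {X : measurableType d}.
Context {mu : {measure set X -> \bar R}}.

(** The factor 2 leaves room to avoid strict inequalities between integrals,
    except when [J = 0]. *)
Lemma exists_le_average (S : set X) (H : X -> \bar R) (m J : R) :
  measurable S -> 0 < m -> (m%:E <= mu S)%E -> measurable_fun S H ->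
  (forall x, 0 <= H x)%E -> 0 <= J -> (\int[mu]_(x in S) H x <= J%:E)%E ->
  exists2 z, S z & (H z <= (2 * J / m)%:E)%E.
Proof.
move=> mS m0 mm mH H0 J0 intH; apply: contrapT => no.
have big z : S z -> ((2 * J / m)%:E < H z)%E.
  by move=> Sz; rewrite ltNge; apply/negP => h; apply: no; exists z.
have pos z : S z -> (0 < H z)%E.
  move=> Sz; apply: le_lt_trans (big z Sz).
  by rewrite lee_fin divr_ge0 ?(ltW m0) // mulr_ge0.
move: J0; rewrite le_eqVlt => /predU1P[JE|J0].
  have int0 : (\int[mu]_(x in S) `|H x| = 0)%E.
    under eq_integral do rewrite gee0_abs //.
    apply/eqP; rewrite eq_le; apply/andP; split; last exact: integral_ge0.
    by apply: (le_trans intH); rewrite -JE.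
  have [/(_ int0) [N [mN N0 sN]] _] := ae_eq_integral_abs mu mS mH.
  have : (mu S <= mu N)%E.
    apply: le_measure; rewrite ?inE // => z Sz; apply: sN => /= /(_ Sz) Hz.
    by have := pos z Sz; rewrite Hz ltxx.
  by rewrite N0 leNgt => /negP; apply; apply: lt_le_trans mm; rewrite lte_fin.
have : ((2 * J / m)%:E * mu S <= J%:E)%E.
  apply: le_trans intH; rewrite -integral_cst //; apply: ge0_le_integral => //.
  - by move=> x _; rewrite lee_fin divr_ge0 ?(ltW m0) // mulr_ge0 // ltW.
  - by move=> x Sx; rewrite ltW // big.
rewrite leNgt => /negP; apply.
apply: (@lt_le_trans _ _ ((2 * J / m)%:E * m%:E)%E).
  by rewrite -EFinM lte_fin divfK ?gt_eqF // ltr_pMl // ltr1n.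
by apply: lee_wpmul2l => //; rewrite lee_fin divr_ge0 ?(ltW m0) // mulr_ge0 // ltW.
Qed.

(** The choice [lam = (J / m)^(1/p)] balances the two terms of [le_add_power]. *)
Lemma integral_norm_le_power (S : set X) (g : X -> R) (G : X -> \bar R) (p m J : R) :
  1 <= p -> measurable S -> 0 < m -> (mu S <= m%:E)%E -> measurable_fun S g ->
  measurable_fun S G -> (forall x, 0 <= G x)%E ->
  (forall x, S x -> ((`|g x| `^ p)%:E <= G x)%E) ->
  0 <= J -> (\int[mu]_(x in S) G x <= J%:E)%E ->
  (\int[mu]_(x in S) `|g x|%:E <= (2 * m * (J / m) `^ p^-1)%:E)%E.
Proof.
move=> p1 mS m0 Sm mg mG G0 gG J0 intG.
have p0 : 0 < p by exact: lt_le_trans p1.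
have step lam : 0 < lam ->
    (\int[mu]_(x in S) `|g x|%:E <= (lam * m + lam `^ (1 - p) * J)%:E)%E.
  move=> l0; set c := lam `^ (1 - p); have c0 : 0 <= c by exact: powR_ge0.
  apply: (@le_trans _ _ (\int[mu]_(x in S) (lam%:E + c%:E * G x))%E).
    apply: ge0_le_integral => //.
    - by apply/measurable_EFinP; apply: measurableT_comp.
    - by apply: emeasurable_funD => //; exact: measurable_funeM.
    move=> x Sx; apply: (@le_trans _ _ (lam + c * `|g x| `^ p)%:E).
      by rewrite lee_fin; exact: le_add_power.
    by rewrite EFinD EFinM leeD2l // lee_wpmul2l ?lee_fin // gG.
  rewrite ge0_integralD //; last first.
  - exact: measurable_funeM.
  - by move=> x _; rewrite mule_ge0 // lee_fin.
  - by move=> x _; rewrite lee_fin ltW.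
  rewrite integral_cst // ge0_integralZl //= ?lee_fin //.
  rewrite EFinD !EFinM; apply: leeD.
    by rewrite lee_wpmul2l ?lee_fin // ltW.
  by rewrite lee_wpmul2l ?lee_fin.
move: J0; rewrite le_eqVlt => /predU1P[JE|J0].
  rewrite -JE mul0r powR0 ?invr_eq0 ?gt_eqF // mulr0; apply/lee_addgt0Pr => e e0.
  have em : 0 < e / m by rewrite divr_gt0.
  by have := step _ em; rewrite -JE mulr0 addr0 divfK ?gt_eqF // add0e.
have l0 : 0 < (J / m) `^ p^-1 by rewrite powR_gt0 // divr_gt0.
apply: (le_trans (step _ l0)); rewrite lee_fin.
set lam := (J / m) `^ p^-1 in l0 *.
have lp : lam `^ p = J / m by rewrite /lam powRVK ?gt_eqF // divr_ge0 // ltW.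
have -> : lam `^ (1 - p) * J = lam * m.
  have -> : J = lam `^ p * m by rewrite lp divfK // gt_eqF.
  rewrite mulrA -powRD ?(gt_eqF l0) ?implybT // subrK powRr1 //.
  exact: ltW.
by rewrite le_eqVlt; apply/orP; left; apply/eqP; ring.
Qed.

Lemma kernel_integral (Y B : set X) (K g : X -> R) (kappa E : R) :
  measurable Y -> measurable B -> measurable_fun Y K -> measurable_fun Y g ->
  0 <= kappa -> (forall y, `|K y| <= kappa) -> (forall y, ~ B y -> K y = 0) ->
  (\int[mu]_(y in B `&` Y) `|g y|%:E <= E%:E)%E ->
  mu.-integrable Y (fun y => (K y * g y)%:E) /\
  `|\int[mu]_(y in Y) (K y * g y)| <= kappa * E.
Proof.
move=> mY mB mK mg k0 leK suppK intg.
have mKg : measurable_fun Y (fun y => K y * g y) by exact: measurable_funM.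
have le_int : (\int[mu]_(y in Y) `|(K y * g y)%:E| <= (kappa * E)%:E)%E.
  apply: (@le_trans _ _ (\int[mu]_(y in Y) (kappa%:E * (`|g y|%:E * (\1_B y)%:E)))%E).
    apply: ge0_le_integral => //.
    - by apply: measurableT_comp => //; exact/measurable_EFinP.
    - apply: measurable_funeM; apply: emeasurable_funM.
        by apply/measurable_EFinP; apply: measurableT_comp.
      by apply: measurable_funTS; apply/measurable_EFinP; exact: measurable_indic.
    move=> y _; rewrite -!EFinM lee_fin indicE; have [By|nB] := pselect (B y).
      by rewrite mem_set //= mulr1 normrM ler_wpM2r.
    by rewrite suppK // mul0r normr0 !mulr_ge0.
  rewrite ge0_integralZl //; last first.
    apply: emeasurable_funM.
      by apply/measurable_EFinP; apply: measurableT_comp.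
    by apply: measurable_funTS; apply/measurable_EFinP; exact: measurable_indic.
  rewrite EFinM; apply: lee_wpmul2l; first by rewrite lee_fin.
  apply: le_trans intg; rewrite setIC integral_mkcondr epatch_indic.
  by [].
have int : mu.-integrable Y (EFin \o (fun y => K y * g y)).
  apply/integrableP; split; first exact/measurable_EFinP.
  by apply: le_lt_trans le_int _; exact: ltry.
split=> //; rewrite -lee_fin EFin_normr_Rintegral //.
by apply: le_trans le_int; apply: le_abse_integral => //; exact/measurable_EFinP.
Qed.
End Averages.

(** * Differences of averages near the domain *)

Definition kernel (R : realType) (X : Type) (D : X -> X -> R) (h : R) (x y : X) : R :=
  cutoff D x (3 * h) (4 * h) y.

Definition smoothing (R : realType) (d : measure_display) (X : measurableType d)
    (mu : {measure set X -> \bar R}) (D : X -> X -> R) (Omega : set X) (h : R)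
    (u : X -> R) (x : X) : R :=
  (\int[mu]_(y in Omega) (kernel D h x y * u y)) / (\int[mu]_(y in Omega) kernel D h x y).

Section Smoothing.
Context {R : realType} {d : measure_display} {X : measurableType d}.
Context {mu : {measure set X -> \bar R}} {D : X -> X -> R} {Cd Qd : R}.
Context {Omega : set X} {c2 r1 : R}.
Hypothesis dmD : doubling_metric D mu Cd Qd.
Hypothesis Qd0 : 0 < Qd.
Hypothesis mO : measurable Omega.
Hypotheses (c20 : 0 < c2) (r10 : 0 < r1).
Hypothesis dens : forall x r, Omega x -> 0 < r -> r <= r1 ->
  c2 * fine (mu (qball D x r)) <= fine (mu (qball D x r `&` Omega)).

Let Dm : is_pmetric D := dm_pmetric dmD.
Let mD := dm_measurable_ball dmD.
Let V x r := fine (mu (qball D x r)).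
Let muE x r : mu (qball D x r) = (V x r)%:E. Proof. by rewrite fineK // (dm_fin dmD). Qed.
Let V0 x r : 0 < r -> 0 < V x r. Proof. exact: (dm_gt0 dmD). Qed.
Let Cd0 : 0 < Cd := dm_const_gt0 dmD.
Local Notation f h u x := (smoothing mu D Omega h u x).
Local Notation S x r := (qball D x r `&` Omega).

Let mS x r : measurable (S x r). Proof. exact: measurableI. Qed.

(** Points at which averages over the domain at scale [h] make sense. *)
Definition near_domain (h : R) (x : X) := exists2 w, Omega w & D x w < 2 * h.

Let c3 := c2 / (Cd * 4 `^ Qd).
Let c30 : 0 < c3. Proof. by rewrite divr_gt0 // mulr_gt0 // powR_gt0. Qed.

(** This is where the measure density of the domain is used. *)
Lemma mass_near_domain h x w : 0 < h -> h <= r1 -> Omega w -> D x w < 3 * h ->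
  ((c3 * V x h)%:E <= mu (S w h))%E.
Proof.
move=> h0 hr Ow xw; have Sfin : mu (S w h) \is a fin_num.
  rewrite ge0_fin_numE //; apply: (@le_lt_trans _ _ (mu (qball D w h))).
    by apply: le_measure; rewrite ?inE //; exact: mS.
  by rewrite muE ltry.
rewrite -[leRHS]fineK // lee_fin; apply: le_trans (dens Ow h0 hr); rewrite -/(V w h).
have hh : h <= h + D x w by rewrite lerDl (pm_ge0 Dm).
have le_V := dm_mass_le dmD h0 (ltW h0) hh.
rewrite /c3 -mulrA ler_pM2l // mulrC ler_pdivrMr ?mulr_gt0 ?powR_gt0 // mulrC.
apply: (le_trans le_V); apply: ler_wpM2r; first by rewrite ltW // V0.
apply: ler_wpM2l; first exact: ltW.
apply: powR_le; rewrite ?(ltW Qd0) ?divr_ge0 ?addr_ge0 ?(pm_ge0 Dm) ?(ltW h0) //.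
rewrite ler_pdivrMr //; apply: (@le_trans _ _ (h + 3 * h)); first by rewrite lerD2l ltW.
by rewrite -[X in X + _]mul1r -mulrDl.
Qed.

Lemma kernel_sym h x y : kernel D h x y = kernel D h y x.
Proof. by rewrite /kernel /cutoff (pm_sym Dm). Qed.

Lemma kernel_norm_le1 h x y : `|kernel D h x y| <= 1.
Proof. by rewrite ger0_norm ?cutoff_ge0 ?cutoff_le1. Qed.

Lemma kernel_lip h x x' y : 0 < h -> `|kernel D h x y - kernel D h x' y| <= D x x' / h.
Proof.
move=> h0; rewrite !(kernel_sym h _ y).
have h34 : 3 * h < 4 * h by rewrite ltr_pM2r // ltr_nat.
have := cutoff_lip Dm y h34 x x'; rewrite le_min => /andP[_].
by rewrite -mulrBl (_ : 4 - 3 = 1 :> R) ?mul1r //; ring.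
Qed.

Lemma measurable_kernel h x : measurable_fun Omega (kernel D h x).
Proof.
apply: measurable_funTS.
by apply: (@measurable_cutoff _ _ _ setT) => // z _; exact: (dm_measurable_dist dmD).
Qed.

Lemma kernel_support h x x' y : 0 < h -> D x x' < h -> ~ qball D x (9 * h) y ->
  kernel D h x' y = 0.
Proof.
move=> h0 xx' /negP; rewrite -leNgt => far.
have h34 : 3 * h < 4 * h by rewrite ltr_pM2r // ltr_nat.
apply: cutoff_eq0 => //; rewrite -(lerD2l (D x x')); apply: le_trans (pm_tri Dm x' x y).
apply: le_trans far; apply: (@le_trans _ _ (h + 4 * h)); first by rewrite lerD2r ltW.
by rewrite (_ : h + 4 * h = 5 * h); [rewrite ler_pM2r // ler_nat|ring].
Qed.

Lemma kernel_mass h x x' : 0 < h -> h <= r1 -> near_domain h x' -> D x x' < h ->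
  c3 * V x h <= \int[mu]_(y in Omega) kernel D h x' y.
Proof.
move=> h0 hr [w Ow x'w] xx'.
have xw : D x w < 3 * h.
  apply: (le_lt_trans (pm_tri Dm x' x w)).
  by rewrite (_ : 3 * h = h + 2 * h); [exact: ltrD|ring].
have mass := mass_near_domain h0 hr Ow xw.
rewrite -lee_fin; apply: (le_trans mass).
have intK : mu.-integrable Omega (EFin \o kernel D h x').
  have [|int _] := @kernel_integral _ _ _ mu Omega (qball D x (9 * h)) (kernel D h x')
    (cst 1) 1 (V x (9 * h)) mO (mD _ _) (measurable_kernel h x') (measurable_cst _) ler01
    (kernel_norm_le1 h x') (fun y => @kernel_support h x x' y h0 xx').
    under eq_integral do rewrite normr1.
    rewrite integral_cst // mul1e -muE; apply: le_measure; rewrite ?inE //.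
  by apply: eq_integrable int => // y _; rewrite /= mulr1.
rewrite /Rintegral fineK ?integrable_fin_num //.
apply: (@le_trans _ _ (\int[mu]_(y in Omega) (\1_(S w h) y)%:E)%E).
  rewrite integral_indic //.
  by rewrite -setIA setIid.
apply: ge0_le_integral => //.
- by apply: measurable_funTS; apply/measurable_EFinP; apply: measurable_indic; exact: mS.
- by apply/measurable_EFinP; exact: measurable_kernel.
move=> y Oy; rewrite lee_fin indicE; have [wy|nwy] := pselect (S w h y); last first.
  by rewrite memNset //= cutoff_ge0.
rewrite mem_set //= /kernel cutoff_eq1 //; first by rewrite ltr_pM2r // ltr_nat.
apply: (le_trans (pm_tri Dm w x' y)).
rewrite (_ : 3 * h = 2 * h + h); last by ring.
by apply: lerD; apply: ltW => //; exact: wy.1.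
Qed.

Let b0 := Cd * 9 `^ Qd.
Let b00 : 0 < b0. Proof. by rewrite mulr_gt0 // powR_gt0. Qed.

(** Numerator and denominator are both Lipschitz at scale [h], and the denominator
    is comparable to the mass of the ball; subtracting [a] from [u] does not change
    the differences of averages. *)
Lemma smoothing_estimate : exists2 K : R, 0 < K & forall (u : X -> R) (h : R) x (a E : R), 0 < h -> h <= r1 ->
  measurable_fun Omega u -> near_domain h x -> 0 <= E ->
  (\int[mu]_(y in S x (9 * h)) `|u y - a|%:E <= E%:E)%E ->
  `|f h u x - a| <= K * (E / V x h) /\
  forall x', near_domain h x' -> D x x' < h ->
    `|f h u x - f h u x'| <= K * (D x x' / h) * (E / V x h).
Proof.
exists (c3^-1 * (1 + b0 / c3)).
  by rewrite mulr_gt0 ?invr_gt0 // addr_gt0 // divr_gt0.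
move=> u h x a E h0 hr mu_ nx E0 intE.
have Vx0 := V0 x h0; set B := qball D x (9 * h).
have mua : measurable_fun Omega (fun y => u y - a) by apply: measurable_funB.
have V9 : V x (9 * h) <= b0 * V x h.
  have hh : h <= 9 * h by rewrite ler_peMl ?(ltW h0) // ler1n.
  by have := dm_doubling dmD x h0 hh; rewrite mulfK ?gt_eqF.
have int1 : (\int[mu]_(y in B `&` Omega) `|(cst 1 y : R)|%:E <= (b0 * V x h)%:E)%E.
  under eq_integral do rewrite normr1.
  rewrite integral_cst ?mul1e; last exact: mS.
  apply: (@le_trans _ _ (mu B)); last by rewrite muE lee_fin.
  by apply: le_measure; rewrite ?inE; [exact: mS|exact: mD|exact: subIsetl].
pose A z := \int[mu]_(y in Omega) kernel D h z y.
pose N z := \int[mu]_(y in Omega) (kernel D h z y * (u y - a)).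
have alpha0 : 0 < c3 * V x h by rewrite mulr_gt0.
have xx : D x x < h by rewrite (pm_xx Dm).
have main z : near_domain h z -> D x z < h ->
    [/\ c3 * V x h <= A z, `|N z| <= E & f h u z - a = N z / A z].
  move=> nz xz; have leA := kernel_mass h0 hr nz xz.
  have suppz y := @kernel_support h x z y h0 xz.
  have [int2 leN] := kernel_integral mO (mD x (9 * h)) (measurable_kernel h z) mua ler01
    (kernel_norm_le1 h z) suppz intE.
  have [int3 _] := kernel_integral mO (mD x (9 * h)) (measurable_kernel h z) (measurable_cst (1 : R))
    ler01 (kernel_norm_le1 h z) suppz int1.
  split=> //; first by rewrite mul1r in leN.
  have A0 : A z != 0 by rewrite gt_eqF //; exact: lt_le_trans leA.
  have int4 : mu.-integrable Omega (EFin \o kernel D h z).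
    by apply: eq_integrable int3 => // y _; rewrite /= mulr1.
  have int5 : mu.-integrable Omega (EFin \o (fun y => a * kernel D h z y)).
    have := integrableZl mO a int4.
    by apply: eq_integrable => // y _ /=; rewrite EFinM.
  have -> : f h u z = (N z + a * A z) / A z.
    rewrite /smoothing -/(A z); congr (_ / _).
    rewrite /N /A -RintegralZl // -RintegralD //.
    by apply: eq_Rintegral => y _; ring.
  by field.
have [A1 N1 f1] := main x nx xx.
have A0 : 0 < A x by exact: lt_le_trans A1.
have EV : 0 <= E / V x h by rewrite divr_ge0 // ltW.
have q1 : 1 <= 1 + b0 / c3 by rewrite lerDl divr_ge0 // ltW.
split.
  rewrite f1 normrM normfV (gtr0_norm A0).
  apply: (@le_trans _ _ (E / (c3 * V x h))).
    apply: ler_pM => //; first by rewrite invr_ge0 ltW.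
    by rewrite lef_pV2.
  rewrite invfM mulrCA -mulrA; apply: ler_wpM2l; first by rewrite invr_ge0 ltW.
  by rewrite ler_peMl.
move=> x' nx' xx'; have [A2 N2 f2] := main x' nx' xx'.
have -> : f h u x - f h u x' = N x / A x - N x' / A x' by rewrite -f1 -f2; ring.
have t0 : 0 <= D x x' / h by rewrite divr_ge0 ?(pm_ge0 Dm) // ltW.
have leK y : `|kernel D h x y - kernel D h x' y| <= D x x' / h by exact: kernel_lip.
have suppK y : ~ qball D x (9 * h) y -> kernel D h x y - kernel D h x' y = 0.
  by move=> ny; rewrite (kernel_support h0 xx ny) (kernel_support h0 xx' ny) subrr.
have mK : measurable_fun Omega (fun y => kernel D h x y - kernel D h x' y).
  by apply: measurable_funB; exact: measurable_kernel.
have int_u z : D x z < h -> mu.-integrable Omega (EFin \o (fun y => kernel D h z y * (u y - a))).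
  move=> xz; have suppz y := @kernel_support h x z y h0 xz.
  by have [] := kernel_integral mO (mD x (9 * h)) (measurable_kernel h z) mua ler01
    (kernel_norm_le1 h z) suppz intE.
have int_1 z : D x z < h -> mu.-integrable Omega (EFin \o kernel D h z).
  move=> xz; have suppz y := @kernel_support h x z y h0 xz.
  have [int3 _] := kernel_integral mO (mD x (9 * h)) (measurable_kernel h z) (measurable_cst (1 : R))
    ler01 (kernel_norm_le1 h z) suppz int1.
  by apply: eq_integrable int3 => // y _; rewrite /= mulr1.
have [_ dN] := kernel_integral mO (mD x (9 * h)) mK mua t0 leK suppK intE.
have [_ dA] := kernel_integral mO (mD x (9 * h)) mK (measurable_cst (1 : R)) t0 leK suppK int1.
have NE : N x - N x' = \int[mu]_(y in Omega) ((kernel D h x y - kernel D h x' y) * (u y - a)).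
  rewrite /N -RintegralB //; [|exact: int_u|exact: int_u].
  by apply: eq_Rintegral => y _; ring.
have AE : A x - A x' = \int[mu]_(y in Omega) ((kernel D h x y - kernel D h x' y) * cst 1 y).
  rewrite /A -RintegralB //; [|exact: int_1|exact: int_1].
  by apply: eq_Rintegral => y _; rewrite mulr1.
rewrite -NE in dN; rewrite -AE in dA.
have bV : 0 <= b0 * V x h by rewrite mulr_ge0 // ltW.
apply: (le_trans (quotient_lip alpha0 A1 A2 t0 E0 bV dN N2 dA)).
rewrite le_eqVlt; apply/orP; left; apply/eqP; field.
by rewrite !gt_eqF.
Qed.

Let V_le x h k : 0 < h -> 1 <= k -> V x (k * h) <= Cd * k `^ Qd * V x h.
Proof.
move=> h0 k1; have hh : h <= k * h by rewrite ler_peMl // ltW.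
by have := dm_doubling dmD x h0 hh; rewrite mulfK ?gt_eqF.
Qed.

Let muS_le x r : (mu (S x r) <= (V x r)%:E)%E.
Proof. by rewrite -muE; apply: le_measure; rewrite ?inE; [exact: mS|exact: mD|exact: subIsetl]. Qed.

(** The constant is a value of [u] at a point where the gradient does not exceed
    twice its average. *)
Lemma average_oscillation (p : R) : 1 <= p -> exists2 K : R, 0 < K &
  forall (u : X -> R) (h : R) x (H : X -> \bar R) (J : R), 0 < h -> h <= r1 ->
    measurable_fun Omega u -> near_domain h x -> pgradient Omega D p u (36 * h) H ->
    0 <= J -> (\int[mu]_(y in S x (18 * h)) H y <= J%:E)%E ->
    exists a : R, (\int[mu]_(y in S x (18 * h)) `|u y - a|%:E <=
      (K * (V x h * (J / V x h) `^ p^-1))%:E)%E.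
Proof.
move=> p1; set b1 := Cd * 18 `^ Qd.
have b10 : 0 < b1 by rewrite mulr_gt0 // powR_gt0.
set k := 1 + 2 * b1 / c3.
have k0 : 0 < k by rewrite addr_gt0 // divr_gt0 // mulr_gt0.
exists (2 * b1 * (k / b1) `^ p^-1).
  by rewrite mulr_gt0 ?powR_gt0 ?divr_gt0 // mulr_gt0.
move=> u h x H J h0 hr mu_ [w Ow xw] [mH H0 gH] J0 intH.
have Vx0 := V0 x h0; have mS18 := mS x (18 * h).
have SO : S x (18 * h) `<=` Omega by exact: subIsetr.
have mHS := measurable_funS mO SO mH.
have xw3 : D x w < 3 * h by apply: (lt_trans xw); rewrite ltr_pM2r // ltr_nat.
have mass : ((c3 * V x h)%:E <= mu (S x (18 * h)))%E.
  apply: (le_trans (mass_near_domain h0 hr Ow xw3)).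
  apply: le_measure; rewrite ?inE; [exact: mS|exact: mS|].
  move=> y [wy Oy]; split=> //; apply: (le_lt_trans (pm_tri Dm w x y)).
  apply: (@lt_le_trans _ _ (2 * h + h)); first exact: ltrD.
  by rewrite (_ : 2 * h + h = 3 * h); [rewrite ler_pM2r // ler_nat|ring].
have m0 : 0 < c3 * V x h by rewrite mulr_gt0.
have [z0 [xz0 Oz0] Hz0] := exists_le_average mS18 m0 mass mHS H0 J0 intH.
exists (u z0).
have V18 : V x (18 * h) <= b1 * V x h by apply: V_le => //; rewrite ler1n.
have le_m : (mu (S x (18 * h)) <= (b1 * V x h)%:E)%E.
  by apply: (le_trans (muS_le _ _)); rewrite lee_fin.
have bV0 : 0 < b1 * V x h by rewrite mulr_gt0.
have mg : measurable_fun (S x (18 * h)) (fun y => u y - u z0).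
  by apply: measurable_funB => //; exact: (measurable_funS mO SO mu_).
have mG : measurable_fun (S x (18 * h)) (fun y => H y + H z0)%E by exact: emeasurable_funD.
have G0 y : (0 <= H y + H z0)%E by exact: adde_ge0.
have gG y : S x (18 * h) y -> ((`|u y - u z0| `^ p)%:E <= H y + H z0)%E.
  move=> [xy Oy]; apply: gH => //; apply: (le_lt_trans (pm_tri Dm x y z0)).
  rewrite (_ : 36 * h = 18 * h + 18 * h); last by ring.
  by apply: ltrD => //; rewrite (pm_sym Dm).
have kJ0 : 0 <= k * J by rewrite mulr_ge0 // ltW.
have intG : (\int[mu]_(y in S x (18 * h)) (H y + H z0) <= (k * J)%:E)%E.
  rewrite ge0_integralD // integral_cst //.
  apply: (@le_trans _ _ (J%:E + (2 * J / (c3 * V x h))%:E * (b1 * V x h)%:E)%E).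
    by apply: leeD => //; apply: lee_pmul.
  rewrite -EFinM -EFinD lee_fin le_eqVlt; apply/orP; left; apply/eqP.
  by rewrite /k; field; rewrite !gt_eqF.
apply: (le_trans (integral_norm_le_power p1 mS18 bV0 le_m mg mG G0 gG kJ0 intG)).
rewrite lee_fin le_eqVlt; apply/orP; left; apply/eqP.
have -> : k * J / (b1 * V x h) = (k / b1) * (J / V x h) by field; rewrite !gt_eqF.
rewrite powRM; last 2 first.
- by rewrite divr_ge0 // ltW.
- by rewrite divr_ge0 // ltW.
by ring.
Qed.

(** Size and modulus of continuity, at scale [h], of a function near the domain. *)
Definition block (h : R) (F Phi : X -> R) := forall x, near_domain h x ->
  `|F x| <= Phi x /\ forall x', near_domain h x' -> D x x' < h ->
    `|F x - F x'| <= D x x' / h * Phi x.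

Let localJ h (H : X -> \bar R) x := fine (\int[mu]_(y in S x (18 * h)) H y).

Let localJP h H x : measurable_fun Omega H -> (forall y, (0 <= H y)%E) ->
  (\int[mu]_(y in Omega) H y < +oo)%E ->
  (\int[mu]_(y in S x (18 * h)) H y)%E = (localJ h H x)%:E.
Proof.
move=> mH H0 fin; rewrite fineK // ge0_fin_numE ?integral_ge0 //.
by apply: le_lt_trans fin; apply: ge0_subset_integral => //; exact: mS.
Qed.

(** Averages at two successive scales are compared with the same constant. *)
Lemma smoothing_difference (p : R) : 1 <= p -> exists2 K : R, 0 < K &
  forall (u : X -> R) (h : R) (H : X -> \bar R), 0 < h -> 2 * h <= r1 ->
    measurable_fun Omega u -> pgradient Omega D p u (36 * h) H ->
    (\int[mu]_(y in Omega) H y < +oo)%E ->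
    block h (fun x => f h u x - f (2 * h) u x)
      (fun x => K * (fine (\int[mu]_(y in S x (18 * h)) H y) / V x h) `^ p^-1).
Proof.
move=> p1; have [K1 K10 osc] := average_oscillation p1.
have [K2 K20 est] := smoothing_estimate.
exists (2 * (K2 * K1)); first by rewrite mulr_gt0 // mulr_gt0.
move=> u h H h0 hr mu_ gH finH x nx.
have [mH H0 _] := gH; have hr1 : h <= r1.
  by apply: le_trans hr; rewrite ler_peMl ?ler1n // ltW.
have h20 : 0 < 2 * h by rewrite mulr_gt0.
have JE := localJP h x mH H0 finH; set J := localJ h H x in JE.
have J0 : 0 <= J by rewrite fine_ge0 // integral_ge0.
have leJ : (\int[mu]_(y in S x (18 * h)) H y <= J%:E)%E by rewrite JE.
have [a int_a] := osc u h x H J h0 hr1 mu_ nx gH J0 leJ.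
set P := (J / V x h) `^ p^-1; set E := K1 * (V x h * P) in int_a.
have Vx0 := V0 x h0; have V2x0 := V0 x h20.
have P0 : 0 <= P by exact: powR_ge0.
have E0 : 0 <= E by rewrite mulr_ge0 ?(ltW K10) // mulr_ge0 // ltW.
have EV : E / V x h = K1 * P by rewrite /E; field; rewrite gt_eqF.
have mua : measurable_fun Omega (fun y => u y - a) by apply: measurable_funB.
have mna : measurable_fun Omega (fun y => `|u y - a|%:E).
  by apply/measurable_EFinP; apply: measurableT_comp.
have int1 : (\int[mu]_(y in S x (9 * h)) `|u y - a|%:E <= E%:E)%E.
  apply: le_trans int_a; apply: ge0_subset_integral; [exact: mS|exact: mS| |by []|].
    exact: (measurable_funS mO (@subIsetr _ _ _) mna).
  move=> y [xy Oy]; split=> //; apply: (lt_le_trans xy).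
  by rewrite ler_pM2r // ler_nat.
have int2 : (\int[mu]_(y in S x (9 * (2 * h))) `|u y - a|%:E <= E%:E)%E.
  by rewrite mulrA (_ : 9 * 2 = 18 :> R) //; ring.
have wide z : near_domain h z -> near_domain (2 * h) z.
  move=> [w Ow zw]; exists w => //; apply: (lt_trans zw).
  by rewrite ltr_pM2l // ltr_pMl // ltr1n.
have [e1 l1] := est u h x a E h0 hr1 mu_ nx E0 int1.
have [e2 l2] := est u (2 * h) x a E h20 hr mu_ (wide _ nx) E0 int2.
have EV2 : E / V x (2 * h) <= E / V x h.
  apply: ler_wpM2l => //; rewrite lef_pV2 // -lee_fin -!muE.
  apply: le_measure; rewrite ?inE; [exact: mD|exact: mD|].
  by move=> y xy; apply: (lt_trans xy); rewrite ltr_pMl // ltr1n.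
rewrite -/J -/P; split.
  rewrite (_ : f h u x - f (2 * h) u x = (f h u x - a) - (f (2 * h) u x - a)); last by ring.
  apply: (le_trans (ler_normB _ _)).
  rewrite (_ : 2 * (K2 * K1) * P = K2 * (E / V x h) + K2 * (E / V x h)); last first.
    by rewrite EV; ring.
  by apply: lerD => //; apply: (le_trans e2); apply: ler_wpM2l => //; exact: ltW.
move=> x' nx' xx'.
have xx2 : D x x' < 2 * h by apply: (lt_trans xx'); rewrite ltr_pMl // ltr1n.
have l1x := l1 x' nx' xx'; have l2x := l2 x' (wide _ nx') xx2.
rewrite (_ : f h u x - f (2 * h) u x - (f h u x' - f (2 * h) u x') =
  (f h u x - f h u x') - (f (2 * h) u x - f (2 * h) u x')); last by ring.
apply: (le_trans (ler_normB _ _)).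
rewrite (_ : D x x' / h * (2 * (K2 * K1) * P) =
  K2 * (D x x' / h) * (E / V x h) + K2 * (D x x' / h) * (E / V x h)); last first.
  by rewrite EV; ring.
apply: lerD => //; apply: (le_trans l2x); apply: ler_pM => //.
- by rewrite mulr_ge0 ?(ltW K20) // divr_ge0 ?(pm_ge0 Dm) // ltW.
- by rewrite divr_ge0 // ltW.
apply: ler_wpM2l; first exact: ltW.
apply: ler_wpM2l; first exact: (pm_ge0 Dm).
by rewrite lef_pV2 // ler_peMl ?ler1n // ltW.
Qed.

(** Used with [a = 0] for the coarsest average, and with [a = u x] for the
    convergence of the averages at [x]. *)
Lemma smoothing_power (p : R) : 1 <= p -> exists2 K : R, 0 < K &
  forall (u : X -> R) (h a J : R) (H : X -> \bar R) x, 0 < h -> h <= r1 ->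
    measurable_fun Omega u -> measurable_fun Omega H -> (forall y, (0 <= H y)%E) ->
    near_domain h x -> 0 <= J -> (\int[mu]_(y in S x (18 * h)) H y <= J%:E)%E ->
    (forall y, S x (18 * h) y -> ((`|u y - a| `^ p)%:E <= H y)%E) ->
    let P := (J / V x h) `^ p^-1 in
    `|f h u x - a| <= K * P /\
    forall x', near_domain h x' -> D x x' < h ->
      `|f h u x - f h u x'| <= D x x' / h * (K * P).
Proof.
move=> p1; have [K2 K20 est] := smoothing_estimate.
set b1 := Cd * 18 `^ Qd; have b10 : 0 < b1 by rewrite mulr_gt0 // powR_gt0.
set K1 := 2 * b1 * b1^-1 `^ p^-1.
have K10 : 0 < K1 by rewrite mulr_gt0 ?powR_gt0 ?invr_gt0 // mulr_gt0.
exists (K2 * K1); first by rewrite mulr_gt0.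
move=> u h a J H x h0 hr mu_ mH H0 nx J0 leJ uH P.
have SO : S x (18 * h) `<=` Omega by exact: subIsetr.
have Vx0 := V0 x h0.
have V18 : V x (18 * h) <= b1 * V x h by apply: V_le => //; rewrite ler1n.
have le_m : (mu (S x (18 * h)) <= (b1 * V x h)%:E)%E.
  by apply: (le_trans (muS_le _ _)); rewrite lee_fin.
have bV0 : 0 < b1 * V x h by rewrite mulr_gt0.
have mua : measurable_fun Omega (fun y => u y - a) by apply: measurable_funB.
have int_a := integral_norm_le_power p1 (mS x (18 * h)) bV0 le_m (measurable_funS mO SO mua)
  (measurable_funS mO SO mH) H0 uH J0 leJ.
have mna : measurable_fun Omega (fun y => `|u y - a|%:E).
  by apply/measurable_EFinP; apply: measurableT_comp.
set E := 2 * (b1 * V x h) * (J / (b1 * V x h)) `^ p^-1 in int_a.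
have int1 : (\int[mu]_(y in S x (9 * h)) `|u y - a|%:E <= E%:E)%E.
  apply: le_trans int_a; apply: ge0_subset_integral; [exact: mS|exact: mS| |by []|].
    exact: (measurable_funS mO SO mna).
  move=> y [xy Oy]; split=> //; apply: (lt_le_trans xy).
  by rewrite ler_pM2r // ler_nat.
have E0 : 0 <= E by rewrite mulr_ge0 ?powR_ge0 // mulr_ge0 // ltW.
have EV : E / V x h = K1 * P.
  have JV : J / (b1 * V x h) = b1^-1 * (J / V x h) by field; rewrite !gt_eqF.
  rewrite /E JV powRM ?invr_ge0 ?(ltW b10) // ?divr_ge0 ?(ltW Vx0) //.
  by rewrite /K1 -/P; field; rewrite gt_eqF.
have [e1 l1] := est u h x a E h0 hr mu_ nx E0 int1.
split; first by rewrite -mulrA -EV.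
move=> x' nx' xx'; apply: (le_trans (l1 x' nx' xx')).
by rewrite EV le_eqVlt; apply/orP; left; apply/eqP; ring.
Qed.

Definition domain_dist (x : X) : R := inf [set D x w | w in Omega].

Definition domain_bump (h : R) (x : X) : R := Num.max 0 (Num.min 1 (2 - domain_dist x / h)).

Lemma domain_bump_ge0 h x : 0 <= domain_bump h x. Proof. by rewrite le_max lexx. Qed.

Lemma domain_bump_le1 h x : domain_bump h x <= 1. Proof. by rewrite ge_max ler01 ge_min lexx. Qed.

Hypothesis Omega_neq0 : Omega !=set0.

Let dist_set0 x : [set D x w | w in Omega] !=set0.
Proof. by have [w Ow] := Omega_neq0; exists (D x w); exists w. Qed.

Let dist_lb x : has_lbound [set D x w | w in Omega].
Proof. by exists 0 => _ [w _ <-]; exact: (pm_ge0 Dm). Qed.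

Lemma domain_dist_lip x y : `|domain_dist x - domain_dist y| <= D x y.
Proof.
have le z w : domain_dist z <= D z w + domain_dist w.
  rewrite addrC -lerBlDr; apply: lb_le_inf; first exact: dist_set0.
  move=> _ [v Ov <-]; rewrite lerBlDr addrC.
  by apply: le_trans (pm_tri Dm w z v); apply: ge_inf => //; exists v.
have := le x y; have := le y x; rewrite (pm_sym Dm y x) => h1 h2.
rewrite ler_norml; apply/andP; split; last by rewrite lerBlDr.
by rewrite lerBrDr addrC lerBlDr addrC.
Qed.

Lemma domain_bump_near h x : 0 < h -> domain_bump h x != 0 -> near_domain h x.
Proof.
move=> h0; apply: contra_neqP => no.
have far : 2 * h <= domain_dist x.
  apply: lb_le_inf; first exact: dist_set0.
  by move=> _ [w Ow <-]; rewrite leNgt; apply/negP => xw; apply: no; exists w.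
have le0 : 2 - domain_dist x / h <= 0 by rewrite subr_le0 ler_pdivlMr.
apply/eqP; rewrite eq_le domain_bump_ge0 andbT ge_max lexx /= ge_min.
by rewrite le0 orbT.
Qed.

Lemma domain_bump_eq1 h x : Omega x -> 0 < h -> domain_bump h x = 1.
Proof.
move=> Ox h0; have le0 : domain_dist x <= 0.
  by rewrite -(pm_xx Dm x); apply: ge_inf => //; exists x.
have h1 : 1 <= 2 - domain_dist x / h.
  have le1 : domain_dist x / h <= 0 by rewrite pmulr_lle0 // invr_gt0.
  by rewrite lerBrDr; apply: (@le_trans _ _ (1 + 0)); [rewrite lerD2l|rewrite addr0 ler1n].
by rewrite /domain_bump (min_idPl h1) (max_idPr ler01).
Qed.

Lemma domain_bump_lip h x y : 0 < h -> `|domain_bump h x - domain_bump h y| <= D x y / h.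
Proof.
move=> h0; rewrite /domain_bump; set a := 2 - _ / _; set b := 2 - domain_dist y / h.
apply: (@le_trans _ _ `|a - b|); last first.
  rewrite (_ : a - b = (domain_dist y - domain_dist x) / h); last by rewrite /a /b; ring.
  rewrite normrM normfV (gtr0_norm h0) ler_pM2r ?invr_gt0 // distrC.
  exact: domain_dist_lip.
have le (v w : R) : Num.max 0 (Num.min 1 v) - Num.max 0 (Num.min 1 w) <= `|v - w|.
  have vw : v <= `|v - w| + w by have := ler_norm (v - w); rewrite lerBlDr.
  rewrite lerBlDr ge_max addr_ge0 ?le_max ?lexx //=.
  have [w1|w1] := lerP 1 w; first by rewrite (max_idPr ler01) ge_min lerDr normr_ge0.
  rewrite ge_min; apply/orP; right; apply: (le_trans vw).
  by rewrite lerD2l le_max lexx orbT.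
have := le a b; have := le b a; rewrite (distrC b) => h1 h2.
by rewrite ler_norml h2 andbT lerNl opprB.
Qed.

(** The cut-off function extends the estimates from a neighbourhood of the domain
    to the whole space. *)
Lemma domain_bump_block h F Phi : 0 < h -> (forall x, 0 <= Phi x) -> block h F Phi ->
  forall x, `|domain_bump h x * F x| <= Phi x /\
  forall x', `|domain_bump h x * F x - domain_bump h x' * F x'| <=
    2 * Num.min 1 (D x x' / h) * (Phi x + Phi x').
Proof.
move=> h0 Phi0 bl.
have size x : `|domain_bump h x * F x| <= Phi x.
  have [->|nz] := eqVneq (domain_bump h x) 0; first by rewrite mul0r normr0.
  have [leF _] := bl x (domain_bump_near h0 nz).
  rewrite normrM (ger0_norm (domain_bump_ge0 h x)); apply: le_trans leF.
  by rewrite ler_piMl // domain_bump_le1.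
move=> x; split=> // x'; set t := D x x' / h.
have t0 : 0 <= t by rewrite divr_ge0 ?(pm_ge0 Dm) // ltW.
have P0 : 0 <= Phi x + Phi x' by exact: addr_ge0.
have [far|close] := lerP 1 t.
  rewrite mulr1; apply: (le_trans (ler_normB _ _)).
  apply: (@le_trans _ _ (Phi x + Phi x')); first exact: lerD.
  by rewrite ler_peMl // ler1n.
have xx' : D x x' < h by move: close; rewrite /t ltr_pdivrMr // mul1r.
have [x0|nx] := eqVneq (domain_bump h x) 0; have [x'0|nx'] := eqVneq (domain_bump h x') 0.
- rewrite x0 x'0 !mul0r subrr normr0; apply: mulr_ge0 => //; exact: mulr_ge0.
- have [leF _] := bl x' (domain_bump_near h0 nx').
  have := domain_bump_lip x x' h0; rewrite x0 sub0r normrN -/t => le_b.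
  rewrite mul0r sub0r normrN normrM; apply: (@le_trans _ _ (t * Phi x')); first exact: ler_pM.
  rewrite -mulrA; apply: (@le_trans _ _ (t * (Phi x + Phi x'))).
    by apply: ler_wpM2l => //; rewrite lerDr.
  by rewrite ler_peMl ?ler1n // mulr_ge0.
- have [leF _] := bl x (domain_bump_near h0 nx).
  have := domain_bump_lip x x' h0; rewrite x'0 subr0 -/t => le_b.
  rewrite mul0r subr0 normrM; apply: (@le_trans _ _ (t * Phi x)); first exact: ler_pM.
  rewrite -mulrA; apply: (@le_trans _ _ (t * (Phi x + Phi x'))).
    by apply: ler_wpM2l => //; rewrite lerDl.
  by rewrite ler_peMl ?ler1n // mulr_ge0.
have [leF lipF] := bl x (domain_bump_near h0 nx).
have := lipF x' (domain_bump_near h0 nx') xx'; rewrite -/t => le_F.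
have := domain_bump_lip x x' h0; rewrite -/t => le_b.
have -> : domain_bump h x * F x - domain_bump h x' * F x' =
  (domain_bump h x - domain_bump h x') * F x + domain_bump h x' * (F x - F x') by ring.
apply: (le_trans (ler_normD _ _)); rewrite !normrM (ger0_norm (domain_bump_ge0 h x')).
have -> : 2 * t * (Phi x + Phi x') = t * Phi x + (t * Phi x + 2 * t * Phi x') by ring.
apply: lerD; first exact: ler_pM.
apply: (@le_trans _ _ (t * Phi x)).
  apply: le_trans le_F; rewrite ler_piMl // ?domain_bump_le1 //.
by rewrite lerDl; apply: mulr_ge0 => //; exact: mulr_ge0.
Qed.
End Smoothing.

Arguments near_domain {R d X} D Omega h x.
Arguments block {R d X} D Omega h F Phi.
Arguments domain_bump {R d X} D Omega h x.

Import numFieldNormedType.Exports.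

(** * Summation over scales *)

Section TwoSidedGeometric.
Context {R : realType} (theta : R).
Hypotheses (th0 : 0 < theta) (th1 : theta < 1).

Lemma sum_two_sided_geometric (j n : nat) :
  \sum_(m < n) theta ^+ ((m - j) + (j - m)) <= 2 / (1 - theta).
Proof.
have th10 : 0 < 1 - theta by rewrite subr_gt0.
pose F n := \sum_(m < n) theta ^+ ((m - j) + (j - m)).
have F_S k : F k.+1 = F k + theta ^+ ((k - j) + (j - k)) by rewrite /F big_ord_recr.
have low k : (k <= j)%N -> (1 - theta) * F k <= theta ^+ (j - k).+1.
  elim: k => [_|k IH kj]; first by rewrite /F big_ord0 mulr0 exprn_ge0 // ltW.
  rewrite F_S mulrDr; have -> : ((k - j) + (j - k) = j - k)%N by lia.
  have -> : (j - k.+1).+1 = (j - k)%N by lia.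
  have := IH (ltnW kj); rewrite exprS => h.
  rewrite [leRHS](_ : _ = theta * theta ^+ (j - k) + (1 - theta) * theta ^+ (j - k)); last by ring.
  by rewrite lerD2r.
have high k : (1 - theta) * F (j + k)%N <= 2 - theta ^+ k.
  elim: k => [|k IH].
    rewrite addn0 expr0; apply: (le_trans (low j (leqnn j))).
    rewrite subnn expr1; apply: (@le_trans _ _ 1); first exact: ltW.
    by rewrite lerBrDr -[X in _ <= X]/(1 + 1).
  rewrite addnS F_S mulrDr; have -> : ((j + k - j) + (j - (j + k)) = k)%N by lia.
  have -> : 2 - theta ^+ k.+1 = 2 - theta ^+ k + (1 - theta) * theta ^+ k by rewrite exprS; ring.
  by rewrite lerD2r.
rewrite ler_pdivlMr // mulrC -/(F n).
apply: (@le_trans _ _ ((1 - theta) * F (j + n)%N)); last first.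
  by apply: (le_trans (high n)); rewrite gerDl oppr_le0 exprn_ge0 // ltW.
apply: ler_wpM2l; first exact: ltW.
have -> : (j + n = n + j)%N by rewrite addnC.
elim: {+}j => [|i IH]; first by rewrite addn0.
by rewrite addnS F_S; apply: (le_trans IH); rewrite lerDl exprn_ge0 // ltW.
Qed.

Lemma series_bound (a : nat -> R) (v C : R) (j : nat) : 0 <= C ->
  (series a @ \oo --> v)%classic ->
  (forall m, `|a m| <= C * theta ^+ ((m - j) + (j - m))) -> `|v| <= C * (2 / (1 - theta)).
Proof.
move=> C0 cv le_a; have cvn : (`|series a n| @[n --> \oo] --> `|v|)%classic by exact: cvg_norm.
rewrite -(cvg_lim (@Rhausdorff R) cvn); apply: limr_le.
  by apply/cvg_ex; exists `|v|.
apply: nearW => n.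
rewrite seriesEord /=; apply: (le_trans (ler_norm_sum _ _ _)).
apply: (@le_trans _ _ (\sum_(m < n) C * theta ^+ ((m - j) + (j - m)))).
  by apply: ler_sum => i _; exact: le_a.
by rewrite -mulr_sumr; apply: ler_wpM2l => //; exact: sum_two_sided_geometric.
Qed.

Lemma series_geometric_cvg (a : nat -> R) (C : R) :
  (forall m, `|a m| <= C * theta ^+ m) -> cvgn (series a).
Proof.
move=> le_a; apply: normed_cvg; apply: (@series_le_cvg _ _ (fun m => C * theta ^+ m)).
- by move=> n; exact: normr_ge0.
- by move=> n; exact: le_trans (le_a n).
- exact: le_a.
have := @is_cvg_geometric_series R C theta.
by apply; rewrite ger0_norm // ltW.
Qed.
End TwoSidedGeometric.

Section Scales.
Context {R : realType} {d : measure_display} {X : measurableType d}.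
Context {mu : {measure set X -> \bar R}} {D : X -> X -> R} {Cd Qd : R}.
Context (Omega : set X) (c2 r1 : R).
Hypothesis dmD : doubling_metric D mu Cd Qd.
Hypothesis Qd0 : 0 < Qd.
Hypothesis mO : measurable Omega.
Hypotheses (c20 : 0 < c2) (r10 : 0 < r1).
Hypothesis dens : forall x r, Omega x -> 0 < r -> r <= r1 ->
  c2 * fine (mu (qball D x r)) <= fine (mu (qball D x r `&` Omega)).
Hypothesis Omega_neq0 : Omega !=set0.
Context (sigma p : R).
Hypotheses (sg0 : 0 < sigma) (sg1 : sigma <= 2^-1) (p1 : 1 <= p).
Hypothesis Qsp : 2 * Qd <= sigma * p.

Let Dm : is_pmetric D := dm_pmetric dmD.
Let mD := dm_measurable_ball dmD.
Let V x r := fine (mu (qball D x r)).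
Let muE x r : mu (qball D x r) = (V x r)%:E. Proof. by rewrite fineK // (dm_fin dmD). Qed.
Let V0 x r : 0 < r -> 0 < V x r. Proof. exact: (dm_gt0 dmD). Qed.
Let Cd0 : 0 < Cd := dm_const_gt0 dmD.
Let p0 : 0 < p. Proof. exact: lt_le_trans p1. Qed.
Local Notation S x r := (qball D x r `&` Omega).
Let mS x r : measurable (S x r). Proof. exact: measurableI. Qed.

Definition scale (m : nat) : R := r1 / 2 * 2^-1 ^+ m.
Local Notation h := scale.
Let theta : R := 2^-1 `^ (sigma / 2).

Let half0 : 0 < 2^-1 :> R. Proof. by rewrite invr_gt0. Qed.
Let half1 : 2^-1 <= 1 :> R. Proof. by rewrite invf_le1 // ler1n. Qed.

Lemma scale_gt0 m : 0 < h m.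
Proof. by rewrite mulr_gt0 ?exprn_gt0 // divr_gt0. Qed.

Lemma scale_double m : 2 * h m.+1 = h m.
Proof. by rewrite /scale exprS; field. Qed.

Lemma scale_decr m j : (m <= j)%N -> h j = 2^-1 ^+ (j - m) * h m.
Proof. by move=> mj; rewrite /scale mulrCA -exprD subnK. Qed.

Lemma scale_le m : h m <= r1.
Proof.
apply: (@le_trans _ _ (r1 / 2)).
  by rewrite ler_piMr ?exprn_ile1 ?divr_ge0 // ltW.
by rewrite ler_pdivrMr // ler_peMr ?ler1n // ltW.
Qed.

Lemma theta_gt0 : 0 < theta. Proof. by rewrite powR_gt0. Qed.

Lemma theta_lt1 : theta < 1.
Proof. by rewrite -[ltRHS](powRr0 2^-1); apply: half_powR_lt; rewrite divr_gt0. Qed.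

Lemma thetaXE m : theta ^+ m = (2^-1 ^+ m) `^ (sigma / 2).
Proof. by rewrite half_powR. Qed.

Lemma thetaX2E m : theta ^+ (m + m) = (2^-1 ^+ m) `^ sigma.
Proof.
by rewrite exprD !thetaXE -powRD ?gt_eqF ?exprn_gt0 ?implybT // -splitr.
Qed.

(** Gradients of [u] at all scales; at the coarsest one the values of [u]
    themselves play the part of increments. *)
Definition gradient_scales (M : R) (u : X -> R) (H : nat -> X -> \bar R) : Prop :=
  [/\ measurable_fun Omega u /\ 0 <= M,
      forall y, Omega y -> ((`|u y| `^ p)%:E <= H 0%N y)%E,
      forall m, pgradient Omega D p u (36 * h m.+1) (H m.+1),
      forall m, measurable_fun Omega (H m) /\ forall y, (0 <= H m y)%E &
      forall m, (\int[mu]_(y in Omega) H m y <= ((M * h m `^ sigma) `^ p)%:E)%E].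

Definition scale_term (u : X -> R) (m : nat) (x : X) : R :=
  domain_bump D Omega (h m) x *
    (smoothing mu D Omega (h m) u x -
     if m is m'.+1 then smoothing mu D Omega (h m') u x else 0).

Definition local_average (H : nat -> X -> \bar R) (m : nat) (x : X) : R :=
  fine (\int[mu]_(y in S x (18 * h m)) H m y) / V x (h m).

Section Data.
Context (M : R) (u : X -> R) (H : nat -> X -> \bar R).
Hypothesis data : gradient_scales M u H.

Let mu_ : measurable_fun Omega u. Proof. by case: data => -[]. Qed.
Let M0 : 0 <= M. Proof. by case: data => -[]. Qed.
Let mH m : measurable_fun Omega (H m). Proof. by case: data => _ _ _ /(_ m)[]. Qed.
Let H0 m y : (0 <= H m y)%E. Proof. by case: data => _ _ _ /(_ m)[]. Qed.
Let intH m : (\int[mu]_(y in Omega) H m y <= ((M * h m `^ sigma) `^ p)%:E)%E.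
Proof. by case: data. Qed.

Let le_local m x r : (\int[mu]_(y in S x r) H m y <= \int[mu]_(y in Omega) H m y)%E.
Proof. by apply: ge0_subset_integral => //; exact: mS. Qed.

Lemma local_integral_fin m x :
  (\int[mu]_(y in S x (18 * h m)) H m y)%E =
    (fine (\int[mu]_(y in S x (18 * h m)) H m y))%:E.
Proof.
rewrite fineK // ge0_fin_numE ?integral_ge0 //; apply: (le_lt_trans (le_local _ _ _)).
by apply: le_lt_trans (intH m) _; exact: ltry.
Qed.

Lemma local_average_ge0 m x : 0 <= local_average H m x.
Proof. by rewrite divr_ge0 ?fine_ge0 ?integral_ge0. Qed.

Lemma local_average_le m x : local_average H m x <= (M * h m `^ sigma) `^ p / V x (h m).
Proof.
apply: ler_wpM2r; first by rewrite invr_ge0 ltW // V0 // scale_gt0.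
rewrite -lee_fin -local_integral_fin; apply: (le_trans (le_local _ _ _)).
exact: intH.
Qed.

Lemma local_average_root_le m x :
  local_average H m x `^ p^-1 <= M * h m `^ sigma * (V x (h m))^-1 `^ p^-1.
Proof.
have Mh : 0 <= M * h m `^ sigma by rewrite mulr_ge0 // powR_ge0.
rewrite -[X in X * _](powRKV Mh (lt0r_neq0 p0)) -powRM ?powR_ge0 //; last first.
  by rewrite invr_ge0 ltW // V0 // scale_gt0.
apply: powR_le; rewrite ?local_average_ge0 ?local_average_le //.
by rewrite invr_ge0 ltW.
Qed.

(** The mass of balls shrinks at most like [2^(-m Qd)]; for [2 Qd <= sigma p] its
    [p]-th root costs only half of the decay [2^(-m sigma)] of the gradients. *)
Lemma local_average_decay x : exists2 A, 0 <= A &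
  forall m, local_average H m x `^ p^-1 <= A * theta ^+ m.
Proof.
have Vx0 := V0 x (scale_gt0 0).
exists (M * h 0 `^ sigma * (Cd / V x (h 0)) `^ p^-1).
  by rewrite !mulr_ge0 ?powR_ge0.
move=> m; apply: (le_trans (local_average_root_le m x)).
have hE : h m = 2^-1 ^+ m * h 0 by rewrite (scale_decr (leq0n m)) subn0.
have e0 : 0 < 2^-1 ^+ m :> R by rewrite exprn_gt0.
have e1 : 2^-1 ^+ m <= 1 :> R by rewrite exprn_ile1 // ltW.
have -> : h m `^ sigma = h 0 `^ sigma * (theta ^+ m * theta ^+ m).
  by rewrite hE powRM ?(ltW e0) ?(ltW (scale_gt0 0)) // -thetaX2E exprD mulrC.
have le_V : (V x (h m))^-1 `^ p^-1 <= (Cd / V x (h 0)) `^ p^-1 * (theta ^+ m)^-1.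
  have le1 : (V x (h m))^-1 <= Cd / V x (h 0) * ((2^-1 ^+ m)^-1 `^ Qd).
    have hm0 : h m <= h 0 by rewrite hE ler_piMl // ltW // scale_gt0.
    have := dm_doubling dmD x (scale_gt0 m) hm0; rewrite -/(V x (h 0)) -/(V x (h m)).
    have -> : h 0 / h m = (2^-1 ^+ m)^-1.
      by rewrite hE; field; rewrite !gt_eqF ?scale_gt0.
    move=> le2; rewrite -(ler_pM2r (V0 x (scale_gt0 0))) -(ler_pM2l (V0 x (scale_gt0 m))).
    rewrite mulrA divff ?gt_eqF ?V0 ?scale_gt0 // mul1r; apply: (le_trans le2).
    by rewrite le_eqVlt; apply/orP; left; apply/eqP; field; rewrite gt_eqF.
  have c0 : 0 <= Cd / V x (h 0) by rewrite divr_ge0 // ltW.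
  have iV : 0 <= (V x (h m))^-1 by rewrite invr_ge0 ltW // V0 // scale_gt0.
  have ip : 0 <= p^-1 by rewrite invr_ge0 ltW.
  apply: (le_trans (powR_le ip iV le1)); rewrite powRM ?powR_ge0 //.
  apply: ler_wpM2l; first exact: powR_ge0.
  rewrite thetaXE -powRrM -powR_invl ?(ltW e0) //.
  apply: ler_powR; first by rewrite invf_ge1.
  rewrite ler_pdivrMr // -(ler_pM2l (ltr0Sn R 1)) (le_trans Qsp) //.
  by rewrite le_eqVlt; apply/orP; left; apply/eqP; field.
have t0 : 0 < theta ^+ m by rewrite exprn_gt0 // theta_gt0.
apply: (@le_trans _ _ (M * (h 0 `^ sigma * (theta ^+ m * theta ^+ m)) *
  ((Cd / V x (h 0)) `^ p^-1 * (theta ^+ m)^-1))).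
  by apply: ler_wpM2l => //; rewrite mulr_ge0 // mulr_ge0 ?powR_ge0 // mulr_ge0 // ltW.
by rewrite le_eqVlt; apply/orP; left; apply/eqP; field; rewrite gt_eqF.
Qed.

Lemma kernel_term_integrable k x : 0 < k -> mu.-integrable Omega (fun y => (kernel D k x y * u y)%:E).
Proof.
move=> k0; have xx : D x x < k by rewrite (pm_xx Dm).
have [_ uH _ _ _] := data.
have SO : S x (9 * k) `<=` Omega by exact: subIsetr.
have V9 : 0 < V x (9 * k) by apply: V0; rewrite mulr_gt0.
have muS : (mu (S x (9 * k)) <= (V x (9 * k))%:E)%E.
  by rewrite -muE; apply: le_measure; rewrite ?inE; [exact: mS|exact: mD|exact: subIsetl].
have uH' y : S x (9 * k) y -> ((`|u y| `^ p)%:E <= H 0%N y)%E by move=> [_ Oy]; exact: uH.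
have J0 : 0 <= (M * h 0 `^ sigma) `^ p by exact: powR_ge0.
have intS := le_trans (le_local 0 x (9 * k)) (intH 0).
have intu := integral_norm_le_power p1 (mS x (9 * k)) V9 muS (measurable_funS mO SO mu_)
  (measurable_funS mO SO (mH 0)) (H0 0) uH' J0 intS.
have [int _] := kernel_integral mO (mD x (9 * k)) (@measurable_kernel _ _ _ mu D Cd Qd Omega dmD k x)
  mu_ ler01 (kernel_norm_le1 k x) (fun y => @kernel_support _ _ _ mu D Cd Qd dmD k x x y k0 xx) intu.
exact: int.
Qed.
End Data.

Let block_le k F Phi Phi' : (forall x, Phi x <= Phi' x) ->
  block D Omega k F Phi -> block D Omega k F Phi'.
Proof.
move=> le_Phi bl x nx; have [le1 le2] := bl x nx; split.
  exact: le_trans (le_Phi x).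
move=> x' nx' xx'; apply: (le_trans (le2 x' nx' xx')); apply: ler_wpM2l => //.
rewrite divr_ge0 ?(pm_ge0 Dm) //; apply: ltW; apply: le_lt_trans xx'; exact: (pm_ge0 Dm).
Qed.

Lemma scale_term_bound : exists2 K : R, 0 < K & forall M u H, gradient_scales M u H ->
  forall m x, `|scale_term u m x| <= K * local_average H m x `^ p^-1 /\
    forall x', `|scale_term u m x - scale_term u m x'| <=
      2 * Num.min 1 (D x x' / h m) *
        (K * local_average H m x `^ p^-1 + K * local_average H m x' `^ p^-1).
Proof.
have [K1 K10 diff] := smoothing_difference dmD Qd0 mO c20 dens p1.
have [K2 K20 pow] := smoothing_power dmD Qd0 mO c20 dens p1.
exists (K1 + K2); first by rewrite addr_gt0.
move=> M u H data m x; have [[mu_ M0] uH gH mH intH] := data.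
have finH k : (\int[mu]_(y in Omega) H k y < +oo)%E.
  by apply: le_lt_trans (intH k) _; exact: ltry.
have la0 k y : 0 <= local_average H k y by exact: local_average_ge0 data k y.
pose F x := smoothing mu D Omega (h m) u x -
  if m is m'.+1 then smoothing mu D Omega (h m') u x else 0.
have K0 : 0 <= K1 + K2 by rewrite addr_ge0 // ltW.
suff bl : block D Omega (h m) F (fun y => (K1 + K2) * local_average H m y `^ p^-1).
  have Phi0 y : 0 <= (K1 + K2) * local_average H m y `^ p^-1 by rewrite mulr_ge0 ?powR_ge0.
  exact: (domain_bump_block dmD Omega_neq0 (scale_gt0 m) Phi0 bl).
rewrite /F; case: m {F} => [|m].
  apply: (@block_le _ _ (fun y => K2 * local_average H 0 y `^ p^-1)).
    by move=> y; apply: ler_wpM2r; rewrite ?powR_ge0 // lerDr ltW.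
  move=> y ny; have JE := local_integral_fin data 0 y.
  have J0 : 0 <= fine (\int[mu]_(z in S y (18 * h 0)) H 0%N z).
    by rewrite fine_ge0 // integral_ge0 // => z _; have [] := mH 0%N.
  have leJ : (\int[mu]_(z in S y (18 * h 0)) H 0%N z <=
      (fine (\int[mu]_(z in S y (18 * h 0)) H 0%N z))%:E)%E by rewrite -JE.
  have uH0 z : S y (18 * h 0) z -> ((`|u z - 0| `^ p)%:E <= H 0%N z)%E.
    by move=> [_ Oz]; rewrite subr0; exact: uH.
  have [e1 e2] := pow u (h 0) 0 _ (H 0%N) y (scale_gt0 0) (scale_le 0) mu_ (mH 0%N).1 (mH 0%N).2
    ny J0 leJ uH0.
  by split=> // y' ny' yy'; rewrite !subr0; exact: e2.
apply: (@block_le _ _ (fun y => K1 * local_average H m.+1 y `^ p^-1)).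
  by move=> y; apply: ler_wpM2r; rewrite ?powR_ge0 // lerDl ltW.
have h2 : 2 * h m.+1 <= r1 by rewrite scale_double scale_le.
have := diff u (h m.+1) (H m.+1) (scale_gt0 m.+1) h2 mu_ (gH m) (finH m.+1).
by rewrite scale_double.
Qed.

Definition scale_sum (u : X -> R) (x : X) : R := limn (series (fun m => scale_term u m x)).

Lemma scale_sum_cvg M u H : gradient_scales M u H -> forall x,
  (series (fun m => scale_term u m x) @ \oo --> scale_sum u x)%classic.
Proof.
move=> data x; have [K K0 bd] := scale_term_bound.
have [A A0 le_A] := local_average_decay data x.
have : cvgn (series (fun m => scale_term u m x)).
  apply: (@series_geometric_cvg _ theta theta_gt0 theta_lt1 _ (K * A)) => m.
  apply: (le_trans (bd M u H data m x).1); rewrite -mulrA.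
  by apply: ler_wpM2l; [exact: ltW|exact: le_A].
by [].
Qed.

(** Each term is continuous for [D]. *)
Lemma measurable_scale_term M u H m : gradient_scales M u H ->
  measurable_fun setT (scale_term u m).
Proof.
move=> data; have [K K0 bd] := scale_term_bound.
have [_ cont _ _] := dmD; apply: cont => // x _ e e0.
have [[_ M0] _ _ _ _] := data.
have hm := scale_gt0 m.
set W := M * h m `^ sigma * ((Cd * 2 `^ Qd) / V x (h m)) `^ p^-1.
have W0 : 0 <= W by rewrite mulr_ge0 ?powR_ge0 // mulr_ge0 ?powR_ge0.
have k20 : 0 < Cd * 2 `^ Qd by rewrite mulr_gt0 // powR_gt0.
have leW y : D x y < h m -> local_average H m y `^ p^-1 <= W.
  move=> xy; apply: (le_trans (local_average_root_le data m y)).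
  apply: ler_wpM2l; first by rewrite mulr_ge0 ?powR_ge0.
  have Vx := V0 x hm; have Vy := V0 y hm.
  apply: powR_le; rewrite ?invr_ge0 ?(ltW p0) ?(ltW Vy) //.
  rewrite ler_pdivlMr // mulrC ler_pdivrMr //.
  have hh : h m <= h m + D x y by rewrite lerDl (pm_ge0 Dm).
  apply: (le_trans (dm_mass_le dmD hm (ltW hm) hh)).
  apply: ler_wpM2r; first exact: ltW.
  apply: ler_wpM2l; first exact: ltW.
  apply: powR_le; rewrite ?(ltW Qd0) ?divr_ge0 ?addr_ge0 ?(pm_ge0 Dm) ?(ltW hm) //.
  by rewrite ler_pdivrMr // mulrDl mul1r lerD2l ltW.
pose C := 2 * (K * W + K * W) / h m + 1.
have C0 : 0 < C.
  have KW : 0 <= K * W by apply: mulr_ge0 => //; exact: ltW.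
  by apply: ltr_wpDl => //; apply: divr_ge0; [rewrite mulr_ge0 // addr_ge0|exact: ltW].
exists (Num.min (h m) (e / C)); first by rewrite lt_min hm divr_gt0.
move=> y _; rewrite lt_min => /andP[xy xyC].
have xx : D x x < h m by rewrite (pm_xx Dm).
apply: (le_lt_trans ((bd M u H data m x).2 y)).
apply: (@le_lt_trans _ _ (D x y * C)); last by rewrite -ltr_pdivlMr.
have t0 : 0 <= D x y / h m by rewrite divr_ge0 ?(pm_ge0 Dm) // ltW.
apply: (@le_trans _ _ (2 * (D x y / h m) * (K * W + K * W))).
  apply: ler_pM.
  - by apply: mulr_ge0 => //; rewrite le_min ler01.
  - by rewrite addr_ge0 // mulr_ge0 ?powR_ge0 // ltW.
  - by apply: ler_wpM2l => //; rewrite ge_min lexx orbT.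
  by apply: lerD; apply: ler_wpM2l; rewrite ?(ltW K0) ?leW.
have -> : D x y * C = 2 * (D x y / h m) * (K * W + K * W) + D x y by rewrite /C; ring.
by rewrite lerDl (pm_ge0 Dm).
Qed.

Lemma measurable_scale_sum M u H : gradient_scales M u H -> measurable_fun setT (scale_sum u).
Proof.
move=> data; apply: (@measurable_fun_cvg _ _ _ _ (fun n x => series (fun m => scale_term u m x) n)).
  move=> n; rewrite (_ : (fun x => _) = (fun x => \sum_(i < n) scale_term u i x)); last first.
    by apply/funext => x; rewrite seriesEord.
  by apply: measurable_sum => i; exact: measurable_scale_term data.
by move=> x _; exact: scale_sum_cvg data x.
Qed.

Let dist_scale (m j : nat) := ((m - j) + (j - m))%N.

(** For [m <= j] the Lipschitz estimate gains [2^-(j-m)], more than the power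
    [2 sigma <= 1] of it that is claimed. *)
Lemma scale_weight m j :
  2^-1 ^+ (j - m) * h m `^ sigma <= h j `^ sigma * theta ^+ (dist_scale m j + dist_scale m j).
Proof.
have hm := scale_gt0 m; have hj := scale_gt0 j.
rewrite thetaX2E /dist_scale; have [mj|/ltnW jm] := leqP m j.
  have -> : (m - j = 0)%N by apply/eqP; rewrite subn_eq0.
  rewrite add0n.
  set e := 2^-1 ^+ (j - m) : R; have e0 : 0 < e by rewrite exprn_gt0.
  have e1 : e <= 1 by rewrite exprn_ile1 // ltW.
  have -> : h j = e * h m by exact: scale_decr.
  rewrite (powRM _ (ltW e0) (ltW hm)) mulrAC; apply: ler_wpM2r; first exact: powR_ge0.
  rewrite -powRD ?(gt_eqF e0) ?implybT //; apply: ger1_powR; first by rewrite e0 e1.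
  rewrite -[X in X + _]mul1r -[X in _ + X]mul1r -mulrDl -ler_pdivlMl //.
  by rewrite mulr1.
have -> : (j - m = 0)%N by apply/eqP; rewrite subn_eq0.
rewrite addn0 expr0 mul1r (scale_decr jm) powRM ?exprn_ge0 ?(ltW hj) ?(ltW half0) //.
by rewrite mulrC.
Qed.

Lemma min_scale_le m j t : 0 <= t -> t <= h j -> Num.min 1 (t / h m) <= 2^-1 ^+ (j - m).
Proof.
move=> t0 tj; have hm := scale_gt0 m; rewrite ge_min; have [mj|/ltnW jm] := leqP m j.
  by apply/orP; right; rewrite ler_pdivrMr // -scale_decr.
by apply/orP; left; have -> : (j - m = 0)%N by apply/eqP; rewrite subn_eq0.
Qed.

(** The weights [theta^|m-j|] are spread over the scales so that a supremum can
    take the place of a sum; the exponent [sigma] of the gradients pays for them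
    on both sides of [j]. *)
Lemma scale_sum_majorant : exists2 K : R, 0 < K & forall M u H, gradient_scales M u H ->
  forall j, exists G : X -> \bar R, [/\ measurable_fun setT G, forall x, (0 <= G x)%E,
    (\int[mu]_x G x <= ((K * (M * h j `^ sigma)) `^ p)%:E)%E,
    forall x y, D x y <= h j ->
      ((`|scale_sum u x - scale_sum u y| `^ p)%:E <= G x + G y)%E &
    j = 0%N -> forall x, ((`|scale_sum u x| `^ p)%:E <= G x)%E].
Proof.
have [K K0 bd] := scale_term_bound.
have [C C0 maj] := average_majorant dmD (ler0n R 18).
have th0 := theta_gt0; have th1 := theta_lt1.
have th10 : 0 < 1 - theta by rewrite subr_gt0.
set B := 8 * K / (1 - theta); have B0 : 0 < B by rewrite divr_gt0 // mulr_gt0.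
set L := C * (2 / (1 - theta)); have L0 : 0 < L by rewrite mulr_gt0 // divr_gt0.
exists (B * L `^ p^-1); first by rewrite mulr_gt0 // powR_gt0.
move=> M u H data j; have [[mu_ M0] uH gH mH intH] := data.
have /choice[G GP] : forall m, exists G : X -> \bar R, [/\ measurable_fun setT G,
    forall x, (0 <= G x)%E,
    forall x, (((V x (h m))^-1)%:E * \int[mu]_(y in S x (18 * h m)) H m y <= G x)%E &
    (\int[mu]_x G x <= C%:E * \int[mu]_(x in Omega) H m x)%E].
  by move=> m; apply: maj => //; [exact: scale_gt0|exact: (mH m).1|exact: (mH m).2].
have mG m : measurable_fun setT (G m) by case: (GP m).
have G0 m x : (0 <= G m x)%E by case: (GP m).
have avG m x : ((local_average H m x)%:E <= G m x)%E.
  case: (GP m) => _ _ /(_ x) le_G _; apply: le_trans le_G.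
  by rewrite (local_integral_fin data) -EFinM mulrC.
have intG m : (\int[mu]_x G m x <= (C * (M * h m `^ sigma) `^ p)%:E)%E.
  case: (GP m) => _ _ _ le_G; apply: (le_trans le_G); rewrite EFinM.
  by apply: lee_wpmul2l; rewrite ?lee_fin ?(ltW C0) ?intH.
pose e m : R := 2^-1 ^+ (j - m); pose t m : R := theta ^+ dist_scale m j.
have e0 m : 0 < e m by rewrite exprn_gt0.
have t0 m : 0 < t m by rewrite exprn_gt0.
pose w m := (e m / t m) `^ p.
have w0 m : 0 <= w m by exact: powR_ge0.
pose g x := (\sum_(m <oo) (w m)%:E * G m x)%E.
have wG0 m x : (0 <= (w m)%:E * G m x)%E by rewrite mule_ge0 // lee_fin.
have g0 x : (0 <= g x)%E by apply: nneseries_ge0 => m _ _.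
have mwG m : measurable_fun setT (fun x => (w m)%:E * G m x)%E by exact: measurable_funeM.
have mg : measurable_fun setT g by exact: ge0_emeasurable_sum.
have Bp0 : 0 < B `^ p by rewrite powR_gt0.
have ge0Bg x : (0 <= (B `^ p)%:E * g x)%E by rewrite mule_ge0 // lee_fin ltW.
(* All the weighted averages at a point are controlled by one number. *)
have ptw x (gx : R) : g x = gx%:E -> 0 <= gx /\
    forall m, e m * local_average H m x `^ p^-1 <= t m * gx `^ p^-1.
  move=> gE; have gx0 : 0 <= gx by rewrite -lee_fin -gE.
  split=> // m; have la0 : 0 <= local_average H m x by exact: local_average_ge0 data m x.
  have le1 : w m * local_average H m x <= gx.
    rewrite -lee_fin -gE EFinM; apply: (@le_trans _ _ ((w m)%:E * G m x)%E).
      by apply: lee_wpmul2l; rewrite ?lee_fin.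
    have h1 := @nneseries_lim_ge _ (fun i => (w i)%:E * G i x)%E xpredT 0 m.+1
      (fun i _ _ => wG0 i x).
    by apply: le_trans h1; rewrite big_nat_recr //= leeDr // sume_ge0.
  have et : 0 <= e m / t m by rewrite divr_ge0 // ltW.
  have : (w m * local_average H m x) `^ p^-1 <= gx `^ p^-1.
    by apply: powR_le => //; [rewrite invr_ge0 ltW|exact: mulr_ge0].
  by rewrite (powRM _ (w0 m) la0) (powRKV et (lt0r_neq0 p0)) mulrAC ler_pdivrMr // [leRHS]mulrC.
have Kg (gx : R) : 0 <= gx -> (B * gx `^ p^-1) `^ p = B `^ p * gx.
  by move=> gx0; rewrite (powRM _ (ltW B0) (powR_ge0 _ _)) (powRVK gx0 (lt0r_neq0 p0)).
exists (fun x => (B `^ p)%:E * g x)%E; split=> //.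
- exact: measurable_funeM.
- have -> : (\int[mu]_x ((B `^ p)%:E * g x) = (B `^ p)%:E * \int[mu]_x g x)%E.
    by apply: ge0_integralZl => //; rewrite lee_fin ltW.
  have -> : (B * L `^ p^-1 * (M * h j `^ sigma)) `^ p = B `^ p * (L * (M * h j `^ sigma) `^ p).
    rewrite -mulrA (powRM _ (ltW B0)); last by rewrite !mulr_ge0 ?powR_ge0.
    by rewrite (powRM _ (powR_ge0 _ _)) ?(powRVK (ltW L0) (lt0r_neq0 p0)) // mulr_ge0 ?powR_ge0.
  rewrite EFinM; apply: lee_wpmul2l; first by rewrite lee_fin ltW.
  rewrite /g integral_nneseries //.
  set Mj := (M * h j `^ sigma) `^ p.
  have Mj0 : 0 <= Mj by exact: powR_ge0.
  have le_term m : (\int[mu]_x ((w m)%:E * G m x) <= (C * Mj * t m)%:E)%E.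
    have -> : (\int[mu]_x ((w m)%:E * G m x) = (w m)%:E * \int[mu]_x G m x)%E.
      by apply: ge0_integralZl => //; rewrite lee_fin.
    apply: (@le_trans _ _ ((w m)%:E * (C * (M * h m `^ sigma) `^ p)%:E)%E).
      by apply: lee_wpmul2l; rewrite ?lee_fin.
    rewrite -EFinM lee_fin mulrCA -mulrA; apply: ler_wpM2l; first exact: ltW.
    have Mh k : 0 <= M * h k `^ sigma by rewrite mulr_ge0 ?powR_ge0.
    have et : 0 <= e m / t m by rewrite divr_ge0 // ltW.
    rewrite /w -(powRM _ et (Mh m)).
    apply: (@le_trans _ _ ((M * h j `^ sigma * t m) `^ p)).
      apply: powR_le; [exact: ltW|exact: mulr_ge0|].
      have -> : e m / t m * (M * h m `^ sigma) = M * (e m * h m `^ sigma) / t m by ring.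
      rewrite ler_pdivrMr // -!mulrA; apply: ler_wpM2l => //.
      by rewrite -exprD; exact: scale_weight.
    rewrite (powRM _ (Mh j) (ltW (t0 m))); apply: ler_wpM2l; first exact: powR_ge0.
    by apply: ge1r_powR => //; rewrite t0 exprn_ile1 // ltW.
  apply: lime_le; first by apply: is_cvg_nneseries => m _ _; exact: integral_ge0.
  apply: nearW => n; rewrite big_mkord.
  apply: (@le_trans _ _ (\sum_(m < n) (C * Mj * t m)%:E)%E).
    by apply: lee_sum => m _; exact: le_term.
  rewrite sumEFin lee_fin -mulr_sumr.
  rewrite (_ : L * Mj = C * Mj * (2 / (1 - theta))); last by rewrite /L; ring.
  apply: ler_wpM2l.
    by rewrite mulr_ge0 // ltW.
  exact: sum_two_sided_geometric.
- move=> x y xyj; have := g0 x; have := g0 y.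
  case gx: (g x) => [a| |] //; last first.
    by move=> _ _; rewrite gt0_muley ?lte_fin // addye ?leey // -ltNye; apply: lt_le_trans (ge0Bg y); rewrite ltNy0.
  case gy: (g y) => [b| |] //; last first.
    by move=> _ _; rewrite gt0_muley ?lte_fin // addey ?leey // -ltNye ltNyr.
  move=> _ _; have [a0 le_a] := ptw x a gx; have [b0 le_b] := ptw y b gy.
  rewrite -!EFinM -EFinD lee_fin.
  set ga := a `^ p^-1 in le_a; set gb := b `^ p^-1 in le_b.
  have ga0 : 0 <= ga by exact: powR_ge0.
  have gb0 : 0 <= gb by exact: powR_ge0.
  have cv : (series (fun m => scale_term u m x - scale_term u m y) @ \oo -->
      scale_sum u x - scale_sum u y)%classic.
    rewrite (_ : series _ = (fun n => series (fun m => scale_term u m x) n -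
      series (fun m => scale_term u m y) n)).
      by apply: cvgB; exact: scale_sum_cvg data _.
    by apply/funext => n; rewrite !seriesEord /= sumrB.
  have le_terms m : `|scale_term u m x - scale_term u m y| <=
      2 * K * (ga + gb) * theta ^+ ((m - j) + (j - m)).
    apply: (le_trans ((bd M u H data m x).2 y)).
    have le_e := min_scale_le m (pm_ge0 Dm x y) xyj.
    rewrite -mulrDr; apply: (@le_trans _ _ (2 * e m *
      (K * (local_average H m x `^ p^-1 + local_average H m y `^ p^-1)))).
      apply: ler_wpM2r; first by apply: mulr_ge0; [exact: ltW|rewrite addr_ge0 ?powR_ge0].
      by apply: ler_wpM2l.
    have -> : 2 * e m * (K * (local_average H m x `^ p^-1 + local_average H m y `^ p^-1)) =
      2 * K * (e m * local_average H m x `^ p^-1 + e m * local_average H m y `^ p^-1) by ring.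
    rewrite -[leRHS]mulrA; apply: ler_wpM2l; first by rewrite mulr_ge0 // ltW.
    by rewrite [leRHS]mulrC mulrDr; apply: lerD.
  have c0 : 0 <= 2 * K * (ga + gb) by rewrite mulr_ge0 ?addr_ge0 // mulr_ge0 // ltW.
  have le_s := series_bound th0 th1 c0 cv le_terms.
  apply: (@le_trans _ _ ((B / 2 * (ga + gb)) `^ p)).
    apply: powR_le; rewrite ?(ltW p0) //; apply: (le_trans le_s).
    by rewrite le_eqVlt; apply/orP; left; apply/eqP; rewrite /B; field; rewrite gt_eqF.
  have B20 : 0 <= B / 2 by rewrite divr_ge0 // ltW.
  rewrite (powRM _ B20) ?addr_ge0 //.
  apply: (@le_trans _ _ ((B / 2) `^ p * (2 `^ p * (ga `^ p + gb `^ p)))).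
    by apply: ler_wpM2l; [exact: powR_ge0|exact: powR_addr_le].
  rewrite mulrA -(powRM _ B20) // divfK // (powRVK a0 (lt0r_neq0 p0)) (powRVK b0 (lt0r_neq0 p0)).
  by rewrite mulrDr.
move=> j0 x; have := g0 x; case gx: (g x) => [a| |] //; last first.
  by move=> _; rewrite gt0_muley ?lte_fin // leey.
move=> _; have [a0 le_a] := ptw x a gx; rewrite -EFinM lee_fin -(Kg _ a0).
set ga := a `^ p^-1 in le_a *; have ga0 : 0 <= ga by exact: powR_ge0.
have le_terms m : `|scale_term u m x| <= K * ga * theta ^+ ((m - j) + (j - m)).
  apply: (le_trans (bd M u H data m x).1); rewrite -mulrA; apply: ler_wpM2l; first exact: ltW.
  by have := le_a m; rewrite /e j0 sub0n expr0 mul1r mulrC /t /dist_scale j0.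
have c0 : 0 <= K * ga by rewrite mulr_ge0 // ltW.
have le_s := series_bound th0 th1 c0 (@scale_sum_cvg M u H data x) le_terms.
apply: powR_le; rewrite ?(ltW p0) //; apply: (le_trans le_s).
have -> : B * ga = 4 * (K * ga * (2 / (1 - theta))) by rewrite /B; field; rewrite gt_eqF.
rewrite ler_peMl ?ler1n //; apply: mulr_ge0 => //.
by rewrite divr_ge0 // ltW.
Qed.

Lemma smoothing_eq k u v x : (forall y, Omega y -> u y = v y) ->
  smoothing mu D Omega k u x = smoothing mu D Omega k v x.
Proof.
move=> uv; rewrite /smoothing; congr (_ / _); apply: eq_Rintegral => y /set_mem Oy.
by rewrite uv.
Qed.

Lemma scale_sum_eq u v : (forall y, Omega y -> u y = v y) -> scale_sum u = scale_sum v.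
Proof.
move=> uv; apply/funext => x; rewrite /scale_sum.
suff -> : (fun m => scale_term u m x) = (fun m => scale_term v m x) by [].
apply/funext => m; rewrite /scale_term (smoothing_eq _ _ uv).
by case: m => [//|m]; rewrite (smoothing_eq _ _ uv).
Qed.

Lemma scale_sum_linear a M u H M' v H' : gradient_scales M u H -> gradient_scales M' v H' ->
  forall x, scale_sum (fun y => a * u y + v y) x = a * scale_sum u x + scale_sum v x.
Proof.
move=> du dv x.
have lin k : 0 < k -> smoothing mu D Omega k (fun y => a * u y + v y) x =
    a * smoothing mu D Omega k u x + smoothing mu D Omega k v x.
  move=> k0; have iu := kernel_term_integrable du x k0; have iv := kernel_term_integrable dv x k0.
  have iau : mu.-integrable Omega (EFin \o (fun y => a * (kernel D k x y * u y))).
    by have := integrableZl mO a iu; apply: eq_integrable => // y _ /=; rewrite EFinM.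
  rewrite /smoothing mulrA -mulrDl; congr (_ / _).
  rewrite -RintegralZl // -RintegralD //.
  by apply: eq_Rintegral => y _; ring.
have linS m : scale_term (fun y => a * u y + v y) m x = a * scale_term u m x + scale_term v m x.
  rewrite /scale_term (lin _ (scale_gt0 m)).
  by case: m => [|m]; [|rewrite (lin _ (scale_gt0 m))]; ring.
apply: cvg_lim; first exact: Rhausdorff.
rewrite (_ : series _ = (fun n => a * series (fun m => scale_term u m x) n +
  series (fun m => scale_term v m x) n)).
  apply: cvgD; last exact: (@scale_sum_cvg M' v H' dv x).
  by apply: cvgM; [exact: cvg_cst|exact: (@scale_sum_cvg M u H du x)].
apply/funext => n; rewrite !seriesEord /= mulr_sumr -big_split /=.
by apply: eq_bigr => i _; exact: linS.
Qed.

Lemma scale_partial_sum u n x : Omega x ->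
  series (fun m => scale_term u m x) n.+1 = smoothing mu D Omega (h n) u x.
Proof.
move=> Ox; rewrite seriesEord /=; elim: n => [|n IH].
  by rewrite big_ord1 /scale_term (domain_bump_eq1 dmD Ox (scale_gt0 0)) mul1r subr0.
rewrite big_ord_recr /= IH /scale_term (domain_bump_eq1 dmD Ox (scale_gt0 n.+1)) mul1r.
by rewrite addrC subrK.
Qed.

(** Almost every point of the domain is a point where the gradients tend to 0,
    and there the averages tend to the value. *)
Lemma scale_sum_ae M u H : gradient_scales M u H ->
  exists E, [/\ measurable E, mu E = 0%E &
    forall x, Omega x -> ~ E x -> scale_sum u x = u x].
Proof.
move=> data; have [[mu_ M0] uH gH mH intH] := data.
have th0 := theta_gt0; have th1 := theta_lt1.
have H0 m y : (0 <= H m y)%E := (mH m).2 y.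
pose Hs x := (\sum_(m <oo) H m x)%E.
have mHs : measurable_fun Omega Hs by apply: ge0_emeasurable_sum => // m _; exact: (mH m).1.
have Hs0 x : (0 <= Hs x)%E by apply: nneseries_ge0.
have finHs : (\int[mu]_(x in Omega) Hs x < +oo)%E.
  rewrite /Hs integral_nneseries //; last by move=> m; exact: (mH m).1.
  set Mj := (M * h 0 `^ sigma) `^ p.
  apply: (@le_lt_trans _ _ (Mj * (2 / (1 - theta)))%:E); last exact: ltry.
  apply: lime_le; first by apply: is_cvg_nneseries => m _ _; exact: integral_ge0.
  apply: nearW => n; rewrite big_mkord.
  apply: (@le_trans _ _ (\sum_(m < n) (Mj * theta ^+ ((m - 0) + (0 - m)))%:E)%E).
    apply: lee_sum => m _; apply: (le_trans (intH m)); rewrite lee_fin.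
    set k := ((m - 0) + (0 - m))%N.
    have tk : 0 < theta ^+ k by rewrite exprn_gt0.
    have tk1 : theta ^+ k <= 1 by rewrite exprn_ile1 // ltW.
    have Mh i : 0 <= M * h i `^ sigma by rewrite mulr_ge0 ?powR_ge0.
    apply: (@le_trans _ _ ((M * h 0 `^ sigma * theta ^+ k) `^ p)).
      apply: powR_le; [exact: ltW|exact: Mh|].
      rewrite -mulrA; apply: ler_wpM2l => //.
      have := scale_weight m 0; rewrite sub0n expr0 mul1r => le1; apply: (le_trans le1).
      apply: ler_wpM2l; first exact: powR_ge0.
      by rewrite exprD -/k ler_piMl // ltW.
    rewrite (powRM _ (Mh 0%N) (ltW tk)); apply: ler_wpM2l; first exact: powR_ge0.
    by apply: ge1r_powR => //; rewrite tk.
  rewrite sumEFin lee_fin -mulr_sumr; apply: ler_wpM2l; first exact: powR_ge0.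
  exact: sum_two_sided_geometric.
have [mE muE0] := finite_integral_infty_null mO mHs Hs0 finHs.
exists (Omega `&` Hs @^-1` [set +oo%E]); split=> // x Ox nE.
have Hfin : (Hs x < +oo)%E.
  by rewrite ltey; apply/eqP => hx; apply: nE; split.
pose hs := fine (Hs x); have HsE : Hs x = hs%:E by rewrite fineK // ge0_fin_numE.
have le_Hs n : (\sum_(m < n) H m x <= Hs x)%E.
  have h1 := @nneseries_lim_ge _ (fun i => H i x) xpredT 0 n (fun i _ _ => H0 i x).
  by apply: le_trans h1; rewrite big_mkord.
have Hm_fin m : H m x \is a fin_num.
  rewrite ge0_fin_numE //; apply: le_lt_trans Hfin; apply: le_trans (le_Hs m.+1).
  by rewrite big_ord_recr /= leeDr // sume_ge0.
pose a m := fine (H m x).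
have aE m : H m x = (a m)%:E by rewrite fineK.
have a0 m : 0 <= a m by rewrite fine_ge0.
have a_cvg0 : (a @ \oo --> (0 : R))%classic.
  apply: cvg_series_cvg_0; apply: nondecreasing_is_cvgn.
    by apply: nondecreasing_series => n _ _; exact: a0.
  exists hs => _ [n _ <-]; rewrite seriesEord /= -lee_fin -HsE -sumEFin.
  by apply: le_trans (le_Hs n); apply: lee_sum => i _; rewrite aE.
have [K K0 pow] := smoothing_power dmD Qd0 mO c20 dens p1.
have [A A0 le_A] := local_average_decay data x.
set b := Cd * 18 `^ Qd; have b0 : 0 < b by rewrite mulr_gt0 // powR_gt0.
set K' := K * 2 `^ p^-1; have K'0 : 0 < K' by rewrite mulr_gt0 // powR_gt0.
have step n : `|smoothing mu D Omega (h n.+1) u x - u x| <=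
    K' * A * theta ^+ n.+1 + K' * (b * a n.+1) `^ p^-1.
  set k := n.+1; have hk := scale_gt0 k; have Vk := V0 x hk.
  have nx : near_domain D Omega (h k) x by exists x; rewrite // (pm_xx Dm) mulr_gt0.
  have JE := local_integral_fin data k x.
  set J := fine _ in JE; have J0 : 0 <= J by rewrite fine_ge0 // integral_ge0.
  have V18 : V x (18 * h k) <= b * V x (h k).
    have hh : h k <= 18 * h k by rewrite ler_peMl ?ler1n // ltW.
    by have := dm_doubling dmD x hk hh; rewrite mulfK ?gt_eqF.
  pose H' y := (H k y + (a k)%:E)%E.
  have mH' : measurable_fun Omega H' by apply: emeasurable_funD => //; exact: (mH k).1.
  have H'0 y : (0 <= H' y)%E by rewrite adde_ge0 // lee_fin.
  have SO : S x (18 * h k) `<=` Omega by exact: subIsetr.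
  have J'0 : 0 <= J + a k * (b * V x (h k)).
    by apply: addr_ge0 => //; apply: mulr_ge0 => //; apply: mulr_ge0; exact: ltW.
  have int' : (\int[mu]_(y in S x (18 * h k)) H' y <= (J + a k * (b * V x (h k)))%:E)%E.
    have mS18 := mS x (18 * h k); have mHS := measurable_funS mO SO (mH k).1.
    have a00 y : S x (18 * h k) y -> (0 <= (a k)%:E)%E by rewrite lee_fin.
    rewrite ge0_integralD // integral_cst //.
    rewrite EFinD; apply: leeD; first by rewrite JE.
    rewrite EFinM; apply: lee_wpmul2l; first by rewrite lee_fin.
    apply: (@le_trans _ _ (V x (18 * h k))%:E); last by rewrite lee_fin.
    by rewrite -muE; apply: le_measure; rewrite ?inE; [exact: mS|exact: mD|exact: subIsetl].
  have uH' y : S x (18 * h k) y -> ((`|u y - u x| `^ p)%:E <= H' y)%E.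
    move=> [xy Oy]; rewrite /H' -aE; have [_ _ gk] := gH n; apply: gk => //.
    rewrite (pm_sym Dm); apply: (lt_le_trans xy).
    by apply: ler_wpM2r; [exact: ltW|rewrite ler_nat].
  have [e1 _] := pow u (h k) (u x) _ H' x hk (scale_le k) mu_ mH' H'0 nx J'0 int' uH'.
  apply: (le_trans e1); rewrite -/(V x (h k)).
  set P := (J + a k * (b * V x (h k))) / V x (h k).
  have P0 : 0 <= P by rewrite divr_ge0 // ltW.
  have PE : P = local_average H k x + b * a k.
    by rewrite /P /local_average -/J; field; rewrite gt_eqF.
  have ba0 : 0 <= b * a k by rewrite mulr_ge0 // ltW.
  have la0 : 0 <= local_average H k x := local_average_ge0 data k x.
  have le_P : P `^ p^-1 <= 2 `^ p^-1 * (local_average H k x `^ p^-1 + (b * a k) `^ p^-1).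
    by apply: powR_root_le; rewrite ?powR_ge0 // (powRVK P0 (lt0r_neq0 p0)) PE.
  have -> : K' * A * theta ^+ k + K' * (b * a k) `^ p^-1 =
    K * (2 `^ p^-1 * (A * theta ^+ k + (b * a k) `^ p^-1)) by rewrite /K'; ring.
  apply: ler_wpM2l; first exact: ltW.
  apply: (le_trans le_P); apply: ler_wpM2l; first exact: powR_ge0.
  by rewrite lerD2r; exact: le_A.
apply/eqP; rewrite -subr_eq0 -normr_eq0; apply: contraT => nz.
set del := `|scale_sum u x - u x| in nz; have del0 : 0 < del by rewrite lt0r nz normr_ge0.
have d4 : 0 < del / 4 by rewrite divr_gt0.
have eta0 : 0 < (del / 4 / K') `^ p / b by rewrite divr_gt0 // powR_gt0 // divr_gt0.
have /cvgrPdist_lt/(_ _ d4)[N1 _ c1] := @scale_sum_cvg M u H data x.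
have /cvgrPdist_lt/(_ _ eta0)[N2 _ c2'] := a_cvg0.
have thn : `|theta| < 1 by rewrite ger0_norm // ltW.
have /cvgrPdist_lt/(_ _ d4)[N3 _ c3'] := @cvg_geometric R (K' * A) theta thn.
pose n := (N1 + N2 + N3)%N.
have n1 : (N1 <= n.+2)%N.
  by apply: (@leq_trans n); [rewrite /n -addnA leq_addr|rewrite -addn2 leq_addr].
have n2 : (N2 <= n.+1)%N.
  by apply: (@leq_trans n); [rewrite /n addnAC leq_addl|exact: leqnSn].
have n3 : (N3 <= n.+1)%N.
  by apply: (@leq_trans n); [rewrite /n leq_addl|exact: leqnSn].
have := c1 n.+2 n1; rewrite /= (scale_partial_sum u n.+1 Ox) => e1.
have := c2' n.+1 n2; rewrite /= sub0r normrN ger0_norm // => e2.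
have := c3' n.+1 n3; rewrite /= sub0r normrN => e3.
have e4 : K' * (b * a n.+1) `^ p^-1 <= del / 4.
  rewrite mulrC -ler_pdivlMr //.
  have q0 : 0 <= del / 4 / K' by rewrite divr_ge0 // ltW.
  rewrite -[leRHS](powRKV q0 (lt0r_neq0 p0)); apply: powR_le.
  - by rewrite invr_ge0 ltW.
  - by rewrite mulr_ge0 // ltW.
  by rewrite mulrC -ler_pdivlMr // ltW.
have : del < del.
  apply: (@le_lt_trans _ _ (`|scale_sum u x - smoothing mu D Omega (h n.+1) u x| +
    `|smoothing mu D Omega (h n.+1) u x - u x|)).
    by rewrite /del -[X in `|X|](subrKA (smoothing mu D Omega (h n.+1) u x)); exact: ler_normD.
  apply: (@lt_le_trans _ _ (del / 4 + (del / 4 + del / 4))).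
    apply: ltr_leD => //; apply: (le_trans (step n)); apply: lerD => //.
    by apply: le_trans (ltW e3); exact: ler_norm.
  have -> : del / 4 + (del / 4 + del / 4) = 3 / 4 * del by field.
  by rewrite ler_piMl ?(ltW del0) // ler_pdivrMr // mul1r ler_nat.
by rewrite ltxx.
Qed.
End Scales.

(** * The extension operator *)

Section AlmostEverywhere.
Context {R : realType} {d : measure_display} {X : measurableType d}.
Context (rho : X -> X -> R) (mu : {measure set X -> \bar R}).

(** The exceptional sets of fractional gradients absorb null sets. *)
Lemma dotN_norm_ae (Y E : set X) (s p : R) (q : \bar R) (u v : X -> R) :
  measurable E -> mu E = 0%E -> (forall x, (Y `\` E) x -> u x = v x) ->
  (dotN_norm rho mu Y s p q u <= dotN_norm rho mu Y s p q v)%E.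
Proof.
move=> mE muE uv; apply: le_ereal_inf_tmp => _ [g [mg g0 [F [mF muF gF]]] <-].
apply: ereal_inf_lbound; exists g => //; split=> //.
have mEF : measurable (E `|` F) by exact: measurableU.
exists (E `|` F); split=> //.
  by rewrite measureU0.
move=> k x y [Yx nx] [Yy ny] h1 h2.
have nEx : ~ E x by move=> Ex; apply: nx; left.
have nEy : ~ E y by move=> Ey; apply: ny; left.
rewrite uv ?uv //; apply: gF => //; split=> //.
- by move=> Fx; apply: nx; right.
- by move=> Fy; apply: ny; right.
Qed.

Lemma Lp_norm_ae_le (E : set X) (p M : R) (u v : X -> R) : 0 < p -> 0 <= M ->
  measurable E -> mu E = 0%E -> measurable_fun setT u -> measurable_fun setT v ->
  (forall x, ~ E x -> u x = v x) ->
  (Lp_norm mu setT p v <= M%:E)%E -> (Lp_norm mu setT p u <= M%:E)%E.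
Proof.
move=> p0 M0 mE muE mu_ mv uv; rewrite (Lp_norm_le mu setT u p0 M0) (Lp_norm_le mu setT v p0 M0).
suff -> : (\int[mu]_x (`|u x| `^ p)%:E = \int[mu]_x (`|v x| `^ p)%:E)%E by [].
apply: ge0_ae_eq_integral => //.
- exact: (@measurable_normr_powR _ _ _ setT u).
- exact: (@measurable_normr_powR _ _ _ setT v).
exists E; split=> // x /= nx; apply: contrapT => nE; apply: nx => _.
by rewrite uv.
Qed.
End AlmostEverywhere.

Section Extension.
Context {R : realType} {d : measure_display} {X : measurableType d}.
Context (rho : X -> X -> R) (mu : {measure set X -> \bar R}) (Q : R) (Omega : set X).
Hypothesis hX : quasi_metric_measure_space rho mu.
Hypothesis hQ : 0 < Q.
Hypothesis hdoubling : doubling rho mu Q.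
Hypothesis hOmega : measurable Omega.
Hypothesis Omega_neq0 : Omega !=set0.

(** The operator keeps [u] on the domain, where the sum over scales gives it back
    almost everywhere only.  At scales above the coarsest one increments are
    estimated by the values of the extension. *)
Lemma extension_of_density : measure_density rho mu Omega ->
  exists (s p : R) (q : \bar R),
    [/\ 0 < s /\ (s%:E < qm_index setT rho)%E, 0 < p, (0 < q)%E,
        Q / (Q + s) < p /\ ((Q / (Q + s))%:E < q)%E &
        exists E : (X -> R) -> (X -> R),
          bounded_linear_extension rho mu Omega s p q E].
Proof.
move=> hdens; have rho_ge0 := qm_ge0 hX; have mrho := qm_measurable_ball hX.
have [beta [D [c [Cd [b0 c1 Cd0 snow dmD]]]]] := snowflake_X hX hdoubling.
have c0 : 0 < c by exact: lt_le_trans c1.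
have qmX : is_quasi_metric setT rho by case: hX.
have rho_eq0 x y : rho x y = 0 -> x = y.
  by case: hX => -[_ [? [? [_ _ h]]]] _ _ xy; have [_ [/(_ xy)] ] := h x y y I I I.
have [b1 b10 b1le] := qm_exponent_gt0 qmX.
have ind_b1 : (b1%:E <= qm_index setT rho)%E.
  exact: le_trans b1le (qm_exponent_le_index qmX).
pose s := Num.min (beta / 2) (b1 / 2).
have s0 : 0 < s by rewrite lt_min !divr_gt0.
have sb1 : s < b1 by rewrite gt_min [X in _ || X]ltr_pdivrMr // ltr_pMr // ltr1n orbT.
have s_ind : (s%:E < qm_index setT rho)%E by apply: lt_le_trans ind_b1; rewrite lte_fin.
pose sigma := s / beta; have sg0 : 0 < sigma by rewrite divr_gt0.
have sg1 : sigma <= 2^-1.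
  by rewrite ler_pdivrMr // mulrC ge_min lexx.
have Qd0 : 0 < Q / beta by rewrite divr_gt0.
pose p := 2 * (Q / beta) / sigma + 1.
have p1 : 1 <= p by rewrite lerDr divr_ge0 ?(ltW sg0) // mulr_ge0 // ltW.
have p0 : 0 < p by exact: lt_le_trans p1.
have Qsp : 2 * (Q / beta) <= sigma * p.
  have -> : sigma * p = 2 * (Q / beta) + sigma by rewrite /p; field; rewrite !gt_eqF.
  by rewrite lerDl ltW.
have spb : s * p / beta = sigma * p by rewrite /sigma; ring.
have QQs : Q / (Q + s) < p.
  by apply: lt_le_trans p1; rewrite ltr_pdivrMr ?addr_gt0 // mul1r ltrDl.
have [c2 [r1 [c20 r10 dens]]] := density_dist rho_ge0 mrho b0 c1 Cd0 snow dmD hOmega hdens.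
pose h := scale r1; have h0 m : 0 < h m by exact: scale_gt0.
pose v u := @scale_sum R d X mu D Omega r1 u.
pose Ext (u : X -> R) x := if pselect (Omega x) then u x else v u x.
have ExtO u x : Omega x -> Ext u x = u x by rewrite /Ext; case: pselect.
have ExtN u x : ~ Omega x -> Ext u x = v u x by rewrite /Ext; case: pselect.
(* Gradients at all scales, with a constant that does not depend on the function. *)
set C0 := 2 `^ p * 2 `^ (s * p) / (1 - 2 `^ (- (s * p))).
have C00 : 0 < C0.
  rewrite divr_gt0 ?mulr_gt0 ?powR_gt0 // subr_gt0 powRN -powR_invl // -[ltRHS](powRr0 2^-1).
  by apply: half_powR_lt; rewrite mulr_gt0.
set K1 := (h 0%N `^ sigma)^-1 + C0 `^ p^-1 * (36 * c) `^ sigma.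
have K10 : 0 < K1.
  by apply: addr_gt0; [rewrite invr_gt0 powR_gt0|rewrite mulr_gt0 ?powR_gt0 // mulr_gt0].
have scales u M : 0 < M -> measurable_fun Omega u ->
    (dotN_norm rho mu Omega s p +oo u < M%:E)%E -> (Lp_norm mu Omega p u <= M%:E)%E ->
    exists H, @gradient_scales R d X mu D Omega r1 sigma p (K1 * M) u H.
  move=> M0 mu_ ltM leM.
  have /choice[G GP] : forall m, exists G : X -> \bar R,
      pgradient Omega D p u (36 * h m.+1) G /\
      (\int[mu]_(x in Omega) G x <=
        (C0 * (M `^ p * (c * (36 * h m.+1)) `^ (s * p / beta)))%:E)%E.
    move=> m; have r0 : 0 < 36 * h m.+1 by rewrite mulr_gt0.
    have [G gG iG] := pgradient_dist rho_ge0 b0 c1 snow hOmega rho_eq0 s0 p0 (ltry 0) ltM r0.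
    by exists G.
  exists (fun m => if m is m'.+1 then G m' else fun y => (`|u y| `^ p)%:E); split=> //.
  - by split=> //; rewrite mulr_ge0 // ltW.
  - by move=> m; case: (GP m).
  - case=> [|m]; last by have [[mG G0 _] _] := GP m.
    split; first exact: measurable_normr_powR.
    by move=> y; rewrite lee_fin powR_ge0.
  case=> [|m].
    move: leM; rewrite Lp_norm_le ?(ltW M0) // => leM; apply: (le_trans leM).
    rewrite lee_fin; apply: powR_le; rewrite ?(ltW p0) ?(ltW M0) //.
    rewrite mulrAC ler_peMl ?(ltW M0) // -ler_pdivrMr ?powR_gt0 // div1r lerDl.
    by rewrite mulr_ge0 ?powR_ge0.
  apply: (le_trans (GP m).2); rewrite lee_fin spb.
  have e36 : 0 <= 36 * c by rewrite mulr_ge0 // ltW.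
  have -> : c * (36 * h m.+1) = 36 * c * h m.+1 by ring.
  rewrite (powRM _ e36 (ltW (h0 _))).
  have q1 : 0 <= C0 `^ p^-1 * (36 * c) `^ sigma by rewrite mulr_ge0 ?powR_ge0.
  have q2 : 0 <= M * h m.+1 `^ sigma by rewrite mulr_ge0 ?powR_ge0 // ltW.
  apply: (@le_trans _ _ ((C0 `^ p^-1 * (36 * c) `^ sigma * (M * h m.+1 `^ sigma)) `^ p)).
    rewrite (powRM _ q1 q2) (powRM _ (powR_ge0 _ _) (powR_ge0 _ _)).
    rewrite (powRM _ (ltW M0) (powR_ge0 _ _)) (powRVK (ltW C00) (lt0r_neq0 p0)) -!powRrM.
    by rewrite le_eqVlt; apply/orP; left; apply/eqP; ring.
  apply: powR_le; [exact: ltW|exact: mulr_ge0|].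
  rewrite -[leRHS]mulrA; apply: ler_wpM2r => //.
  by rewrite lerDr invr_ge0 powR_ge0.
have [K2 K20 maj] := scale_sum_majorant dmD Qd0 hOmega c20 r10 dens Omega_neq0 sg0 sg1 p1 Qsp.
set K3 := 2 * (K2 * K1) * (2 * c) `^ sigma.
have K30 : 0 < K3 by rewrite mulr_gt0 ?powR_gt0 ?mulr_gt0 // mulr_gt0.
set K4 := K2 * K1 * h 0%N `^ sigma.
have K40 : 0 < K4 by rewrite mulr_gt0 ?powR_gt0 // mulr_gt0.
set K := 2 `^ s * 2 `^ p^-1 * K3 + K4.
have K_0 : 0 < K by apply: addr_gt0 => //; apply: mulr_gt0 => //; rewrite mulr_gt0 ?powR_gt0.
have main u M : 0 < M -> measurable_fun Omega u ->
    (dotN_norm rho mu Omega s p +oo u < M%:E)%E -> (Lp_norm mu Omega p u <= M%:E)%E ->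
    [/\ measurable_fun setT (Ext u),
        (dotN_norm rho mu setT s p +oo (Ext u) <= (2 `^ s * 2 `^ p^-1 * K3 * M)%:E)%E &
        (Lp_norm mu setT p (Ext u) <= (K4 * M)%:E)%E].
  move=> M0 mu_ ltM leM; have [H data] := scales u M M0 mu_ ltM leM.
  have mv : measurable_fun setT (v u).
    exact: (measurable_scale_sum dmD Qd0 hOmega c20 r10 dens Omega_neq0 sg0 p1 Qsp data).
  have [E [mE muE vE]] :=
    scale_sum_ae dmD Qd0 hOmega c20 r10 dens Omega_neq0 sg0 sg1 p1 Qsp data.
  have ExtE x : ~ E x -> Ext u x = v u x.
    by move=> nE; have [Ox|nO] := pselect (Omega x); [rewrite ExtO // -vE|rewrite ExtN].
  have mExt : measurable_fun setT (Ext u).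
    rewrite -(setUv Omega); apply/measurable_funU; [exact: hOmega|exact: measurableC|].
    split.
      by apply: (eq_measurable_fun u) => // x /set_mem Ox; rewrite ExtO.
    apply: (eq_measurable_fun (v u)); last exact: measurable_funTS.
    by move=> x /set_mem nO; rewrite ExtN.
  have [G0 [mG0 G00 intG0 _ /(_ erefl) vG0]] := maj _ _ _ data 0%N.
  have K1M : 0 <= K1 * M by rewrite mulr_ge0 // ltW.
  have intv : (\int[mu]_x (`|v u x| `^ p)%:E <= ((K4 * M) `^ p)%:E)%E.
    apply: (@le_trans _ _ (\int[mu]_x G0 x)%E).
      apply: ge0_le_integral => //; exact: (@measurable_normr_powR _ _ _ setT (v u)).
    apply: (le_trans intG0); rewrite -/(h 0%N) (_ : K2 * _ = K4 * M) //.
    by rewrite /K4; ring.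
  split=> //; last first.
    apply: (Lp_norm_ae_le p0 _ mE muE mExt mv ExtE); first by rewrite mulr_ge0 // ltW.
    by rewrite Lp_norm_le // mulr_ge0 // ltW.
  apply: (@le_trans _ _ (dotN_norm rho mu setT s p +oo (v u))).
    by apply: (dotN_norm_ae rho s p +oo mE muE) => x [_ nE]; exact: ExtE.
  rewrite -(mulrA _ K3 M); apply: dotN_of_pgradient => //; first by rewrite mulr_ge0 // ltW.
  move=> k; set e : R := 2 ^ (- k); have e0 : 0 < e by exact: exprz_gt0.
  set r := c * e `^ beta; have r0 : 0 < r by rewrite mulr_gt0 // powR_gt0.
  have rs : r `^ sigma = c `^ sigma * e `^ s.
    rewrite (powRM _ (ltW c0) (powR_ge0 _ _)) -powRrM; congr (_ * _ `^ _).
    by rewrite /sigma mulrC divfK // gt_eqF.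
  have near_r x y : rho x y < e -> D x y < r.
    exact: (dist_lt_of_rho rho_ge0 b0 c1 snow (ltW e0)).
  have Mh m : 0 <= K1 * M * h m `^ sigma by rewrite mulr_ge0 ?powR_ge0.
  have [r_small|r_large] := lerP r (h 0%N).
    have [j [rj jr]] : exists j, r <= h j /\ h j <= 2 * r.
      move: r_small; rewrite le_eqVlt => /predU1P[rE|r_lt].
        by exists 0%N; rewrite -rE; split=> //; rewrite ler_peMl ?ler1n // ltW.
      have z1 : 1 < h 0%N / r by rewrite ltr_pdivlMr // mul1r.
      have [j [j1 j2]] := geometric_bracket (ltr1n R 2) z1; exists j.
      have hE : h j = h 0%N / 2 ^+ j.
        by rewrite /h (scale_decr r1 (leq0n j)) subn0 exprVn mulrC.
      have t0 : 0 < 2 ^+ j :> R by rewrite exprn_gt0.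
      move: j1 j2; rewrite ltr_pdivlMr // => j1; rewrite ler_pdivrMr // exprS => j2.
      by rewrite hE ler_pdivlMr // mulrC (ltW j1) ler_pdivrMr // mulrAC.
    have [G [mG Gge0 intG vG _]] := maj _ _ _ data j.
    exists G.
      by split=> // x y _ _ xy; apply: vG; apply: le_trans rj; exact: ltW (near_r _ _ xy).
    apply: (le_trans intG); rewrite lee_fin; apply: powR_le; first exact: ltW.
      by apply: mulr_ge0; [exact: ltW|exact: Mh].
    have hj : h j `^ sigma <= (2 * c) `^ sigma * e `^ s.
      apply: (@le_trans _ _ ((2 * r) `^ sigma)); first by apply: powR_le; rewrite ?(ltW sg0) // ltW.
      rewrite (powRM _ (ler0n _ 2) (ltW r0)) rs (powRM _ (ler0n _ 2) (ltW c0)).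
      by rewrite mulrA.
    have -> : K3 * M * e `^ s = 2 * (K2 * (K1 * M * ((2 * c) `^ sigma * e `^ s))).
      by rewrite /K3; ring.
    apply: (@le_trans _ _ (K2 * (K1 * M * ((2 * c) `^ sigma * e `^ s)))).
      by apply: ler_wpM2l; [exact: ltW|apply: ler_wpM2l].
    rewrite ler_peMl ?ler1n // mulr_ge0 ?(ltW K20) // mulr_ge0 // mulr_ge0 ?powR_ge0 //.
  exists (fun x => (2 `^ p * `|v u x| `^ p)%:E).
    split.
    - apply/measurable_EFinP; apply: measurable_funM => //; apply/measurable_EFinP.
      exact: (@measurable_normr_powR _ _ _ setT (v u)).
    - by move=> x; rewrite lee_fin mulr_ge0 ?powR_ge0.
    move=> x y _ _ _; rewrite -EFinD lee_fin -mulrDr.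
    apply: le_trans (powR_addr_le (normr_ge0 _) (normr_ge0 _) p0).
    by apply: powR_le; rewrite ?(ltW p0) ?ler_normB.
  have -> : (\int[mu]_x (2 `^ p * `|v u x| `^ p)%:E =
      (2 `^ p)%:E * \int[mu]_x (`|v u x| `^ p)%:E)%E.
    under eq_integral do rewrite EFinM.
    apply: ge0_integralZl => //.
    exact: (@measurable_normr_powR _ _ _ setT (v u)).
  apply: (@le_trans _ _ ((2 `^ p)%:E * ((K4 * M) `^ p)%:E)%E).
    by apply: lee_wpmul2l; rewrite ?lee_fin ?powR_ge0.
  have K4M : 0 <= K4 * M by rewrite mulr_ge0 // ltW.
  rewrite -EFinM lee_fin -(powRM _ (ler0n _ 2) K4M); apply: powR_le; first exact: ltW.
    by rewrite mulr_ge0.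
  have hr : h 0%N `^ sigma <= (2 * c) `^ sigma * e `^ s.
    apply: (@le_trans _ _ (r `^ sigma)); first by apply: powR_le; rewrite ?(ltW sg0) // ltW.
    rewrite rs; apply: ler_wpM2r; first exact: powR_ge0.
    by apply: powR_le; rewrite ?(ltW sg0) ?(ltW c0) // ler_peMl ?ler1n // ltW.
  have -> : 2 * (K4 * M) = 2 * (K2 * (K1 * M * h 0%N `^ sigma)) by rewrite /K4; ring.
  have -> : K3 * M * e `^ s = 2 * (K2 * (K1 * M * ((2 * c) `^ sigma * e `^ s))).
    by rewrite /K3; ring.
  by apply: ler_wpM2l => //; apply: ler_wpM2l; [exact: ltW|apply: ler_wpM2l].
have bigM u : N_space rho mu Omega s p +oo u -> exists2 N : R, 0 <= N &
    N_norm rho mu Omega s p +oo u = N%:E /\ forall M, N < M ->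
      (dotN_norm rho mu Omega s p +oo u < M%:E)%E /\ (Lp_norm mu Omega p u <= M%:E)%E.
  move=> [[_ fd] fL]; have d0 : (0 <= dotN_norm rho mu Omega s p +oo u)%E by exact: dotN_norm_ge0.
  have L0 : (0 <= Lp_norm mu Omega p u)%E by exact: Lp_norm_ge0.
  have N0 : (0 <= N_norm rho mu Omega s p +oo u)%E by exact: adde_ge0.
  have NE : N_norm rho mu Omega s p +oo u \is a fin_num.
    by rewrite ge0_fin_numE // lte_add_pinfty.
  exists (fine (N_norm rho mu Omega s p +oo u)); first exact: fine_ge0.
  rewrite fineK //; split=> // M; rewrite -lte_fin fineK // => ltM; split.
    by apply: le_lt_trans ltM; rewrite leeDl.
  by apply: le_trans (ltW ltM); rewrite leeDr.
have scales_ex u : N_space rho mu Omega s p +oo u ->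
    exists M H, @gradient_scales R d X mu D Omega r1 sigma p M u H.
  move=> Nu; have [N N0 [_ big]] := bigM u Nu.
  have N1 : N < N + 1 by rewrite ltrDl.
  have [ltM leM] := big _ N1; have M0 : 0 < N + 1 by exact: le_lt_trans N1.
  by have [H data] := scales u _ M0 Nu.1.1 ltM leM; exists (K1 * (N + 1)), H.
exists s, p, +oo%E; split=> //; first by rewrite ltry.
exists Ext; split.
- move=> u Nu; have [N N0 [_ big]] := bigM u Nu.
  have N1 : N < N + 1 by rewrite ltrDl.
  have [ltM leM] := big _ N1; have M0 : 0 < N + 1 by exact: le_lt_trans N1.
  have [mE le_d le_L] := main u _ M0 Nu.1.1 ltM leM.
  by split; [split=> //; exact: le_lt_trans le_d (ltry _)|exact: le_lt_trans le_L (ltry _)].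
- move=> u w _ uw; apply/funext => x; rewrite /Ext; case: pselect => Ox; first exact: uw.
  by rewrite /v (scale_sum_eq r1 uw).
- move=> a u w Nu Nw; apply/funext => x; rewrite /Ext; case: pselect => // nO.
  have [M [H du]] := scales_ex u Nu; have [M' [H' dw]] := scales_ex w Nw.
  exact: (scale_sum_linear dmD Qd0 hOmega c20 r10 dens Omega_neq0 sg0 p1 Qsp a du dw).
- exists K => // u Nu; have [N N0 [NE big]] := bigM u Nu.
  have all_n (n : nat) : (N_norm rho mu setT s p +oo (Ext u) <= (K * (N + n.+1%:R^-1))%:E)%E.
    have N1 : N < N + n.+1%:R^-1 by rewrite ltrDl invr_gt0.
    have [ltM leM] := big _ N1; have M0 : 0 < N + n.+1%:R^-1 by exact: le_lt_trans N1.
    have [_ le_d le_L] := main u _ M0 Nu.1.1 ltM leM.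
    by rewrite /K mulrDl EFinD; apply: leeD.
  have NE0 : (0 <= N_norm rho mu setT s p +oo (Ext u))%E.
    by apply: adde_ge0; [exact: dotN_norm_ge0|exact: Lp_norm_ge0].
  have fin : N_norm rho mu setT s p +oo (Ext u) \is a fin_num.
    by rewrite ge0_fin_numE //; apply: le_lt_trans (all_n 0%N) (ltry _).
  rewrite NE -EFinM -(fineK fin) lee_fin; apply: le_mul_addV; first exact: ltW.
  by move=> n; rewrite -lee_fin fineK.
by move=> u _ x Ox; rewrite ExtO.
Qed.
End Extension.

Theorem theorem4p10 (R : realType) (d : measure_display) (X : measurableType d)
    (rho : X -> X -> R) (mu : {measure set X -> \bar R}) (Q : R) (Omega : set X)
    (hX : quasi_metric_measure_space rho mu)
    (hreg : borel_regular rho mu)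
    (hQ : 0 < Q)
    (hdoubling : doubling rho mu Q)
    (hOmega : measurable Omega)
    (hOmega_perfect : locally_uniformly_perfect rho Omega)
    (hOmega_two : exists x y : X, [/\ Omega x, Omega y & x <> y])
    (hOmega_pos : forall (x : X) (r : R), Omega x -> 0 < r -> r <= 1 ->
       (0 < mu (qball rho x r `&` Omega))%E) :
  [<->
   (* (a) *)
   exists2 Cmu : R, 0 < Cmu &
     forall (x : X) (r : R), Omega x -> 0 < r -> r <= 1 ->
       (mu (qball rho x r) <= Cmu%:E * mu (qball rho x r `&` Omega))%E ;
   (* (b) *)
   exists (s p : R) (q : \bar R),
     [/\ 0 < s, (s%:E < qm_index setT rho)%E, 0 < p, (0 < q)%E &
         extension_domain rho mu Omega s p q] ;
   (* (c) *)
   exists (s p : R) (q : \bar R),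
     [/\ 0 < s /\ (s%:E < qm_index setT rho)%E, 0 < p, (0 < q)%E,
         Q / (Q + s) < p /\ ((Q / (Q + s))%:E < q)%E &
         exists E : (X -> R) -> (X -> R),
           bounded_linear_extension rho mu Omega s p q E] ;
   (* (d) *)
   exists (eps s p : R) (q : \bar R) (CS : R),
     [/\ [/\ 0 < eps, 0 < s, 0 < p, p < Q / eps & (0 < q)%E],
         eps < s, le_qm_index q s Omega rho, 0 < CS &
         forall (x0 : X) (R0 : R), Omega x0 -> 0 < R0 -> R0 <= 1 ->
         forall u : X -> R, dotN rho mu Omega s p q u ->
           let B0 := qball rho x0 R0 in
           (Lp_norm mu (B0 `&` Omega) (Q * p / (Q - eps * p)) u
            <= (CS / fine (mu B0) `^ (eps / Q))%:E
               * ((R0 `^ s)%:E * dotN_norm rho mu Omega s p q u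
                  + Lp_norm mu Omega p u))%E] ;
   (* (e) *)
   exists (eps s p : R) (q : \bar R) (CP : R),
     [/\ [/\ 0 < eps, 0 < s, 0 < p, p < Q / eps & (0 < q)%E],
         eps < s, le_qm_index q s Omega rho, 0 < CP &
         forall (x0 : X) (R0 : R), Omega x0 -> 0 < R0 -> R0 <= 1 ->
         forall u : X -> R, dotN rho mu Omega s p q u ->
           let B0 := qball rho x0 R0 in
           (ereal_inf (range (fun gamma : R =>
              Lp_norm mu (B0 `&` Omega) (Q * p / (Q - eps * p))
                (fun x => (u x - gamma)%R)))
            <= (CP * R0 `^ s / fine (mu B0) `^ (eps / Q))%:E
               * dotN_norm rho mu Omega s p q u)%E] ;
   (* (f) *)
   exists (c1 c2 omega : R) (q : \bar R) (eps s : R),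
     [/\ [/\ 0 < c1, 0 < c2, 0 < omega & (0 < q)%E],
         [/\ 0 < eps, 0 < s & eps < s], le_qm_index q s Omega rho &
         forall (x0 : X) (R0 : R), Omega x0 -> 0 < R0 -> R0 <= 1 ->
         forall u : X -> R, dotN rho mu Omega s (Q / eps) q u ->
           (0 < dotN_norm rho mu Omega s (Q / eps) q u)%E ->
           let B0 := qball rho x0 R0 in
           mu.-integrable (B0 `&` Omega) (EFin \o u) /\
           (\int[mu]_(x in B0 `&` Omega)
              (expR ((c1 * (fine (mu B0) `^ (eps / Q)
                            * `|u x - mean mu (B0 `&` Omega) u|
                            / (R0 `^ s
                               * fine (dotN_norm rho mu Omega s (Q / eps) q u))))
                     `^ omega))%:E
            <= c2%:E * mu B0)%E] ;
   (* (g) *)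
   exists (eps s p : R) (q : \bar R) (CH : R),
     [/\ [/\ 0 < eps, 0 < s, Q / eps < p & (0 < q)%E],
         eps < s, le_qm_index q s Omega rho, 0 < CH &
         forall (x0 : X) (R0 : R), Omega x0 -> 0 < R0 -> R0 <= 1 ->
         forall u : X -> R, dotN rho mu Omega s p q u ->
           let B0 := qball rho x0 R0 in
           exists v : X -> R,
             [/\ {ae mu, forall x, (B0 `&` Omega) x -> v x = u x},
                 hoelder_on rho (B0 `&` Omega) (s - Q / p) v &
                 forall x y : X, (B0 `&` Omega) x -> (B0 `&` Omega) y ->
                   (`|v x - v y|%:E
                    <= (CH * rho x y `^ (s - Q / p)
                        * (R0 `^ (Q / p) / fine (mu B0) `^ p^-1))%:E
                       * dotN_norm rho mu Omega s p q u)%E]]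
  ].
Proof.
have [x [y [Ox Oy xy]]] := hOmega_two; have Omega_neq0 : Omega !=set0 by exists x.
have b_a (s p : R) (q : \bar R) : 0 < s -> (s%:E < qm_index setT rho)%E -> 0 < p -> (0 < q)%E ->
    extension_domain rho mu Omega s p q -> measure_density rho mu Omega.
  move=> s0 ls p0 q0.
  exact: (density_of_extension hX hQ hdoubling hOmega hOmega_perfect hOmega_two hOmega_pos
    s0 ls p0 q0).
have a_c := extension_of_density hX hQ hdoubling hOmega Omega_neq0.
have c_b (s p : R) (q : \bar R) : (exists E : (X -> R) -> X -> R,
    bounded_linear_extension rho mu Omega s p q E) -> extension_domain rho mu Omega s p q.
  move=> [E [E1 _ _ [C C0 EC] E2]]; exists C => // u Nu.
  by exists (E u); split; [exact: E1|exact: E2|exact: EC].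
have a_osc := density_hoelder hX hQ hdoubling hOmega hOmega_two.
tfae.
- move=> /a_c[s [p [q [[s0 ls] p0 q0 _ ext]]]]; exists s, p, q; split=> //.
  exact: c_b.
- by move=> [s [p [q [s0 ls p0 q0 ext]]]]; apply: a_c; exact: b_a ext.
- move=> [s [p [q [[s0 ls] p0 q0 _ /c_b ext]]]].
  have dens : measure_density rho mu Omega by exact: b_a ext.
  have [s' [C [D [c [s'0 C0 ls' _ osc]]]]] := a_osc dens.
  exact: (embedding_sobolev hX hQ hOmega hOmega_pos s'0 C0 ls' osc dens).
- move=> [eps [s [p [q [CS [h1 h2 h3 h4 h5]]]]]].
  have dens : measure_density rho mu Omega.
    exact: (density_of_sobolev hX hQ hdoubling hOmega hOmega_perfect hOmega_two hOmega_pos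
      h1 h3 h4 h5).
  have [s' [C [D [c [s'0 C0 ls' _ osc]]]]] := a_osc dens.
  exact: (embedding_poincare hX hQ hOmega hOmega_pos s'0 C0 ls' osc).
- move=> [eps [s [p [q [CP [h1 h2 h3 h4 h5]]]]]].
  have dens : measure_density rho mu Omega.
    exact: (density_of_poincare hX hQ hdoubling hOmega hOmega_perfect hOmega_two hOmega_pos
      h1 h3 h4 h5).
  have [s' [C [D [c [s'0 C0 ls' _ osc]]]]] := a_osc dens.
  exact: (embedding_exponential hX hQ hOmega hOmega_pos s'0 C0 ls' osc).
- move=> [c1 [c2 [omega [q [eps [s [h1 h2 h3 h4]]]]]]].
  have dens : measure_density rho mu Omega.
    exact: (density_of_exponential hX hQ hdoubling hOmega hOmega_perfect hOmega_two hOmega_pos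
      h1 h2 h3 h4).
  have [s' [C [D [c [s'0 C0 ls' [[Dm c0] snow] osc]]]]] := a_osc dens.
  exact: (embedding_hoelder hQ s'0 C0 ls' osc Dm c0 snow).
move=> [eps [s [p [q [CH [h1 h2 h3 h4 h5]]]]]].
exact: (density_of_hoelder hX hQ hdoubling hOmega hOmega_perfect hOmega_two hOmega_pos
  h1 h2 h3 h4 h5).
Qed.
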